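(* Let $k\ge1$, $a_1,\dots,a_k>0$, $\zeta_1,\dots,\zeta_k\in\mathbb{T}$ and $\mu_k=\sum_{i=1}^k a_i\delta_{\zeta_i}$. The Bass stable rank of $M(D(\mu_k))$ is one.
   Context: $\mathbb{D}$ is the open unit disc, $\mathbb{T}$ its boundary. For a finite nonnegative Borel measure $\mu$ on $\mathbb{T}$, $\varphi_\mu(z)=\int_{\mathbb{T}}\frac{1-|z|^2}{|\zeta-z|^2}d\mu(\zeta)$ and $D(\mu)$ is the space of analytic $f\in H^2(\mathbb{D})$ with $\int_{\mathbb{D}}|f'|^2\varphi_\mu\,dA<\infty$. $\delta_\zeta$ is the unit point mass at $\zeta$. $M(D(\mu))=\{\phi\in D(\mu):\phi f\in D(\mu)\ \forall f\in D(\mu)\}$ is the multiplier algebra. For a ring $A$ with identity, an $n$-tuple $(a_1,\dots,a_n)$ is unimodular if $\sum a_ib_i=1$ for some $b_i\in A$; an $(n+1)$-tuple $(x_1,\dots,x_{n+1})$ is reducible if there are $y_1,\dots,y_n\in A$ with $(x_1+y_1x_{n+1},\dots,x_n+y_nx_{n+1})$ unimodular; the Bass stable rank of $A$ is the least $n$ such that every unimodular $(n+1)$-tuple is reducible. *)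

(* Defs.v *)
From HB Require Import structures.
From mathcomp Require Import all_boot all_order all_algebra.
From mathcomp Require Import all_classical all_reals all_analysis.
From mathcomp Require Import complex.
Set Implicit Arguments. Unset Strict Implicit. Unset Printing Implicit Defensive.
Import Order.TTheory GRing.Theory Num.Theory.
Import numFieldNormedType.Exports.
Local Open Scope classical_set_scope.
Local Open Scope ring_scope.
Local Open Scope complex_scope.

(* The complex plane, as a normed module over itself (so that [derivable f z 1]
   is complex differentiability). *)
Definition Cx (R : realType) := (R[i])^o.

Definition cmod (R : realType) (z : R[i]) : R := Num.sqrt (complex.Re z ^+ 2 + complex.Im z ^+ 2).

Definition in_disc (R : realType) (z : R[i]) : Prop := cmod z < 1.

Definition holo_disc (R : realType) (f : Cx R -> Cx R) : Prop :=
  forall z : R[i], in_disc z -> derivable f z 1.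

Definition H2 (R : realType) (f : Cx R -> Cx R) : Prop :=
  holo_disc f /\
  exists M : R, forall r : R, 0 <= r < 1 ->
    (\int[lebesgue_measure]_(t in `[0%R, (2 * pi)%R])
        ((cmod (f ((r * cos t) +i* (r * sin t)))) ^+ 2)%R%:E <= M%:E)%E.

(* Poisson integral of mu_k = sum_i a_i delta_{zeta_i}:
   phi_mu(z) = \int_T (1-|z|^2)/|zeta - z|^2 dmu(zeta)
             = sum_i a_i (1-|z|^2)/|zeta_i - z|^2  *)
Definition poisson_atomic (R : realType) (k : nat) (a : 'I_k -> R)
    (zeta : 'I_k -> R[i]) (z : R[i]) : R :=
  \sum_(i < k) a i * ((1 - cmod z ^+ 2) / (cmod (zeta i - z)) ^+ 2).

(* normalized area measure dA = dx dy / pi on the disc *)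
Definition dirichlet_finite (R : realType) (phi : R[i] -> R)
    (f : Cx R -> Cx R) : Prop :=
  (\int[(lebesgue_measure \x lebesgue_measure)%E]_(p in
        [set p : R * R | (p.1 ^+ 2 + p.2 ^+ 2 < 1)%R])
      ((cmod (derive1 f (p.1 +i* p.2))) ^+ 2 * phi (p.1 +i* p.2) / pi)%R%:E
    < +oo)%E.

Definition Dmu (R : realType) (k : nat) (a : 'I_k -> R) (zeta : 'I_k -> R[i])
    (f : Cx R -> Cx R) : Prop :=
  H2 f /\ dirichlet_finite (poisson_atomic a zeta) f.

(* multiplier algebra M(D(mu_k)), as a set of functions
   (ring operations pointwise, functions identified when equal on D) *)
Definition multiplier_alg (R : realType) (k : nat) (a : 'I_k -> R)
    (zeta : 'I_k -> R[i]) : set (Cx R -> Cx R) :=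
  [set phi | Dmu a zeta phi /\
     forall f, Dmu a zeta f -> Dmu a zeta (fun z => phi z * f z)].

(* Bass stable rank for a ring A of functions on D with pointwise operations,
   equality meaning equality on D. *)
Definition unimodular (R : realType) (A : set (Cx R -> Cx R)) (n : nat)
    (x : 'I_n -> Cx R -> Cx R) : Prop :=
  exists b : 'I_n -> Cx R -> Cx R, (forall i, A (b i)) /\
    forall z : R[i], in_disc z -> \sum_(i < n) x i z * b i z = 1.

Definition reducible (R : realType) (A : set (Cx R -> Cx R)) (n : nat)
    (x : 'I_n.+1 -> Cx R -> Cx R) : Prop :=
  exists y : 'I_n -> Cx R -> Cx R, (forall i, A (y i)) /\
    unimodular A (fun i z => x (widen_ord (leqnSn n) i) z + y i z * x ord_max z).

Definition stable_range_cond (R : realType) (A : set (Cx R -> Cx R)) (n : nat) : Prop :=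
  forall x : 'I_n.+1 -> Cx R -> Cx R, (forall i, A (x i)) ->
    unimodular A x -> reducible A x.

Definition bass_stable_rank_eq (R : realType) (A : set (Cx R -> Cx R)) (n : nat) : Prop :=
  (1 <= n)%N /\ stable_range_cond A n /\
  forall m : nat, (1 <= m < n)%N -> ~ stable_range_cond A m.

(* Main.v *)
(* For a finite sum of point masses, [f] lies in D(mu) iff at each node [zeta i] it is a constant plus
 [z - zeta i] times a function of H^2; hence the multiplier algebra A consists of the bounded analytic
 functions with such values at the nodes. Given [x0 b0 + x1 b1 = 1] in A, adding a small multiple of [x1]
 to [x0] makes the values of [x0] nonzero, and the Bezout coefficient of [x1] can then be made to vanish at
 the nodes; call it [B1]. Treil's theorem (H^oo has stable rank one) gives a bounded analytic [Y] such that
 [x0 + x1 B1 Y] is bounded below. As [B1] vanishes at the nodes, [B1 Y] is in A, and so is the inverse.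
 Treil's theorem is proved for polynomials [f], [g] without common zeros on the closed disc: one constructs
 [W] with bounded real part, equal to a logarithm of [f] where [g] is small, such that [dW/d(conj z)] is [g]
 times a function [G] which is Carleson against H^1. Hahn-Banach then yields an analytic [h] close to [W]
 with [h - W] of size [O(|g|)], and [Y = (exp h - f) / g] is the solution; a normal family argument
 (along an ultrafilter) removes the restriction to polynomials. *)
Require Import Defs.
From HB Require Import structures.
From mathcomp Require Import all_boot all_order all_algebra.
From mathcomp Require Import all_classical all_reals all_analysis.
From mathcomp Require Import complex measurable_realfun.
From mathcomp Require Import ring lra zify.
Set Implicit Arguments. Unset Strict Implicit. Unset Printing Implicit Defensive.
Import Order.TTheory GRing.Theory Num.Theory.
Import numFieldNormedType.Exports.
Local Open Scope classical_set_scope.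
Local Open Scope ring_scope.
Local Open Scope complex_scope.
Local Notation Re := complex.Re.
Local Notation Im := complex.Im.
Local Notation "'onD' z , P" := (forall z, cmod z <= 1 -> P) (at level 200, z name, P at level 200).
Local Notation "'inD' z , P" := (forall z, cmod z < 1 -> P) (at level 200, z name, P at level 200).
Local Notation cj := conjc.

(** * The modulus of a complex number as a real number *)

Section Cmod.
Variable R : realType.
Local Notation C := R[i].
Implicit Types z w : C.

(** [f] may have zeros, so log f is at best multivalued, and yet [W] needs a bounded real part and a
    d-bar derivative divisible by [g]. The way out is W = L + i phi, with [L] a smoothed log |f| and
    [phi] real and otherwise free. Let psi = g theta be a smooth cutoff of |g|^2. If the
    z-derivative of phi is i (psi dV - V dpsi - dL) for some real V, where d is the z-derivative,
    then the terms in L cancel in d-bar W, which becomes g (theta d-bar V - V d-bar theta). Such a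
    real phi exists exactly if psi lap V - V lap psi = lap L. This elliptic equation has the right
    sign for the maximum principle, and a bounded solution, because lap L vanishes where psi is
    small and is at most a multiple of |f'|^2, which makes 1 - |f|^2 a barrier. The bound on V and a
    lower bound on V lap V give the Carleson estimate by Green's formula applied to V^2. As the
    equation is solved only approximately, phi is slightly off; where [g] is small this shows as a
    slowly varying unimodular factor, whose argument is subtracted. *)

Lemma cmodE z : cmod z = ComplexField.Normc.normc z.
Proof. by case: z. Qed.
Lemma cge0 z : 0 <= cmod z.
Proof. exact: sqrtr_ge0. Qed.

Lemma cmod0 : cmod (0 : C) = 0.
Proof. by rewrite cmodE ComplexField.Normc.normc0. Qed.
Lemma cmod1 : cmod (1 : C) = 1.
Proof. by rewrite cmodE ComplexField.Normc.normc1. Qed.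

Lemma cmodM z w : cmod (z * w) = cmod z * cmod w.
Proof. by rewrite !cmodE ComplexField.Normc.normcM. Qed.
Lemma cmodV z : cmod z^-1 = (cmod z)^-1.
Proof. by rewrite !cmodE ComplexField.Normc.normcV. Qed.

Lemma cmodN z : cmod (- z) = cmod z.
Proof. by rewrite /cmod; case: z => a b /=; rewrite !sqrrN. Qed.
Lemma cmodBC z w : cmod (z - w) = cmod (w - z).
Proof. by rewrite -cmodN opprB. Qed.

Lemma cmodX z n : cmod (z ^+ n) = cmod z ^+ n.
Proof. by elim: n => [|n IH]; rewrite ?expr0 ?cmod1 // !exprS cmodM IH. Qed.
Lemma cmodJ z : cmod (cj z) = cmod z.
Proof. by rewrite /cmod; case: z => a b /=; rewrite sqrrN. Qed.

Lemma cmodR (x : R) : cmod x%:C = `|x|.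
Proof. by rewrite /cmod /= expr0n addr0 sqrtr_sqr. Qed.
Lemma cmod_i : cmod ('i : C) = 1.
Proof. by rewrite /cmod /= expr0n add0r expr1n sqrtr1. Qed.

Lemma cmod_sqE z : cmod z ^+ 2 = Re z ^+ 2 + Im z ^+ 2.
Proof. by rewrite /cmod sqr_sqrtr // addr_ge0 ?sqr_ge0. Qed.
Lemma mulcJ z : z * cj z = (cmod z ^+ 2)%:C.
Proof. by rewrite cmod_sqE; case: z => a b; apply/eqP; rewrite eq_complex /=; apply/andP; split; apply/eqP; ring. Qed.

Lemma cmod_eq0 z : (cmod z == 0) = (z == 0).
Proof.
apply/idP/idP => [/eqP H|/eqP->]; last by rewrite cmod0.
by apply/eqP/(@ComplexField.Normc.eq0_normc R); rewrite -cmodE.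
Qed.
Lemma cmod_gt0 z : (0 < cmod z) = (z != 0).
Proof. by rewrite lt_def cge0 andbT cmod_eq0. Qed.

Lemma cmod_Re z : `|Re z| <= cmod z.
Proof. by rewrite /cmod -sqrtr_sqr ler_wsqrtr // lerDl sqr_ge0. Qed.
Lemma cmod_Im z : `|Im z| <= cmod z.
Proof. by rewrite /cmod -sqrtr_sqr ler_wsqrtr // lerDr sqr_ge0. Qed.

Lemma ler_Re_cmod z : Re z <= cmod z.
Proof. exact: le_trans (ler_norm _) (cmod_Re z). Qed.

Lemma cmodD z w : cmod (z + w) <= cmod z + cmod w.
Proof.
have z0 := cge0 z; have w0 := cge0 w.
rewrite -(@ler_pXn2r _ 2) ?nnegrE ?cge0 ?addr_ge0 //.
have H : Re (z * cj w) <= cmod z * cmod w.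
 by apply: le_trans (ler_Re_cmod _) _; rewrite cmodM cmodJ.
rewrite sqrrD !cmod_sqE; move: H; case: z {z0} => a b; case: w {w0} => c d /= H; nra.
Qed.
Lemma cmodB z w : cmod (z - w) <= cmod z + cmod w.
Proof. by rewrite -(cmodN w); exact: cmodD. Qed.

Lemma cmodD3 z w : cmod z <= cmod w + cmod (z - w).
Proof. by rewrite -{1}(subrK w z) addrC; exact: cmodD. Qed.

Lemma cmod_dist z w : `|cmod z - cmod w| <= cmod (z - w).
Proof.
rewrite ler_norml; have := cmodD3 z w; have := cmodD3 w z; rewrite (cmodBC w z).
by move=> *; apply/andP; split; lra.
Qed.

Lemma cmod_ReIm z : cmod z <= `|Re z| + `|Im z|.
Proof.
rewrite -(@ler_pXn2r _ 2) ?nnegrE ?cge0 // cmod_sqE sqrrD !real_normK ?num_real //.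
by rewrite lerD2r lerDl mulrn_wge0 // mulr_ge0.
Qed.

Lemma cmod_sum (I : Type) (s : seq I) (P : pred I) (F : I -> C) :
 cmod (\sum_(i <- s | P i) F i) <= \sum_(i <- s | P i) cmod (F i).
Proof.
elim/big_ind2 : _ => [|x1 x2 y1 y2 H1 H2|//]; first by rewrite cmod0.
by apply: le_trans (cmodD _ _) _; exact: lerD.
Qed.
Lemma cReD z w : Re (z + w) = Re z + Re w.
Proof. by case: z; case: w. Qed.
Lemma cImD z w : Im (z + w) = Im z + Im w.
Proof. by case: z; case: w. Qed.
Lemma cReN z : Re (- z) = - Re z.
Proof. by case: z. Qed.
Lemma cImN z : Im (- z) = - Im z.
Proof. by case: z. Qed.
Lemma cReM z w : Re (z * w) = Re z * Re w - Im z * Im w.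
Proof. by case: z; case: w. Qed.
Lemma cImM z w : Im (z * w) = Re z * Im w + Im z * Re w.
Proof. by case: z => a b; case: w => c d /=; ring. Qed.
Lemma cx_eq z w : Re z = Re w -> Im z = Im w -> z = w.
Proof. by case: z => a b; case: w => c d /= -> ->. Qed.
Lemma realCD (x y : R) : (x + y)%:C = x%:C + y%:C.
Proof. by apply: cx_eq => /=; rewrite ?addr0. Qed.
Lemma realCN (x : R) : (- x)%:C = - x%:C.
Proof. by apply: cx_eq => /=; rewrite ?oppr0. Qed.
Lemma realCM (x y : R) : (x * y)%:C = x%:C * y%:C.
Proof. by apply: cx_eq => /=; ring. Qed.
Lemma realCV (x : R) : (x^-1)%:C = (x%:C)^-1.
Proof.
have [->|x0] := eqVneq x 0; first by rewrite !invr0.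
apply: (mulfI (x := x%:C)); first by rewrite eq_complex eqxx andbT.
by rewrite -realCM divff // divff // eq_complex /= eqxx andbT.
Qed.
Lemma conjcD z w : cj (z + w) = cj z + cj w.
Proof. exact: rmorphD. Qed.
Lemma conjcN z : cj (- z) = - cj z.
Proof. exact: rmorphN. Qed.
Lemma conjcM z w : cj (z * w) = cj z * cj w.
Proof. exact: rmorphM. Qed.
Lemma mulii : 'i%C * 'i%C = -1 :> C.
Proof. by rewrite -expr2 sqr_i. Qed.
Lemma conji : cj 'i%C = - 'i%C :> C.
Proof. by apply: cx_eq; rewrite /= ?oppr0. Qed.
Lemma conj_real (x : R) : cj x%:C = x%:C :> C.
Proof. by rewrite /= oppr0. Qed.

End Cmod.

Ltac tri := apply: le_trans (cmodD _ _) _.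

(** * Continuity and Wirtinger derivatives through explicit remainders *)

Section Wirtinger.
Variable R : realType.
Local Notation C := R[i].
Implicit Types (u v e : C -> C) (z w h p q : C).

(** Limits are written with a real [eps] and [cmod]: the norm that the library puts on [R[i]] takes
    complex values, and the two are reconciled ([normC_cmod]) only where the notions of the
    statement are reached. *)
Definition tend0 e := forall eps : R, 0 < eps -> exists2 d : R, 0 < d &
 forall h, cmod h < d -> cmod (e h) <= eps.

Definition lito e := forall eps : R, 0 < eps -> exists2 d : R, 0 < d &
 forall h, cmod h < d -> cmod (e h) <= eps * cmod h.

Definition ccont u z := tend0 (fun h=> u (z + h) - u z).

(* [p] and [q] are the Wirtinger derivatives of [u] with respect to [z] and its conjugate. *)
Definition wd u z p q := lito (fun h=> u (z + h) - u z - (p * h + q * cj h)).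

Lemma tend0D e1 e2 : tend0 e1 -> tend0 e2 -> tend0 (fun h=> e1 h + e2 h).
Proof.
move=> H1 H2 eps e0; have e2' : 0 < eps / 2 by lra.
have [d1 d10 D1] := H1 _ e2'; have [d2 d20 D2] := H2 _ e2'.
exists (Num.min d1 d2); first by rewrite lt_min d10.
move=> h; rewrite lt_min => /andP[/D1 A /D2 B].
by tri; lra.
Qed.

Lemma litoD e1 e2 : lito e1 -> lito e2 -> lito (fun h=> e1 h + e2 h).
Proof.
move=> H1 H2 eps e0; have e2' : 0 < eps / 2 by lra.
have [d1 d10 D1] := H1 _ e2'; have [d2 d20 D2] := H2 _ e2'.
exists (Num.min d1 d2); first by rewrite lt_min d10.
move=> h; rewrite lt_min => /andP[/D1 A /D2 B].
by tri; lra.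
Qed.
Lemma tend0_ext e1 e2 : e1 =1 e2 -> tend0 e1 -> tend0 e2.
Proof. by move=> /funext->. Qed.

Lemma lito_ext e1 e2 : e1 =1 e2 -> lito e1 -> lito e2.
Proof. by move=> /funext->. Qed.

Definition lbdd e := exists2 K : R, 0 < K & exists2 d : R, 0 < d & forall h, cmod h < d -> cmod (e h) <= K.

Lemma tend0M e1 e2 : tend0 e1 -> lbdd e2 -> tend0 (fun h=> e1 h * e2 h).
Proof.
move=> H1 [K K0 [d2 d20 D2]] eps e0.
have [d1 d10 D1] := H1 (eps / K) (divr_gt0 e0 K0).
exists (Num.min d1 d2); first by rewrite lt_min d10.
move=> h; rewrite lt_min => /andP[/D1 A /D2 B].
rewrite cmodM -(divfK (lt0r_neq0 K0) eps); apply: ler_pM => //; exact: cge0.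
Qed.

Lemma litoM e1 e2 : lito e1 -> lbdd e2 -> lito (fun h=> e1 h * e2 h).
Proof.
move=> H1 [K K0 [d2 d20 D2]] eps e0.
have [d1 d10 D1] := H1 (eps / K) (divr_gt0 e0 K0).
exists (Num.min d1 d2); first by rewrite lt_min d10.
move=> h; rewrite lt_min => /andP[/D1 A /D2 B].
rewrite cmodM -(divfK (lt0r_neq0 K0) eps) mulrAC; apply: ler_pM => //; exact: cge0.
Qed.
Lemma lbdd_tend0 e : tend0 e -> lbdd e.
Proof. by move=> /(_ 1 ltr01)[d d0 D]; exists 1 => //; exists d. Qed.

Lemma lbddD e1 e2 : lbdd e1 -> lbdd e2 -> lbdd (fun h=> e1 h + e2 h).
Proof.
move=> [K1 K10 [d1 d10 D1]] [K2 K20 [d2 d20 D2]].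
exists (K1 + K2); first lra.
exists (Num.min d1 d2); first by rewrite lt_min d10.
move=> h; rewrite lt_min => /andP[/D1 A /D2 B].
by tri; lra.
Qed.
Lemma lbdd_cst c : lbdd (fun=> c).
Proof. by exists (cmod c + 1); [have := cge0 c; lra|exists 1 => // h _; rewrite lerDl]. Qed.

Lemma tend0_id : tend0 id.
Proof. by move=> eps e0; exists eps => // h /ltW. Qed.

Lemma lito_tend0M e1 e2 : tend0 e1 -> (exists2 K : R, 0 < K & exists2 d : R, 0 < d & forall h, cmod h < d -> cmod (e2 h) <= K * cmod h) ->
 lito (fun h=> e1 h * e2 h).
Proof.
move=> H1 [K K0 [d2 d20 D2]] eps e0.
have [d1 d10 D1] := H1 (eps / K) (divr_gt0 e0 K0).
exists (Num.min d1 d2); first by rewrite lt_min d10.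
move=> h; rewrite lt_min => /andP[/D1 A /D2 B].
have -> : eps * cmod h = eps / K * (K * cmod h) by rewrite mulrA divfK ?gt_eqF.
by rewrite cmodM; apply: ler_pM => //; exact: cge0.
Qed.

Lemma lito_tend0 e : lito e -> tend0 e.
Proof.
move=> H eps e0; have [d d0 D] := H _ e0.
exists (Num.min d 1); first by rewrite lt_min d0 ltr01.
move=> h; rewrite lt_min => /andP[/D A B].
by have := cge0 h; nra.
Qed.
Lemma ccont_ext u v z : u =1 v -> ccont u z -> ccont v z.
Proof. by move=> /funext->. Qed.

Lemma ccontD u v z : ccont u z -> ccont v z -> ccont (fun z=> u z + v z) z.
Proof. by move=> Hu Hv; apply: tend0_ext (tend0D Hu Hv) => h /=; ring. Qed.

Lemma lbdd_ccont u z : ccont u z -> lbdd (fun h=> u (z + h)).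
Proof.
move=> H; have := lbddD (lbdd_tend0 H) (lbdd_cst (u z)).
by congr lbdd; apply/funext => h; rewrite subrK.
Qed.

Lemma ccontM u v z : ccont u z -> ccont v z -> ccont (fun z=> u z * v z) z.
Proof.
move=> Hu Hv; apply: tend0_ext (tend0D (tend0M Hu (lbdd_ccont Hv)) (tend0M Hv (lbdd_cst (u z)))) => h /=; ring.
Qed.
Lemma ccont_cst c z : ccont (fun=> c) z.
Proof. by move=> e e0; exists 1 => // h _; rewrite subrr cmod0 ltW. Qed.

Lemma ccont_id z : ccont id z.
Proof. by apply: tend0_ext tend0_id => h /=; ring. Qed.
Lemma ccont_conj u z : ccont u z -> ccont (fun z=> cj (u z)) z.
Proof. by move=> H e /H[d d0 D]; exists d => // h /D; rewrite -rmorphB cmodJ. Qed.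

Lemma ccontN u z : ccont u z -> ccont (fun z=> - u z) z.
Proof. by move=> H; apply: ccont_ext (ccontM (ccont_cst (-1) z) H) => h /=; ring. Qed.
Lemma ccontB u v z : ccont u z -> ccont v z -> ccont (fun z=> u z - v z) z.
Proof. by move=> Hu Hv; apply: ccontD => //; exact: ccontN. Qed.

Lemma ccontX u n z : ccont u z -> ccont (fun z=> u z ^+ n) z.
Proof.
move=> Hu; elim: n => [|n IH].
 by apply: ccont_ext (ccont_cst 1 z) => w.
by apply: ccont_ext (ccontM Hu IH) => w; rewrite exprS.
Qed.

Lemma ccont_comp u v z : ccont u z -> ccont v (u z) -> ccont (fun z=> v (u z)) z.
Proof.
move=> Hu Hv e e0; have [d d0 D] := Hv _ e0; have d2 : 0 < d / 2 by lra.
have [d' d'0 D'] := Hu _ d2; exists d' => // h /D' A.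
by have := D (u (z + h) - u z); rewrite (addrC (u z) (_ - _)) subrK; apply; lra.
Qed.

Lemma ccont_inv z : z != 0 -> ccont (fun z=> z^-1) z.
Proof.
move=> z0 e e0; have cz : 0 < cmod z by rewrite cmod_gt0.
have dp : 0 < Num.min (cmod z / 2) (e * (cmod z ^+ 2 / 2)).
 by rewrite lt_min; apply/andP; split; [lra|rewrite mulr_gt0 // divr_gt0 // exprn_gt0].
exists (Num.min (cmod z / 2) (e * (cmod z ^+ 2 / 2))) => // h; rewrite lt_min => /andP[h1 h2].
have hz : cmod z / 2 <= cmod (z + h).
 have := cmodD3 z (z + h); have -> : z - (z + h) = - h by ring.
 by rewrite cmodN; lra.
have zh : z + h != 0 by rewrite -cmod_gt0; lra.
have -> : (z + h)^-1 - z^-1 = - h / ((z + h) * z) by field; rewrite z0.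
rewrite !cmodM cmodN cmodV cmodM ler_pdivrMr ?mulr_gt0 //; last lra.
apply: le_trans (ltW h2) _; rewrite ler_pM2l //.
by have := ler_wpM2r (ltW cz) hz; lra.
Qed.
Lemma ccontV u z : ccont u z -> u z != 0 -> ccont (fun z=> (u z)^-1) z.
Proof. by move=> Hu z0; apply: (ccont_comp (v := fun z=> z^-1)) Hu (ccont_inv z0). Qed.

Lemma ccont_wd u z p q : wd u z p q -> ccont u z.
Proof.
move=> /lito_tend0 H.
have H2 : tend0 (fun h=> h * p + cj h * q).
 apply: tend0D; apply: tend0M (lbdd_cst _); first exact: tend0_id.
 by move=> e e0; exists e => // h; rewrite cmodJ => /ltW.
by apply: tend0_ext (tend0D H H2) => h /=; ring.
Qed.
Lemma wd_ext u v z p q : u =1 v -> wd u z p q -> wd v z p q.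
Proof. by move=> /funext->. Qed.

Lemma wd_loc u v z p q (d : R) : 0 < d -> (forall w, cmod (w - z) < d -> u w = v w) ->
 wd u z p q -> wd v z p q.
Proof.
move=> d0 E H e /H[d' d'0 D]; exists (Num.min d d'); first by rewrite lt_min d0.
move=> h; rewrite lt_min => /andP[h1 h2]; rewrite -!E ?D //.
 by rewrite subrr cmod0.
by rewrite addrC addKr.
Qed.
Lemma wdD u v z p q p' q' : wd u z p q -> wd v z p' q' -> wd (fun z=> u z + v z) z (p + p') (q + q').
Proof. by move=> Hu Hv; apply: lito_ext (litoD Hu Hv) => h /=; ring. Qed.

Lemma lip_wd u z p q : wd u z p q -> exists2 K : R, 0 < K & exists2 d : R, 0 < d &
 forall h, cmod h < d -> cmod (u (z + h) - u z) <= K * cmod h.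
Proof.
move=> /(_ 1 ltr01)[d d0 D]; exists (1 + cmod p + cmod q); first by have := cge0 p; have := cge0 q; lra.
exists d => // h /D; set a := u _ - u _ => A.
have := cmodD3 a (p * h + q * cj h); have := cmodD (p * h) (q * cj h).
rewrite !cmodM cmodJ => *; lra.
Qed.

Lemma wdM u v z p q p' q' : wd u z p q -> wd v z p' q' ->
 wd (fun z=> u z * v z) z (p * v z + u z * p') (q * v z + u z * q').
Proof.
move=> Hu Hv.
have H3 := lito_tend0M (ccont_wd Hu) (lip_wd Hv).
have := litoD (litoD (litoM Hu (lbdd_cst (v z))) (litoM Hv (lbdd_cst (u z)))) H3.
by apply: lito_ext => h /=; ring.
Qed.
Lemma lito0 : lito (fun=> 0).
Proof. by move=> e e0; exists 1 => // h _; rewrite cmod0 mulr_ge0 ?cge0 // ltW. Qed.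

Lemma wd_cst c z : wd (fun=> c) z 0 0.
Proof. by apply: lito_ext lito0 => h /=; ring. Qed.
Lemma wd_id z : wd id z 1 0.
Proof. by apply: lito_ext lito0 => h /=; ring. Qed.

Lemma wd_conj u z p q : wd u z p q -> wd (fun z=> cj (u z)) z (cj q) (cj p).
Proof.
move=> H e /H[d d0 D]; exists d => // h /D; rewrite -[in cmod _ <= _]cmodJ.
by rewrite !rmorphB rmorphD !rmorphM /= conjcK [cj p * _ + _]addrC.
Qed.
Lemma wd_eq u z p q p' q' : p = p' -> q = q' -> wd u z p q -> wd u z p' q'.
Proof. by move=> -> ->. Qed.

Lemma wdZ c u z p q : wd u z p q -> wd (fun z=> c * u z) z (c * p) (c * q).
Proof. by move=> H; apply: wd_eq (wdM (wd_cst c z) H); ring. Qed.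
Lemma wdN u z p q : wd u z p q -> wd (fun z=> - u z) z (- p) (- q).
Proof. by move=> H; apply: wd_ext (wd_eq _ _ (wdZ (-1) H)) => [w /=||]; ring. Qed.

Lemma wdB u v z p q p' q' : wd u z p q -> wd v z p' q' -> wd (fun z=> u z - v z) z (p - p') (q - q').
Proof. by move=> Hu Hv; apply: wdD => //; exact: wdN. Qed.

Lemma wd_comp u v z p q P Q : wd u z p q -> wd v (u z) P Q ->
 wd (fun z=> v (u z)) z (P * p + Q * cj q) (P * q + Q * cj p).
Proof.
move=> Hu Hv.
have [K K0 [d0 d00 D0]] := lip_wd Hu.
have H1 : lito (fun h=> v (u (z + h)) - v (u z) - (P * (u (z + h) - u z) + Q * cj (u (z + h) - u z))).
 move=> e e0; have [d1 d10 D1] := Hv (e / K) (divr_gt0 e0 K0).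
 exists (Num.min d0 (d1 / K)); first by rewrite lt_min d00 divr_gt0.
 move=> h; rewrite lt_min => /andP[/D0 A B].
 have B' : cmod (u (z + h) - u z) < d1.
  by apply: le_lt_trans A _; rewrite mulrC -ltr_pdivlMr.
 have := D1 _ B'; rewrite (addrC (u z)) subrK => X; apply: le_trans X _.
 by rewrite mulrAC ler_pdivrMr // -mulrA (mulrC (cmod h)) ler_wpM2l // ltW.
have H2 := litoM Hu (lbdd_cst P).
have H3 := litoM (wd_conj Hu) (lbdd_cst Q).
apply: lito_ext (litoD (litoD H1 H2) H3) => h /=.
rewrite /=; ring.
Qed.

Lemma wd_inv z : z != 0 -> wd (fun z=> z^-1) z (- z ^- 2) 0.
Proof.
move=> z0.
have Hc := ccont_inv z0.
have H : lito (fun h=> ((z + h)^-1 - z^-1) * (- h / z)).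
 apply: lito_tend0M => //; exists (cmod z)^-1; first by rewrite invr_gt0 cmod_gt0.
 by exists 1 => // h _; rewrite cmodM cmodN cmodV mulrC.
have cz : 0 < cmod z by rewrite cmod_gt0.
move=> e e0; have [d d0 D] := H _ e0.
exists (Num.min d (cmod z)); first by rewrite lt_min d0.
move=> h; rewrite lt_min => /andP[/D A hz].
suff -> : (z + h)^-1 - z^-1 - (- z ^- 2 * h + 0 * cj h) = ((z + h)^-1 - z^-1) * (- h / z) by [].
have zh : z + h != 0.
 by apply/negP => /eqP/(canRL (addKr z)); rewrite addr0 => E; move: hz; rewrite E cmodN ltxx.
by field; rewrite z0 zh.
Qed.

Lemma wdV u z p q : wd u z p q -> u z != 0 ->
 wd (fun z=> (u z)^-1) z (- p / u z ^+ 2) (- q / u z ^+ 2).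
Proof.
move=> H z0; apply: wd_eq (wd_comp H (wd_inv z0)); first by rewrite mul0r addr0 mulNr mulrC mulNr.
by rewrite mul0r addr0 mulNr mulrC mulNr.
Qed.

Lemma wdX u n z p q : wd u z p q -> wd (fun z=> u z ^+ n) z (n%:R * u z ^+ n.-1 * p) (n%:R * u z ^+ n.-1 * q).
Proof.
move=> Hu; elim: n => [|n IH].
 by apply: wd_ext (wd_eq _ _ (wd_cst 1 z)) => [w||]; rewrite ?mul0r.
apply: wd_ext (wd_eq _ _ (wdM Hu IH)) => [w||]; rewrite ?exprS //=.
 by case: n {IH} => [|n] /=; rewrite ?exprS; ring.
by case: n {IH} => [|n] /=; rewrite ?expr0 ?exprS -?natr1; ring.
Qed.

(** A real-linear map that is o(h) vanishes by homogeneity; its values at 1 and at i then separate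
    the two coefficients. *)
Lemma wd_uniq u z p q p' q' : wd u z p q -> wd u z p' q' -> p = p' /\ q = q'.
Proof.
move=> H H'.
have D : lito (fun h=> (p - p') * h + (q - q') * cj h).
 by apply: lito_ext (litoD H' (litoM H (lbdd_cst (-1)))) => h /=; ring.
have E c : c != 0 -> (p - p') * c + (q - q') * cj c = 0.
 move=> c0; apply/eqP; rewrite -cmod_eq0; apply/eqP/le_anti; rewrite cge0 andbT.
 apply/ler_addgt0Pr => e e0; rewrite add0r.
 have cc : 0 < cmod c by rewrite cmod_gt0.
 have [d d0 Dd] := D (e / cmod c) (divr_gt0 e0 cc).
 pose t : R := d / (2 * cmod c).
 have t0 : 0 < t by rewrite divr_gt0 // mulr_gt0.
 have ht : cmod (t%:C * c) < d.
  rewrite cmodM cmodR gtr0_norm // /t invfM mulrA mulfVK; lra.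
 have := Dd _ ht; rewrite conjcM conjc_real.
 have -> : (p - p') * (t%:C * c) + (q - q') * (t%:C * cj c) = t%:C * ((p - p') * c + (q - q') * cj c) by ring.
 rewrite !cmodM cmodR gtr0_norm // mulrCA ler_pM2l // divfK ?gt_eqF //.
have E1 := E 1 (oner_neq0 _); have Ei := E 'i (neq0Ci _).
move: E1 Ei; rewrite conjc1 !mulr1.
have -> : cj ('i : C) = - 'i by apply: cx_eq => /=; rewrite ?oppr0.
move=> E1 E2.
have E3 : (p - p') - (q - q') = 0.
 apply: (mulIf (neq0Ci C)); rewrite mul0r -E2 -complexiE; ring.
have E4 : p - p' = 0 by apply: (mulfI (x := 2%:R)); [rewrite pnatr_eq0|rewrite mulr0 -[RHS]addr0 -{1}E1 -E3; ring].
have E5 : q - q' = 0 by move: E1; rewrite E4 add0r.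
by split; apply/eqP; rewrite -subr_eq0 ?E4 ?E5.
Qed.

End Wirtinger.

(** * Compactness of closed discs *)

Section Compact.
Variable R : realType.
Local Notation C := R[i].

Lemma real_BW (u : nat -> R) (r : R) : (forall n, `|u n| <= r) ->
 exists2 f : nat -> nat, (forall n, (n <= f n)%N) & exists l : R, (u \o f) @ \oo --> l.
Proof.
move=> H; have [|f fi fc] := @bolzano_weierstrass R u.
 exists r; split; first exact: num_real.
 by move=> x rx n _ /=; apply: le_trans (H n) (ltW rx).
exists f; last by exists (lim (u \o f @ \oo)).
move=> n; elim: n => // n IH; apply: leq_ltn_trans IH _.
by rewrite ltnNge; have := fi n.+1 n; rewrite !leEnat ltnn => ->.
Qed.

(** Extraction on the real parts, then on the imaginary parts. A cluster point suffices for all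
    later compactness arguments, so that no subsequence is carried along. *)
Lemma cluster_C (u : nat -> C) (r : R) : (forall n, cmod (u n) <= r) ->
 exists2 z : C, cmod z <= r & forall (e : R) N, 0 < e -> exists2 n, (N <= n)%N & cmod (u n - z) < e.
Proof.
move=> H.
have [f f1 [a fa]] := real_BW (fun n=> le_trans (cmod_Re (u n)) (H n)).
have [g g1 [b gb]] := real_BW (fun n=> le_trans (cmod_Im (u (f n))) (H (f n))).
have P (e : R) N : 0 < e -> exists2 n, (N <= n)%N & cmod (u n - (a +i* b)) < e.
 move=> e0; have e2 : 0 < e / 2 by lra.
 have /cvgrPdist_lt/(_ _ e2)[N1 _ H1] := fa.
 have /cvgrPdist_lt/(_ _ e2)[N2 _ H2] := gb.
 pose m := maxn N (maxn N1 N2).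
 exists (f (g m)).
  by apply: leq_trans (f1 _); apply: leq_trans (g1 _); rewrite leq_maxl.
 apply: le_lt_trans (cmod_ReIm _) _.
 have A1 := H1 (g m) (leq_trans (leq_trans (leq_maxl _ _) (leq_maxr _ _)) (g1 m)).
 have A2 := H2 m (leq_trans (leq_maxr _ _) (leq_maxr _ _)).
 rewrite !cReD !cImD !cReN !cImN /= [`|Re _ - a|]distrC [`|Im _ - b|]distrC.
 by move: A1 A2 => /=; lra.
exists (a +i* b) => //.
rewrite leNgt; apply/negP => lt.
have e0 : 0 < cmod (a +i* b) - r by lra.
have [n _ Hn] := P _ 0%N e0.
by have := cmodD3 (a +i* b) (u n); have := H n; rewrite cmodBC; lra.
Qed.

(** Continuity is asked at the points of the closed disc, but through all nearby points of the
    plane; so boundary points need no one-sided notions and Green's formula can use ordinary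
    derivatives there. *)
Definition con (r : R) (u : C -> C) := forall z, cmod z <= r -> ccont u z.

Lemma con_unif (r : R) (u : C -> C) : con r u -> forall e, 0 < e -> exists2 d : R, 0 < d &
 forall z w, cmod z <= r -> cmod w <= r -> cmod (z - w) < d -> cmod (u z - u w) <= e.
Proof.
move=> Hu e e0; apply: contrapT => Hn.
have Hn' (n : nat) : exists p : C * C, [/\ cmod p.1 <= r, cmod p.2 <= r, cmod (p.1 - p.2) < n.+1%:R^-1 & e < cmod (u p.1 - u p.2)].
 apply: contrapT => H2; apply: Hn; exists n.+1%:R^-1; first by rewrite invr_gt0.
 move=> z w hz hw hzw; rewrite leNgt; apply/negP => lt; apply: H2.
 by exists (z, w).
have [p Hp] := choice Hn'.
have [z hz Hz] := @cluster_C (fun n=> (p n).1) r (fun n=> let: And4 h _ _ _ := Hp n in h).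
have e2 : 0 < e / 2 by lra.
have [d d0 D] := Hu z hz _ e2.
have d2 : 0 < d / 2 by lra.
have /cvgrPdist_lt/(_ _ d2)[N _ HN] := @cvg_harmonic R.
have [n Nn Hn2] := Hz (d / 2) N d2.
have [h1 h2 h3 h4] := Hp n.
have := HN n Nn; rewrite sub0r normrN /harmonic /= ger0_norm ?invr_ge0 // => h5.
have D1 : cmod (u (p n).1 - u z) <= e / 2.
 have -> : (p n).1 = z + ((p n).1 - z) by ring.
 by apply: D; lra.
have D2 : cmod (u (p n).2 - u z) <= e / 2.
 have -> : (p n).2 = z + ((p n).2 - z) by ring.
 apply: D; have := cmodD ((p n).2 - (p n).1) ((p n).1 - z).
 have -> : (p n).2 - (p n).1 + ((p n).1 - z) = (p n).2 - z by ring.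
 by rewrite (cmodBC (p n).2 (p n).1); move: h3 h5; set iv := _^-1 => h3 h5; lra.
have := cmodD (u (p n).1 - u z) (u z - u (p n).2); rewrite addrA subrK (cmodBC (u z)).
lra.
Qed.

Lemma con_bdd (r : R) (u : C -> C) : con r u -> exists2 K : R, 0 < K & forall z, cmod z <= r -> cmod (u z) <= K.
Proof.
move=> Hu; apply: contrapT => Hn.
have Hn' (n : nat) : exists p : C, cmod p <= r /\ n.+1%:R < cmod (u p).
 apply: contrapT => H2; apply: Hn; exists n.+1%:R => // z hz.
 by rewrite leNgt; apply/negP => lt; apply: H2; exists z.
have [p Hp] := choice Hn'.
have [z hz Hz] := @cluster_C p r (fun n=> proj1 (Hp n)).
have [d d0 D] := Hu z hz _ ltr01.
have [n Nn hn] := Hz d (Num.truncn (cmod (u z) + 1)) d0.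
have := D (p n - z) hn; rewrite (addrC z) subrK => h1.
have [_ h2] := Hp n.
have := cmodD3 (u (p n)) (u z).
have : cmod (u z) + 1 < n.+1%:R.
 apply: lt_le_trans (Num.Theory.truncnS_gt _) _.
 by rewrite ler_nat.
lra.
Qed.

Lemma con_max (r : R) (u : C -> C) : 0 <= r -> con r u ->
 exists2 z, cmod z <= r & forall w, cmod w <= r -> Re (u w) <= Re (u z).
Proof.
move=> r0 Hu; have [K K0 HK] := con_bdd Hu.
pose E := [set x : R | exists2 z, cmod z <= r & x = Re (u z)].
have hE : has_sup E.
 split; first by exists (Re (u 0)); exists 0; rewrite ?cmod0.
 by exists K => x [z hz ->]; apply: le_trans (ler_Re_cmod _) (HK _ hz).
have Hn (n : nat) : exists z : C, cmod z <= r /\ sup E - n.+1%:R^-1 < Re (u z).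
 have [|x [z hz ->] lt] := sup_adherent (_ : 0 < n.+1%:R^-1) hE; first by rewrite invr_gt0.
 by exists z.
have [p Hp] := choice Hn.
have [z hz Hz] := @cluster_C p r (fun n=> proj1 (Hp n)).
exists z => // w hw; apply: (@le_trans _ _ (sup E)).
 by apply: sup_ubound; [case: hE|exists w].
apply/ler_addgt0Pr => e e0.
have e2 : 0 < e / 2 by lra.
have [d d0 D] := Hu z hz _ e2.
have /cvgrPdist_lt/(_ _ e2)[N _ HN] := @cvg_harmonic R.
have [n Nn hn] := Hz d N d0.
have := HN n Nn; rewrite sub0r normrN /harmonic /= ger0_norm ?invr_ge0 // => h5.
have := D (p n - z) hn; rewrite (addrC z) subrK => h1.
have [_ h2] := Hp n.
have h6 := ler_Re_cmod (u (p n) - u z); rewrite cReD cReN in h6.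
have h7 : Re (u (p n)) <= Re (u z) + e / 2 by lra.
by move: h2 h5; set iv := _^-1; lra.
Qed.

End Compact.

(** * Weierstrass approximation on a disc by a Bernstein-type random walk *)

Section Weierstrass.
Variable R : realType.
Local Notation C := R[i].

(** Polynomials in z and its conjugate, in a form that allows induction for measurability and for
    the passage to sums of monomials. *)
Inductive bip : (C -> C) -> Prop :=
| bip_cst c : bip (fun=> c)
| bip_id : bip id
| bip_conj : bip (fun z=> cj z)
| bip_add u v : bip u -> bip v -> bip (fun z=> u z + v z)
| bip_mul u v : bip u -> bip v -> bip (fun z=> u z * v z).

Lemma bip_ext u v : u =1 v -> bip u -> bip v.
Proof. by move=> /funext->. Qed.

(** The radial retraction onto the closed disc. Composition with it turns a function continuous on
    the disc into one continuous on the plane. *)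
Definition clip (r : R) (z : C) : C := (r / Num.max r (cmod z))%:C * z.

Lemma clip_id r z : 0 < r -> cmod z <= r -> clip r z = z.
Proof. by move=> r0 h; rewrite /clip (max_idPl h) divff ?gt_eqF // mul1r. Qed.

Lemma clip_le r z : 0 < r -> cmod (clip r z) <= r.
Proof.
move=> r0; have m0 : 0 < Num.max r (cmod z) by rewrite lt_max r0.
have rm : 0 <= r / Num.max r (cmod z) by rewrite divr_ge0 // ltW.
rewrite /clip cmodM cmodR (ger0_norm rm) mulrAC ler_pdivrMr //.
by rewrite ler_pM2l // le_max lexx orbT.
Qed.

Lemma ccont_lip (v : C -> R) z : (forall w, `|v w - v z| <= cmod (w - z)) -> ccont (fun z=> (v z)%:C) z.
Proof.
move=> H e e0; exists e => // h he; rewrite -realCN -realCD cmodR.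
by apply: le_trans (H _) _; rewrite addrC addKr ltW.
Qed.

Lemma clip_ccont r z : 0 < r -> ccont (clip r) z.
Proof.
move=> r0.
have m0 w : 0 < Num.max r (cmod w) by rewrite lt_max r0.
apply: ccont_ext (ccontM (ccontM (ccont_cst r%:C z) (ccontV (u := fun z=> (Num.max r (cmod z))%:C) _ _)) (ccont_id z)).
- by move=> w /=; rewrite /clip realCM realCV.
- apply: ccont_lip => w; apply: le_trans (cmod_dist _ _).
 rewrite ler_norml; have := ler_norm (cmod w - cmod z); have := ler_norm (cmod z - cmod w).
 by rewrite (distrC (cmod z)); case: (ltP r (cmod w)); case: (ltP r (cmod z)); lra.
- by rewrite eq_complex /= eqxx andbT gt_eqF.
Qed.

Lemma bip_sum (I : Type) (s : seq I) (u : I -> C -> C) : (forall i, bip (u i)) -> bip (fun z=> \sum_(i <- s) u i z).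
Proof.
move=> H; elim: s => [|i s IH]; first by apply: bip_ext (bip_cst 0) => z; rewrite big_nil.
by apply: bip_ext (bip_add (H i) IH) => z; rewrite big_cons.
Qed.

Lemma bip_Re (c : C) : bip (fun z=> (Re (c * z))%:C).
Proof.
have := bip_mul (bip_cst (2^-1 : C)) (bip_add (bip_mul (bip_cst c) bip_id) (bip_mul (bip_cst (cj c)) bip_conj)).
apply: bip_ext => z.
have h2 : (2 : C) != 0 by rewrite pnatr_eq0.
by apply: (mulfI h2); rewrite mulrA divff // mul1r -conjcM addcJ.
Qed.

(* A random walk whose steps [s i^j], [j < 4], have probabilities [wp s x j] and hence mean [x];
 its expectations are polynomials in [z] and its conjugate when [x] is a multiple of [z]. *)
Definition wp (s : R) (x : C) j : R := 1 / 4 + (2 * s)^-1 * Re (cj ('i%C ^+ j) * x).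

Fixpoint walk s x n (phi : C -> C) w : C :=
 if n is m.+1 then \sum_(j < 4) (wp s x j)%:C * walk s x m phi (w + 'i%C ^+ j * s%:C) else phi w.

(** A quadratic majorant survives each step: the mean moves by [x] and the variance of a step is s^2
    - |x|^2, which is at most s^2. The condition 2 |x| <= s makes the probabilities [wp]
    nonnegative. *)
Lemma walk_le (s e L : R) (x c z : C) n phi w : 0 < s -> 0 <= L -> 2 * cmod x <= s -> (forall w, cmod (phi w - c) <= e + L * cmod (w - z) ^+ 2) ->
 cmod (walk s x n phi w - c) <= e + L * (cmod (w + n%:R * x - z) ^+ 2 + n%:R * s ^+ 2).
Proof.
move=> s0 L0 xs H; elim: n w => [|n IH] w /=; first by rewrite !mul0r !addr0.
have p0 j : 0 <= wp s x j.
 have := cmod_Re (cj ('i%C ^+ j) * x); rewrite cmodM cmodJ cmodX cmod_i expr1n mul1r ler_norml => /andP[h _].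
 have : - (1 / 4) <= Re (cj ('i%C ^+ j) * x) / (2 * s) by rewrite ler_pdivlMr; lra.
 by rewrite /wp mulrC; lra.
have sp (F : nat -> C) : \sum_(j < 4) F j = F 0%N + F 1%N + F 2%N + F 3%N by rewrite !big_ord_recr big_ord0 /= add0r.
have s2 : 2 * s != 0 by rewrite gt_eqF //; lra.
have -> : \sum_(j < 4) (wp s x j)%:C * walk s x n phi (w + 'i%C ^+ j * s%:C) - c = \sum_(j < 4) (wp s x j)%:C * (walk s x n phi (w + 'i%C ^+ j * s%:C) - c).
 under [RHS]eq_bigr do rewrite mulrBr; rewrite sumrB -mulr_suml (sp (fun j=> (wp s x j)%:C)) -!realCD.
 rewrite (_ : wp s x 0 + _ + _ + _ = 1) ?mul1r // /wp; case: x {xs H IH p0} => a b; rewrite !exprS expr0 /=; field; lra.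
apply: le_trans (cmod_sum _ _ _) _.
apply: (@le_trans _ _ (\sum_(j < 4) wp s x j * (e + L * (cmod (w + n%:R * x - z + 'i%C ^+ j * s%:C) ^+ 2 + n%:R * s ^+ 2)))).
 apply: ler_sum => j _; rewrite cmodM cmodR ger0_norm // ler_wpM2l //.
 by have := IH (w + 'i%C ^+ j * s%:C); rewrite (_ : w + _ + _ - z = w + n%:R * x - z + 'i%C ^+ j * s%:C) //; ring.
have -> : w + n.+1%:R * x - z = (w + n%:R * x - z) + x by rewrite -natr1; ring.
have : 0 <= L * cmod x ^+ 2 by rewrite mulr_ge0 ?sqr_ge0.
rewrite -natr1 !big_ord_recr big_ord0 /= /wp !cmod_sqE; case: x (w + n%:R * x - z) {xs H IH p0 sp} => a b [c' d]; rewrite !exprS expr0 /=; move: (n%:R : R) => m h.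
rewrite -subr_ge0; apply: le_trans h _; rewrite le_eqVlt; apply/orP; left; apply/eqP; field; lra.
Qed.

Lemma walk_bip (s k : R) n phi w : bip (fun z=> walk s (k%:C * z) n phi w).
Proof.
elim: n w => [|n IH] w /=; first exact: bip_cst.
apply: bip_sum => j; apply: bip_mul (IH _).
apply: bip_ext (bip_add (bip_cst (1 / 4)%:C) (bip_mul (bip_cst ((2 * s)^-1)%:C) (bip_Re (cj ('i%C ^+ j) * k%:C)))) => z.
by rewrite -realCM -realCD -mulrA.
Qed.

Lemma weierstrass (r : R) (u : C -> C) : 0 < r -> con r u -> forall e, 0 < e ->
 exists2 P, bip P & forall z, cmod z <= r -> cmod (u z - P z) <= e.
Proof.
move=> r0 Hu e e0; pose w z := u (clip r z).
have Hw s : con s w.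
 by move=> z _; apply: ccont_comp (clip_ccont z r0) _; apply: Hu; exact: clip_le.
have e2 : 0 < e / 2 by lra.
have [d d0 D] := con_unif (Hw (2 * r)) e2.
have [K K0 HK] := con_bdd Hu.
pose d' := Num.min d r; have d'0 : 0 < d' by rewrite lt_min d0.
(* Chebyshev's argument: where |v - z| >= d', the crude bound 2 K equals L d'^2 and is absorbed by
   the quadratic term. *)
pose L := 2 * K / d' ^+ 2.
have L0 : 0 < L by rewrite divr_gt0 ?exprn_gt0 ?mulr_gt0.
have est z v : cmod z <= r -> cmod (w v - w z) <= e / 2 + L * cmod (v - z) ^+ 2.
 move=> h; have [|ge] := ltP (cmod (v - z)) d'.
  rewrite lt_min => /andP[h1 h2].
  have [v2 z2] : cmod v <= 2 * r /\ cmod z <= 2 * r by have := cmodD3 v z; split; lra.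
  by apply: le_trans (D _ _ v2 z2 h1) _; rewrite lerDl mulr_ge0 ?sqr_ge0 // ltW.
 apply: le_trans (cmodB _ _) _; apply: (@le_trans _ _ (L * d' ^+ 2)).
  rewrite /L divfK ?gt_eqF ?exprn_gt0 //.
  by rewrite -[2]/(1 + 1) mulrDl mul1r; apply: lerD; rewrite HK // clip_le.
 have : d' ^+ 2 <= cmod (v - z) ^+ 2 by rewrite ler_pXn2r ?nnegrE ?cge0 // ltW.
 by move=> h2; have := ler_wpM2l (ltW L0) h2; lra.
(* After [n] steps of length 2r/n and mean z/n the walk from 0 has mean z and variance at most 4 r^2
   / n. *)
pose n := (Num.truncn (8 * L * r ^+ 2 / e)).+1.
have hn : L * (n%:R * (2 * r / n%:R) ^+ 2) <= e / 2.
 have -> : L * (n%:R * (2 * r / n%:R) ^+ 2) = 4 * L * r ^+ 2 / n%:R by field; rewrite gt_eqF.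
 have := ltW (Num.Theory.truncnS_gt (8 * L * r ^+ 2 / e)).
 by rewrite -/n !ler_pdivrMr //; lra.
exists (fun z=> walk (2 * r / n%:R) (n%:R^-1%:C * z) n w 0); first exact: walk_bip.
move=> z hz; have uz : u z = w z by rewrite /w clip_id.
have xs : 2 * cmod (n%:R^-1%:C * z) <= 2 * r / n%:R.
 by rewrite cmodM cmodR gtr0_norm ?invr_gt0 // [_^-1 * _]mulrC mulrA ler_pM2r ?invr_gt0 // ler_pM2l.
rewrite uz cmodBC; apply: le_trans (walk_le n 0 _ (ltW L0) xs (fun v=> est z v hz)) _.
 by rewrite divr_gt0 // mulr_gt0.
have -> : n%:R * (n%:R^-1%:C * z) = z by rewrite mulrA realCV rmorph_nat mulfV ?mul1r // pnatr_eq0.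
by rewrite add0r subrr cmod0 expr0n add0r; lra.
Qed.
End Weierstrass.

(** * Positive linear functionals on the continuous functions of a disc *)

Section PositiveFunctionals.
Variable R : realType.
Local Notation C := R[i].
Implicit Types (u : C -> C) (v w : C -> R) (r : R).

Definition rc r v := con r (fun z=> (v z)%:C).

(** A common interface for the circle, area and segment integrals, so that one set of lemmas serves
    all three. The mass [I (fun=> 1)] is left free. *)
Record posf r (I : (C -> R) -> R) : Prop := {
 posfD : forall v w, rc r v -> rc r w -> I (fun z=> v z + w z) = I v + I w;
 posfZ : forall c v, rc r v -> I (fun z=> c * v z) = c * I v;
 posf_le : forall v w, rc r v -> rc r w -> (forall z, cmod z <= r -> v z <= w z) -> I v <= I w }.

Lemma con_ext r u u' : u =1 u' -> con r u -> con r u'.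
Proof. by move=> /funext->. Qed.
Lemma conD r u u' : con r u -> con r u' -> con r (fun z=> u z + u' z).
Proof. by move=> H H' z hz; apply: ccontD; [exact: H|exact: H']. Qed.
Lemma conM r u u' : con r u -> con r u' -> con r (fun z=> u z * u' z).
Proof. by move=> H H' z hz; apply: ccontM; [exact: H|exact: H']. Qed.
Lemma conN r u : con r u -> con r (fun z=> - u z).
Proof. by move=> H z hz; apply: ccontN; exact: H. Qed.
Lemma con_conj r u : con r u -> con r (fun z=> cj (u z)).
Proof. by move=> H z hz; apply: ccont_conj; exact: H. Qed.
Lemma con_cst r c : con r (fun=> c).
Proof. by move=> z _; exact: ccont_cst. Qed.
Lemma con_id r : con r id.
Proof. by move=> z _; exact: ccont_id. Qed.
Lemma conX r u n : con r u -> con r (fun z=> u z ^+ n).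
Proof. by move=> H z hz; apply: ccontX; exact: H. Qed.
Lemma con_sum r (J : Type) (s : seq J) (F : J -> C -> C) :
 (forall j, con r (F j)) -> con r (fun z=> \sum_(j <- s) F j z).
Proof.
move=> H; elim: s => [|j s IH].
 by apply: con_ext (con_cst (r:=r) 0) => z; rewrite big_nil.
by apply: con_ext (conD (H j) IH) => z; rewrite big_cons.
Qed.
Lemma rc_ext r v w : v =1 w -> rc r v -> rc r w.
Proof. by move=> /funext->. Qed.
Lemma rcD r v w : rc r v -> rc r w -> rc r (fun z=> v z + w z).
Proof. by move=> H H'; apply: con_ext (conD H H') => z; rewrite realCD. Qed.
Lemma rcM r v w : rc r v -> rc r w -> rc r (fun z=> v z * w z).
Proof. by move=> H H'; apply: con_ext (conM H H') => z; rewrite realCM. Qed.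
Lemma rcN r v : rc r v -> rc r (fun z=> - v z).
Proof. by move=> H; apply: con_ext (conN H) => z; rewrite realCN. Qed.
Lemma rc_cst r c : rc r (fun=> c).
Proof. exact: con_cst. Qed.
Lemma rcB r v w : rc r v -> rc r w -> rc r (fun z=> v z - w z).
Proof. by move=> H H'; apply: rcD => //; exact: rcN. Qed.
Lemma rcX r v n : rc r v -> rc r (fun z=> v z ^+ n).
Proof.
move=> H; elim: n => [|n IH]; first by apply: rc_ext (rc_cst (r:=r) 1) => z; rewrite expr0.
by apply: rc_ext (rcM H IH) => z; rewrite exprS.
Qed.
Lemma rc_lip r u (F : C -> R) : (forall z w : C, `|F z - F w| <= cmod (z - w)) -> con r u -> rc r (fun z=> F (u z)).
Proof.
move=> H Hu z hz e e0; have [d d0 D] := Hu z hz _ e0; exists d => // h /D A.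
by rewrite -realCN -realCD cmodR; apply: le_trans (H _ _) A.
Qed.
Lemma rc_Re r u : con r u -> rc r (fun z=> Re (u z)).
Proof. by apply: rc_lip => z w; rewrite -cReN -cReD; exact: cmod_Re. Qed.
Lemma rc_Im r u : con r u -> rc r (fun z=> Im (u z)).
Proof. by apply: rc_lip => z w; rewrite -cImN -cImD; exact: cmod_Im. Qed.
Lemma rc_cmod r u : con r u -> rc r (fun z=> cmod (u z)).
Proof. by apply: rc_lip => z w; exact: cmod_dist. Qed.

End PositiveFunctionals.

Ltac conT := repeat (cbv beta; lazymatch goal with
 | |- con _ (fun _=> ?a) => exact: con_cst
 | |- con _ (fun z=> z) => exact: con_id
 | |- con _ id => exact: con_id
 | |- con ?r (fun z=> @?a z + @?b z)%R => apply: (@conD _ r a b)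
 | |- con ?r (fun z=> - @?a z)%R => apply: (@conN _ r a)
 | |- con ?r (fun z=> @?a z * @?b z)%R => apply: (@conM _ r a b)
 | |- con ?r (fun z=> cj (@?a z)) => apply: (@con_conj _ r a)
 | |- con ?r (fun z=> @?a z ^+ ?n)%R => apply: (@conX _ r a n)
 | |- con ?r (fun z=> (@?v z)%:C) => change (rc r v)
 | |- rc _ (fun _=> ?a) => exact: rc_cst
 | |- rc ?r (fun z=> @?a z + @?b z)%R => apply: (@rcD _ r a b)
 | |- rc ?r (fun z=> - @?a z)%R => apply: (@rcN _ r a)
 | |- rc ?r (fun z=> @?a z * @?b z)%R => apply: (@rcM _ r a b)
 | |- rc ?r (fun z=> @?a z ^+ ?n)%R => apply: (@rcX _ r a n)
 | |- rc ?r (fun z=> Re (@?a z)) => apply: (@rc_Re _ r a)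
 | |- rc ?r (fun z=> Im (@?a z)) => apply: (@rc_Im _ r a)
 | |- rc ?r (fun z=> cmod (@?a z)) => apply: (@rc_cmod _ r a)
 | _ => assumption
 end).

Section PositiveFunctionals2.
Variable R : realType.
Local Notation C := R[i].
Implicit Types (u : C -> C) (v w : C -> R) (r : R).

Lemma posf_eq r I v w : posf r I -> rc r v -> rc r w -> (forall z, cmod z <= r -> v z = w z) -> I v = I w.
Proof. by move=> HI Hv Hw E; apply/le_anti; rewrite !(posf_le HI) // => z hz; rewrite E. Qed.
Lemma posfN r I v : posf r I -> rc r v -> I (fun z=> - v z) = - I v.
Proof.
move=> HI Hv; rewrite -mulN1r -(posfZ HI) //; apply: (posf_eq HI) => //.
- exact: rcN.
- by conT.
- by move=> z _; rewrite mulN1r.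
Qed.
Lemma posfB r I v w : posf r I -> rc r v -> rc r w -> I (fun z=> v z - w z) = I v - I w.
Proof. by move=> HI Hv Hw; rewrite (posfD HI) ?(posfN HI) //; exact: rcN. Qed.
Lemma posf_cst r I c : posf r I -> I (fun=> c) = c * I (fun=> 1).
Proof.
move=> HI; rewrite -(posfZ HI) //; last exact: rc_cst.
by congr I; apply/funext => z; rewrite mulr1.
Qed.
Lemma posf_ge0 r I v : posf r I -> rc r v -> (forall z, cmod z <= r -> 0 <= v z) -> 0 <= I v.
Proof. by move=> HI Hv H; rewrite -(mul0r (I (fun=> 1))) -(posf_cst 0 HI) (posf_le HI) //; exact: rc_cst. Qed.

Definition cI (I : (C -> R) -> R) u : C := I (fun z=> Re (u z)) +i* I (fun z=> Im (u z)).

Lemma cID r I u u' : posf r I -> con r u -> con r u' -> cI I (fun z=> u z + u' z) = cI I u + cI I u'.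
Proof.
move=> HI H H'; apply: cx_eq; rewrite ?cReD ?cImD /=.
 by rewrite -(posfD HI); [congr I; apply/funext => z; rewrite cReD|exact: rc_Re..].
by rewrite -(posfD HI); [congr I; apply/funext => z; rewrite cImD|exact: rc_Im..].
Qed.

Lemma cIZ r I c u : posf r I -> con r u -> cI I (fun z=> c * u z) = c * cI I u.
Proof.
move=> HI H; have Hr := rc_Re H; have Hi := rc_Im H.
apply: cx_eq; rewrite ?cReM ?cImM /=.
 rewrite -!(posfZ HI) // -(posfB HI); [|by conT|by conT].
 by congr I; apply/funext => z; rewrite cReM.
rewrite -!(posfZ HI) // -(posfD HI); [|by conT|by conT].
by congr I; apply/funext => z; rewrite cImM; ring.
Qed.

Lemma cI_ext r I u u' : posf r I -> con r u -> con r u' -> (forall z, cmod z <= r -> u z = u' z) -> cI I u = cI I u'.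
Proof.
move=> HI H H' E; apply: cx_eq => /=.
 by apply: (posf_eq HI (rc_Re H) (rc_Re H')) => z hz; rewrite E.
by apply: (posf_eq HI (rc_Im H) (rc_Im H')) => z hz; rewrite E.
Qed.
Lemma cIN r I u : posf r I -> con r u -> cI I (fun z=> - u z) = - cI I u.
Proof. by move=> HI H; rewrite -mulN1r -(cIZ _ HI) //; congr cI; apply/funext => z; rewrite mulN1r. Qed.
Lemma cIB r I u u' : posf r I -> con r u -> con r u' -> cI I (fun z=> u z - u' z) = cI I u - cI I u'.
Proof. by move=> HI H H'; rewrite (cID HI) ?(cIN HI) //; exact: conN. Qed.
Lemma cI_real I v : I (fun=> 0) = 0 -> cI I (fun z=> (v z)%:C) = (I v)%:C.
Proof. by move=> E; rewrite /cI /= E. Qed.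

(** Multiplication by a unimodular constant makes the integral real and nonnegative; then real parts
    are compared with moduli. *)
Lemma cI_norm r I u : posf r I -> con r u -> cmod (cI I u) <= I (fun z=> cmod (u z)).
Proof.
move=> HI H; have Hc := rc_cmod H.
have [->|n0] := eqVneq (cI I u) 0.
 by rewrite cmod0; apply: (posf_ge0 HI) => // z _; exact: cge0.
have c0 : 0 < cmod (cI I u) by rewrite cmod_gt0.
pose a := cj (cI I u) / (cmod (cI I u))%:C.
have E : cI I (fun z=> a * u z) = (cmod (cI I u))%:C.
 rewrite (cIZ _ HI) // /a mulrAC (mulrC (cj _)) mulcJ expr2 realCM mulfK //.
 by rewrite eq_complex /= eqxx andbT gt_eqF.
have -> : cmod (cI I u) = Re (cI I (fun z=> a * u z)) by rewrite E.
apply: (posf_le HI) => //; first by conT.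
move=> z _; apply: le_trans (ler_Re_cmod _) _.
by rewrite cmodM /a cmodM cmodJ cmodV cmodR gtr0_norm // divff ?mul1r // gt_eqF.
Qed.

Lemma cI_sum r I (J : Type) (s : seq J) (F : J -> C -> C) : posf r I -> (forall j, con r (F j)) ->
 cI I (fun z=> \sum_(j <- s) F j z) = \sum_(j <- s) cI I (F j).
Proof.
move=> HI H; elim: s => [|j s IH].
 rewrite big_nil; under [X in cI I X]funext do rewrite big_nil.
 rewrite -[RHS](mul0r (cI I (fun=> 0))) -(cIZ 0 HI (con_cst (r:=r) 0)).
 by congr cI; apply/funext => z; rewrite mul0r.
rewrite big_cons -IH -(cID HI) //; last exact: con_sum.
by congr cI; apply/funext => z; rewrite big_cons.
Qed.

Lemma cI_le r I u e : posf r I -> con r u -> (forall z, cmod z <= r -> cmod (u z) <= e) ->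
 cmod (cI I u) <= e * I (fun=> 1).
Proof.
move=> HI H le; rewrite -(posf_cst _ HI); apply: le_trans (cI_norm HI H) _.
by apply: (posf_le HI) => //; [exact: rc_cmod|exact: rc_cst].
Qed.

End PositiveFunctionals2.

(** * Lebesgue integrals as positive functionals *)

Section Integrals.
Variable R : realType.
Local Notation C := R[i].
Variables (d : measure_display) (T : measurableType d) (mu : {measure set T -> \bar R}).
Variables (D : set T) (g : T -> C) (r : R).
Hypotheses (mD : measurable D) (finD : (mu D < +oo)%E) (r0 : 0 < r).
Hypotheses (mgr : measurable_fun D (fun x=> Re (g x))) (mgi : measurable_fun D (fun x=> Im (g x))).
Hypothesis gr : forall x, D x -> cmod (g x) <= r.

Lemma bip_measurable u : bip u -> measurable_fun D (fun x=> Re (u (g x))) /\ measurable_fun D (fun x=> Im (u (g x))).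
Proof.
elim=> [c|||u1 u2 _ [r1 i1] _ [r2 i2]|u1 u2 _ [r1 i1] _ [r2 i2]].
- by split; exact: measurable_cst.
- by split.
- split.
  by apply: eq_measurable_fun mgr => x _; case: (g x).
 by apply: eq_measurable_fun (measurable_funN mgi) => x _ /=; case: (g x).
- split.
  by apply: eq_measurable_fun (measurable_funD r1 r2) => x _ /=; rewrite cReD.
 by apply: eq_measurable_fun (measurable_funD i1 i2) => x _ /=; rewrite cImD.
- split.
  by apply: eq_measurable_fun (measurable_funB (measurable_funM r1 r2) (measurable_funM i1 i2)) => x _ /=; rewrite cReM.
 by apply: eq_measurable_fun (measurable_funD (measurable_funM r1 i2) (measurable_funM i1 r2)) => x _ /=; rewrite cImM.
Qed.

(** By Weierstrass approximation [v \o g] is a pointwise limit of polynomials in the coordinates of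
    [g]; no measurable structure on the complex plane enters. *)
Lemma rc_measurable (v : C -> R) : rc r v -> measurable_fun D (fun x=> v (g x)).
Proof.
move=> Hv.
have H (n : nat) : exists P, bip P /\ forall z, cmod z <= r -> cmod ((v z)%:C - P z) <= n.+1%:R^-1.
 have [|P bP HP] := weierstrass r0 Hv (_ : 0 < n.+1%:R^-1); first by rewrite invr_gt0.
 by exists P.
have [P HP] := choice H.
apply: (@measurable_fun_cvg _ _ _ _ (fun n x => Re (P n (g x)))).
 by move=> n; have [] := bip_measurable (HP n).1.
move=> x Dx; apply/cvgrPdist_lt => e e0.
have /cvgrPdist_lt/(_ _ e0)[N _ HN] := @cvg_harmonic R.
exists N => // n Nn; have := HN n Nn; rewrite sub0r normrN /harmonic /= ger0_norm ?invr_ge0 //.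
apply: le_lt_trans; apply: le_trans ((HP n).2 _ (gr Dx)).
by apply: le_trans (cmod_Re _); rewrite cReD cReN.
Qed.

Lemma rc_integrable (v : C -> R) : rc r v -> mu.-integrable D (EFin \o (fun x=> v (g x))).
Proof.
move=> Hv; apply: measurable_bounded_integrable => //; first exact: rc_measurable.
have [K K0 HK] := con_bdd Hv.
exists K; split; first exact: num_real.
move=> x Kx y Dy /=; apply: le_trans (ltW Kx).
by have := HK _ (gr Dy); rewrite cmodR.
Qed.

Lemma posf_int : posf r (fun v=> (\int[mu]_(x in D) v (g x))%R).
Proof.
split=> [v w Hv Hw|c v Hv|v w Hv Hw le].
- by rewrite RintegralD //; exact: rc_integrable.
- by rewrite RintegralZl //; exact: rc_integrable.
- by apply: le_Rintegral => //; [exact: rc_integrable..|move=> x Dx; apply/le/gr].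
Qed.

End Integrals.

(** * Calculus on the real line and along plane curves *)

Section RealLine.
Variable R : realType.
Local Notation C := R[i].
Local Notation leb := (@lebesgue_measure R).

Definition RI (a b : R) (F : R -> R) : R := (\int[leb]_(x in `[a, b]) F x)%R.

Lemma is_deriveP (f : R -> R) (t df : R) :
 (forall e, 0 < e -> exists2 d : R, 0 < d & forall h, `|h| < d -> `|f (t + h) - f t - df * h| <= e * `|h|)
 <-> is_derive t 1 f df.
Proof.
split => [H|[D E]].
- have cv : (fun h : R => h^-1 *: ((f \o shift t) (h *: (1 : R)) - f t)) @ 0^' --> df.
  apply/cvgrPdist_le => e e0; have [d d0 Hd] := H _ e0.
  near=> h.
  have h0 : h != 0 by near: h; exact: nbhs_dnbhs_neq.
  have hd : `|h| < d.
   near: h; apply: nbhs_dnbhs; exists d => //= x /=; by rewrite sub0r normrN.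
  rewrite /= /GRing.scale /= mulr1 distrC (addrC h t).
  have := Hd h hd.
  have -> : f (t + h) - f t - df * h = (h^-1 * (f (t + h) - f t) - df) * h by field.
  by rewrite normrM ler_pM2r // normr_gt0.
 by split; [apply/cvg_ex; exists df|apply/cvg_lim].
- move=> e e0.
 have cv : (fun h : R => h^-1 *: ((f \o shift t) (h *: (1 : R)) - f t)) @ 0^' --> df.
  by rewrite -E; exact: D.
 move/cvgrPdist_le : cv => /(_ e e0) [d /= d0 Hd].
 exists d => // h hd.
 have [->|h0] := eqVneq h 0; first by rewrite addr0 subrr mulr0 subrr normr0 mulr0.
 have := Hd h; rewrite /= sub0r normrN => /(_ hd h0).
 rewrite /GRing.scale /= mulr1 distrC (addrC h t) => A.
 have -> : f (t + h) - f t - df * h = (h^-1 * (f (t + h) - f t) - df) * h by field.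
 by rewrite normrM ler_wpM2r.
Unshelve. all: by end_near.
Qed.
Lemma derive_cont (f : R -> R) (t df : R) : is_derive t 1 f df -> {for t, continuous f}.
Proof. by move=> H; apply/differentiable_continuous/derivable1_diffP; exact: ex_derive. Qed.

Lemma cont_integrable (F : R -> R) (a b : R) : continuous F -> leb.-integrable `[a, b] (EFin \o F).
Proof.
move=> cF; apply: continuous_compact_integrable; first exact: segment_compact.
exact: continuous_subspaceT.
Qed.

Lemma RI_FTC (F G : R -> R) (a b : R) : a < b -> continuous F -> (forall x : R, a <= x <= b -> is_derive x 1 G (F x)) ->
 RI a b F = G b - G a.
Proof.
move=> ab cF dG; rewrite /RI /Rintegral.
rewrite (@continuous_FTC2 R F G a b) //.
- exact: continuous_subspaceT.
- split.
 + by move=> x; rewrite in_itv /= => /andP[h1 h2]; have [] := dG x (introT andP (conj (ltW h1) (ltW h2))).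
 + apply: cvg_at_right_filter; apply: derive_cont (dG a _); by rewrite lexx ltW.
 + apply: cvg_at_left_filter; apply: derive_cont (dG b _); by rewrite lexx ltW.
- move=> x; rewrite in_itv /= => /andP[h1 h2]; rewrite derive1E.
 by have [_ ->] := dG x (introT andP (conj (ltW h1) (ltW h2))).
Qed.

Lemma antideriv (F : R -> R) (N : R) : continuous F -> exists G : R -> R, forall x : R, `|x| < N -> is_derive x 1 G (F x).
Proof.
move=> cF; exists (fun x=> RI (- N) x F) => x; rewrite ltr_norml => /andP[h1 h2].
have [] := @continuous_FTC1_closed R F (- N) x N h2 (cont_integrable _ _ cF) h1 (cF x).
by rewrite derive1E => D E; split.
Qed.

Lemma RI_le (F G : R -> R) a b : continuous F -> continuous G -> (forall x, a <= x <= b -> F x <= G x) ->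
 RI a b F <= RI a b G.
Proof.
move=> cF cG le; by apply: le_Rintegral => //; exact: cont_integrable.
Qed.
Lemma RI_eq (F G : R -> R) a b : (forall x, a <= x <= b -> F x = G x) -> RI a b F = RI a b G.
Proof. by move=> E; apply: eq_Rintegral => x; rewrite inE /= in_itv; exact: E. Qed.

Lemma RI_cst c a b : a <= b -> RI a b (fun=> c) = c * (b - a).
Proof.
move=> ab; have E : fine (leb `[a, b]%classic) = b - a.
 rewrite lebesgue_measure_itv /=.
 move: ab; rewrite le_eqVlt => /orP[/eqP->|ab]; first by rewrite ltxx subrr.
 by rewrite lte_fin ab.
by rewrite /RI Rintegral_cst //; congr (_ * _); exact: E.
Qed.
Lemma cont_mul (f g : R -> R) : continuous f -> continuous g -> continuous (fun x=> f x * g x).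
Proof. by move=> cf cg x; apply: continuousM; [exact: cf|exact: cg]. Qed.

Lemma cont_addf (f g : R -> R) : continuous f -> continuous g -> continuous (fun x=> f x + g x).
Proof. by move=> cf cg x; apply: continuousD; [exact: cf|exact: cg]. Qed.
Lemma cont_opp (f : R -> R) : continuous f -> continuous (fun x=> - f x).
Proof. by move=> cf x; apply: continuousN; exact: cf. Qed.

Lemma cont_comp (f g : R -> R) : continuous f -> continuous g -> continuous (fun x=> f (g x)).
Proof. by move=> cf cg x; apply: (continuous_comp (cg x)); exact: cf. Qed.

Lemma RI_subst (F G g g' : R -> R) (a b : R) : a < b -> continuous F -> continuous g' ->
 (forall x : R, is_derive x 1 g (g' x)) -> (forall x : R, a <= x <= b -> is_derive (g x) 1 G (F (g x))) ->
 RI a b (fun t=> F (g t) * g' t) = G (g b) - G (g a).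
Proof.
move=> ab cF cg' dg dG; apply: (@RI_FTC _ (G \o g) _ _ ab).
 apply: cont_mul => //; apply: cont_comp => // x; exact: derive_cont (dg x).
by move=> x hx; have Hg := dg x; have HG := dG x hx; exact: is_derive1_comp.
Qed.

Lemma contP (f : R -> R) t : {for t, continuous f} <->
 forall e, 0 < e -> exists2 d : R, 0 < d & forall h, `|h| < d -> `|f (t + h) - f t| <= e.
Proof.
split => [/cvgrPdist_le H e e0|H].
 have [d /= d0 D] := H e e0; exists d => // h hd; rewrite distrC; apply: D => /=.
 by rewrite opprD addNKr normrN.
apply/cvgrPdist_le => e e0; have [d d0 D] := H e e0; exists d => // h /= hd.
by rewrite distrC -(subrK t h) (addrC _ t); apply: D; rewrite distrC.
Qed.

Lemma ccont_real (s : R -> R) z : {for Re z, continuous s} -> ccont (fun z=> (s (Re z))%:C) z.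
Proof.
move=> /contP H e e0; have [d d0 D] := H e e0; exists d => // h hd.
rewrite -realCN -realCD cmodR cReD; apply: D; apply: le_lt_trans (cmod_Re h) hd.
Qed.

Lemma ccont_curve (u : C -> C) (s1 s2 : R -> R) t : {for t, continuous s1} -> {for t, continuous s2} ->
 ccont u (s1 t +i* s2 t) -> {for t, continuous (fun t=> Re (u (s1 t +i* s2 t)))}.
Proof.
move=> /contP c1 /contP c2 cu; apply/contP => e e0.
have [d d0 D] := cu e e0; have d2 : 0 < d / 4 by lra.
have [d1 d10 D1] := c1 _ d2; have [d3 d30 D3] := c2 _ d2.
exists (Num.min d1 d3); first by rewrite lt_min d10.
move=> h; rewrite lt_min => /andP[/D1 A1 /D3 A2].
have E : (s1 t +i* s2 t) + ((s1 (t + h) - s1 t) +i* (s2 (t + h) - s2 t)) = s1 (t + h) +i* s2 (t + h).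
 by apply: cx_eq => /=; ring.
rewrite -cReN -cReD; apply: le_trans (cmod_Re _) _.
by rewrite -E; apply: D; apply: le_lt_trans (cmod_ReIm _) _ => /=; lra.
Qed.

Lemma wd_real (s : R -> R) (z : C) (ds : R) : is_derive (Re z) 1 s ds ->
 wd (fun z=> (s (Re z))%:C) z (ds / 2)%:C (ds / 2)%:C.
Proof.
move=> /is_deriveP H e e0; have [d d0 D] := H e e0; exists d => // h hd.
have -> : (s (Re (z + h)))%:C - (s (Re z))%:C - ((ds / 2)%:C * h + (ds / 2)%:C * cj h)
 = (s (Re z + Re h) - s (Re z) - ds * Re h)%:C.
 rewrite cReD; case: h {hd} => h1 h2 /=; by apply: cx_eq => /=; field.
rewrite cmodR; apply: le_trans (D _ _) _; first by apply: le_lt_trans (cmod_Re h) hd.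
by rewrite ler_wpM2l ?cmod_Re // ltW.
Qed.

Lemma wd_real_derive (u : C -> C) (t : R) p q : wd u t%:C p q ->
 is_derive t 1 (fun t : R => Re (u t%:C)) (Re (p + q)).
Proof.
move=> H; apply/is_deriveP => e e0; have [d d0 D] := H e e0; exists d => // h hd.
have := D h%:C; rewrite cmodR => /(_ hd); apply: le_trans.
apply: le_trans (cmod_Re _); rewrite conjc_real -mulrDl -realCD.
have -> (a b : C) (x : R) : Re (a - b * x%:C) = Re a - Re b * x.
 by rewrite cReD cReN cReM /= mulr0 subr0.
by rewrite [Re (_ - u _)]cReD cReN.
Qed.

(** The curve is read as the function s1 (Re z) + i s2 (Re z) of a complex variable, so that the
    chain rule for Wirtinger derivatives applies before the restriction to the real line. *)
Lemma wd_curve (u : C -> C) (s1 s2 : R -> R) (t d1 d2 : R) p q :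
 is_derive t 1 s1 d1 -> is_derive t 1 s2 d2 -> wd u (s1 t +i* s2 t) p q ->
 is_derive t 1 (fun t=> Re (u (s1 t +i* s2 t))) (Re (p * (d1 +i* d2) + q * (d1 -i* d2))).
Proof.
move=> H1 H2 Hu.
have G : wd (fun z=> (s1 (Re z))%:C + 'i%C * (s2 (Re z))%:C) t%:C ((d1 / 2)%:C + 'i%C * (d2 / 2)%:C) ((d1 / 2)%:C + 'i%C * (d2 / 2)%:C).
 by apply: wdD; [exact: wd_real|apply: wdZ; exact: wd_real].
have E x : (s1 x)%:C + 'i%C * (s2 x)%:C = s1 x +i* s2 x.
 by apply: cx_eq => /=; ring.
have Hu' : wd u ((fun z=> (s1 (Re z))%:C + 'i%C * (s2 (Re z))%:C) t%:C) p q by rewrite /= E.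
have := wd_real_derive (wd_comp G Hu').
rewrite (_ : (fun t=> _) = (fun t=> Re (u (s1 t +i* s2 t)))); last first.
 by apply/funext => x; rewrite /= E.
rewrite (_ : Re _ = Re (p * (d1 +i* d2) + q * (d1 -i* d2))) //.
by case: p {Hu Hu'} => p1 p2; case: q => q1 q2 /=; field.
Qed.

End RealLine.

(** * Circle and area integrals on discs, and Fubini's theorem *)

Section DiscIntegrals.
Variable R : realType.
Local Notation C := R[i].
Local Notation leb := (@lebesgue_measure R).

Lemma leb_itv (a b : R) : a <= b -> leb `[a, b]%classic = (b - a)%:E.
Proof.
move=> ab; rewrite lebesgue_measure_itv /=.
move: ab; rewrite le_eqVlt => /orP[/eqP->|ab]; first by rewrite ltxx subrr.
by rewrite lte_fin ab.
Qed.
Lemma leb_fin (a b : R) : (leb `[a, b]%classic < +oo)%E.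
Proof. by rewrite lebesgue_measure_itv /=; case: ifP => _; [exact: ltry|exact: lt0y]. Qed.

Lemma abs_le_sq (x r : R) : 0 <= r -> x ^+ 2 <= r ^+ 2 -> `|x| <= r.
Proof. by move=> r0 h; rewrite -(ger0_norm r0) -!sqrtr_sqr ler_wsqrtr. Qed.

Definition circ (r t : R) : C := (r * cos t) +i* (r * sin t).
Definition Mr (r : R) (v : C -> R) : R := (\int[leb]_(t in `[0, 2 * pi]) v (circ r t))%R.
Definition dsk (r : R) : set (R * R) := [set p | p.1 ^+ 2 + p.2 ^+ 2 < r ^+ 2].
Definition Ar (r : R) (v : C -> R) : R :=
 (\int[(leb \x leb)%E]_(p in dsk r) v (p.1 +i* p.2))%R.

Lemma cmod_circ r t : 0 <= r -> cmod (circ r t) = r.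
Proof.
move=> r0; rewrite /cmod /= !exprMn -mulrDr cos2Dsin2 mulr1 sqrtr_sqr ger0_norm //.
Qed.
Lemma cont_cos : continuous (@cos R).
Proof. exact: continuous_cos. Qed.
Lemma cont_sin : continuous (@sin R).
Proof. exact: continuous_sin. Qed.
Lemma cont_cst (c : R) : continuous (fun _ : R => c).
Proof. by move=> x; exact: cst_continuous. Qed.

Lemma cont_circ r (v : C -> R) : 0 <= r -> rc r v -> continuous (fun t=> v (circ r t)).
Proof.
move=> r0 Hv t.
apply: (@ccont_curve R (fun z=> (v z)%:C) (fun t=> r * cos t) (fun t=> r * sin t)).
- by apply: cont_mul; [exact: cont_cst|exact: cont_cos].
- by apply: cont_mul; [exact: cont_cst|exact: cont_sin].
- by apply: Hv; rewrite cmod_circ.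
Qed.

Lemma posf_Mr r : 0 < r -> posf r (Mr r).
Proof.
move=> r0; apply: (@posf_int R _ _ leb `[0, 2 * pi]%classic (circ r) r) => //.
- exact: leb_fin.
- apply: measurable_funTS; apply: continuous_measurable_fun.
 by apply: cont_mul; [exact: cont_cst|exact: cont_cos].
- apply: measurable_funTS; apply: continuous_measurable_fun.
 by apply: cont_mul; [exact: cont_cst|exact: cont_sin].
- by move=> t _; rewrite cmod_circ // ltW.
Qed.

Lemma measurable_dsk r : measurable (dsk r).
Proof.
pose h (p : R * R) := r ^+ 2 - (p.1 ^+ 2 + p.2 ^+ 2).
have mh : measurable_fun setT h.
 apply: measurable_funB => //; apply: measurable_funD; apply: measurable_funX => //.
have -> : dsk r = setT `&` h @^-1` `]0, +oo[%classic.
 by apply/seteqP; split => p /=; rewrite /dsk /h /= in_itv /= andbT subr_gt0 // => -[].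
by apply: mh => //; exact: measurable_itv.
Qed.

Lemma dsk_sub r : 0 < r -> dsk r `<=` `[- r, r]%classic `*` `[- r, r]%classic.
Proof.
move=> r0 [x y]; rewrite /dsk /= => h; rewrite !in_itv /= -!ler_norml.
by split; apply: abs_le_sq; rewrite ?(ltW r0) //; have := sqr_ge0 x; have := sqr_ge0 y; lra.
Qed.

Lemma dsk_fin r : 0 < r -> ((leb \x leb)%E (dsk r) < +oo)%E.
Proof.
move=> r0; apply: (@le_lt_trans _ _ ((leb \x leb)%E (`[- r, r]%classic `*` `[- r, r]%classic))).
 apply: le_measure; rewrite ?inE; [exact: measurable_dsk|by apply: measurableX|exact: dsk_sub].
rewrite product_measure1E //; apply: (@le_lt_trans _ _ ((r - - r)%:E * (r - - r)%:E)%E); last by rewrite -EFinM ltry.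
rewrite le_eqVlt; apply/orP; left; apply/eqP.
by congr (_ * _)%E; apply: leb_itv; lra.
Qed.

Lemma posf_Ar r : 0 < r -> posf r (Ar r).
Proof.
move=> r0; apply: (@posf_int R _ _ (leb \x leb)%E (dsk r) (fun p=> p.1 +i* p.2) r) => //.
- exact: measurable_dsk.
- exact: dsk_fin.
- exact: (measurable_funTS measurable_fst).
- exact: (measurable_funTS measurable_snd).
- move=> p; rewrite /dsk /cmod /= => h.
 by rewrite -[leRHS](gtr0_norm r0) -sqrtr_sqr ler_wsqrtr // ltW.
Qed.

Lemma Ar_integrable r v : 0 < r -> rc r v ->
 (leb \x leb)%E.-integrable (dsk r) (EFin \o (fun p=> v (p.1 +i* p.2))).
Proof.
move=> r0 Hv; apply: (@rc_integrable R _ _ (leb \x leb)%E (dsk r) (fun p=> p.1 +i* p.2) r) => //.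
- exact: measurable_dsk.
- exact: dsk_fin.
- exact: (measurable_funTS measurable_fst).
- exact: (measurable_funTS measurable_snd).
- move=> p; rewrite /dsk /cmod /= => h.
 by rewrite -[leRHS](gtr0_norm r0) -sqrtr_sqr ler_wsqrtr // ltW.
Qed.

(** Half-width of the slice at height [y]. The square root of a negative number being 0, it vanishes
    for |y| >= r, so that slices outside the disc need no separate formula. *)
Definition hs (r y : R) := Num.sqrt (r ^+ 2 - y ^+ 2).

Lemma slice_set r y : [set x | x ^+ 2 + y ^+ 2 < r ^+ 2] = `](- hs r y), (hs r y)[%classic.
Proof.
apply/seteqP; split => x /=; rewrite in_itv /= -ltr_norml => h.
 rewrite -sqrtr_sqr /hs ltr_sqrt; have := sqr_ge0 x; lra.
have p : 0 < r ^+ 2 - y ^+ 2.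
 by rewrite -sqrtr_gt0; apply: le_lt_trans h.
move: h; rewrite -(@ltr_pXn2r _ 2) ?nnegrE ?sqrtr_ge0 // real_normK ?num_real // sqr_sqrtr ?ltW //; lra.
Qed.

Lemma hs_bound r x y : `|x| <= hs r y -> `|y| <= r -> 0 < r -> cmod (x +i* y) <= r.
Proof.
move=> hx hy r0; rewrite -(@ler_pXn2r _ 2) ?nnegrE ?cge0 ?(ltW r0) // cmod_sqE /=.
have p : 0 <= r ^+ 2 - y ^+ 2.
 by rewrite subr_ge0 -[_ ^+ 2]real_normK ?num_real // ler_pXn2r ?nnegrE ?(ltW r0).
have : `|x| ^+ 2 <= hs r y ^+ 2 by rewrite ler_pXn2r ?nnegrE // sqrtr_ge0.
rewrite real_normK ?num_real // /hs sqr_sqrtr //; lra.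
Qed.

Lemma slice_integral (r y : R) (v : R * R -> R) : continuous (fun x=> v (x, y)) ->
 (\int[leb]_x ((v \_ (dsk r)) (x, y))%:E)%E = (RI (- hs r y) (hs r y) (fun x=> v (x, y)))%:E.
Proof.
move=> cv.
have ii a b : leb.-integrable `[a, b] (EFin \o (fun x=> v (x, y))) by exact: cont_integrable.
have iioo : leb.-integrable `](- hs r y), (hs r y)[ (EFin \o (fun x=> v (x, y))).
 apply: integrableS (ii (- hs r y) (hs r y)) => // x /=.
 by rewrite !in_itv /= => /andP[h1 h2]; rewrite !ltW.
have iico : leb.-integrable `[(- hs r y), (hs r y)[ (EFin \o (fun x=> v (x, y))).
 apply: integrableS (ii (- hs r y) (hs r y)) => // x /=.
 by rewrite !in_itv /= => /andP[h1 h2]; rewrite h1 ltW.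
transitivity ((\int[leb]_(x in `](- hs r y), (hs r y)[) v (x, y))%R%:E); last first.
 congr EFin; rewrite Rintegral_itv_obnd_cbnd; last exact: iioo.
 by rewrite Rintegral_itv_bndo_bndc.
rewrite /Rintegral fineK; last first.
 by apply: (integrable_fin_num _ iioo) => //; exact: measurable_itv.
rewrite [RHS]integral_mkcond; apply: eq_integral => x _.
rewrite /patch -slice_set.
have -> : ((x, y) \in dsk r) = (x \in [set x | x ^+ 2 + y ^+ 2 < r ^+ 2]).
 by apply/idP/idP; rewrite !inE.
by case: ifP.
Qed.

Lemma hs_out r y : 0 < r -> r <= `|y| -> hs r y = 0.
Proof.
move=> r0 h; rewrite /hs; apply/eqP; rewrite sqrtr_eq0 subr_le0 -[leRHS]real_normK ?num_real //.
by rewrite ler_pXn2r ?nnegrE ?(ltW r0).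
Qed.

Lemma RI_out (r : R) (F : R -> R) : 0 < r -> (forall y, r <= `|y| -> F y = 0) ->
 (\int[leb]_y F y)%R = RI (- r) r F.
Proof.
move=> r0 H; rewrite /RI [RHS]Rintegral_mkcond; apply: eq_Rintegral => y _.
rewrite /patch; case: ifPn => // /negP; rewrite inE /= in_itv /= -ler_norml => h.
by apply: H; rewrite leNgt; apply/negP => /ltW.
Qed.
Lemma RI0 (a : R) F : RI a a F = 0.
Proof. by rewrite /RI set_itv1 Rintegral_set1. Qed.

Lemma clip_rc r (v : C -> R) : 0 < r -> rc r v -> forall z : C, ccont (fun z=> (v (clip r z))%:C) z.
Proof.
move=> r0 Hv z; apply: (ccont_comp (v := fun z=> (v z)%:C)) (clip_ccont z r0) _.
by apply: Hv; exact: clip_le.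
Qed.

Lemma cont_line_x (v : C -> R) (y : R) : (forall z : C, ccont (fun z=> (v z)%:C) z) -> continuous (fun x : R => v (x +i* y)).
Proof.
move=> H x; apply: (@ccont_curve R (fun z=> (v z)%:C) id (fun=> y)) => //; exact: cst_continuous.
Qed.

Lemma cont_line_y (v : C -> R) (x : R) : (forall z : C, ccont (fun z=> (v z)%:C) z) -> continuous (fun y : R => v (x +i* y)).
Proof.
move=> H y; apply: (@ccont_curve R (fun z=> (v z)%:C) (fun=> x) id) => //; exact: cst_continuous.
Qed.

(** Both orders are kept: [green_x] integrates along horizontal slices first, and [Ar_refl] compares
    the two orders. [clip] makes the inner integrands continuous on whole lines. *)
Lemma Ar_iter r v : 0 < r -> rc r v ->
 Ar r v = RI (- r) r (fun y=> RI (- hs r y) (hs r y) (fun x=> v (clip r (x +i* y)))) /\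
 Ar r v = RI (- r) r (fun x=> RI (- hs r x) (hs r x) (fun y=> v (clip r (x +i* y)))).
Proof.
move=> r0 Hv; have Hc := clip_rc r0 Hv.
pose f (p : R * R) := v (clip r (p.1 +i* p.2)).
have Hf : rc r (fun z=> v (clip r z)) by move=> z _; exact: Hc.
have E1 : Ar r v = Ar r (fun z=> v (clip r z)).
 by apply: (posf_eq (posf_Ar r0) Hv Hf) => z hz; rewrite clip_id.
have E2 : Ar r (fun z=> v (clip r z)) = fine (\int[(leb \x leb)%E]_p ((f \_ (dsk r)) p)%:E)%E.
 rewrite /Ar /Rintegral integral_mkcond; congr fine; apply: eq_integral => p _.
 by rewrite /patch; case: ifP.
have I2 : (leb \x leb)%E.-integrable setT (EFin \o (f \_ (dsk r))).
 rewrite -restrict_EFin; have H := Ar_integrable r0 Hf.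
 by apply: (iffLR (integrable_mkcond _ _) H); exact: measurable_dsk.
have out y F : r <= `|y| -> RI (- hs r y) (hs r y) F = 0.
 by move=> h; rewrite (hs_out r0 h) oppr0 RI0.
rewrite E1 E2; split.
 rewrite -(integral21_prod_meas1 I2) -RI_out //; last by move=> y /out.
 rewrite /Rintegral; congr fine; apply: eq_integral => y _.
 rewrite /fubini_G -(@slice_integral r y f) //.
 by apply: (cont_line_x (v := fun z=> v (clip r z))).
rewrite -(integral12_prod_meas1 I2) -RI_out //; last by move=> y /out.
rewrite /Rintegral; congr fine; apply: eq_integral => x _.
rewrite /fubini_F -(@slice_integral r x (fun p=> f (p.2, p.1))) //; last first.
 by apply: (cont_line_y (v := fun z=> v (clip r z))).
apply: eq_integral => y _; rewrite /patch /=; congr EFin.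
have -> : ((x, y) \in dsk r) = ((y, x) \in dsk r) by apply/idP/idP; rewrite !inE /dsk /= addrC.
by [].
Qed.

End DiscIntegrals.

(** * Green's formula on discs *)

Section Green.
Variable R : realType.
Local Notation C := R[i].

Lemma periodic_antideriv (F G : R -> R) (N a : R) : continuous F -> (forall t, F (t + 2 * pi) = F t) ->
 (forall x : R, `|x| < N -> is_derive x 1 G (F x)) -> a < 0 -> `|a| < N -> 2 * pi < N ->
 G (a + 2 * pi) - G a = G (2 * pi) - G 0.
Proof.
move=> cF per dG a0 aN N2.
have p0 := pi_gt0 R.
have A x : a <= x <= 0 -> `|x| < N.
 by move=> /andP[h1 h2]; move: aN; rewrite !ltr_norml; lra.
have B x : a <= x <= 0 -> `|x + 2 * pi| < N.
 by move=> /andP[h1 h2]; move: aN; rewrite !ltr_norml; lra.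
have E1 : RI a 0 F = G 0 - G a by apply: RI_FTC => // x /A; exact: dG.
have d1 (x : R) : is_derive x 1 (fun t : R => t + 2 * pi) 1.
 by apply: is_derive_eq; rewrite addr0.
have E2 := @RI_subst R F G (fun t=> t + 2 * pi) (fun=> 1) a 0 a0 cF (@cont_cst R 1) d1 (fun x h => dG _ (B x h)).
rewrite add0r in E2.
have : RI a 0 F = G (2 * pi) - G (a + 2 * pi).
 by rewrite -E2; apply: RI_eq => x _; rewrite per mulr1.
by rewrite E1; lra.
Qed.

Lemma is_derive_subr (c x : R) : is_derive x 1 (fun t : R => c - t) (-1).
Proof.
apply/is_deriveP => e e0; exists 1 => // h _.
by rewrite (_ : _ - _ - _ = 0) ?normr0 ?mulr_ge0 ?(ltW e0) //; ring.
Qed.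

Lemma hs_cont r : continuous (@hs R r).
Proof.
apply: (cont_comp (f := Num.sqrt)); first exact: sqrt_continuous.
apply: cont_addf; first exact: cont_cst.
by apply: cont_opp; apply: cont_mul => x; exact: cvg_id.
Qed.

Variables (r : R) (r0 : 0 < r) (u p q : C -> C).
Hypotheses (cp : con r p) (cq : con r q) (Hu : forall z, cmod z <= r -> wd u z (p z) (q z)).

Lemma wd_con : con r u.
Proof. by move=> z hz; apply: ccont_wd (Hu hz). Qed.
Lemma circ_shift t : circ r (t + 2 * pi) = circ r t.
Proof. by rewrite /circ mulrC mulr_natr cosDpi2 || rewrite /circ (_ : 2 * pi = pi *+ 2) ?mulr_natl // cosD2pi sinD2pi. Qed.

(** The fundamental theorem on each horizontal slice leaves the difference [k] of the values at its
    two endpoints on the circle. These endpoints are then parametrised by the angle. *)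
Lemma green_x : Ar r (fun z=> Re (p z + q z)) = Mr r (fun z=> Re (u z) * Re z).
Proof.
have p0 := pi_gt0 R.
have cpq : rc r (fun z=> Re (p z + q z)) by conT.
have cu := wd_con.
pose Uc z := Re (u (clip r z)).
have cUc (z : C) : ccont (fun z=> (Uc z)%:C) z by exact: (clip_rc r0 (rc_Re cu)).
have [-> _] := Ar_iter r0 cpq.
pose k y := Uc (hs r y +i* y) - Uc ((- hs r y) +i* y).
have id_cont : continuous (fun x : R => x) by move=> x; exact: cvg_id.
have ck : continuous k.
 apply: cont_addf; last apply: cont_opp.
  by move=> y; apply: (@ccont_curve R (fun z=> (Uc z)%:C) (hs r) id); [exact: hs_cont|exact: id_cont|exact: cUc].
 move=> y; apply: (@ccont_curve R (fun z=> (Uc z)%:C) (fun y=> - hs r y) id).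
 - by apply: cont_opp; exact: hs_cont.
 - exact: id_cont.
 - exact: cUc.
have hs0 y : 0 <= hs r y by exact: sqrtr_ge0.
have -> : RI (- r) r (fun y=> RI (- hs r y) (hs r y) (fun x=> Re (p (clip r (x +i* y)) + q (clip r (x +i* y))))) = RI (- r) r k.
 apply: RI_eq => y; rewrite -ler_norml => hy.
 have [h0|hn] := eqVneq (hs r y) 0; first by rewrite /k h0 oppr0 RI0 subrr.
 have hp : 0 < hs r y by rewrite lt_def hn hs0.
 have D x : `|x| <= hs r y -> cmod (x +i* y) <= r by move=> hx; exact: hs_bound.
 have -> : k y = Re (u (hs r y +i* y)) - Re (u ((- hs r y) +i* y)).
  by rewrite /k /Uc !clip_id // D // ?normrN ger0_norm.
 apply: (@RI_FTC R _ (fun x=> Re (u (x +i* y)))); first lra.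
  by apply: (cont_line_x (v := fun z=> Re (p (clip r z) + q (clip r z)))); exact: (clip_rc r0 cpq).
 move=> x; rewrite -ler_norml => hx; rewrite clip_id //; last exact: D.
 have := @wd_curve R u id (fun=> y) x 1 0 _ _ (is_derive_id _ _) (is_derive_cst _ _ _) (Hu (D x hx)).
 by rewrite oppr0 !mulr1.
have [K HK] := antideriv (2 * r) ck.
have -> : RI (- r) r k = K r - K (- r).
 have rr : - r < r by rewrite (lt_trans _ r0) // oppr_lt0.
 apply: (RI_FTC rr ck).
 by move=> x hx; apply: HK; rewrite ltr_norml; lra.
have ds (x : R) : is_derive x 1 (fun t : R => r * sin t) (r * cos x).
 by apply: is_derive_eq; rewrite /GRing.scale /= ?mulr0 ?addr0 // mulrC.
have cc : continuous (fun t : R => r * cos t) by apply: cont_mul; [exact: cont_cst|exact: cont_cos].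
have sb (x : R) : `|r * sin x| < 2 * r.
 rewrite normrM (gtr0_norm r0); apply: (@le_lt_trans _ _ r); last by rewrite ltr_pMl // ltr1n.
 by rewrite -[leRHS]mulr1 ler_pM2l // ler_norml sin_geN1 sin_le1.
(* The substitution y = r sin t turns the integral over heights into one over the right half
   circle. *)
have E1 := @RI_subst R k K (fun t=> r * sin t) (fun t=> r * cos t) (- (pi / 2)) (pi / 2) ltac:(lra) ck cc ds (fun x _ => HK _ (sb x)).
rewrite sinN sin_pihalf mulr1 mulrN1 in E1.
rewrite -E1 => {E1}.
pose Phi t := Uc (circ r t) * (r * cos t).
have cPhi : continuous Phi.
 by apply: cont_mul => //; apply: (cont_circ (v := Uc)) => //; exact: ltW.
have circpi t : circ r (pi - t) = (- (r * cos t)) +i* (r * sin t).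
 by rewrite /circ cosB sinB cospi sinpi; congr (_ +i* _); ring.
(* The left endpoint at height r sin t has angle pi - t, where the cosine changes sign; so the two
   half circles together make up one full period of [Phi]. *)
have -> : RI (- (pi / 2)) (pi / 2) (fun t=> k (r * sin t) * (r * cos t)) = RI (- (pi / 2)) (pi / 2) (fun t=> Phi t + Phi (pi - t)).
 apply: RI_eq => t /andP[t1 t2].
 have c0 : 0 <= cos t by apply: cos_ge0_pihalf; rewrite t1.
 have -> : k (r * sin t) = Uc (circ r t) - Uc (circ r (pi - t)).
  have -> : k (r * sin t) = Uc ((r * cos t) +i* (r * sin t)) - Uc ((- (r * cos t)) +i* (r * sin t)).
   rewrite /k; have -> : hs r (r * sin t) = r * cos t; last by [].
   rewrite /hs -[RHS]ger0_norm ?mulr_ge0 ?(ltW r0) // -sqrtr_sqr; congr Num.sqrt.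
   by rewrite !exprMn; have := cos2Dsin2 t; nra.
  by rewrite circpi.
 by rewrite /Phi cosB cospi sinpi; ring.
have [G HG] := antideriv (4 * pi) cPhi.
have -> : RI (- (pi / 2)) (pi / 2) (fun t=> Phi t + Phi (pi - t)) = G (- (pi / 2) + 2 * pi) - G (- (pi / 2)).
 have -> : G (- (pi / 2) + 2 * pi) - G (- (pi / 2)) = (G (pi / 2) - G (pi - pi / 2)) - (G (- (pi / 2)) - G (pi - - (pi / 2))).
  have -> : pi - - (pi / 2) = - (pi / 2) + 2 * pi :> R by field.
  have -> : pi - pi / 2 = pi / 2 :> R by field.
  by ring.
 apply: (@RI_FTC R _ (fun t=> G t - G (pi - t))).
 - by lra.
 - apply: cont_addf => //; apply: cont_comp => //; apply: cont_addf; [exact: cont_cst|exact: cont_opp].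
 - move=> x hx; have H1 : is_derive x 1 G (Phi x) by apply: HG; rewrite ltr_norml; lra.
  have H2 : is_derive (pi - x) 1 G (Phi (pi - x)) by apply: HG; rewrite ltr_norml; lra.
  have H3 := is_derive_subr pi x.
  by apply: is_derive_eq; rewrite mulrN1 opprK.
have cos2 t : cos (t + 2 * pi) = cos t :> R by rewrite (_ : 2 * pi = pi *+ 2) ?cosD2pi // mulr_natl.
have perPhi t : Phi (t + 2 * pi) = Phi t by rewrite /Phi circ_shift cos2.
have hN : `|- (pi / 2)| < 4 * pi :> R by rewrite ltr_norml; lra.
have hN1 : - (pi / 2) < 0 :> R by lra.
have hN2 : 2 * pi < 4 * pi :> R by lra.
rewrite (@periodic_antideriv Phi G (4 * pi) (- (pi / 2)) cPhi perPhi HG hN1 hN hN2).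
have hN3 : 0 < 2 * pi :> R by lra.
have <- : RI 0 (2 * pi) Phi = G (2 * pi) - G 0.
 by apply: (RI_FTC hN3 cPhi) => x hx; apply: HG; rewrite ltr_norml; lra.
apply: RI_eq => t _; rewrite /Phi /Uc clip_id //.
by rewrite cmod_circ // ltW.
Qed.

End Green.

Section Green2.
Variable R : realType.
Local Notation C := R[i].
Variables (r : R) (r0 : 0 < r).

(** Reflection in the diagonal: it exchanges the two coordinates and so derives [green_y] from
    [green_x]. *)
Definition refl (z : C) : C := 'i%C * cj z.

Lemma cmod_refl z : cmod (refl z) = cmod z.
Proof. by rewrite /refl cmodM cmod_i mul1r cmodJ. Qed.
Lemma refl_pair (x y : R) : refl (x +i* y) = y +i* x.
Proof. by apply: cx_eq => /=; ring. Qed.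

Lemma refl_con u : con r u -> con r (fun z=> u (refl z)).
Proof.
move=> H z hz; apply: (ccont_comp (u := refl)).
 by apply: ccontM; [exact: ccont_cst|apply: ccont_conj; exact: ccont_id].
by apply: H; rewrite cmod_refl.
Qed.
Lemma refl_rc v : rc r v -> rc r (fun z=> v (refl z)).
Proof. exact: refl_con. Qed.

Lemma Ar_refl v : rc r v -> Ar r (fun z=> v (refl z)) = Ar r v.
Proof.
move=> Hv; have [-> _] := Ar_iter r0 (refl_rc Hv); have [_ ->] := Ar_iter r0 Hv.
apply: RI_eq => y _; apply: RI_eq => x _; congr v.
rewrite -[y +i* x]refl_pair /clip -[cmod (refl _)]cmod_refl /refl.
by rewrite !cmodM !cmod_i !mul1r !cmodJ cmodM cmod_i mul1r cmodJ conjcM conjc_real mulrCA.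
Qed.

Lemma Mr_refl v : rc r v -> Mr r (fun z=> v (refl z)) = Mr r v.
Proof.
move=> Hv; have p0 := pi_gt0 R.
pose F t := v (circ r t).
have cF : continuous F by apply: (cont_circ (ltW r0) Hv).
have per t : F (t + 2 * pi) = F t by rewrite /F circ_shift.
have [G HG] := antideriv (4 * pi) cF.
have E1 : Mr r v = G (2 * pi) - G 0.
 by apply: RI_FTC => //; [lra|move=> x hx; apply: HG; rewrite ltr_norml; lra].
have E2 : Mr r (fun z=> v (refl z)) = RI 0 (2 * pi) (fun t=> F (pi / 2 - t)).
 apply: RI_eq => t _; rewrite /F; congr v; rewrite /circ refl_pair.
 by rewrite -(opprB t) cosN sinN cosBpihalf sinBpihalf opprK.
have E3 : RI 0 (2 * pi) (fun t=> F (pi / 2 - t)) = - G (pi / 2 - 2 * pi) - - G (pi / 2 - 0).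
 apply: (@RI_FTC R _ (fun t=> - G (pi / 2 - t))).
 - by lra.
 - by apply: cont_comp => //; apply: cont_addf; [exact: cont_cst|apply: cont_opp => x; exact: cvg_id].
 - move=> x hx; have H2 : is_derive (pi / 2 - x) 1 G (F (pi / 2 - x)) by apply: HG; rewrite ltr_norml; lra.
  have H3 := is_derive_subr (pi / 2) x.
  by apply: is_derive_eq; rewrite mulrN1 opprK.
have H := @periodic_antideriv R F G (4 * pi) (pi / 2 - 2 * pi) cF per HG.
rewrite subrK in H; rewrite E1 E2 E3 -H ?subr0; [by ring|lra|rewrite ltr_norml; lra|lra].
Qed.

Variables (u p q : C -> C).
Hypotheses (cp : con r p) (cq : con r q) (Hu : forall z, cmod z <= r -> wd u z (p z) (q z)).

Lemma green_y : Ar r (fun z=> Re ('i%C * (p z - q z))) = Mr r (fun z=> Re (u z) * Im z).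
Proof.
have cu := wd_con Hu.
have Hc : forall z, cmod z <= r -> wd (fun z=> u (refl z)) z (- 'i%C * q (refl z)) ('i%C * p (refl z)).
 move=> z hz.
 have Hr : wd refl z 0 'i%C.
  by apply: wd_eq (wdZ 'i%C (wd_conj (wd_id z))); rewrite ?conjc0 ?conjc1 ?mulr0 ?mulr1.
 have Hu' : wd u (refl z) (p (refl z)) (q (refl z)) by apply: Hu; rewrite cmod_refl.
 apply: wd_eq (wd_comp Hr Hu'); last by rewrite conjc0 mulr0 addr0 mulrC.
 by rewrite mulr0 add0r mulrC; congr (_ * _); apply: cx_eq => /=; rewrite ?oppr0.
have cp' : con r (fun z=> - 'i%C * q (refl z)) by apply: conM; [exact: con_cst|exact: refl_con].
have cq' : con r (fun z=> 'i%C * p (refl z)) by apply: conM; [exact: con_cst|exact: refl_con].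
have := green_x r0 cp' cq' Hc.
have H1 : rc r (fun z=> Re ('i%C * (p z - q z))).
 by conT.
have H2 : rc r (fun z=> Re (u z) * Im z).
 by conT.
rewrite -(Ar_refl H1) -(Mr_refl H2) => E.
transitivity (Ar r (fun z=> Re (- 'i%C * q (refl z) + 'i%C * p (refl z)))).
 by congr Ar; apply/funext => z; congr Re; ring.
rewrite E; congr Mr; apply/funext => z; congr (_ * _).
by case: z => x y /=; ring.
Qed.

End Green2.

Section Green3.
Variable R : realType.
Local Notation C := R[i].
Variables (r : R) (r0 : 0 < r).
Definition Ac (u : C -> C) : C := cI (Ar r) u.
Definition Mc (u : C -> C) : C := cI (Mr r) u.

Lemma green_Re (u p q : C -> C) : con r p -> con r q -> (forall z, cmod z <= r -> wd u z (p z) (q z)) ->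
 Re (Mc (fun z=> z * u z)) = Re (2 * Ac q).
Proof.
move=> cp cq Hu; have cu := wd_con Hu.
have hA := posf_Ar r0; have hM := posf_Mr r0.
have cui : forall z, cmod z <= r -> wd (fun z=> - 'i%C * u z) z (- 'i%C * p z) (- 'i%C * q z).
 by move=> z hz; apply: wdZ; exact: Hu.
have ci c w : con r w -> con r (fun z=> c * w z) by move=> H; apply: conM => //; exact: con_cst.
have E1 := green_x r0 cp cq Hu.
have E2 := green_y r0 (ci (- 'i%C) _ cp) (ci (- 'i%C) _ cq) cui.
have -> : Re (Mc (fun z=> z * u z)) = Mr r (fun z=> Re (u z) * Re z) - Mr r (fun z=> Re (- 'i%C * u z) * Im z).
 rewrite -(posfB hM); first by congr Mr; apply/funext => z; rewrite !cReM /=; ring.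
  by conT.
 by conT.
rewrite -E1 -E2 -(posfB hA); last 2 first.
- by conT.
- by conT.
have -> : 2 * Ac q = Ac (fun z=> 2 * q z) by rewrite /Ac (cIZ _ hA).
congr Ar; apply/funext => z; rewrite -cReN -cReD; congr Re.
have -> : 'i%C * (- 'i%C * p z - - 'i%C * q z) = - ('i%C * 'i%C) * (p z - q z) by ring.
by rewrite -expr2 sqr_i; ring.
Qed.

(** On the circle dz = i z dt, so this is the complex Green formula, the integral of u dz being 2 i
    times the area integral of the d-bar derivative. The imaginary part is the real part for -i
    u. *)
Lemma green (u p q : C -> C) : con r p -> con r q -> (forall z, cmod z <= r -> wd u z (p z) (q z)) ->
 Mc (fun z=> z * u z) = 2 * Ac q.
Proof.
move=> cp cq Hu; have cu := wd_con Hu.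
have hA := posf_Ar r0; have hM := posf_Mr r0.
have ci c w : con r w -> con r (fun z=> c * w z) by move=> H; apply: conM => //; exact: con_cst.
apply: cx_eq; first exact: (green_Re cp cq Hu).
have := green_Re (ci (- 'i%C) _ cp) (ci (- 'i%C) _ cq) (fun z hz => wdZ (- 'i%C) (Hu z hz)).
have -> : Mc (fun z=> z * (- 'i%C * u z)) = - 'i%C * Mc (fun z=> z * u z).
 rewrite /Mc -(cIZ _ hM); last by conT.
 by congr cI; apply/funext => z; ring.
rewrite /Ac (cIZ _ hA) //.
have Ei (z : C) : Re (- 'i%C * z) = Im z by rewrite cReM /=; ring.
by rewrite mulrCA !Ei.
Qed.

Lemma Mc_conj u : con r u -> Mc (fun z=> cj (u z)) = cj (Mc u).
Proof.
move=> Hu; apply: cx_eq => /=; first by congr Mr; apply/funext => z; case: (u z).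
rewrite -(posfN (posf_Mr r0)); last exact: rc_Im.
by congr Mr; apply/funext => z; case: (u z).
Qed.

Lemma Ac_conj u : con r u -> Ac (fun z=> cj (u z)) = cj (Ac u).
Proof.
move=> Hu; apply: cx_eq => /=; first by congr Ar; apply/funext => z; case: (u z).
rewrite -(posfN (posf_Ar r0)); last exact: rc_Im.
by congr Ar; apply/funext => z; case: (u z).
Qed.

Lemma Ac_d (u p q : C -> C) : con r p -> con r q -> (forall z, cmod z <= r -> wd u z (p z) (q z)) ->
 Mc (fun z=> cj z * u z) = 2 * Ac p.
Proof.
move=> cp cq Hu; have cu := wd_con Hu.
have := green (con_conj cq) (con_conj cp) (fun z hz => wd_conj (Hu z hz)).
rewrite Ac_conj // => E; rewrite -[Ac p]conjcK -[LHS]conjcK -Mc_conj; last by conT.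
rewrite -[2 in RHS]conjc_nat -conjcM -E; congr cj; congr cI; apply/funext => z.
by rewrite conjcM conjcK.
Qed.

End Green3.

(* Clearing the hypotheses that [lra] cannot use makes it several times faster in a large context;
   the patterns spare section hypotheses, which [lra] needs to find in place. *)
Ltac qlra := repeat match goal with H : ?T |- _ => lazymatch type of T with Prop => lazymatch T with
 | is_true _ => fail
 | _ = _ => fail
 | forall z, is_true (@?A z) -> is_true (@?B z) => fail
 | forall z, ccont ?u z => fail
 | forall r : Real.sort _, @?A r => fail
 | _ => clear H
 end end end; lra.

(** * Goursat's lemma and primitives *)

Section Goursat.
Variable R : realType.
Local Notation C := R[i].
Local Notation leb := (@lebesgue_measure R).

(** The mean over the segment, not the path integral: it is a positive functional of mass one, and
    [Lseg] restores the factor b - a. *)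
Definition Iseg (a b : C) (v : C -> R) : R := (\int[leb]_(s in `[0%R, 1%R]) v (a + s%:C * (b - a)))%R.

Lemma seg_norm (a b : C) (s r : R) : 0 <= s <= 1 -> cmod a <= r -> cmod b <= r -> cmod (a + s%:C * (b - a)) <= r.
Proof.
move=> /andP[s0 s1] ha hb.
have -> : a + s%:C * (b - a) = (1 - s)%:C * a + s%:C * b by rewrite realCD realCN; ring.
tri; rewrite !cmodM !cmodR !ger0_norm ?subr_ge0 //.
have := ler_wpM2l s0 hb; have h1 : 0 <= 1 - s by lra.
have := ler_wpM2l h1 ha; lra.
Qed.

Lemma Iseg_cont (v : C -> R) a b : (forall z : C, ccont (fun z=> (v z)%:C) z) -> continuous (fun s : R => v (a + s%:C * (b - a))).
Proof.
move=> Hv s.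
have E (x : R) : a + x%:C * (b - a) = (Re a + x * Re (b - a)) +i* (Im a + x * Im (b - a)).
 by apply: cx_eq; rewrite !(cReD, cImD, cReM, cImM) /=; ring.
under [X in continuous_at _ X]funext do rewrite E.
apply: (@ccont_curve R (fun z=> (v z)%:C) (fun x=> Re a + x * Re (b - a)) (fun x=> Im a + x * Im (b - a))); last exact: Hv.
 by apply: cont_addf; [exact: cont_cst|apply: cont_mul; [move=> x; exact: cvg_id|exact: cont_cst]].
by apply: cont_addf; [exact: cont_cst|apply: cont_mul; [move=> x; exact: cvg_id|exact: cont_cst]].
Qed.

Lemma posf_seg r a b : 0 < r -> cmod a <= r -> cmod b <= r -> posf r (Iseg a b).
Proof.
move=> r0 ha hb.
have c1 (z : C) : ccont (fun z=> (Re z)%:C) z by apply: (@rc_Re R (cmod z) id) => //; exact: con_id.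
have c2 (z : C) : ccont (fun z=> (Im z)%:C) z by apply: (@rc_Im R (cmod z) id) => //; exact: con_id.
apply: (@posf_int R _ _ leb `[0, 1]%classic (fun s=> a + s%:C * (b - a)) r) => //.
- exact: leb_fin.
- apply: measurable_funTS; apply: continuous_measurable_fun; exact: (@Iseg_cont _ a b c1).
- apply: measurable_funTS; apply: continuous_measurable_fun; exact: (@Iseg_cont _ a b c2).
- by move=> s /=; rewrite in_itv /= => hs; exact: seg_norm.
Qed.
Lemma Iseg1 a b : Iseg a b (fun=> 1) = 1.
Proof. by have := @RI_cst R 1 0 1 ler01; rewrite subr0 mulr1. Qed.

Lemma is_derive_aff (c d x : R) : is_derive x 1 (fun t : R => c + d * t) d.
Proof.
apply/is_deriveP => e e0; exists 1 => // h _.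
by rewrite (_ : _ - _ - _ = 0) ?normr0 ?mulr_ge0 ?(ltW e0) //; ring.
Qed.

(** A single antiderivative along the whole segment evaluates the means over all its subsegments;
    reversal and bisection are read off from it. *)
Lemma Iseg_aff (v : C -> R) (a b : C) : (forall z : C, ccont (fun z=> (v z)%:C) z) -> exists G : R -> R,
 forall c d : R, 0 <= c <= 1 -> 0 <= c + d <= 1 -> d * Iseg (a + c%:C * (b - a)) (a + (c + d)%:C * (b - a)) v = G (c + d) - G c.
Proof.
move=> Hv; have cg := @Iseg_cont v a b Hv.
set g := (fun s : R => _) in cg; have [G HG] := antideriv 2 cg; exists G => c d c01 cd01.
have -> : Iseg (a + c%:C * (b - a)) (a + (c + d)%:C * (b - a)) v = RI 0 1 (fun s=> g (c + d * s)).
 by apply: RI_eq => s _; rewrite /g; congr v; rewrite !realCD realCM; ring.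
have [->|d0] := eqVneq d 0; first by rewrite mul0r addr0 subrr.
apply: (mulfI (invr_neq0 d0)); rewrite mulrA mulVf // mul1r.
have -> : d^-1 * (G (c + d) - G c) = d^-1 * G (c + d * 1) - d^-1 * G (c + d * 0) by rewrite mulr1 mulr0 addr0 mulrBr.
apply: (@RI_FTC R _ (fun t=> d^-1 * G (c + d * t))) => //.
 apply: cont_comp => //; apply: cont_addf; [exact: cont_cst|].
 by apply: cont_mul; [exact: cont_cst|move=> x; exact: cvg_id].
move=> x /andP[x0 x1]; have H2 : is_derive (c + d * x) 1 G (g (c + d * x)) by apply: HG; rewrite ltr_norml; nra.
have H3 := is_derive_aff c d x.
have H4 : is_derive x 1 (fun t : R => G (c + d * t)) (g (c + d * x) * d) by exact: (@is_derive1_comp R G (fun t=> c + d * t)).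
by apply: is_derive_eq; rewrite /GRing.scale /= ?mulr0 ?addr0 mulrCA mulVf ?mulr1.
Qed.

Lemma Iseg_sym (v : C -> R) a b : (forall z : C, ccont (fun z=> (v z)%:C) z) -> Iseg b a v = Iseg a b v.
Proof.
move=> Hv; have [G H] := @Iseg_aff v a b Hv; have := H 0 1; have := H 1 (-1).
rewrite subrr add0r mul1r mul0r addr0 mul1r mulN1r !(addrC a) !subrK => H1 H2.
by rewrite -[LHS]opprK H1 ?H2 ?opprB // ?lexx ler01.
Qed.

Lemma Iseg_mid (v : C -> R) a b : (forall z : C, ccont (fun z=> (v z)%:C) z) ->
 2 * Iseg a b v = Iseg a ((a + b) / 2) v + Iseg ((a + b) / 2) b v.
Proof.
move=> Hv; have [G H] := @Iseg_aff v a b Hv.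
have hm : a + (1 / 2 : R)%:C * (b - a) = (a + b) / 2 by rewrite realCM realCV rmorph_nat; field.
have := H 0 1; have := H 0 (1 / 2); have := H (1 / 2) (1 / 2).
have -> : 1 / 2 + 1 / 2 = 1 :> R by field.
rewrite !add0r hm mul0r addr0 !mul1r !(addrC a (b - a)) subrK => H1 H2 H3.
by have := H1 ltac:(lra) ltac:(lra); have := H2 ltac:(lra) ltac:(lra); have := H3 ltac:(lra) ltac:(lra); lra.
Qed.

Definition Lseg (f : C -> C) a b : C := (b - a) * cI (Iseg a b) f.

Section Global.
Variable f : C -> C.
Hypothesis Hf : forall z, ccont f z.

Let cr (z : C) : ccont (fun z=> (Re (f z))%:C) z.
Proof. by apply: (@rc_Re R (cmod z) f) => // w _; exact: Hf. Qed.
Let ci (z : C) : ccont (fun z=> (Im (f z))%:C) z.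
Proof. by apply: (@rc_Im R (cmod z) f) => // w _; exact: Hf. Qed.

Lemma Lseg_sym a b : Lseg f b a = - Lseg f a b.
Proof.
rewrite /Lseg; have -> : cI (Iseg b a) f = cI (Iseg a b) f by congr (_ +i* _); apply: Iseg_sym.
by ring.
Qed.

Lemma Lseg_mid a b : Lseg f a b = Lseg f a ((a + b) / 2) + Lseg f ((a + b) / 2) b.
Proof.
rewrite /Lseg; have E : 2 * cI (Iseg a b) f = cI (Iseg a ((a + b) / 2)) f + cI (Iseg ((a + b) / 2) b) f.
 rewrite [X in X * cI _ _](_ : (2 : C) = (2 : R)%:C); last by apply: cx_eq => /=; rewrite ?addr0.
 by apply: cx_eq; rewrite ?(cReD, cImD) ?(cReM, cImM) /= -Iseg_mid //; ring.
have -> : (a + b) / 2 - a = (b - a) / 2 by field.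
have -> : b - (a + b) / 2 = (b - a) / 2 by field.
by rewrite -mulrDr -E; field.
Qed.

Definition Tri (t : C * C * C) : C := Lseg f t.1.1 t.1.2 + Lseg f t.1.2 t.2 + Lseg f t.2 t.1.1.
Definition per (t : C * C * C) : R := cmod (t.1.1 - t.1.2) + cmod (t.1.2 - t.2) + cmod (t.2 - t.1.1).

Lemma cI_seg_bound g a b (e : R) : (forall z, ccont g z) ->
 (forall s : R, 0 <= s <= 1 -> cmod (g (a + s%:C * (b - a))) <= e) -> cmod (cI (Iseg a b) g) <= e.
Proof.
move=> Hg H.
pose r := cmod a + cmod b + 1.
have r0 : 0 < r by have := cge0 a; have := cge0 b; rewrite /r; lra.
have ha : cmod a <= r by have := cge0 b; rewrite /r; lra.
have hb : cmod b <= r by have := cge0 a; rewrite /r; lra.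
have HI := posf_seg r0 ha hb.
have Hgr : con r g by move=> z _; exact: Hg.
apply: le_trans (cI_norm HI Hgr) _.
have cg (z : C) : ccont (fun z=> (cmod (g z))%:C) z by apply: (@rc_cmod R (cmod z) g) => // w _; exact: Hg.
have -> : e = RI 0 1 (fun=> e) by rewrite RI_cst // subr0 mulr1.
by apply: RI_le; [exact: (@Iseg_cont _ a b cg)|exact: cont_cst|exact: H].
Qed.

Lemma Lseg_bound g a b (e : R) : (forall z, ccont g z) ->
 (forall s : R, 0 <= s <= 1 -> cmod (g (a + s%:C * (b - a))) <= e) -> cmod (Lseg g a b) <= cmod (b - a) * e.
Proof. by move=> Hg H; rewrite /Lseg cmodM ler_wpM2l ?cge0 //; exact: cI_seg_bound. Qed.

Lemma cI_seg_cst (c a b : C) : cI (Iseg a b) (fun=> c) = c.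
Proof.
pose r := cmod a + cmod b + 1.
have r0 : 0 < r by have := cge0 a; have := cge0 b; rewrite /r; lra.
have hra : cmod a <= r by have := cge0 b; rewrite /r; lra.
have hrb : cmod b <= r by have := cge0 a; rewrite /r; lra.
by apply: cx_eq => /=; rewrite (posf_cst _ (posf_seg r0 hra hrb)) Iseg1 mulr1.
Qed.

Lemma cI_seg_id (a b : C) : cI (Iseg a b) id = (a + b) / 2.
Proof.
have r2 : (2^-1 : R)%:C = 2^-1 :> C by rewrite realCV; congr (_^-1); apply: cx_eq => /=; rewrite ?addr0.
have K (x y : R) : RI 0 1 (fun s=> x + s * (y - x)) = (x + y) / 2.
 have -> : (x + y) / 2 = (x * 1 + (y - x) / 2 * 1 ^+ 2) - (x * 0 + (y - x) / 2 * 0 ^+ 2) by field.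
 apply: (@RI_FTC R _ (fun t=> x * t + (y - x) / 2 * t ^+ 2)) => //.
  by apply: cont_addf; [exact: cont_cst|apply: cont_mul; [move=> z; exact: cvg_id|exact: cont_cst]].
 move=> w _; apply: is_derive_eq; rewrite /GRing.scale /= ?mulr0 ?addr0; by field.
rewrite -r2; apply: cx_eq; rewrite ?cReM ?cImM ?cReD ?cImD /=.
 rewrite /Iseg -/(RI 0 1 _); transitivity (RI 0 1 (fun s=> Re a + s * (Re b - Re a))).
  by apply: RI_eq => q _; rewrite !(cReD, cReN, cReM, cImD, cImN) /=; ring.
 by rewrite K; ring.
rewrite /Iseg -/(RI 0 1 _); transitivity (RI 0 1 (fun s=> Im a + s * (Im b - Im a))).
 by apply: RI_eq => q _; rewrite !(cReD, cReN, cImM, cImD, cImN) /=; ring.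
by rewrite K; ring.
Qed.

(** The integral over a triangle is the sum of those over its four midpoint triangles, so that one
    of them carries at least a quarter of it, with half the perimeter. *)
Lemma tri_step (t : C * C * C) (rho : R) : cmod t.1.1 <= rho -> cmod t.1.2 <= rho -> cmod t.2 <= rho ->
 exists t' : C * C * C, [/\ cmod t'.1.1 <= rho /\ cmod t'.1.2 <= rho /\ cmod t'.2 <= rho,
  cmod (t'.1.1 - t.1.1) <= per t, per t' = per t / 2 & cmod (Tri t) / 4 <= cmod (Tri t')].
Proof.
case: t => [[a b] c] /= ha hb hc.
have n2 : cmod (2^-1 : C) = 2^-1.
 by rewrite cmodV; congr (_^-1); rewrite (_ : (2 : C) = (2 : R)%:C) ?cmodR ?normr_nat //; apply: cx_eq => /=; rewrite ?addr0.
pose m1 := (a + b) / 2; pose m2 := (b + c) / 2; pose m3 := (c + a) / 2.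
have hm x y : cmod x <= rho -> cmod y <= rho -> cmod ((x + y) / 2) <= rho.
 by move=> hx hy; rewrite cmodM n2; have := cmodD x y; qlra.
have D1 : Tri (a, b, c) = Tri (a, m1, m3) + Tri (m1, b, m2) + Tri (m3, m2, c) + Tri (m1, m2, m3).
 rewrite /Tri /= (Lseg_mid a b) (Lseg_mid b c) (Lseg_mid c a) -/m1 -/m2 -/m3.
 by rewrite (Lseg_sym m3 m1) (Lseg_sym m2 m3) (Lseg_sym m2 m1); ring.
have half (x y : C) : x = y * 2^-1 -> cmod x = cmod y / 2 by move=> ->; rewrite cmodM n2.
have e1 : cmod (a - m1) = cmod (a - b) / 2 by apply: half; rewrite /m1; field.
have e2 : cmod (m1 - m3) = cmod (b - c) / 2 by apply: half; rewrite /m1 /m3; field.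
have e3 : cmod (m3 - a) = cmod (c - a) / 2 by apply: half; rewrite /m3; field.
have e4 : cmod (m1 - b) = cmod (a - b) / 2 by apply: half; rewrite /m1; field.
have e5 : cmod (b - m2) = cmod (b - c) / 2 by apply: half; rewrite /m2; field.
have e6 : cmod (m2 - m1) = cmod (c - a) / 2 by apply: half; rewrite /m2 /m1; field.
have e7 : cmod (m3 - m2) = cmod (a - b) / 2 by apply: half; rewrite /m3 /m2; field.
have e8 : cmod (m2 - c) = cmod (b - c) / 2 by apply: half; rewrite /m2; field.
have e9 : cmod (c - m3) = cmod (c - a) / 2 by apply: half; rewrite /m3; field.
have P1 : per (a, m1, m3) = per (a, b, c) / 2 by rewrite /per /= e1 e2 e3 !mulrDl.
have P2 : per (m1, b, m2) = per (a, b, c) / 2 by rewrite /per /= e4 e5 e6 !mulrDl.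
have P3 : per (m3, m2, c) = per (a, b, c) / 2 by rewrite /per /= e7 e8 e9 !mulrDl.
have P4 : per (m1, m2, m3) = per (a, b, c) / 2.
 by rewrite /per /= (cmodBC m1 m2) (cmodBC m2 m3) (cmodBC m3 m1) e6 e7 e2; qlra.
have per0 := (cge0 (a - b), cge0 (b - c), cge0 (c - a)).
have m1a : cmod (m1 - a) <= per (a, b, c) by rewrite cmodBC e1 /per /=; move: per0 => [[? ?] ?]; qlra.
have m3a : cmod (m3 - a) <= per (a, b, c) by rewrite e3 /per /=; move: per0 => [[? ?] ?]; qlra.
have aa : cmod (a - a) <= per (a, b, c) by rewrite subrr cmod0 /per /=; move: per0 => [[? ?] ?]; qlra.
have T4 := cmodD (Tri (a, m1, m3) + Tri (m1, b, m2) + Tri (m3, m2, c)) (Tri (m1, m2, m3)).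
have T3 := cmodD (Tri (a, m1, m3) + Tri (m1, b, m2)) (Tri (m3, m2, c)).
have T2 := cmodD (Tri (a, m1, m3)) (Tri (m1, b, m2)).
rewrite -D1 in T4.
have [h|h1] := leP (cmod (Tri (a, b, c)) / 4) (cmod (Tri (a, m1, m3))).
 by exists (a, m1, m3); split => //=; split=> //; split; exact: hm.
have [h|h3] := leP (cmod (Tri (a, b, c)) / 4) (cmod (Tri (m1, b, m2))).
 by exists (m1, b, m2); split => //=; split; [exact: hm|split=> //; exact: hm].
have [h|h4] := leP (cmod (Tri (a, b, c)) / 4) (cmod (Tri (m3, m2, c))).
 by exists (m3, m2, c); split => //=; split; [exact: hm|split=> //; exact: hm].
exists (m1, m2, m3); split => //=; last by qlra.
by split; [exact: hm|split; exact: hm].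
Qed.

Lemma goursat rho (t : C * C * C) : (forall z, cmod z <= rho -> exists p, wd f z p 0) ->
 cmod t.1.1 <= rho -> cmod t.1.2 <= rho -> cmod t.2 <= rho -> Tri t = 0.
Proof.
move=> Hd ha hb hc.
pose S := {t : C * C * C | cmod t.1.1 <= rho /\ cmod t.1.2 <= rho /\ cmod t.2 <= rho}.
have st (s : S) : exists s' : S, [/\ cmod ((sval s').1.1 - (sval s).1.1) <= per (sval s), per (sval s') = per (sval s) / 2 & cmod (Tri (sval s)) / 4 <= cmod (Tri (sval s'))].
 case: s => t0 [h1 [h2 h3]] /=; have [t' [h4 h5 h6 h7]] := tri_step h1 h2 h3.
 by exists (exist _ t' h4).
have [nx Hnx] := choice st.
pose s0 : S := exist _ t (conj ha (conj hb hc)).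
pose s n := sval (iter n nx s0).
have Ps n : per (s n) = per t / 2 ^+ n.
 elim: n => [|n IH]; first by rewrite expr0 divr1.
 rewrite /s iterS; have [_ -> _] := Hnx (iter n nx s0); rewrite -/(s n) IH exprS invfM.
 by rewrite mulrA mulrAC.
have Ts n : cmod (Tri t) / 4 ^+ n <= cmod (Tri (s n)).
 elim: n => [|n IH]; first by rewrite expr0 divr1.
 rewrite /s iterS; have [_ _ h] := Hnx (iter n nx s0); apply: le_trans h; rewrite -/(s n).
 by rewrite exprS invfM mulrA mulrAC ler_pM2r.
have per0 (t0 : C * C * C) : 0 <= per t0 by rewrite /per !addr_ge0 ?cge0.
(* Each new first vertex moves by at most the current perimeter, which halves; the displacements
   telescope. *)
have As n m : cmod ((s (n + m)%N).1.1 - (s n).1.1) <= 2 * per (s n) - 2 * per (s (n + m)%N).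
 elim: m => [|m IH]; first by rewrite addn0 !subrr cmod0.
 rewrite addnS /s iterS; have [h1 h2 _] := Hnx (iter (n + m) nx s0); rewrite h2 -/(s (n + m)%N) -/(s n).
 set x := (sval (nx _)).1.1 in h1 *.
 have -> : x - (s n).1.1 = (x - (s (n + m)%N).1.1) + ((s (n + m)%N).1.1 - (s n).1.1) by ring.
 by tri; rewrite -/(s (n + m)%N) in h1; qlra.
have [z0 hz0 Hz] := @cluster_C R (fun n=> (s n).1.1) rho (fun n=> proj1 (svalP (iter n nx s0))).
have zn n : cmod (z0 - (s n).1.1) <= 2 * per (s n).
 apply/ler_addgt0Pr => e e0; have [m hm hm2] := Hz e n e0.
 have := As n (m - n)%N; rewrite subnKC // => h.
 have := cmodD (z0 - (s m).1.1) ((s m).1.1 - (s n).1.1); rewrite addrA subrK (cmodBC z0 (s m).1.1).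
 by have := per0 (s m); qlra.
have [p Hp] := Hd z0 hz0.
apply/eqP; rewrite -cmod_eq0; apply/eqP/le_anti; rewrite cge0 andbT.
apply/ler_addgt0Pr => e e0; rewrite add0r.
(* The n-th triangle lies within 3 D / 2^n of [z0]; its perimeter times the linear error there is of
   order D^2 / 4^n, which beats the factor 4^n lost by bisection. The summand 1 in 3 D^2 + 1 keeps
   the divisor positive. *)
pose D := per t.
have D0 : 0 < 3 * D ^+ 2 + 1 by have := sqr_ge0 D; qlra.
have [d d0 Dd] := Hp (e / (3 * D ^+ 2 + 1)) (divr_gt0 e0 D0).
have [n hn] : exists n : nat, 3 * D / 2 ^+ n < d.
 have [n hn] : exists n : nat, 3 * D / d < n%:R.
  by exists (Num.truncn (3 * D / d)).+1; exact: Num.Theory.truncnS_gt.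
 exists n; rewrite ltr_pdivrMr ?exprn_gt0 //; move: hn; rewrite ltr_pdivrMr // => hn.
 apply: lt_le_trans hn _; rewrite mulrC ler_pM2l //.
 by rewrite -natrX ler_nat ltnW // ltn_expl.
(* Removal of the affine part at [z0] does not change the triangle integral, since affine functions
   integrate to zero around it. *)
pose g z := f z - (f z0 + p * (z - z0)).
have cg z : ccont g z.
 apply: ccontB => //; apply: ccontD; first exact: ccont_cst.
 by apply: ccontM; [exact: ccont_cst|apply: ccontB; [exact: ccont_id|exact: ccont_cst]].
have Lg a b : Lseg g a b = Lseg f a b - ((f z0 - p * z0) * (b - a) + p * (b ^+ 2 - a ^+ 2) / 2).
 pose r := cmod a + cmod b + 1.
 have r0 : 0 < r by have := cge0 a; have := cge0 b; rewrite /r; qlra.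
 have hra : cmod a <= r by have := cge0 b; rewrite /r; qlra.
 have hrb : cmod b <= r by have := cge0 a; rewrite /r; qlra.
 have HI := posf_seg r0 hra hrb.
 have fr : con r f by move=> z _; exact: Hf.
 have -> : g = (fun z=> f z + (- (f z0 - p * z0) * 1 + - p * id z)) by apply/funext => z; rewrite /g /=; ring.
 rewrite /Lseg (cID HI fr); last by conT.
 rewrite (cID HI); [|by conT|by apply: conM; [exact: con_cst|exact: con_id]].
 rewrite !(cIZ _ HI) ?cI_seg_cst ?cI_seg_id; [|exact: con_id|exact: con_cst].
 by rewrite !expr2; ring.
have Tg : Tri (s n) = Lseg g (s n).1.1 (s n).1.2 + Lseg g (s n).1.2 (s n).2 + Lseg g (s n).2 (s n).1.1.
 by rewrite /Tri !Lg; ring.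
have zb a b (q : R) : cmod (a - (s n).1.1) <= per (s n) -> cmod (b - (s n).1.1) <= per (s n) -> 0 <= q <= 1 ->
  cmod (a + q%:C * (b - a) - z0) <= 3 * per (s n).
 move=> h1 h2 hq.
 have := seg_norm hq h1 h2; have := zn n; rewrite cmodBC => h3 h4.
 have -> : a + q%:C * (b - a) - z0 = (a - (s n).1.1 + q%:C * (b - (s n).1.1 - (a - (s n).1.1))) + ((s n).1.1 - z0) by ring.
 by tri; qlra.
have gb z : cmod (z - z0) <= 3 * per (s n) -> cmod (g z) <= e / (3 * D ^+ 2 + 1) * (3 * per (s n)).
 move=> h; have h' : cmod (z - z0) < d by apply: le_lt_trans h _; rewrite Ps mulrA.
 have := Dd (z - z0) h'; rewrite (addrC z0) subrK mul0r addr0 => h3.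
 have -> : g z = f z - f z0 - p * (z - z0) by rewrite /g; ring.
 apply: le_trans h3 _; rewrite ler_wpM2l // ltW // divr_gt0 //.
set ee := e / (3 * D ^+ 2 + 1) * (3 * per (s n)) in gb.
have ee0 : 0 <= ee.
 by rewrite /ee; apply: mulr_ge0; [apply: divr_ge0; exact: ltW|apply: mulr_ge0 => //; exact: per0].
have va : cmod ((s n).1.1 - (s n).1.1) <= per (s n) by rewrite subrr cmod0.
have vb : cmod ((s n).1.2 - (s n).1.1) <= per (s n).
 by rewrite cmodBC /per; have := cge0 ((s n).1.2 - (s n).2); have := cge0 ((s n).2 - (s n).1.1); qlra.
have vc : cmod ((s n).2 - (s n).1.1) <= per (s n).
 by rewrite /per; have := cge0 ((s n).1.2 - (s n).2); have := cge0 ((s n).1.1 - (s n).1.2); qlra.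
have L1 := Lseg_bound cg (fun q hq => gb _ (zb _ _ q va vb hq)).
have L2 := Lseg_bound cg (fun q hq => gb _ (zb _ _ q vb vc hq)).
have L3 := Lseg_bound cg (fun q hq => gb _ (zb _ _ q vc va hq)).
have Tn : cmod (Tri (s n)) <= per (s n) * ee.
 rewrite Tg; tri; apply: le_trans (lerD (cmodD _ _) (lexx _)) _.
 rewrite /per !mulrDl -(cmodBC (s n).1.2) -(cmodBC (s n).2) -(cmodBC (s n).1.1 (s n).2); qlra.
have := le_trans (Ts n) Tn; rewrite /ee Ps.
have -> : D / 2 ^+ n * (e / (3 * D ^+ 2 + 1) * (3 * (D / 2 ^+ n))) = (e * (3 * D ^+ 2) / (3 * D ^+ 2 + 1)) / 4 ^+ n.
 have -> : 4 ^+ n = 2 ^+ n * 2 ^+ n :> R by rewrite -exprMn; congr (_ ^+ _); ring.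
 have p2 : 2 ^+ n != 0 :> R by rewrite expf_neq0 // pnatr_eq0.
 by move: p2; set q2 := 2 ^+ n => p2; field; rewrite ?p2 ?(gt_eqF D0).
rewrite ler_pM2r ?invr_gt0 ?exprn_gt0 // => h; apply: le_trans h _.
rewrite ler_pdivrMr // ler_pM2l //; qlra.
Qed.

Lemma Lseg_add rho z w : (forall z, cmod z <= rho -> exists p, wd f z p 0) -> cmod z <= rho -> cmod w <= rho ->
 Lseg f 0 w - Lseg f 0 z = Lseg f z w.
Proof.
move=> Hd hz hw; have T := @goursat rho (0, z, w) Hd.
rewrite /Tri /= cmod0 in T.
have T0 := T (le_trans (cge0 z) hz) hz hw.
rewrite (Lseg_sym 0 w) in T0; apply/eqP; rewrite -subr_eq0 -oppr_eq0; apply/eqP; rewrite -[RHS]T0; ring.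
Qed.

Lemma primitive rho z : 0 < rho -> (forall z, cmod z <= rho -> exists p, wd f z p 0) ->
 cmod z < rho -> wd (Lseg f 0) z (f z) 0.
Proof.
move=> rho0 Hd hz e e0.
have [d d0 D] := Hf z e0.
have dd : 0 < Num.min d (rho - cmod z) by rewrite lt_min d0 subr_gt0.
exists (Num.min d (rho - cmod z)) => // h; rewrite lt_min => /andP[h1 h2].
have hzh : cmod (z + h) <= rho by have := cmodD z h; lra.
have -> := Lseg_add Hd (ltW hz) hzh.
have zh : z + h - z = h by ring.
have -> : Lseg f z (z + h) - (f z * h + 0 * cj h) = Lseg (fun w=> f w - f z) z (z + h).
 rewrite /Lseg zh mul0r addr0.
 have HI := posf_seg rho0 (ltW hz) hzh.
 rewrite (cIB HI); [|by move=> w _; exact: Hf|exact: con_cst].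
 by rewrite cI_seg_cst; ring.
have := @Lseg_bound (fun w=> f w - f z) z (z + h) e.
rewrite zh mulrC; apply.
 by move=> w; apply: ccontB; [exact: Hf|exact: ccont_cst].
move=> s /andP[s0 s1]; apply: D; rewrite cmodM cmodR ger0_norm //; apply: le_lt_trans h1.
by rewrite -[leRHS]mul1r ler_wpM2r // cge0.
Qed.

End Global.
End Goursat.

Ltac nneg := repeat first [ done | exact: ltW | lazymatch goal with
 | |- is_true (0 <= cmod _)%R => exact: cge0
 | |- is_true (0 <= _ * _)%R => apply: mulr_ge0
 | |- is_true (0 <= _ + _)%R => apply: addr_ge0
 | |- is_true (0 <= _ ^+ 2)%R => apply: sqr_ge0
 | |- is_true (0 <= _ ^+ _)%R => apply: exprn_ge0
 | |- is_true (0 <= _^-1)%R => rewrite invr_ge0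
 | |- is_true (0 <= `|_|)%R => exact: normr_ge0
 end ].
Ltac npos := repeat first [ done | lazymatch goal with
 | |- is_true (0 < _ * _)%R => apply: mulr_gt0
 | |- is_true (0 < _ + _)%R => apply: addr_gt0
 | |- is_true (0 < _ ^+ _)%R => apply: exprn_gt0
 | |- is_true (0 < _^-1)%R => rewrite invr_gt0
 end ].

(** * Power series in the unit disc *)

Section Series.
Variable R : realType.
Local Notation C := R[i].

Lemma pow_small (q e : R) : 0 <= q < 1 -> 0 < e -> exists N, forall n, (N <= n)%N -> q ^+ n <= e.
Proof.
move=> /andP[q0 q1] e0.
have := @cvg_expr R q; rewrite ger0_norm // => /(_ q1)/cvgrPdist_le/(_ _ e0)[N _ H].
exists N => n Nn; have := H n Nn; rewrite sub0r normrN ger0_norm // exprn_ge0 //.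
Qed.

Lemma nq_bound (q : R) : 0 < q < 1 -> exists2 K : R, 0 < K & forall n : nat, n.+1%:R * q ^+ n <= K.
Proof.
move=> /andP[q0 q1]; pose d := q^-1 - 1.
have d0 : 0 < d by rewrite subr_gt0 invf_gt1.
have qE : q^-1 = 1 + d by rewrite /d; ring.
clearbody d.
have B n : 1 + n%:R * d <= q^-1 ^+ n.
 rewrite qE; elim: n => [|n IH]; first by rewrite mul0r addr0 expr0.
 rewrite exprS.
 have d1 : 0 <= 1 + d by lra.
 have := ler_wpM2l d1 IH; rewrite -natr1; have : 0 <= n%:R * d ^+ 2 by rewrite mulr_ge0 ?sqr_ge0.
 by move: (_ ^+ n) (n%:R) => X N; nra.
exists (1 + d^-1); first by rewrite addr_gt0 // invr_gt0.
move=> n; have := B n; rewrite exprVn => h.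
have qn : 0 < q ^+ n by rewrite exprn_gt0.
rewrite -ler_pdivlMr //; have : (1 + d^-1) * (1 + n%:R * d) <= (1 + d^-1) / q ^+ n.
 by rewrite ler_pM2l // addr_gt0 // invr_gt0.
apply: le_trans; rewrite -natr1 mulrDl mul1r mulrDr mulr1 mulrCA mulVf ?gt_eqF // mulr1.
have h1 : 0 <= n%:R * d by rewrite mulr_ge0 // ltW.
have h2 : 0 <= d^-1 by rewrite invr_ge0 ltW.
by lra.
Qed.

Lemma geo_limit (u : nat -> C) (K q : R) : 0 <= K -> 0 <= q < 1 -> (forall n, cmod (u n.+1 - u n) <= K * q ^+ n) ->
 exists l : C, forall n, cmod (u n - l) <= K * q ^+ n / (1 - q).
Proof.
move=> K0 /andP[q0 q1] H.
have p1 : 0 < 1 - q by lra.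
have D n m : cmod (u (n + m)%N - u n) <= K * q ^+ n * (1 - q ^+ m) / (1 - q).
 elim: m => [|m IH]; first by rewrite addn0 subrr cmod0 expr0 subrr mulr0 mul0r.
 rewrite addnS; have -> : u (n + m).+1 - u n = (u (n + m).+1 - u (n + m)%N) + (u (n + m)%N - u n) by ring.
 tri; apply: le_trans (lerD (H _) IH) _.
 rewrite le_eqVlt; apply/orP; left; apply/eqP; rewrite exprD exprS; field; lra.
have D' n m : cmod (u (n + m)%N - u n) <= K * q ^+ n / (1 - q).
 apply: le_trans (D n m) _; rewrite ler_pM2r ?invr_gt0 //.
 have h1 : 0 <= K * q ^+ n by rewrite mulr_ge0 ?exprn_ge0.
 have h2 : 0 <= q ^+ m by rewrite exprn_ge0.
 by nra.
have [l _ Hl] := @cluster_C R (fun n=> u n - u 0%N) (K / (1 - q)) (fun n=> ltac:(by have := D' 0%N n; rewrite add0n expr0 mulr1)).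
exists (l + u 0%N) => n; apply/ler_addgt0Pr => e e0.
have [m nm hm] := Hl e n e0.
have := D' n (m - n)%N; rewrite subnKC // => h.
have -> : u n - (l + u 0%N) = (u n - u m) + (u m - u 0%N - l) by ring.
by tri; rewrite (cmodBC (u n)); lra.
Qed.

Definition psum (a : nat -> C) (z : C) (N : nat) : C := \sum_(n < N) a n * z ^+ n.

(** The coefficient bounds say that the radius of convergence is at least 1. The sum is tied to [f]
    on the open disc only, so [f] may be any function outside. *)
Definition PS (a : nat -> C) (f : C -> C) :=
 (forall rho : R, 0 < rho < 1 -> exists2 K, 0 < K & forall n, cmod (a n) * rho ^+ n <= K) /\
 (inD z, forall e : R, 0 < e -> exists N, forall n, (N <= n)%N -> cmod (psum a z n - f z) <= e).

Lemma psumS a z n : psum a z n.+1 = psum a z n + a n * z ^+ n.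
Proof. by rewrite /psum big_ord_recr. Qed.

Lemma geo_term (a : nat -> C) (rho K : R) z n : 0 < rho -> cmod (a n) * rho ^+ n <= K ->
 cmod (a n * z ^+ n) <= K * (cmod z / rho) ^+ n.
Proof.
move=> r0 H; rewrite cmodM cmodX.
have -> : cmod (a n) * cmod z ^+ n = (cmod (a n) * rho ^+ n) * (cmod z / rho) ^+ n.
 by rewrite -mulrA -exprMn mulrCA divff ?mulr1 // gt_eqF.
by apply: ler_wpM2r => //; rewrite exprn_ge0 // divr_ge0 ?cge0 // ltW.
Qed.

Lemma lim_uniq (u : nat -> C) (l l' : C) : (forall e : R, 0 < e -> exists N, forall n, (N <= n)%N -> cmod (u n - l) <= e) ->
 (forall e : R, 0 < e -> exists N, forall n, (N <= n)%N -> cmod (u n - l') <= e) -> l = l'.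
Proof.
move=> H H'; apply/eqP; rewrite -subr_eq0 -cmod_eq0; apply/eqP/le_anti; rewrite cge0 andbT.
apply/ler_addgt0Pr => e e0; rewrite add0r; have e2 : 0 < e / 2 by lra.
have [N HN] := H _ e2; have [N' HN'] := H' _ e2.
have := HN (maxn N N') (leq_maxl _ _); have := HN' (maxn N N') (leq_maxr _ _).
set m := maxn _ _; have := cmodD (l - u m) (u m - l'); rewrite addrA subrK (cmodBC l); lra.
Qed.

Lemma PS_tail a f (rho K : R) z : PS a f -> 0 < rho < 1 -> (forall n, cmod (a n) * rho ^+ n <= K) -> cmod z < rho ->
 forall n, cmod (psum a z n - f z) <= K * (cmod z / rho) ^+ n / (1 - cmod z / rho).
Proof.
move=> [_ H] /andP[r0 r1] HK hz n.
have K0 : 0 <= K by apply: le_trans (HK 0%N); rewrite mulr_ge0 ?cge0 // expr0.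
have q01 : 0 <= cmod z / rho < 1.
 by rewrite divr_ge0 ?cge0 ?(ltW r0) //= ltr_pdivrMr // mul1r.
have [l Hl] := @geo_limit (psum a z) K (cmod z / rho) K0 q01 (fun n=> ltac:(by rewrite psumS addrC addKr; exact: geo_term)).
suff -> : f z = l by exact: Hl.
apply: (@lim_uniq (psum a z)); first by apply: H; exact: lt_trans r1.
move=> e e0.
have p1 : 0 < 1 - cmod z / rho by move: q01 => /andP[_]; rewrite subr_gt0.
have [N HN] := pow_small q01 (divr_gt0 (mulr_gt0 e0 p1) (ltr_pwDr ltr01 K0)).
exists N => m Nm; apply: le_trans (Hl m) _; rewrite ler_pdivrMr //.
have := HN m Nm; rewrite ler_pdivlMr; last lra.
have : 0 <= (cmod z / rho) ^+ m by rewrite exprn_ge0 //; case/andP: q01.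
by rewrite mulrDr mulr1 (mulrC K); lra.
Qed.

Lemma PS_exists (a : nat -> C) : (forall rho : R, 0 < rho < 1 -> exists2 K, 0 < K & forall n, cmod (a n) * rho ^+ n <= K) ->
 exists f, PS a f.
Proof.
move=> Ha.
have H (z : C) : exists l, cmod z < 1 -> forall e : R, 0 < e -> exists N, forall n, (N <= n)%N -> cmod (psum a z n - l) <= e.
 have [hz|] := ltP (cmod z) 1; last by move=> h; exists 0.
 pose rho := (1 + cmod z) / 2.
 have c0 := cge0 z.
 have r01 : 0 < rho < 1 by rewrite /rho; lra.
 have [K K0 HK] := Ha _ r01.
 have r0 : 0 < rho by case/andP: r01.
 have q01 : 0 <= cmod z / rho < 1.
  by rewrite divr_ge0 ?cge0 ?(ltW r0) //= ltr_pdivrMr // mul1r /rho; lra.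
 have [l Hl] := @geo_limit (psum a z) K (cmod z / rho) (ltW K0) q01 (fun n=> ltac:(by rewrite psumS addrC addKr; exact: geo_term)).
 exists l => _ e e0.
 have p1 : 0 < 1 - cmod z / rho by move: q01 => /andP[_]; rewrite subr_gt0.
 have [N HN] := pow_small q01 (divr_gt0 (mulr_gt0 e0 p1) K0).
 exists N => m Nm; apply: le_trans (Hl m) _; rewrite ler_pdivrMr //.
 by have := HN m Nm; rewrite ler_pdivlMr // mulrC.
have [f Hf] := choice H.
by exists f; split.
Qed.

Definition dcoef (a : nat -> C) n : C := n.+1%:R * a n.+1.

Lemma cmod_nat n : cmod (n%:R : C) = n%:R.
Proof.
rewrite (_ : n%:R = (n%:R : R)%:C) ?cmodR ?normr_nat //.
by rewrite rmorph_nat.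
Qed.

Lemma dcoef_bound (a : nat -> C) : (forall rho : R, 0 < rho < 1 -> exists2 K, 0 < K & forall n, cmod (a n) * rho ^+ n <= K) ->
 forall rho : R, 0 < rho < 1 -> exists2 K, 0 < K & forall n, cmod (dcoef a n) * rho ^+ n <= K.
Proof.
move=> Ha rho /andP[r0 r1]; have [s [s01 rs]] : exists s : R, 0 < s < 1 /\ rho < s by exists ((1 + rho) / 2); lra.
have s0 : 0 < s by case/andP: s01.
have [K K0 HK] := Ha _ s01.
have q01 : 0 < rho / s < 1 by rewrite divr_gt0 //= ltr_pdivrMr // mul1r.
have [K' K'0 HK'] := nq_bound q01.
exists (K / s * K'); first by rewrite mulr_gt0 // divr_gt0.
move=> n; rewrite /dcoef cmodM cmod_nat.
have -> : n.+1%:R * cmod (a n.+1) * rho ^+ n = (cmod (a n.+1) * s ^+ n.+1 / s) * (n.+1%:R * (rho / s) ^+ n).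
 rewrite exprS expr_div_n; have sn : s ^+ n != 0 by rewrite expf_neq0 // gt_eqF.
 by field; rewrite sn gt_eqF.
apply: ler_pM => //.
- by rewrite divr_ge0 ?(ltW s0) // mulr_ge0 ?cge0 // exprn_ge0 // ltW.
- by rewrite mulr_ge0 // exprn_ge0 // ltW //; case/andP: q01.
- by rewrite ler_pM2r ?invr_gt0.
Qed.

(** The real mean value theorem for s |-> Re (conj(Dl) u(z + s k)), whose total increment is
    |Dl|^2. *)
Lemma mvt_seg (u : C -> C) (z k : C) (m : R) : (forall s : R, 0 <= s <= 1 -> exists p q, wd u (z + s%:C * k) p q /\ cmod p + cmod q <= m) ->
 cmod (u (z + k) - u z) <= m * cmod k.
Proof.
move=> H; set Dl := u (z + k) - u z.
have [->|D0] := eqVneq Dl 0.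
 rewrite cmod0; have [p [q [_ h]]] := H 0 ltac:(lra).
 by rewrite mulr_ge0 ?cge0 //; have := cge0 p; have := cge0 q; lra.
have d0 : 0 < cmod Dl by rewrite cmod_gt0.
pose w := cj Dl.
pose phi (s : R) := Re (w * u (z + s%:C * k)).
have E (x : R) : z + x%:C * k = (Re z + Re k * x) +i* (Im z + Im k * x).
 by apply: cx_eq; rewrite !(cReD, cImD, cReM, cImM) /=; ring.
have dp (s : R) : 0 <= s <= 1 -> exists2 d : R, is_derive s 1 phi d & d <= cmod Dl * (m * cmod k).
 move=> hs; have [p [q [W hm]]] := H s hs.
 have W' := wdZ w W; rewrite E in W'.
 have := wd_curve (is_derive_aff (Re z) (Re k) s) (is_derive_aff (Im z) (Im k) s) W'.
 have -> : (fun t : R => Re (w * u ((Re z + Re k * t) +i* (Im z + Im k * t)))) = phi.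
  by apply/funext => t; rewrite /phi E.
 move=> D1; eexists; first exact: D1.
 apply: le_trans (ler_Re_cmod _) _; tri; rewrite !cmodM /w cmodJ.
 have -> : cmod (Re k -i* Im k) = cmod k by rewrite /cmod /= sqrrN.
 have -> : cmod (Re k +i* Im k) = cmod k by case: (k).
 have : cmod Dl * ((cmod p + cmod q) * cmod k) <= cmod Dl * (m * cmod k).
  by rewrite ler_wpM2l ?cge0 // ler_wpM2r ?cge0.
 lra.
have [dphi Hd] : exists dphi : R -> R, forall s : R, 0 <= s <= 1 -> is_derive s 1 phi (dphi s) /\ dphi s <= cmod Dl * (m * cmod k).
 have h (s : R) : exists d, 0 <= s <= 1 -> is_derive s 1 phi d /\ d <= cmod Dl * (m * cmod k).
  have [hs|] := boolP (0 <= s <= 1); last by exists 0.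
  by have [d h1 h2] := dp s hs; exists d.
 by have [dphi Hd] := choice h; exists dphi.
have := @MVT R phi dphi 0 1 ltr01; case=> [x /andP[x0 x1]||c].
- by apply: (Hd x _).1; rewrite (ltW x0) (ltW x1).
- by apply: derivable_within_continuous => x; rewrite in_itv /= => hx; have [] := (Hd x hx).1.
rewrite in_itv /= => /andP[c0 c1]; rewrite subr0 mulr1 => Hc.
have [_ hb] := Hd c ltac:(by rewrite !ltW).
have : phi 1 - phi 0 = cmod Dl ^+ 2.
 rewrite /phi mul0r addr0 mul1r -cReN -cReD -mulrN -mulrDr -/Dl /w mulrC mulcJ //.
by rewrite Hc => E2; move: hb; rewrite E2 expr2 ler_pM2l.
Qed.

Lemma PS_unif a f (r e : R) : PS a f -> 0 < r < 1 -> 0 < e ->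
 exists N, forall n, (N <= n)%N -> forall z, cmod z <= r -> cmod (psum a z n - f z) <= e.
Proof.
move=> H /andP[r0 r1] e0.
have [s [rs s1]] : exists s : R, r < s /\ s < 1 by exists ((1 + r) / 2); lra.
have s0 : 0 < s by lra.
have s01 : 0 < s < 1 by rewrite s0.
have [K K0 HK] := H.1 _ s01.
have q01 : 0 <= r / s < 1 by rewrite divr_ge0 ?(ltW r0) ?(ltW s0) //= ltr_pdivrMr // mul1r.
have p1 : 0 < 1 - r / s by move: q01 => /andP[_]; rewrite subr_gt0.
have [N HN] := pow_small q01 (divr_gt0 (mulr_gt0 e0 p1) K0).
exists N => n Nn z hz; apply: le_trans (PS_tail H s01 HK (le_lt_trans hz rs) n) _.
have zr : cmod z / s <= r / s by rewrite ler_pM2r ?invr_gt0.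
have p2 : 0 < 1 - cmod z / s by lra.
rewrite ler_pdivrMr //; have := HN n Nn; rewrite ler_pdivlMr // => h.
have : (cmod z / s) ^+ n <= (r / s) ^+ n.
 rewrite lerXn2r ?nnegrE //; last by case/andP: q01.
 by rewrite divr_ge0 ?cge0 // ltW.
have z0 : 0 <= (cmod z / s) ^+ n by rewrite exprn_ge0 // divr_ge0 ?cge0 // ltW.
move: ((cmod z / s) ^+ n) ((r / s) ^+ n) h z0 => x y h z0 xy.
apply: (@le_trans _ _ (y * K)); first by rewrite mulrC ler_pM2r.
apply: le_trans h _; rewrite ler_pM2l //; lra.
Qed.
Lemma con_psum a n (r : R) : con r (fun z=> psum a z n).
Proof. by apply: con_sum => j; apply: conM; [exact: con_cst|apply: conX; exact: con_id]. Qed.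

Lemma wd_psum (a : nat -> C) z n : wd (fun z=> psum a z n.+1) z (psum (dcoef a) z n) 0.
Proof.
elim: n => [|n IH].
 by apply: wd_ext (wd_eq _ _ (wd_cst (a 0%N) z)) => [w||]; rewrite /psum ?big_ord1 ?big_ord0 ?expr0 ?mulr1.
apply: wd_ext (wd_eq _ _ (wdD IH (wdZ (a n.+1) (wdX n.+1 (wd_id z))))) => [w||] /=; first by rewrite [RHS]psumS.
 by rewrite psumS /dcoef; ring.
by rewrite !mulr0 addr0.
Qed.

(** The mean value inequality is applied to the partial sums minus f1(z) w; their derivatives are
    uniformly close to f1 - f1(z), which is small near z. *)
Lemma PS_derive (a : nat -> C) f f1 z : PS a f -> PS (dcoef a) f1 -> cmod z < 1 -> wd f z (f1 z) 0.
Proof.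
move=> Pf Pf1 hz e e0; have c0 := cge0 z.
pose s := (1 + cmod z) / 2; have s01 : 0 < s < 1 by rewrite /s; lra.
have e4 : 0 < e / 4 by lra.
have [N HN] := PS_unif Pf1 s01 e4.
have [d d0 D] := @con_psum (dcoef a) N (cmod z) z (lexx _) _ e4.
have zs : cmod z < s by rewrite /s; lra.
exists (Num.min d (s - cmod z)) => [|h]; first by rewrite lt_min d0 subr_gt0.
rewrite lt_min mul0r addr0 => /andP[h1 h2]; have h0 := cge0 h.
apply/ler_addgt0Pr => e' e'0; have e2 : 0 < e' / 2 by lra.
have hzh : cmod (z + h) < 1 by case/andP: s01; have := cmodD z h; lra.
have [N1 H1] := Pf.2 _ hzh _ e2; have [N2 H2] := Pf.2 _ hz _ e2.
pose n := maxn N (maxn N1 N2).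
have A1 := H1 n.+1 (leqW (leq_trans (leq_maxl _ _) (leq_maxr _ _))).
have A2 := H2 n.+1 (leqW (leq_trans (leq_maxr _ _) (leq_maxr _ _))).
have := @mvt_seg (fun w=> psum a w n.+1 - f1 z * w) z h e.
rewrite (_ : psum a (z + h) n.+1 - _ - _ = psum a (z + h) n.+1 - psum a z n.+1 - f1 z * h); last by ring.
move=> M; rewrite (_ : f (z + h) - f z - f1 z * h = (psum a (z + h) n.+1 - psum a z n.+1 - f1 z * h) + ((psum a z n.+1 - f z) - (psum a (z + h) n.+1 - f (z + h)))); last by ring.
tri; apply: lerD; last by apply: le_trans (cmodB _ _) _; lra.
apply: M => t /andP[t0 t1]; exists (psum (dcoef a) (z + t%:C * h) n - f1 z), 0; split.
 by apply: wd_eq (wdB (wd_psum a _ n) (wdZ (f1 z) (wd_id _))); rewrite ?mulr1 ?mulr0 ?subr0.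
have th : cmod (t%:C * h) <= cmod h by rewrite cmodM cmodR ger0_norm // ler_piMl.
have ws : cmod (z + t%:C * h) <= s by tri; lra.
have B1 := HN n (leq_maxl _ _) _ ws; have B2 := HN N (leqnn _) _ ws.
have B3 := HN N (leqnn _) _ (ltW zs); have B4 := D _ (le_lt_trans th h1).
move: B1 B2 B3 B4; rewrite cmod0 addr0.
move: (psum _ _ n) (psum _ (z + _) N) (psum _ z N) (f1 _) (f1 z) => x y u v w B1 B2 B3 B4.
have -> : x - w = (x - v) + ((v - y) + ((y - u) + (u - w))) by ring.
have C1 := cmodD (x - v) ((v - y) + ((y - u) + (u - w))); have C2 := cmodD (v - y) ((y - u) + (u - w)).
by have C3 := cmodD (y - u) (u - w); rewrite (cmodBC v y) in C2; lra.
Qed.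

Definition holo (f : C -> C) := inD z, exists p, wd f z p 0.

Lemma PS_holo a f : PS a f -> holo f.
Proof.
move=> H z hz; have [f1 H1] := PS_exists (dcoef_bound H.1).
by exists (f1 z); exact: PS_derive H H1 hz.
Qed.

End Series.

(** * Cauchy's theorem and power series of holomorphic functions *)

Section Cauchy.
Variable R : realType.
Local Notation C := R[i].

Lemma Mc_ext (r : R) (u v : C -> C) : 0 <= r -> (forall z, cmod z = r -> u z = v z) -> Mc r u = Mc r v.
Proof.
move=> r0 E; apply: cx_eq => /=; apply: RI_eq => t _; rewrite E // cmod_circ //.
Qed.

Lemma Mr1 (r : R) : Mr r (fun=> 1 : R) = 2 * pi.
Proof.
have p0 := pi_gt0 R.
have := @RI_cst R 1 0 (2 * pi); rewrite subr0 mul1r; apply; lra.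
Qed.

Lemma Mc_cst (r : R) c : 0 < r -> Mc r (fun=> c) = (2 * pi)%:C * c.
Proof.
by move=> r0; apply: cx_eq; rewrite ?cReM ?cImM /= (posf_cst _ (posf_Mr r0)) Mr1; ring.
Qed.

(** The derivative of F along the circle with respect to the angle is i z f(z), and F takes the same
    value at both ends of the period. *)
Lemma Mc_FTC (r : R) F f : 0 < r -> con r f -> (forall z, cmod z <= r -> wd F z (f z) 0) ->
 Mc r (fun z=> z * f z) = 0.
Proof.
move=> r0.
have key G g : con r g -> (forall z, cmod z <= r -> wd G z (g z) 0) -> Mr r (fun z=> Re ('i%C * (z * g z))) = 0.
 move=> cg HG; have p0 := pi_gt0 R.
 transitivity (Re (G (circ r (2 * pi))) - Re (G (circ r 0))); last first.
  by have := circ_shift r 0; rewrite add0r => ->; rewrite subrr.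
 apply: (@RI_FTC R _ (fun t=> Re (G (circ r t)))); first lra.
  apply: (cont_circ (v := fun z=> Re ('i%C * (z * g z)))); first exact: ltW.
  apply: rc_Re; apply: conM; first exact: con_cst.
  by conT.
 move=> x _.
 have ds : is_derive x 1 (fun t : R => r * sin t) (r * cos x).
  by apply: is_derive_eq; rewrite /GRing.scale /= ?mulr0 ?addr0 // mulrC.
 have dc : is_derive x 1 (fun t : R => r * cos t) (- (r * sin x)).
  by apply: is_derive_eq; rewrite /GRing.scale /= ?mulr0 ?addr0 //; ring.
 have hx : cmod (circ r x) <= r by rewrite cmod_circ // ltW.
 have := wd_curve dc ds (HG _ hx).
 rewrite mul0r addr0 => H; apply: is_derive_eq; congr Re.
 have -> : - (r * sin x) +i* (r * cos x) = 'i%C * circ r x by apply: cx_eq; rewrite ?cReM ?cImM /=; ring.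
 by ring.
move=> cf HF.
have K1 := key F f cf HF.
have K2 : Mr r (fun z=> Re ('i%C * (z * ('i%C * f z)))) = 0.
 apply: (key (fun z=> 'i%C * F z)); first by conT.
 by move=> z hz; apply: wd_eq (wdZ 'i%C (HF z hz)); rewrite ?mulr0.
apply: cx_eq => /=.
 rewrite -[LHS]opprK -(posfN (posf_Mr r0)); last by conT.
 rewrite -[RHS]oppr0; congr (- _); rewrite -[RHS]K2; congr Mr; apply/funext => z.
 by rewrite !(cReM, cImM) /=; ring.
rewrite -[LHS]opprK -(posfN (posf_Mr r0)); last by conT.
rewrite -[RHS]oppr0; congr (- _); rewrite -[RHS]K1; congr Mr; apply/funext => z.
by rewrite !(cReM, cImM) /=; ring.
Qed.

Definition holo_on (rho : R) (f : C -> C) := forall z, cmod z < rho -> exists p, wd f z p 0.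

Lemma wd_clip (s : R) f z p q : cmod z < s -> wd f z p q -> wd (fun z=> f (clip s z)) z p q.
Proof.
move=> hz; have s0 : 0 < s by apply: le_lt_trans hz; exact: cge0.
apply: (@wd_loc _ _ _ _ _ _ (s - cmod z)); first by rewrite subr_gt0.
by move=> w hw; rewrite clip_id // ltW //; have := cmodD3 w z; lra.
Qed.
Lemma holo_ccont rho f z : holo_on rho f -> cmod z < rho -> ccont f z.
Proof. by move=> H hz; have [p /ccont_wd] := H z hz. Qed.

Lemma holo_con rho r f : holo_on rho f -> r < rho -> con r f.
Proof. by move=> H hr z hz; apply: (holo_ccont H); exact: le_lt_trans hr. Qed.
Lemma clip_con (s : R) f : 0 < s -> con s f -> forall z, ccont (fun z=> f (clip s z)) z.
Proof. by move=> s0 cf z; apply: ccont_comp; [exact: clip_ccont|apply: cf; exact: clip_le]. Qed.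

Lemma cauchy0 rho (r : R) f : holo_on rho f -> 0 < r < rho -> Mc r (fun z=> z * f z) = 0.
Proof.
move=> Hf /andP[r0 rr].
have [s [rs sr]] : exists s : R, r < s /\ s < rho by exists ((r + rho) / 2); lra.
have [s' [rs' ss']] : exists s' : R, r < s' /\ s' < s by exists ((r + s) / 2); lra.
have s0 : 0 < s by lra.
have s'0 : 0 < s' by lra.
have cf := clip_con s0 (holo_con Hf sr).
have Hd z : cmod z <= s' -> exists p, wd (fun z=> f (clip s z)) z p 0.
 move=> hz; have hz' : cmod z < s by lra.
 have hz2 : cmod z < rho by lra.
 by have [p Hp] := Hf z hz2; exists p; exact: wd_clip.
have P z : cmod z <= r -> wd (Lseg (fun z=> f (clip s z)) 0) z (f (clip s z)) 0.
 by move=> hz; apply: (@primitive R _ cf s') => //; lra.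
rewrite -[RHS](@Mc_FTC r _ _ r0 (fun z _ => cf z) P); apply: Mc_ext => [|z hz]; first exact: ltW.
by rewrite clip_id //; lra.
Qed.

(** The quotient is taken for a primitive F of f because it then equals the mean of f over the
    segment from a to z. This mean is differentiable at a as well, so no removable singularity
    theorem is used. *)
Lemma cauchy_quot rho (r : R) f : holo_on rho f -> 0 < r < rho ->
 exists F : C -> C, (forall z, cmod z <= r -> wd F z (f z) 0) /\
 forall a, cmod a < r -> Mc r (fun z=> z * ((F z - F a) / (z - a))) = 0.
Proof.
move=> Hf /andP[r0 rr].
have [s [rs sr]] : exists s : R, r < s /\ s < rho by exists ((r + rho) / 2); lra.
have [s' [rs' ss']] : exists s' : R, r < s' /\ s' < s by exists ((r + s) / 2); lra.
have s0 : 0 < s by lra.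
have s'0 : 0 < s' by lra.
have cf := clip_con s0 (holo_con Hf sr).
pose g z := f (clip s z).
have Hd z : cmod z <= s' -> exists p, wd g z p 0.
 move=> hz; have hz' : cmod z < s by lra.
 have hz2 : cmod z < rho by lra.
 by have [p Hp] := Hf z hz2; exists p; exact: wd_clip.
have HF z : cmod z < s' -> wd (Lseg g 0) z (g z) 0 by move=> hz; exact: (@primitive R _ cf s').
pose F := Lseg g 0.
have ge z : cmod z < s' -> g z = f z by move=> hz; rewrite /g clip_id //; lra.
exists F; split.
 move=> z hz; have hz' : cmod z < s' by lra.
 by rewrite -ge //; exact: HF.
move=> a ar; have as' : cmod a < s' by lra.
have qE z : cmod z < s' -> z != a -> cI (Iseg a z) g = (F z - F a) / (z - a).
 move=> hz za; rewrite /F (Lseg_add cf Hd (ltW as') (ltW hz)) /Lseg mulrAC mulfV ?mul1r // subr_eq0 //.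
have qh : holo_on s' (fun z=> cI (Iseg a z) g).
 move=> z hz; have [->|za] := eqVneq z a.
  (* The mean over the segment from a to a + h of f(a) + p (w - a) is f(a) + p h / 2, hence the
     derivative p / 2. *)
  have [p Hp] := Hd a (ltW as'); exists (p / 2) => e e0.
  have [d d0 D] := Hp e e0; exists d => // h hh.
  have h0 := cge0 h.
  have cg' w : ccont (fun w=> g w - (g a + p * (w - a))) w.
   apply: ccontB; first exact: cf.
   apply: ccontD; first exact: ccont_cst.
   by apply: ccontM; [exact: ccont_cst|apply: ccontB; [exact: ccont_id|exact: ccont_cst]].
  have -> : cI (Iseg a (a + h)) g - cI (Iseg a a) g - (p / 2 * h + 0 * cj h) =
   cI (Iseg a (a + h)) (fun w=> g w - (g a + p * (w - a))).
   pose t := cmod a + cmod h + 1.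
   have t0 : 0 < t by have := cge0 a; rewrite /t; lra.
   have ta : cmod a <= t by rewrite /t; lra.
   have tah : cmod (a + h) <= t by have := cmodD a h; rewrite /t; lra.
   have HI := posf_seg t0 ta tah.
   have -> : (fun w=> g w - (g a + p * (w - a))) = (fun w=> g w - (p * id w + (g a - p * a))).
    by apply/funext => w /=; ring.
   have ci : con t (fun w=> p * id w) by conT.
   rewrite (cIB HI); [|by move=> w _; exact: cf|by conT].
   rewrite (cID HI) //; last exact: con_cst.
   rewrite (cIZ _ HI); last exact: con_id.
   rewrite cI_seg_id cI_seg_cst.
   have -> : cI (Iseg a a) g = g a.
    rewrite -[RHS](cI_seg_cst (g a) a a).
    apply: cx_eq => /=; apply: RI_eq => x _; by rewrite subrr mulr0 addr0.
   by field.
  apply: cI_seg_bound => // x /andP[x0 x1].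
  have E : cmod (x%:C * h) <= cmod h by rewrite cmodM cmodR ger0_norm // ler_piMl.
  have -> : a + x%:C * (a + h - a) = a + x%:C * h by ring.
  have := D (x%:C * h) (le_lt_trans E hh); rewrite mul0r addr0.
  have -> : g (a + x%:C * h) - (g a + p * (a + x%:C * h - a)) = g (a + x%:C * h) - g a - p * (x%:C * h) by ring.
  by move/le_trans; apply; rewrite ler_pM2l.
 pose d := Num.min (cmod (z - a)) (s' - cmod z).
 have d0 : 0 < d by rewrite lt_min cmod_gt0 !subr_gt0 subr_eq0 za.
 have W : wd (fun z=> (F z - F a) / (z - a)) z _ _ := wdM (wdB (HF z hz) (wd_cst _ _)) (wdV (wdB (wd_id z) (wd_cst a _)) ltac:(by rewrite subr_eq0)).
 eexists; apply: (@wd_loc _ (fun z=> (F z - F a) / (z - a)) _ _ _ _ d) => //; last first.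
  by apply: wd_eq W; [reflexivity|rewrite !subrr oppr0 !mul0r mulr0 addr0].
 move=> w; rewrite lt_min => /andP[w1 w2].
 rewrite qE //; first by have := cmodD3 w z; lra.
 by apply/eqP => wa; move: w1; rewrite wa cmodBC ltxx.
have rs'' : 0 < r < s' by rewrite r0.
rewrite -[RHS](cauchy0 qh rs''); apply: Mc_ext => [|z hz]; first exact: ltW.
by rewrite qE ?hz //; apply/eqP => za; move: hz; rewrite za; lra.
Qed.
Lemma conjX (z : C) n : cj (z ^+ n) = cj z ^+ n.
Proof. by elim: n => [|n IH]; rewrite ?expr0 ?conjc1 // !exprS conjcM IH. Qed.

Lemma realCX (x : R) n : (x ^+ n)%:C = x%:C ^+ n.
Proof. by elim: n => [|n IH]; rewrite ?expr0 // !exprS realCM IH. Qed.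

Lemma Mc_pow (r : R) n : 0 < r -> Mc r (fun z=> z ^+ n.+1) = 0.
Proof.
move=> r0; under [X in Mc r X]eq_fun do rewrite exprS.
apply: (@cauchy0 (r + 1) r (fun z=> z ^+ n)); last by rewrite r0 /=; lra.
by move=> z _; eexists; apply: wd_eq (wdX n (wd_id z)); rewrite ?mulr0.
Qed.

Lemma Mc_cpow (r : R) n : 0 < r -> Mc r (fun z=> cj z ^+ n.+1) = 0.
Proof.
move=> r0; rewrite -[RHS](conjc0 R) -(Mc_pow n r0) -(Mc_conj r0); last by conT.
by congr Mc; apply/funext => z; rewrite conjX.
Qed.

(** The Cauchy kernel: on the unit circle it equals z / (z - a), and for |a| < 1 it is continuous on
    the closed disc. *)
Definition ck (a z : C) : C := (1 - a * cj z)^-1.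

Lemma ck_neq0 (a z : C) : cmod a < 1 -> cmod z <= 1 -> 1 - a * cj z != 0.
Proof.
move=> ha hz; rewrite subr_eq0; apply/eqP => E.
have : cmod (a * cj z) < 1 by rewrite cmodM cmodJ; have := cge0 a; nra.
by rewrite -E cmod1 ltxx.
Qed.

Lemma con_ck (a : C) : cmod a < 1 -> con 1 (ck a).
Proof.
move=> ha z hz; apply: ccontV; last exact: ck_neq0.
apply: ccontB; first exact: ccont_cst.
by apply: ccontM; [exact: ccont_cst|apply: ccont_conj; exact: ccont_id].
Qed.

Lemma ck_geo (a z : C) N : cmod a < 1 -> cmod z <= 1 ->
 ck a z = \sum_(n < N) a ^+ n * cj z ^+ n + a ^+ N * (cj z ^+ N * ck a z).
Proof.
move=> ha hz; have n0 := ck_neq0 ha hz.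
elim: N => [|N IH]; first by rewrite big_ord0 !expr0 add0r !mul1r.
rewrite big_ord_recr /= {1}IH -addrA; congr (_ + _).
have E : ck a z = 1 + a * cj z * ck a z.
 by apply: (mulfI n0); rewrite mulrDr mulr1 mulrCA mulfV // mulr1; ring.
by rewrite {1}E !exprSr; ring.
Qed.

Lemma ck_circ (a z : C) : cmod a < 1 -> cmod z = 1 -> z / (z - a) = ck a z.
Proof.
move=> ha hz; have z0 : z != 0 by rewrite -cmod_gt0 hz.
have zz : z * cj z = 1 by rewrite mulcJ hz expr1n.
have -> : z - a = z * (1 - a * cj z) by rewrite mulrBr mulr1 mulrCA zz mulr1.
by rewrite invfM mulrA mulfV // mul1r.
Qed.
Lemma PS_ext (a : nat -> C) f g : (inD z, f z = g z) -> PS a f -> PS a g.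
Proof. by move=> E [H1 H2]; split=> // z hz; rewrite -E //; exact: H2. Qed.

(** The Cauchy formula for the primitive F, with a finite geometric expansion of the kernel, gives
    the series of F; termwise differentiation gives that of f. *)
Lemma holo_on_PS rho f : 1 < rho -> holo_on rho f -> exists a, PS a f.
Proof.
move=> r1 Hf.
have h1 : 0 < (1 : R) < rho by rewrite ltr01.
have [F [HF HC]] := cauchy_quot Hf h1.
have M1 := posf_Mr (@ltr01 R).
have p0 := pi_gt0 R.
have cF : con 1 F by move=> z hz; exact: ccont_wd (HF z hz).
have cc n : con 1 (fun z=> cj z ^+ n) by conT.
have [K K0 HK] := con_bdd cF.
pose A n := Mc 1 (fun z=> cj z ^+ n * F z) / (2 * pi)%:C.
have pc0 : (2 * pi)%:C != 0 :> C by rewrite -cmod_gt0 cmodR gtr0_norm; lra.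
have AE n : Mc 1 (fun z=> cj z ^+ n * F z) = (2 * pi)%:C * A n by rewrite /A mulrC divfK.
have Ab n : cmod (A n) <= K.
 rewrite /A cmodM cmodV cmodR gtr0_norm; last lra.
 rewrite ler_pdivrMr; last lra.
 rewrite -(Mr1 1); apply: (cI_le M1); first exact: conM.
 move=> z hz; rewrite cmodM cmodX cmodJ -[leRHS]mul1r; apply: ler_pM; nneg.
  by rewrite exprn_ile1 ?cge0.
 exact: HK.
have PA : PS A F.
 split.
  move=> rho' /andP[r'0 r'1]; exists K => // n; rewrite -[leRHS]mulr1; apply: ler_pM => //; nneg.
  by rewrite exprn_ile1 // ltW.
 move=> a ha e e0.
 have ca := con_ck ha.
 have [K1 K10 HK1] := con_bdd ca.
 have cFa : con 1 (fun z=> F z - F a) by apply: (@conD _ 1 F (fun=> - F a)) => //; exact: con_cst.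
 have main N : (2 * pi)%:C * (psum A a N.+1 - F a) = - (a ^+ N.+1 * Mc 1 (fun z=> cj z ^+ N.+1 * ck a z * (F z - F a))).
  have := HC a ha.
  have -> : Mc 1 (fun z=> z * ((F z - F a) / (z - a))) = Mc 1 (fun z=> ck a z * (F z - F a)).
   by apply: Mc_ext => // z hz; rewrite -ck_circ //; ring.
  have -> : Mc 1 (fun z=> ck a z * (F z - F a)) = Mc 1 (fun z=> \sum_(n < N.+1) a ^+ n * (cj z ^+ n * (F z - F a)) + a ^+ N.+1 * (cj z ^+ N.+1 * ck a z * (F z - F a))).
   apply: Mc_ext => // z hz; rewrite {1}(ck_geo N.+1 ha) ?hz // mulrDl mulr_suml; congr (_ + _); last by ring.
   by apply: eq_bigr => i _; ring.
  have c1 n : con 1 (fun z=> a ^+ n * (cj z ^+ n * (F z - F a))).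
   by conT.
  have c2 : con 1 (fun z=> cj z ^+ N.+1 * ck a z * (F z - F a)) by conT.
  rewrite /Mc (cID M1); [|by apply: con_sum => j; exact: c1|by conT].
  rewrite (cI_sum _ M1); last by move=> j; exact: c1.
  rewrite (cIZ _ M1) // => H; apply/eqP; rewrite -subr_eq0 opprK; apply/eqP; rewrite -[RHS]H; congr (_ + _).
  rewrite mulrBr /psum mulr_sumr.
  have T (n : nat) : cI (Mr 1) (fun z=> a ^+ n * (cj z ^+ n * (F z - F a))) = (2 * pi)%:C * (A n * a ^+ n) - a ^+ n * F a * Mc 1 (fun z=> cj z ^+ n).
   rewrite (cIZ _ M1); last by conT.
   under [X in cI _ X]eq_fun do rewrite mulrBr (mulrC _ (F a)).
   rewrite (cIB M1); [|by conT|by conT].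
   rewrite (cIZ _ M1) // -/(Mc 1 _) AE -/(Mc 1 _); ring.
  rewrite [RHS](eq_bigr (fun n : 'I_N.+1 => (2 * pi)%:C * (A n * a ^+ n) - a ^+ n * F a * Mc 1 (fun z=> cj z ^+ n))); last by move=> i _; exact: T.
  rewrite sumrB; congr (_ - _); rewrite big_ord_recl [X in _ = _ + X]big1; last by move=> i _; rewrite lift0 Mc_cpow // mulr0.
  rewrite /= expr0 mul1r.
  under [X in Mc 1 X]eq_fun do rewrite expr0.
  by rewrite Mc_cst // mulr1 addr0 mulrC.
 have B N : cmod (psum A a N.+1 - F a) <= cmod a ^+ N.+1 * (K1 * (K + K)).
  have : cmod ((2 * pi)%:C * (psum A a N.+1 - F a)) <= cmod a ^+ N.+1 * (K1 * (K + K) * (2 * pi)).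
   rewrite main cmodN cmodM cmodX; apply: ler_wpM2l; first by nneg.
   rewrite -(Mr1 1); apply: (cI_le M1); first by conT.
   move=> z hz; rewrite !cmodM cmodX cmodJ; apply: ler_pM; nneg.
    rewrite -[leRHS]mul1r; apply: ler_pM; nneg; last exact: HK1.
    by rewrite exprn_ile1 ?cge0.
   apply: le_trans (cmodB _ _) _; apply: lerD; apply: HK => //; exact: ltW.
  rewrite cmodM cmodR gtr0_norm; last lra.
  by rewrite mulrC !mulrA ler_pM2r //; lra.
 have K2 : 0 < K1 * (K + K) by npos.
 have a01 : 0 <= cmod a < 1 by rewrite cge0.
 have [N HN] := pow_small a01 (divr_gt0 e0 K2).
 exists N.+1 => -[//|n] nN; apply: le_trans (B n) _; rewrite -ler_pdivlMr //; apply: HN; exact: ltnW.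
exists (dcoef A).
have [f1 Pf1] := PS_exists (dcoef_bound PA.1).
apply: (@PS_ext _ f1) => // z hz.
by have [-> _] := wd_uniq (PS_derive PA Pf1 hz) (HF z (ltW hz)).
Qed.

Lemma Mc_orth (r : R) m n : 0 < r ->
 Mc r (fun z=> cj z ^+ n * z ^+ m) = if m == n then (2 * pi * r ^+ (2 * n))%:C else 0.
Proof.
move=> r0; have M0 := posf_Mr r0.
have zz (z : C) k : cmod z = r -> cj z ^+ k * z ^+ k = (r ^+ (2 * k))%:C.
 by move=> hz; rewrite -exprMn mulrC mulcJ hz -realCX exprM.
have cz k : con r (fun z=> z ^+ k) by conT.
have cc k : con r (fun z=> cj z ^+ k) by conT.
have [nm|mn|->] := ltngtP m n.
- have [k ->] : exists k, n = (k.+1 + m)%N by exists (n - m).-1; lia.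
 transitivity (Mc r (fun z=> (r ^+ (2 * m))%:C * cj z ^+ k.+1)).
  by apply: Mc_ext => [|z hz]; [exact: ltW|rewrite exprD -mulrA (zz z) // mulrC].
 by rewrite /Mc (cIZ _ M0) // -/(Mc r _) Mc_cpow // mulr0.
- have [k ->] : exists k, m = (n + k.+1)%N by exists (m - n).-1; lia.
 transitivity (Mc r (fun z=> (r ^+ (2 * n))%:C * z ^+ k.+1)).
  by apply: Mc_ext => [|z hz]; [exact: ltW|rewrite exprD mulrA (zz z)].
 by rewrite /Mc (cIZ _ M0) // -/(Mc r _) Mc_pow // mulr0.
rewrite [RHS]realCM -(Mc_cst _ r0); apply: Mc_ext => [|z hz]; [exact: ltW|exact: zz].
Qed.
Lemma PS_con a f (r : R) : PS a f -> r < 1 -> con r f.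
Proof. by move=> H r1 z hz; have [p /ccont_wd] := PS_holo H (le_lt_trans hz r1). Qed.

Lemma PS_coef a f (r : R) n : PS a f -> 0 < r < 1 -> Mc r (fun z=> cj z ^+ n * f z) = (2 * pi * r ^+ (2 * n))%:C * a n.
Proof.
move=> H r01; have /andP[r0 r1] := r01; have M0 := posf_Mr r0; have p0 := pi_gt0 R.
have cc k : con r (fun z=> cj z ^+ k) by conT.
have cf := PS_con H r1.
apply/eqP; rewrite -subr_eq0 -cmod_eq0; apply/eqP/le_anti; rewrite cge0 andbT.
apply/ler_addgt0Pr => e e0; rewrite add0r.
have e1 : 0 < e / (2 * pi) by rewrite divr_gt0 //; lra.
have [N HN] := PS_unif H r01 e1.
pose m := maxn N n.+1.
have -> : (2 * pi * r ^+ (2 * n))%:C * a n = Mc r (fun z=> cj z ^+ n * psum a z m).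
 transitivity (Mc r (fun z=> \sum_(i < m) a i * (cj z ^+ n * z ^+ i))).
  rewrite /Mc (cI_sum _ M0); last by move=> j; apply: conM; [exact: con_cst|apply: conM => //; apply: conX; exact: con_id].
  have nm : (n < m)%N by rewrite leq_max leqnn orbT.
  rewrite (bigD1 (Ordinal nm)) //= (cIZ _ M0); last by conT.
  rewrite -/(Mc r _) Mc_orth // eqxx big1 ?addr0 1?mulrC // => i ni.
  rewrite (cIZ _ M0); last by conT.
  rewrite -/(Mc r _) Mc_orth // ifF ?mulr0 //; apply/negbTE; apply: contra ni => /eqP E; exact/eqP/val_inj.
 by congr Mc; apply/funext => z; rewrite /psum mulr_sumr; apply: eq_bigr => i _; ring.
rewrite /Mc -(cIB M0); [|by conT|by apply: conM => //; exact: con_psum].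
rewrite -[leRHS](@divfK _ (2 * pi)) ?gt_eqF //; last lra.
rewrite -[X in _ <= _ * X](Mr1 r); apply: (cI_le M0).
 by apply: (@conD _ r _ (fun z=> - _)); [apply: conM|apply: conN; apply: conM => //; exact: con_psum].
move=> z hz; rewrite -mulrBr cmodM cmodX cmodJ cmodBC -[leRHS]mul1r; apply: ler_pM; nneg.
 by rewrite exprn_ile1 ?cge0 //; lra.
by apply: HN => //; rewrite leq_maxl.
Qed.

Lemma PS_uniq (a b : nat -> C) (f : C -> C) : PS a f -> PS b f -> a =1 b.
Proof.
move=> Ha Hb n; have h : 0 < (1 / 2 : R) < 1 by lra.
have := PS_coef n Ha h; rewrite (PS_coef n Hb h) => /mulfI E; apply/esym/E.
have p0 := pi_gt0 R.
by rewrite -cmod_gt0 cmodR gtr0_norm; npos; lra.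
Qed.

Lemma PS_scale b g (q : R) : 0 < q <= 1 -> PS b g -> PS (fun n=> b n * q%:C ^+ n) (fun z=> g (q%:C * z)).
Proof.
move=> /andP[q0 q1] [H1 H2]; have cq : cmod (q%:C : C) = q by rewrite cmodR gtr0_norm.
split=> [r hr|z hz e e0].
 have [K K0 HK] := H1 r hr; exists K => // n; apply: le_trans (HK n).
 have /andP[/ltW r0 _] := hr; rewrite cmodM cmodX cq -mulrA ler_wpM2l ?cge0 // ler_piMl ?exprn_ge0 //.
 by rewrite exprn_ile1 // ltW.
have hq : cmod (q%:C * z) < 1 by apply: le_lt_trans hz; rewrite cmodM cq ler_piMl ?cge0.
have [N HN] := H2 _ hq e e0; exists N => n /HN.
by rewrite /psum; under eq_bigr do rewrite exprMn mulrA.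
Qed.

(** A function holomorphic only in the open disc is treated through its dilates f(r z). The
    coefficients are normalised at radius 1/2, and uniqueness shows that they serve every r < 1. *)
Lemma holo_PS (f : C -> C) : holo f -> exists a, PS a f.
Proof.
move=> Hf.
have sc (r : R) : 0 < r < 1 -> exists a, PS a (fun z=> f (r%:C * z)).
 move=> /andP[r0 r1]; apply: (@holo_on_PS r^-1); first by rewrite invf_gt1.
 move=> z hz; have hr : cmod (r%:C * z) < 1.
  by rewrite cmodM cmodR gtr0_norm // mulrC -ltr_pdivlMr // mul1r.
 have [p Hp] := Hf _ hr; exists (p * r%:C).
 by apply: wd_eq (wd_comp (wdZ r%:C (wd_id z)) Hp); rewrite ?mulr1 ?mulr0 ?mul0r ?addr0 ?mulr0.
have [a0 Ha0] : exists a0, PS a0 (fun z=> f ((1 / 2 : R)%:C * z)) by apply: sc; lra.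
pose a n := a0 n * 2 ^+ n.
have key (t : R) : 0 <= t < 1 -> exists r : R, [/\ 0 < r < 1, t < r & PS (fun n=> a n * r%:C ^+ n) (fun z=> f (r%:C * z))].
 move=> ht; pose r := (1 + t) / 2; have hr : 0 < r < 1 by rewrite /r; lra.
 exists r; split=> //; first by rewrite /r; lra.
 have [b Hb] := sc r hr; have /andP[r0 r1] := hr.
 suff E n : b n = a n * r%:C ^+ n by rewrite (_ : (fun n=> a n * r%:C ^+ n) = b) //; apply/funext => n.
 have q01 : 0 < 1 / 2 / r <= 1 by rewrite divr_gt0 ?ler_pdivrMr //= /r; lra.
 have := PS_scale q01 Hb.
 have -> : (fun z=> f (r%:C * ((1 / 2 / r)%:C * z))) = (fun z=> f ((1 / 2)%:C * z)).
  by apply/funext => z; rewrite mulrA -realCM; congr (f (_%:C * _)); field; rewrite gt_eqF.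
 move=> H; rewrite /a -(PS_uniq H Ha0) -(mulrA (b n)) -(mulrA (b n)) -!exprMn -(mulrA _ 2).
 rewrite (_ : _ * (2 * r%:C) = 1) ?expr1n ?mulr1 //.
 by rewrite (_ : 2 = (2 : R)%:C) -?realCM ?rmorph_nat // (_ : _ * _ = 1) //; field; rewrite gt_eqF.
exists a; split=> [t /andP[t0 t1]|z hz].
 have [r [/andP[r0 _] tr [H _]]] := key t ltac:(by rewrite ltW).
 have [K K0 HK] := H (t / r) ltac:(by rewrite divr_gt0 //= ltr_pdivrMr // mul1r).
 exists K => // n; have := HK n; rewrite cmodM cmodX cmodR gtr0_norm // -mulrA -exprMn.
 by rewrite mulrCA divff ?mulr1 // gt_eqF.
have [r [/andP[r0 _] zr [_ H]]] := key (cmod z) ltac:(by rewrite cge0).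
have E : r%:C * (z / r%:C) = z by rewrite mulrCA divff ?mulr1 // -cmod_gt0 cmodR gtr0_norm.
have := H (z / r%:C); rewrite E cmodM cmodV cmodR gtr0_norm // ltr_pdivrMr // mul1r => {}H e e0.
have [N HN] := H zr e e0; exists N => n /HN.
by rewrite /psum; under eq_bigr do rewrite -mulrA -exprMn E.
Qed.

End Cauchy.

(** * Real functions with continuous Laplacian, and weighted Green formulas *)

Section C2.
Variable R : realType.
Local Notation C := R[i].
Implicit Types (v w s : C -> R).

Lemma wd_real_conj v (z p q : C) : wd (fun z=> (v z)%:C) z p q -> q = cj p.
Proof.
move=> Hv; have := wd_conj Hv; have -> : (fun z=> cj (v z)%:C) = (fun z=> (v z)%:C).
 by apply/funext => x; rewrite /= oppr0.
by move=> H'; have [E1 E2] := wd_uniq Hv H'.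
Qed.

Lemma wd_re_comp (H : R -> R) v (z p q : C) (dH : R) : wd (fun z=> (v z)%:C) z p q -> is_derive (v z) 1 H dH ->
 wd (fun z=> (H (v z))%:C) z (dH%:C * p) (dH%:C * q).
Proof.
move=> Hv HH.
have P : wd (fun z=> (H (Re z))%:C) (v z)%:C (dH / 2)%:C (dH / 2)%:C by exact: wd_real.
have := wd_comp Hv P.
have qE := wd_real_conj Hv; rewrite qE conjcK => W.
have h : (dH / 2)%:C + (dH / 2)%:C = dH%:C :> C by rewrite -realCD; congr (_%:C); field.
by apply: wd_eq W; rewrite -h ?qE; ring.
Qed.

Lemma rc_comp (r : R) (H : R -> R) v : rc r v -> (forall z : C, cmod z <= r -> {for v z, continuous H}) -> rc r (fun z=> H (v z)).
Proof.
move=> Hv HH z hz; have := @ccont_real R H (v z)%:C (HH z hz).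
by move=> K; exact: (ccont_comp (Hv z hz) K).
Qed.

Section Radius.
Variable rr : R.

(* [v] is real and C^2 on the closed disc of radius [rr], with [p] its z-derivative and [s] a quarter of its Laplacian. *)
Record C2 v (p : C -> C) s : Prop := {
 C2p : con rr p;
 C2s : rc rr s;
 C2wd : forall z, cmod z <= rr -> wd (fun z=> (v z)%:C) z (p z) (cj (p z));
 C2wd2 : exists2 a, con rr a & forall z, cmod z <= rr -> wd p z (a z) (s z)%:C }.

Lemma C2v v (p : C -> C) s : C2 v p s -> rc rr v.
Proof. by move=> H z hz; exact: ccont_wd (C2wd H hz). Qed.
Lemma C2_ext v w (p q : C -> C) s t : v =1 w -> p =1 q -> s =1 t -> C2 v p s -> C2 w q t.
Proof. by move=> /funext -> /funext -> /funext ->. Qed.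

Lemma C2_cst (c : R) : C2 (fun=> c) (fun=> 0) (fun=> 0).
Proof.
split; [exact: con_cst|exact: rc_cst|move=> z _|].
 by rewrite conjc0; exact: wd_cst.
by exists (fun=> 0); [exact: con_cst|move=> z _; exact: wd_cst].
Qed.

Lemma C2D v w p q s t : C2 v p s -> C2 w q t -> C2 (fun z=> v z + w z) (fun z=> p z + q z) (fun z=> s z + t z).
Proof.
move=> H K; have [a ca Ha] := C2wd2 H; have [b cb Hb] := C2wd2 K.
split; [by apply: conD; [exact: C2p H|exact: C2p K]|by apply: rcD; [exact: C2s H|exact: C2s K]|move=> z hz|].
 apply: (@wd_ext _ (fun z=> (v z)%:C + (w z)%:C)) => [x|]; first by rewrite realCD.
 by rewrite conjcD; apply: wdD; [exact: (C2wd H hz)|exact: (C2wd K hz)].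
exists (fun z=> a z + b z); first by conT.
by move=> z hz; rewrite realCD; apply: wdD; [exact: Ha|exact: Hb].
Qed.

Lemma C2M v w p q s t : C2 v p s -> C2 w q t ->
 C2 (fun z=> v z * w z) (fun z=> p z * (w z)%:C + (v z)%:C * q z)
  (fun z=> s z * w z + v z * t z + 2 * Re (p z * cj (q z))).
Proof.
move=> H K; have cp := C2p H; have cq := C2p K; have cs := C2s H; have ct := C2s K; have cv := C2v H; have cw := C2v K.
have [a ca Ha] := C2wd2 H; have [b cb Hb] := C2wd2 K.
split.
- by conT.
- by conT.
- move=> z hz; apply: (@wd_ext _ (fun z=> (v z)%:C * (w z)%:C)) => [x|]; first by rewrite realCM.
 apply: wd_eq (wdM (C2wd H hz) (C2wd K hz)) => //.
 by rewrite conjcD !conjcM /= !oppr0.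
- exists (fun z=> a z * (w z)%:C + p z * q z + (p z * q z + (v z)%:C * b z)); first by conT.
 move=> z hz; apply: wd_eq (wdD (wdM (Ha z hz) (C2wd K hz)) (wdM (C2wd H hz) (Hb z hz))) => //.
 by apply: cx_eq; rewrite !(cReD, cImD, cReM, cImM) /=; case: (p z) => x y; case: (q z) => x' y' /=; ring.
Qed.

Lemma C2Z c v p s : C2 v p s -> C2 (fun z=> c * v z) (fun z=> c%:C * p z) (fun z=> c * s z).
Proof.
move=> H; have := C2M (C2_cst c) H; apply: C2_ext => z //; first by rewrite mul0r add0r.
by rewrite !mul0r add0r /=; ring.
Qed.

Lemma C2N v p s : C2 v p s -> C2 (fun z=> - v z) (fun z=> - p z) (fun z=> - s z).
Proof.
by move=> H; have := C2Z (-1) H; apply: C2_ext => z; rewrite ?mulN1r // realCN mulN1r.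
Qed.
Lemma C2B v w p q s t : C2 v p s -> C2 w q t -> C2 (fun z=> v z - w z) (fun z=> p z - q z) (fun z=> s z - t z).
Proof. by move=> H K; exact: C2D H (C2N K). Qed.

Lemma C2_comp (H H1 H2 : R -> R) v p s : C2 v p s ->
 (forall z : C, cmod z <= rr -> [/\ is_derive (v z) 1 H (H1 (v z)), is_derive (v z) 1 H1 (H2 (v z)) & {for v z, continuous H2}]) ->
 C2 (fun z=> H (v z)) (fun z=> (H1 (v z))%:C * p z) (fun z=> H1 (v z) * s z + H2 (v z) * cmod (p z) ^+ 2).
Proof.
move=> K HH; have cv := C2v K; have cp := C2p K.
have c1 : rc rr (fun z=> H1 (v z)).
 by apply: rc_comp => // z hz; have [_ h _] := HH z hz; exact: derive_cont h.
have c2 : rc rr (fun z=> H2 (v z)) by apply: rc_comp => // z hz; have [_ _ h] := HH z hz.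
split.
- by conT.
- by have cs := C2s K; conT.
- move=> z hz; have [h _ _] := HH z hz; apply: wd_eq (wd_re_comp (C2wd K hz) h) => //.
 by rewrite conjcM /= oppr0.
- have [a ca Ha] := C2wd2 K; exists (fun z=> (H2 (v z))%:C * p z * p z + (H1 (v z))%:C * a z); first by conT.
 move=> z hz; have [_ h _] := HH z hz; apply: wd_eq (wdM (wd_re_comp (C2wd K hz) h) (Ha z hz)) => //.
 by rewrite -mulrA (mulrC (cj _)) mulcJ -!realCM -realCD; congr (_%:C); ring.
Qed.
Lemma cmod2_real (z : C) : (cmod z ^+ 2)%:C = z * cj z.
Proof. by rewrite mulcJ. Qed.

Definition hol2 (f f1 f2 : C -> C) := con rr f2 /\ forall z, cmod z <= rr -> wd f z (f1 z) 0 /\ wd f1 z (f2 z) 0.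

Lemma hol2_con f f1 f2 : hol2 f f1 f2 -> con rr f /\ con rr f1.
Proof. by move=> [_ H]; split=> z hz; have [h1 h2] := H z hz; [exact: ccont_wd h1|exact: ccont_wd h2]. Qed.

Lemma C2_cmod2 f f1 f2 : hol2 f f1 f2 -> C2 (fun z=> cmod (f z) ^+ 2) (fun z=> f1 z * cj (f z)) (fun z=> cmod (f1 z) ^+ 2).
Proof.
move=> K; have [c0 c1] := hol2_con K; have [c2 Hf] := K; split.
- by conT.
- by conT.
- move=> z hz; have [h1 h2] := Hf z hz; apply: (@wd_ext _ (fun z=> f z * cj (f z))) => [x|]; first by rewrite cmod2_real.
 by apply: wd_eq (wdM h1 (wd_conj h1)); rewrite ?conjc0 ?mulr0 ?addr0 ?mul0r ?add0r // conjcM conjcK mulrC.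
- exists (fun z=> f2 z * cj (f z) + f1 z * 0); first by conT.
 move=> z hz; have [h1 h2] := Hf z hz; apply: wd_eq (wdM h2 (wd_conj h1)); first by rewrite conjc0.
 by rewrite mul0r add0r cmod2_real.
Qed.

End Radius.

Definition rho (z : C) : R := 1 - cmod z ^+ 2.

Lemma rho_ge0 z : cmod z <= 1 -> 0 <= rho z.
Proof. by move=> h; rewrite subr_ge0 exprn_ile1 ?cge0. Qed.
Lemma rho_le1 z : rho z <= 1.
Proof. by rewrite /rho; have := sqr_ge0 (cmod z); lra. Qed.

Lemma rhoE z : (rho z)%:C = 1 - z * cj z.
Proof. by rewrite /rho realCD realCN cmod2_real. Qed.

Lemma wd_rho z : wd (fun z=> (rho z)%:C) z (- cj z) (- z).
Proof.
apply: (@wd_ext _ (fun z=> 1 - z * cj z)) => [x|]; first by rewrite rhoE.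
by apply: wd_eq (wdB (wd_cst 1 z) (wdM (wd_id z) (wd_conj (wd_id z)))); rewrite ?conjc0 ?conjc1; ring.
Qed.
Lemma rc_rho r : rc r rho.
Proof. by move=> z _; exact: ccont_wd (wd_rho z). Qed.

Lemma rho_circ z : cmod z = 1 -> rho z = 0.
Proof. by rewrite /rho => ->; rewrite expr1n subrr. Qed.
Lemma Ac_real v : Ac 1 (fun z=> (v z)%:C) = (Ar 1 v)%:C.
Proof. by apply: cI_real; rewrite (posf_cst _ (posf_Ar ltr01)) mul0r. Qed.

Lemma Mc_real v : Mc 1 (fun z=> (v z)%:C) = (Mr 1 v)%:C.
Proof. by apply: cI_real; rewrite (posf_cst _ (posf_Mr ltr01)) mul0r. Qed.

(** The function rho z X vanishes on the circle, so its z-derivative has integral 0; with |z|^2 = 1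
    - rho this is the formula. It brings in the weight rho, without which the gradient estimates
    fail to apply. *)
Lemma int_rho (X dX bX : C -> C) : con 1 dX -> con 1 bX -> (onD z, wd X z (dX z) (bX z)) ->
 Ac 1 X = Ac 1 (fun z=> 2 * (rho z)%:C * X z + (rho z)%:C * z * dX z).
Proof.
move=> cd cb H; have A1 := posf_Ar (@ltr01 R).
have cX : con 1 X by move=> z hz; exact: ccont_wd (H z hz).
have cr : con (R:=R) 1 (fun z=> (rho z)%:C) by exact: rc_rho.
have cN (u : C -> C) : con 1 u -> con 1 (fun z=> - u z) by exact: conN.
have c0 : con 1 (fun z=> - cj z * (z * X z) + (rho z)%:C * (1 * X z + z * dX z)).
 by conT.
have := @Ac_d R 1 ltr01 (fun z=> (rho z)%:C * (z * X z)) _ (fun z=> - z * (z * X z) + (rho z)%:C * (0 * X z + z * bX z)) c0.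
have -> : Mc 1 (fun z=> cj z * ((rho z)%:C * (z * X z))) = 0.
 rewrite -[RHS](mulr0 ((2 * pi)%:C : C)) -(Mc_cst 0 ltr01); apply: Mc_ext => // z hz.
 by rewrite rho_circ // mul0r mulr0.
have c1 : con 1 (fun z=> - z * (z * X z) + (rho z)%:C * (0 * X z + z * bX z)).
 by conT.
move=> /(_ c1) E; have {E} : 0 = 2 * Ac 1 (fun z=> - cj z * (z * X z) + (rho z)%:C * (1 * X z + z * dX z)).
 by apply: E => z hz; apply: wdM; [exact: wd_rho|apply: wdM; [exact: wd_id|exact: H]].
move=> /esym/eqP; rewrite mulf_eq0 pnatr_eq0 /= => /eqP E.
have c2 : con 1 (fun z=> 2 * (rho z)%:C * X z + (rho z)%:C * z * dX z).
 by conT.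
apply/eqP; rewrite eq_sym -subr_eq0; apply/eqP; rewrite -[RHS]E /Ac -(cIB A1) //.
apply: (cI_ext A1) => //; first by apply: (@conD _ 1 _ (fun z=> - X z)) => //; exact: cN.
by move=> z hz; rewrite rhoE; ring.
Qed.

(** Two applications of Green's formula, to z v and to rho p. The identity is of Littlewood-Paley
    type with the weight 1 - |z|^2 in place of the logarithm. *)
Lemma green_C2 v p s : C2 1 v p s -> Mr 1 v = 2 * Ar 1 v + 2 * Ar 1 (fun z=> rho z * s z).
Proof.
move=> H; have A1 := posf_Ar (@ltr01 R).
have cp := C2p H; have cs := C2s H; have cv := C2v H.
have cr : rc (R:=R) 1 rho by exact: rc_rho.
have E1 : Ac 1 (fun z=> z * p z) = Ac 1 (fun z=> (rho z)%:C * (s z)%:C).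
 have [a ca Ha] := C2wd2 H.
 have := @green R 1 ltr01 (fun z=> (rho z)%:C * p z) (fun z=> - cj z * p z + (rho z)%:C * a z) (fun z=> - z * p z + (rho z)%:C * (s z)%:C).
 have -> : Mc 1 (fun z=> z * ((rho z)%:C * p z)) = 0.
  rewrite -[RHS](mulr0 ((2 * pi)%:C : C)) -(Mc_cst 0 ltr01); apply: Mc_ext => // z hz.
  by rewrite rho_circ // mul0r mulr0.
 move=> /(_ ltac:(by conT) ltac:(by conT)) E; have {E} : 0 = 2 * Ac 1 (fun z=> - z * p z + (rho z)%:C * (s z)%:C).
  by apply: E => z hz; apply: wdM; [exact: wd_rho|exact: Ha].
 move=> /esym/eqP; rewrite mulf_eq0 pnatr_eq0 /= => /eqP E.
 apply/eqP; rewrite eq_sym -subr_eq0; apply/eqP; rewrite -[RHS]E /Ac -(cIB A1) //; [|by conT|by conT].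
 by apply: (cI_ext A1); [conT|conT|move=> z _; ring].
have E2 : Mc 1 (fun z=> (v z)%:C) = 2 * Ac 1 (fun z=> 1 * (v z)%:C + z * p z).
 rewrite -(@Ac_d R 1 ltr01 (fun z=> z * (v z)%:C) (fun z=> 1 * (v z)%:C + z * p z) (fun z=> 0 * (v z)%:C + z * cj (p z))); [|by conT|by conT|].
  by apply: Mc_ext => // z hz; rewrite mulrA (mulrC (cj _)) mulcJ hz expr1n mul1r.
 by move=> z hz; apply: wdM; [exact: wd_id|exact: C2wd H _ hz].
have c2 : con 1 (fun z=> z * p z) by conT.
suff : (Mr 1 v)%:C = (2 * Ar 1 v + 2 * Ar 1 (fun z=> rho z * s z))%:C by case.
rewrite -Mc_real E2 realCD !realCM -!Ac_real -mulrDr; congr (_ * _).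
 by apply: cx_eq => /=; rewrite ?addr0.
under [X in _ + Ac 1 X]eq_fun do rewrite realCM.
by rewrite -E1 /Ac -(cID A1) //; congr cI; apply/funext => z; rewrite mul1r.
Qed.

End C2.

(** * Maximum principle and the equation s - q V = r0 with zero boundary values *)

Section PDE.
Variable R : realType.
Local Notation C := R[i].

Lemma cReE (z : C) : (Re z)%:C = 2^-1 * (z + cj z).
Proof. by rewrite addcJ mulrA mulVf ?mul1r // pnatr_eq0. Qed.

(* Second derivative test: in the second order expansion of [v] at [z0], the sum over the
 increments [t], [-t], [i t], [-i t] leaves only the mixed derivative [s z0]. *)
Lemma max_test (v : C -> R) p s z0 : C2 1 v p s -> cmod z0 < 1 ->
 (onD z, v z <= v z0) -> s z0 <= 0.
Proof.
move=> K hz0 Hm; rewrite leNgt; apply/negP => s0.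
have [a _ Ha] := C2wd2 K; have s4 : 0 < s z0 / 4 by lra.
have [d d0 D] := Ha z0 (ltW hz0) _ s4.
pose t := Num.min (d / 2) (1 - cmod z0).
have [t0 td tz] : [/\ 0 < t, t < d & t <= 1 - cmod z0].
 by rewrite lt_min gt_min ge_min lexx orbT; split=> //; [apply/andP; split|apply/orP; left]; lra.
clearbody t; have [A A2] : exists A, a z0 = 2 * A by exists (a z0 / 2); rewrite mulrC divfK // pnatr_eq0.
(* The quadratic Taylor polynomial of v - v(z0) at z0; with a z0 = 2 A its mixed coefficient is s
   z0. The mean value inequality shows that v differs from it by at most (s z0 / 2) t^2 at distance
   t. *)
pose T w := p z0 * (w - z0) + cj (p z0) * cj (w - z0) + (A * (w - z0) ^+ 2 + cj A * cj (w - z0) ^+ 2 + (s z0)%:C * ((w - z0) * cj (w - z0))).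
have wT w : wd T w (p z0 + (a z0 * (w - z0) + (s z0)%:C * cj (w - z0))) (cj (p z0 + (a z0 * (w - z0) + (s z0)%:C * cj (w - z0)))).
 have Q := wdB (wd_id w) (wd_cst z0 w); have Q' := wd_conj Q.
 apply: wd_eq (wdD (wdD (wdZ (p z0) Q) (wdZ (cj (p z0)) Q')) (wdD (wdD (wdZ A (wdX 2 Q)) (wdZ (cj A) (wdX 2 Q'))) (wdZ (s z0)%:C (wdM Q Q')))).
  by rewrite !subr0 conjc0 A2 /=; ring.
 by move: (w - z0) => k; rewrite !subr0 conjc1 !conjcD A2 !conjcM conjcK conj_real conjc_nat /=; ring.
have Tz h : cmod h = t -> Re (T (z0 + h)) = 2 * Re (p z0 * h) + 2 * Re (A * h ^+ 2) + s z0 * t ^+ 2.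
 move=> ht; rewrite /T (addrC z0) addrK mulcJ ht -conjX -!conjcM; case: (p z0 * h) (A * h ^+ 2) => x y [x' y'] /=; ring.
have Hv h : cmod h = t -> 2 * Re (p z0 * h) + 2 * Re (A * h ^+ 2) + s z0 / 2 * t ^+ 2 <= 0.
 move=> ht; suff : Re (T (z0 + h)) <= s z0 / 2 * t ^+ 2 by rewrite Tz //; lra.
 have zh : cmod (z0 + h) <= 1 by have := cmodD z0 h; lra.
 have := @mvt_seg R (fun w=> (v w)%:C - T w) z0 h (s z0 / 2 * t).
 have T0 : T z0 = 0 by rewrite /T subrr conjc0 expr0n /= !mulr0 !addr0.
 rewrite T0 subr0 ht => M; rewrite (_ : s z0 / 2 * t ^+ 2 = s z0 / 2 * t * t); last by ring.
 have : cmod ((v (z0 + h))%:C - T (z0 + h) - (v z0)%:C) <= s z0 / 2 * t * t; last first.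
  have := Hm _ zh; have := cmod_Re ((v (z0 + h))%:C - T (z0 + h) - (v z0)%:C).
  by rewrite ler_norml !(cReD, cReN) /= => /andP[h1 _]; lra.
 apply: M => x /andP[x0 x1].
 have xh : cmod (x%:C * h) <= t by rewrite cmodM cmodR ger0_norm // ht ler_piMl // ltW.
 have zx : cmod (z0 + x%:C * h) <= 1 by have := cmodD z0 (x%:C * h); lra.
 do 2 eexists; split; first exact: wdB (C2wd K zx) (wT _).
 rewrite -rmorphB cmodJ (addrC z0) addrK opprD addrA; have := D _ (le_lt_trans xh td); rewrite (addrC z0).
 by have := ler_wpM2l (ltW s4) xh; lra.
have tt : cmod (t%:C : C) = t by rewrite cmodR gtr0_norm.
have := Hv t%:C tt; have := Hv (- t%:C) ltac:(by rewrite cmodN).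
have := Hv ('i%C * t%:C) ltac:(by rewrite cmodM cmod_i mul1r); have := Hv (- ('i%C * t%:C)) ltac:(by rewrite cmodN cmodM cmod_i mul1r).
rewrite !mulrN !sqrrN !exprMn sqr_i mulN1r mulrN !cReN; have := mulr_gt0 s0 (exprn_gt0 2 t0).
by move: (t ^+ 2) (Re _) (Re _) (Re _) => S x y w; lra.
Qed.
Lemma max_principle (v : C -> R) p s : C2 1 v p s -> (forall z, cmod z = 1 -> v z <= 0) ->
 (inD z, 0 < v z -> 0 < s z) -> onD z, v z <= 0.
Proof.
move=> K Hb Hs z hz.
have [z0 h0 Hm] := con_max ler01 (C2v K).
apply: le_trans (Hm z hz) _; rewrite /= leNgt; apply/negP => v0.
have h1 : cmod z0 < 1.
 rewrite lt_neqAle h0 andbT; apply/eqP => /Hb; lra.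
by have := max_test K h1 Hm; have := Hs _ h1 v0; lra.
Qed.

Lemma bip_sumform (u : C -> C) : bip u -> exists s : seq (C * nat * nat),
 u =1 fun z=> \sum_(t <- s) t.1.1 * z ^+ t.1.2 * cj z ^+ t.2.
Proof.
elim=> {u} [c|||u v _ [s Hs] _ [s' Hs']|u v _ [s Hs] _ [s' Hs']].
- by exists [:: (c, 0%N, 0%N)] => z; rewrite big_seq1 /= !expr0 !mulr1.
- by exists [:: (1, 1%N, 0%N)] => z; rewrite big_seq1 /= expr0 expr1 mul1r mulr1.
- by exists [:: (1, 0%N, 1%N)] => z; rewrite big_seq1 /= expr0 expr1 !mul1r.
- by exists (s ++ s') => z; rewrite big_cat /= -Hs -Hs'.
exists [seq (t.1.1 * t'.1.1, (t.1.2 + t'.1.2)%N, (t.2 + t'.2)%N) | t <- s, t' <- s'] => z.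
rewrite big_allpairs_dep Hs Hs' mulr_suml; apply: eq_bigr => t _; rewrite mulr_sumr; apply: eq_bigr => t' _ /=.
by rewrite !exprD; ring.
Qed.

Lemma C2_Re r (u p q a s b : C -> C) : con r p -> con r q -> con r a -> con r s -> con r b ->
 (forall z, [/\ wd u z (p z) (q z), wd p z (a z) (s z) & wd q z (s z) (b z)]) ->
 C2 r (fun z=> Re (u z)) (fun z=> 2^-1 * (p z + cj (q z))) (fun z=> Re (s z)).
Proof.
move=> cp cq ca cs cb H; split; [by conT|by conT|move=> z hz|].
 apply: (@wd_ext _ (fun z=> 2^-1 * (u z + cj (u z)))); first by move=> w; rewrite cReE.
 have [h1 _ _] := H z; apply: wd_eq (wdZ 2^-1 (wdD h1 (wd_conj h1))) => //.
 by rewrite conjcM conjcD conjcK conjc_inv conjc_nat addrC.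
exists (fun z=> 2^-1 * (a z + cj (b z))); first by conT.
by move=> z hz; have [_ h2 h3] := H z; apply: wd_eq (wdZ 2^-1 (wdD h2 (wd_conj h3))); rewrite // -cReE.
Qed.

(** The monomial z^(m+1) conj(z)^(n+1), divided by (m+1)(n+1), has the right mixed derivative. On
    the circle it equals a multiple of z^(m-n), whose real part is harmonic and can be
    subtracted. *)
Lemma poisson_mon (c : C) m n : (n <= m)%N -> exists V p, (forall r, C2 r V p (fun z=> Re (c * z ^+ m * cj z ^+ n))) /\ forall z, cmod z = 1 -> V z = 0.
Proof.
move=> nm; pose k : C := c / (m.+1 * n.+1)%:R.
have wX (z : C) j : wd (fun z=> z ^+ j) z (j%:R * z ^+ j.-1) 0 by apply: wd_eq (wdX j (wd_id z)); rewrite ?mulr1 ?mulr0.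
have wC (z : C) j : wd (fun z=> cj z ^+ j) z 0 (j%:R * cj z ^+ j.-1).
 by apply: wd_eq (wdX j (wd_conj (wd_id z))); rewrite ?conjc0 ?conjc1 ?mulr1 ?mulr0.
have wXC (d : C) (z : C) i j : wd (fun z=> d * (z ^+ i * cj z ^+ j)) z (d * (i%:R * (z ^+ i.-1 * cj z ^+ j))) (d * (j%:R * (z ^+ i * cj z ^+ j.-1))).
 by apply: wd_eq (wdZ d (wdM (wX z i) (wC z j))); ring.
pose l := (m - n)%N.
exists (fun z=> Re (k * (z ^+ m.+1 * cj z ^+ n.+1) - k * z ^+ l)); eexists; split=> [r|z hz].
 apply: C2_ext (@C2_Re r (fun z=> k * (z ^+ m.+1 * cj z ^+ n.+1) - k * z ^+ l)
  (fun z=> k * m.+1%:R * (z ^+ m * cj z ^+ n.+1) - k * (l%:R * z ^+ l.-1)) (fun z=> k * n.+1%:R * (z ^+ m.+1 * cj z ^+ n))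
  (fun z=> k * m.+1%:R * (m%:R * (z ^+ m.-1 * cj z ^+ n.+1)) - k * (l%:R * (l.-1%:R * z ^+ l.-1.-1)))
  (fun z=> c * z ^+ m * cj z ^+ n) (fun z=> k * n.+1%:R * (n%:R * (z ^+ m.+1 * cj z ^+ n.-1))) _ _ _ _ _ _) => //; try by conT.
 have kc : k * m.+1%:R * n.+1%:R = c by rewrite -mulrA -natrM divfK // pnatr_eq0.
 move=> z; split.
 - by apply: wd_eq (wdB (wXC k z m.+1 n.+1) (wdZ k (wX z l))) => /=; ring.
 - by apply: wd_eq (wdB (wXC _ z m n.+1) (wdZ k (wdZ l%:R (wX z l.-1)))) => //=; rewrite -kc; ring.
 - by apply: wd_eq (wXC _ z m.+1 n) => //=; rewrite -kc; ring.
by rewrite (_ : m.+1 = (l + n.+1)%N) ?exprD -?mulrA -?exprMn ?mulcJ ?hz ?expr1n ?mulr1 ?subrr //; rewrite /l; lia.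
Qed.

Lemma poisson_bip (u : C -> C) : bip u -> exists V p, (forall r, C2 r V p (fun z=> Re (u z))) /\ forall z, cmod z = 1 -> V z = 0.
Proof.
move=> /bip_sumform[s /funext ->]; elim: s => [|[[c m] n] s [V [p [K HV]]]].
 by exists (fun=> 0), (fun=> 0); split=> // r; apply: C2_ext (C2_cst r 0) => // z; rewrite big_nil.
have [V1 [p1 [K1 HV1]]] : exists V p, (forall r, C2 r V p (fun z=> Re (c * z ^+ m * cj z ^+ n))) /\ forall z, cmod z = 1 -> V z = 0.
 have [nm|/ltnW mn] := leqP n m; first exact: poisson_mon.
 have [V1 [p1 [K1 HV1]]] := poisson_mon (cj c) mn; exists V1, p1; split=> // r.
 apply: C2_ext (K1 r) => // z; rewrite -!conjX -[z ^+ n in LHS]conjcK -!conjcM; case: (z ^+ m) (cj (z ^+ n)) c {K1} => x y [x' y'] [x'' y''] /=; ring.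
exists (fun z=> V1 z + V z), (fun z=> p1 z + p z); split=> [r|z hz]; last by rewrite HV // HV1 // addr0.
by apply: C2_ext (C2D (K1 r) (K r)) => // z; rewrite big_cons cReD.
Qed.
Lemma C2_rho r : C2 r (@rho R) (fun z=> - cj z) (fun=> -1).
Proof.
have h : hol2 (R:=R) r id (fun=> 1) (fun=> 0).
 by split; [exact: con_cst|move=> z _; split; [exact: wd_id|exact: wd_cst]].
apply: C2_ext (C2B (C2_cst r 1) (C2_cmod2 h)) => z //=; first by rewrite sub0r mul1r.
by rewrite cmod1 expr1n sub0r.
Qed.

Section Solve.
Variable q : C -> R.
Hypotheses (cq : rc 1 q) (q0 : onD z, 0 <= q z).

(** Comparison of V with (m + e) rho, whose mixed derivative is -(m + e); the extra e makes the
    inequality at a positive maximum strict. *)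
Lemma apriori_half (t m : R) V p s : 0 <= t -> 0 <= m -> C2 1 V p s -> (forall z, cmod z = 1 -> V z = 0) ->
 (onD z, - m <= s z - t * q z * V z) -> onD z, V z <= m.
Proof.
move=> t0 m0 K HV Hs z hz; apply/ler_addgt0Pr => e e0.
have me : 0 <= m + e by lra.
have KV := C2B K (C2Z (m + e) (C2_rho 1)).
have : V z - (m + e) * rho z <= 0.
 apply: (max_principle KV) => // w hw; first by rewrite HV // rho_circ // mulr0 subrr.
 have hw' := ltW hw; have r0 := rho_ge0 hw'; have := Hs w hw'; have := q0 hw' => qw h1 h2.
 have V0 : 0 < V w by have := mulr_ge0 me r0; lra.
 have : 0 <= t * q w * V w by rewrite !mulr_ge0 // ltW.
 by lra.
have := ler_wpM2l me (rho_le1 z); lra.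
Qed.

Lemma apriori (t m : R) V p s : 0 <= t -> 0 <= m -> C2 1 V p s -> (forall z, cmod z = 1 -> V z = 0) ->
 (onD z, `|s z - t * q z * V z| <= m) -> onD z, `|V z| <= m.
Proof.
move=> t0 m0 K HV Hs z hz; rewrite ler_norml lerNl; apply/andP; split.
 apply: (apriori_half t0 m0 (C2N K)) => // [w hw|w hw]; first by rewrite HV // oppr0.
 by have := Hs w hw; rewrite ler_norml mulrN => /andP[h1 h2]; lra.
apply: (apriori_half t0 m0 K) => // w hw.
by have := Hs w hw; rewrite ler_norml => /andP[h1 h2]; lra.
Qed.

(** Solutions are approximate, which avoids any regularity theory. They are C^2 on every disc, being
    built from polynomials, and so leave room around the unit disc for [potential]. *)
Definition solvable (t : R) := forall r0 : C -> R, rc 1 r0 -> forall e, 0 < e -> exists V p s, [/\ (forall r, C2 r V p s),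
 forall z, cmod z = 1 -> V z = 0 & onD z, `|s z - t * q z * V z - r0 z| <= e].

Lemma solvable0 : solvable 0.
Proof.
move=> r0 cr e e0; have [P bP HP] := weierstrass ltr01 cr e0.
have [V [p [K HV]]] := poisson_bip bP; exists V, p, (fun z=> Re (P z)); split=> // z hz.
rewrite !mul0r subr0; have := le_trans (cmod_Re _) (HP z hz).
by rewrite cReD cReN /= distrC.
Qed.

(** The residual for t + tau is corrected by repeated solution for t; the a priori bound controls
    the new term tau q U, which is at most half of U. *)
Lemma solvable_step (t tau : R) : 0 <= t -> 0 <= tau -> (onD z, tau * q z <= 1 / 2) ->
 solvable t -> solvable (t + tau).
Proof.
move=> t0 tau0 Hq S r0 cr e e0.
have [M M0 HM] := con_bdd cr.
have main n : exists V p s, [/\ (forall r, C2 r V p s),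
 forall z, cmod z = 1 -> V z = 0 & onD z, `|s z - (t + tau) * q z * V z - r0 z| <= (3 / 4) ^+ n * M].
 elim: n => [|n [V [p [s [K HV Hs]]]]].
  exists (fun=> 0), (fun=> 0), (fun=> 0); split => //; first by move=> r; exact: C2_cst.
  by move=> z /HM; rewrite cmodR mulr0 !sub0r oppr0 add0r normrN expr0 mul1r.
 pose m := (3 / 4) ^+ n * M.
 have m0 : 0 < m by rewrite mulr_gt0 // exprn_gt0 //; lra.
 have cs := C2s (K 1); have cV := C2v (K 1).
 have cR : rc 1 (fun z=> r0 z - (s z - (t + tau) * q z * V z)) by conT.
 (* The next residual is at most m/6 from the approximate solution plus (m + m/6)/2 from tau q U,
    which is 3/4 of m. *)
 have m6 : 0 < m / 6 by lra.
 have [U [p' [s' [K' HU Hs']]]] := S _ cR _ m6.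
 have m76 : 0 <= m + m / 6 by lra.
 have HUb : onD z, `|U z| <= m + m / 6.
  apply: (apriori t0 m76 (K' 1)) => // z hz; have := Hs z hz; have := Hs' z hz.
  by rewrite -/m !ler_norml => /andP[h1 h2] /andP[h3 h4]; apply/andP; split; lra.
 exists (fun z=> V z + U z), (fun z=> p z + p' z), (fun z=> s z + s' z); split.
 - by move=> r; exact: C2D.
 - by move=> z hz; rewrite HV // HU // addr0.
 move=> z hz; have := Hs' z hz; have := HUb z hz; have := Hq z hz; have := q0 hz.
 have -> : (3 / 4) ^+ n.+1 * M = 3 / 4 * m by rewrite /m exprS mulrA.
 move=> qz qz2 Uz; have tq : 0 <= tau * q z by exact: mulr_ge0.
 have : `|tau * q z * U z| <= (m + m / 6) / 2.
  by rewrite normrM ger0_norm //; have := ler_pM tq (normr_ge0 _) qz2 Uz; lra.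
 by rewrite !ler_norml => /andP[h1 h2] /andP[h3 h4]; apply/andP; split; lra.
have [n Hn] := @pow_small R (3 / 4) (e / M) ltac:(lra) (divr_gt0 e0 M0).
have [V [p [s [K HV Hs]]]] := main n; exists V, p, s; split=> // z hz.
apply: le_trans (Hs z hz) _; rewrite -ler_pdivlMr //; exact: Hn.
Qed.

(** The continuity method: [N] steps of length 1/N lead from 0 to 1, and N > 2 M makes each step
    admissible. *)
Lemma pde_solvable : solvable 1.
Proof.
have [M M0 HM] := con_bdd cq.
pose N := (Num.truncn (2 * M)).+1.
have NM : 2 * M < N%:R by exact: Num.Theory.truncnS_gt.
have main n : solvable (n%:R / N%:R).
 elim: n => [|n IH]; first by rewrite mul0r; exact: solvable0.
 rewrite -natr1 mulrDl; apply: solvable_step => //.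
 move=> z hz; have := HM z hz; rewrite cmodR ger0_norm; last exact: q0.
  by rewrite div1r mulrC => h; rewrite ler_pdivrMr //; lra.
by have := main N; rewrite divff // gt_eqF.
Qed.

End Solve.
End PDE.

(** * The Poincare lemma for forms that are nearly closed *)

Section SegFTC.
Variable R : realType.
Local Notation C := R[i].

Lemma seg_FTC_re (r : R) (B p q : C -> C) (z k : C) : 0 < r -> con r p -> con r q ->
 (forall z, cmod z <= r -> wd B z (p z) (q z)) -> cmod z <= r -> cmod (z + k) <= r ->
 Re (B (z + k) - B z) = Iseg z (z + k) (fun w=> Re (p w * k + q w * cj k)).
Proof.
move=> r0 cp cq HB hz hzk.
pose v w := Re (p w * k + q w * cj k).
have cv : rc r v by rewrite /v; conT.
have zk : z + k - z = k by ring.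
have hs (x : R) : 0 <= x <= 1 -> cmod (z + x%:C * (z + k - z)) <= r by move=> hx; exact: seg_norm.
transitivity (RI 0 1 (fun s=> v (clip r (z + s%:C * (z + k - z))))); last first.
 by apply: RI_eq => x hx; rewrite clip_id //; exact: hs.
have E (x : R) : z + x%:C * (z + k - z) = (Re z + Re k * x) +i* (Im z + Im k * x).
 by apply: cx_eq; rewrite zk !(cReD, cImD, cReM, cImM) /=; ring.
symmetry.
have -> : Re (B (z + k) - B z) = Re (B (z + (1 : R)%:C * (z + k - z))) - Re (B (z + (0 : R)%:C * (z + k - z))).
 by rewrite cReD cReN zk mul0r addr0 mul1r.
apply: (@RI_FTC R _ (fun s=> Re (B (z + s%:C * (z + k - z))))) => //.
 exact: (@Iseg_cont R _ z (z + k) (clip_rc r0 cv)).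
move=> x hx; have hx' := hs x hx; rewrite clip_id //.
have W := HB _ hx'; rewrite E in W.
have := wd_curve (is_derive_aff (Re z) (Re k) x) (is_derive_aff (Im z) (Im k) x) W.
have -> : (fun t : R => Re (B ((Re z + Re k * t) +i* (Im z + Im k * t)))) =
 (fun t=> Re (B (z + t%:C * (z + k - z)))) by apply/funext => t; rewrite E.
by rewrite /v E; case: (k).
Qed.

Lemma seg_FTC (r : R) (B p q : C -> C) (z k : C) : 0 < r -> con r p -> con r q ->
 (forall z, cmod z <= r -> wd B z (p z) (q z)) -> cmod z <= r -> cmod (z + k) <= r ->
 B (z + k) - B z = cI (Iseg z (z + k)) (fun w=> p w * k + q w * cj k).
Proof.
move=> r0 cp cq HB hz hzk; apply: cx_eq; first exact: (seg_FTC_re r0 cp cq HB).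
have H2 w : cmod w <= r -> wd (fun z=> - 'i%C * B z) w (- 'i%C * p w) (- 'i%C * q w).
 by move=> hw; apply: wdZ; exact: HB.
have := @seg_FTC_re r (fun z=> - 'i%C * B z) (fun z=> - 'i%C * p z) (fun z=> - 'i%C * q z) z k r0 ltac:(conT) ltac:(conT) H2 hz hzk.
have Ei (x : C) : Re (- 'i%C * x) = Im x by rewrite cReM /=; ring.
rewrite -mulrBr Ei => -> /=; congr Iseg; apply/funext => w.
by rewrite -[RHS]Ei; congr Re; ring.
Qed.

Lemma unif_wd (B p q : C -> C) : con 2 p -> con 2 q -> (forall z, cmod z <= 2 -> wd B z (p z) (q z)) ->
 forall e : R, 0 < e -> exists2 d : R, 0 < d & forall w k, cmod w <= 1 -> cmod k < d ->
  cmod (B (w + k) - B w - (p w * k + q w * cj k)) <= e * cmod k.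
Proof.
move=> cp cq HB e e0; have e2 : 0 < e / 2 by lra.
have [d1 d10 D1] := con_unif cp e2; have [d2 d20 D2] := con_unif cq e2.
exists (Num.min 1 (Num.min d1 d2)); first by rewrite !lt_min ltr01 d10.
move=> w k hw; rewrite !lt_min => /andP[k1 /andP[kd1 kd2]].
have := @mvt_seg R (fun z=> B z - (p w * z + q w * cj z)) w k e.
rewrite conjcD (_ : _ - _ - _ = B (w + k) - B w - (p w * k + q w * cj k)); last by ring.
apply=> t /andP[t0 t1].
have th : cmod (t%:C * k) <= cmod k by rewrite cmodM cmodR ger0_norm // ler_piMl ?cge0.
have hy : cmod (w + t%:C * k) <= 2 by tri; lra.
exists (p (w + t%:C * k) - p w), (q (w + t%:C * k) - q w); split.
 apply: wd_eq (wdB (HB _ hy) (wdD (wdZ (p w) (wd_id _)) (wdZ (q w) (wd_conj (wd_id _))))); rewrite ?conjc0 ?conjc1; ring.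
have hw2 : cmod w <= 2 by lra.
have ty : w + t%:C * k - w = t%:C * k by rewrite addrC addKr.
have := D1 _ _ hy hw2; have := D2 _ _ hy hw2; rewrite ty => /(_ (le_lt_trans th kd2)) + /(_ (le_lt_trans th kd1)); lra.
Qed.
Section Potential.
Variables (B Bz Bb : C -> C).
Hypotheses (cz : con 2 Bz) (cb : con 2 Bb) (HB : forall z, cmod z <= 2 -> wd B z (Bz z) (Bb z)).

Let I0 := @Iseg R 0 1.
Let P0 : posf 1 I0.
Proof. by apply: posf_seg; rewrite ?cmod0 ?cmod1. Qed.

Let I01 : I0 (fun=> 1) = 1. Proof. exact: Iseg1. Qed.

Let rez (w z : C) : cmod w <= 1 -> cmod ((Re w)%:C * z) <= cmod z.
Proof.
move=> hw; rewrite cmodM cmodR ler_piMl ?cge0 //.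
exact: le_trans (cmod_Re w) hw.
Qed.

Let cu (u : C -> C) z : con 2 u -> cmod z <= 2 -> con 1 (fun w=> u ((Re w)%:C * z)).
Proof.
move=> Hu hz w hw; apply: (@ccont_comp R (fun w=> (Re w)%:C * z)).
 have : con 1 (fun w : C => (Re w)%:C * z) by conT.
 exact.
by apply: Hu; apply: le_trans (rez _ hw) hz.
Qed.

Let cRe : con 1 (fun w : C => (Re w)%:C).
Proof. by conT. Qed.

(** The functional [I0] lives on the segment from 0 to 1 in the complex plane, and Re w reads off
    the parameter. So J(z) is the mean of B(t z), and [K u] is that of t u(t z), which arises when
    B(t z) is differentiated in z. *)
Let J z := cI I0 (fun w=> B ((Re w)%:C * z)).
Let K (u : C -> C) z := cI I0 (fun w=> (Re w)%:C * u ((Re w)%:C * z)).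

Let cB : con 2 B. Proof. by move=> z hz; exact: ccont_wd (HB hz). Qed.

Let avg_con (W : C -> C) (u : C -> C) : con 1 W -> (onD w, cmod (W w) <= 1) -> con 2 u ->
 con 1 (fun z=> cI I0 (fun w=> W w * u ((Re w)%:C * z))).
Proof.
move=> cW HW Hu z hz e e0; have [d d0 D] := con_unif Hu e0.
exists (Num.min 1 d); first by rewrite lt_min ltr01.
move=> h; rewrite lt_min => /andP[h1 hd].
have hz2 : cmod z <= 2 by lra.
have hzh : cmod (z + h) <= 2 by have := cmodD z h; lra.
have c1 := cu Hu hz2; have c2 := cu Hu hzh.
rewrite -(cIB P0); [|by conT|by conT].
rewrite -[e]mulr1 -I01; apply: (cI_le P0); first by conT.
move=> w hw; rewrite -mulrBr cmodM -[leRHS]mul1r; apply: ler_pM; rewrite ?cge0 ?HW //.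
apply: D; [exact: le_trans (rez _ hw) hzh|exact: le_trans (rez _ hw) hz2|].
rewrite -mulrBr addrC addKr; exact: le_lt_trans (rez _ hw) hd.
Qed.

Let K_con u : con 2 u -> con 1 (K u).
Proof. by apply: avg_con => // w hw; rewrite cmodR; exact: le_trans (cmod_Re w) hw. Qed.

Let wdJ z : cmod z <= 1 -> wd J z (K Bz z) (K Bb z).
Proof.
move=> hz e e0; have [d d0 D] := unif_wd cz cb HB e0.
exists (Num.min 1 d); first by rewrite lt_min ltr01.
move=> h; rewrite lt_min => /andP[h1 hd].
have hz2 : cmod z <= 2 by lra.
have hzh : cmod (z + h) <= 2 by have := cmodD z h; lra.
have c1 := cu cB hz2; have c2 := cu cB hzh; have c3 := cu cz hz2; have c4 := cu cb hz2.
have -> : J (z + h) - J z - (K Bz z * h + K Bb z * cj h) =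
 cI I0 (fun w=> B ((Re w)%:C * (z + h)) - B ((Re w)%:C * z) -
 (h * ((Re w)%:C * Bz ((Re w)%:C * z)) + cj h * ((Re w)%:C * Bb ((Re w)%:C * z)))).
 rewrite (cIB P0); [|by conT|by conT].
 rewrite (cIB P0) // (cID P0); [|by conT|by conT].
 rewrite !(cIZ _ P0); [|by conT|by conT].
 by rewrite /J /K; ring.
rewrite -[e * _]mulr1 -I01; apply: (cI_le P0); first by conT.
move=> w hw; set x := (Re w)%:C.
have hx : cmod (x * z) <= 1 by exact: le_trans (rez _ hw) hz.
have hxh : cmod (x * h) <= cmod h by exact: rez.
have := D (x * z) (x * h) hx (le_lt_trans hxh hd).
rewrite -mulrDr.
have -> : cj (x * h) = x * cj h by rewrite conjcM /x /= oppr0.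
have -> : Bz (x * z) * (x * h) + Bb (x * z) * (x * cj h) = h * (x * Bz (x * z)) + cj h * (x * Bb (x * z)) by ring.
by move/le_trans; apply; rewrite ler_wpM2l // ltW.
Qed.

(** The derivative of t B(t z) with respect to t, integrated from 0 to 1. *)
Let FTC z : cmod z <= 1 -> B z = J z + z * K Bz z + cj z * K Bb z.
Proof.
move=> hz; have hz2 : cmod z <= 2 by lra.
have c1 := cu cB hz2; have c3 := cu cz hz2; have c4 := cu cb hz2.
have wdRe (w : C) : wd (fun w=> (Re w)%:C) w 2^-1 2^-1.
 apply: (@wd_ext _ (fun w=> 2^-1 * (w + cj w))); first by move=> x; rewrite cReE.
 by apply: wd_eq (wdZ 2^-1 (wdD (wd_id w) (wd_conj (wd_id w)))); rewrite ?conjc0 ?conjc1 ?addr0 ?add0r ?mulr1.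
pose D w := 2^-1 * B ((Re w)%:C * z) + (Re w)%:C * (2^-1 * (Bz ((Re w)%:C * z) * z + Bb ((Re w)%:C * z) * cj z)).
have cD : con 1 D by rewrite /D; conT.
have W w : cmod w <= 1 -> wd (fun w=> (Re w)%:C * B ((Re w)%:C * z)) w (D w) (D w).
 move=> hw; have hx : cmod ((Re w)%:C * z) <= 2 by exact: le_trans (rez _ hw) hz2.
 have i2 : cj 2^-1 = 2^-1 :> C by rewrite conjc_inv conjc_nat.
 by apply: wd_eq (wdM (wdRe w) (wd_comp (wdM (wdRe w) (wd_cst z w)) (HB hx))); rewrite /D !mulr0 !addr0 ?conjcM ?i2; ring.
have := @seg_FTC 1 _ D D 0 1 ltr01 cD cD W ltac:(by rewrite cmod0) ltac:(by rewrite add0r cmod1).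
rewrite !add0r /= mul0r subr0 !mul1r => ->; rewrite -/I0.
rewrite (_ : 1 -i* 0 = 1 :> C) ?oppr0 //; under [X in cI _ X]eq_fun do rewrite !mulr1.
have -> : J z + z * K Bz z + cj z * K Bb z = cI I0 (fun w=> B ((Re w)%:C * z) +
 z * ((Re w)%:C * Bz ((Re w)%:C * z)) + cj z * ((Re w)%:C * Bb ((Re w)%:C * z))).
 rewrite (cID P0); [|by conT|by conT].
 rewrite (cID P0); [|by conT|by conT].
 by rewrite !(cIZ _ P0) //; conT.
by congr cI; apply/funext => w; rewrite /D; field.
Qed.

(** The potential is 2 Re (z J(z)). Its z-derivative differs from B by conj(z) (conj(K Bb) - K Bb),
    so that the error is governed by Im Bb, the defect of closedness of the form Re (B dz). *)
Lemma potential : exists (phi : C -> R) p, [/\ con 1 p, onD z, wd (fun z=> (phi z)%:C) z (p z) (cj (p z)) &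
 forall m : R, (onD w, `|Im (Bb w)| <= m) -> onD z, cmod (p z - B z) <= 2 * m].
Proof.
have cJ : con 1 J.
 have := @avg_con (fun=> 1) B (@con_cst _ 1 1) (fun w _ => ltac:(by rewrite cmod1)) cB.
 by apply: con_ext => z; congr cI; apply/funext => w; rewrite mul1r.
have cKz := K_con cz; have cKb := K_con cb.
exists (fun z=> 2 * Re (z * J z)), (fun z=> J z + z * K Bz z + cj (z * K Bb z)); split.
- by conT.
- move=> z hz; apply: (@wd_ext _ (fun z=> z * J z + cj (z * J z))).
  by move=> w; rewrite realCM cReE mulrA (_ : (2 : R)%:C * 2^-1 = 1) ?mul1r //; apply: cx_eq; rewrite ?cReM ?cImM /=; field.
 have W := wdM (wd_id z) (wdJ hz).
 apply: wd_eq (wdD W (wd_conj W)); first by rewrite mul1r mul0r add0r.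
 by rewrite mul1r mul0r add0r !conjcD conjcK addrC -conjcD.
move=> m Hm z hz; have hz2 : cmod z <= 2 by lra.
have c4 := cu cb hz2.
rewrite [B z]FTC // conjcM.
have -> : J z + z * K Bz z + cj z * cj (K Bb z) - (J z + z * K Bz z + cj z * K Bb z) = cj z * (cj (K Bb z) - K Bb z) by ring.
rewrite cmodM cmodJ -[leRHS]mul1r; apply: ler_pM; rewrite ?cge0 //.
have -> : cj (K Bb z) - K Bb z = cI I0 (fun w=> (Re w)%:C * (- 2%:C * 'i%C * (Im (Bb ((Re w)%:C * z)))%:C)).
 apply: cx_eq; rewrite !(cReD, cImD, cReN, cImN) /=; last first.
  rewrite -opprD -(posfD P0); [|by conT|by conT].
  rewrite -(posfN P0); last by conT.
  by congr I0; apply/funext => w; rewrite !(cReM, cImM, cReN, cImN) /=; ring.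
 rewrite subrr -[LHS](mul0r (I0 (fun=> 1))) -(posf_cst _ P0); congr I0; apply/funext => w.
 by ring.
rewrite -[leRHS]mulr1 -[X in _ <= _ * X]I01; apply: (cI_le P0); first by conT.
move=> w hw; rewrite !cmodM cmodN !cmodR cmod_i mulr1 normr_nat -[leRHS]mul1r.
apply: ler_pM; rewrite ?mulr_ge0 //; first exact: le_trans (cmod_Re w) hw.
by rewrite ler_wpM2l // Hm //; exact: le_trans (rez _ hw) hz.
Qed.

End Potential.
End SegFTC.

(** * The Carleson estimate against H^1 *)

Section Carleson.
Variable R : realType.
Local Notation C := R[i].

Lemma rcV (r : R) (v : C -> R) : rc r v -> (forall z, cmod z <= r -> v z != 0) -> rc r (fun z=> (v z)^-1).
Proof.
move=> Hv H z hz; apply: (@ccont_ext R (fun z=> ((v z)%:C)^-1)); first by move=> w; rewrite realCV.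
by apply: ccontV; [exact: Hv|rewrite -cmod_eq0 cmodR normr_eq0; exact: H].
Qed.
Lemma is_derive_sqrt (x : R) : 0 < x -> is_derive x 1 (@Num.sqrt R) (2 * Num.sqrt x)^-1.
Proof. exact: is_derive1_sqrt. Qed.

Lemma sqrt_C2 (t : C -> R) p s : (onD z, 0 < t z) -> C2 1 t p s ->
 C2 1 (fun z=> Num.sqrt (t z)) (fun z=> ((2 * Num.sqrt (t z))^-1)%:C * p z)
  (fun z=> (2 * Num.sqrt (t z))^-1 * s z - (4 * Num.sqrt (t z) ^+ 3)^-1 * cmod (p z) ^+ 2).
Proof.
move=> t0 K; have := @C2_comp R 1 (@Num.sqrt R) (fun x=> (2 * Num.sqrt x)^-1) (fun x=> - (4 * Num.sqrt x ^+ 3)^-1) t p s K.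
have E : (fun z=> (2 * Num.sqrt (t z))^-1 * s z - (4 * Num.sqrt (t z) ^+ 3)^-1 * cmod (p z) ^+ 2) =
 (fun z=> (2 * Num.sqrt (t z))^-1 * s z + - (4 * Num.sqrt (t z) ^+ 3)^-1 * cmod (p z) ^+ 2).
 by apply/funext => z; rewrite mulNr.
rewrite E; apply => z hz; have tz := t0 z hz.
have sz : 0 < Num.sqrt (t z) by rewrite sqrtr_gt0.
have D1 := is_derive_sqrt tz; split => //.
- have D2 : is_derive (t z) 1 (fun x : R => 2 * Num.sqrt x) (2 * (2 * Num.sqrt (t z))^-1).
  by apply: is_derive_eq; rewrite /GRing.scale /= ?mulr0 ?addr0 // mulrC.
 have n0 : 2 * Num.sqrt (t z) != 0 by rewrite gt_eqF //; npos.
 have := @is_deriveV R (fun x=> 2 * Num.sqrt x) (t z) _ 1 n0 D2.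
 move=> D3; apply: (is_derive_eq D3); rewrite /GRing.scale /=.
 by field; rewrite gt_eqF.
- apply: cvgN; apply: cvgV; first by rewrite gt_eqF //; npos.
 apply: cvgM; first exact: cvg_cst.
 have cs : Num.sqrt x @[x --> t z] --> Num.sqrt (t z) by exact: sqrt_continuous.
 have -> : (fun x : R => Num.sqrt x ^+ 3) = (fun x : R => Num.sqrt x * (Num.sqrt x * Num.sqrt x)) by apply/funext => x; rewrite !exprS expr0 mulr1.
 have -> : Num.sqrt (t z) ^+ 3 = Num.sqrt (t z) * (Num.sqrt (t z) * Num.sqrt (t z)) by rewrite !exprS expr0 mulr1.
 by apply: cvgM => //; apply: cvgM.
Qed.

Section Fixed.
Variables (f f1 f2 g g1 g2 k k1 k2 G dG bG p : C -> C) (V s : C -> R) (B b c : R).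
Hypotheses (Hf : hol2 1 f f1 f2) (Hg : hol2 1 g g1 g2) (Hk : hol2 1 k k1 k2).
Hypotheses (f_le : onD z, cmod (f z) <= 1) (g_le : onD z, cmod (g z) <= 1).
Hypotheses (B0 : 0 <= B) (b0 : 0 <= b) (c0 : 0 <= c).
Hypotheses (HV : C2 1 V p s) (VB : onD z, `|V z| <= B).
Hypothesis Vs : onD z, - (b * (cmod (f1 z) ^+ 2 + 1)) <= V z * s z.
(** The density that, with the weight rho, is a Carleson measure: this is [AQ]. G^2 and the
    z-derivative of G are to be dominated by it. *)
Definition Qmaj z := cmod (p z) ^+ 2 + cmod (f1 z) ^+ 2 + cmod (g1 z) ^+ 2 + 1.
Hypotheses (cdG : con 1 dG) (cbG : con 1 bG) (wG : onD z, wd G z (dG z) (bG z)).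
Hypotheses (GQ : onD z, cmod (G z) ^+ 2 <= c * Qmaj z) (dGQ : onD z, cmod (dG z) <= c * Qmaj z).

(** The sum of the constants in [AQ]: 5/2 B^2 + 7 b from V, 3 each from f and g, and 1/2 from the
    constant term of [Qmaj]. *)
Definition Kc : R := (5 / 2 * B ^+ 2 + 7 * b + 13 / 2).

Let cf1 : con 1 f1. Proof. by have [] := hol2_con Hf. Qed.
Let cg1 : con 1 g1. Proof. by have [] := hol2_con Hg. Qed.
Let ck1 : con 1 k1. Proof. by have [] := hol2_con Hk. Qed.
Let ck0 : con 1 k. Proof. by have [] := hol2_con Hk. Qed.
Let cp : con 1 p. Proof. exact: C2p HV. Qed.
Let cs : rc 1 s. Proof. exact: C2s HV. Qed.
Let cV : rc 1 V. Proof. exact: C2v HV. Qed.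
Let cG : con 1 G. Proof. by move=> z hz; exact: ccont_wd (wG hz). Qed.
Let cr : rc 1 (@rho R). Proof. exact: rc_rho. Qed.
Let PA : posf 1 (@Ar R 1). Proof. exact: posf_Ar. Qed.
Let PM : posf 1 (@Mr R 1). Proof. exact: posf_Mr. Qed.

Section Eta.
Variables (eta : R) (eta0 : 0 < eta).
(** Here eta > 0 makes the modulus of k smooth at its zeros; it is sent to 0 in [eta_lim]. *)
Definition eT z := cmod (k z) ^+ 2 + eta.
Definition eN z := Num.sqrt (eT z).
Let T0 z : 0 < eT z. Proof. by rewrite /eT ltr_wpDl // sqr_ge0. Qed.
Let N0 z : 0 < eN z. Proof. by rewrite /eN sqrtr_gt0. Qed.
Let N2 z : eN z ^+ 2 = eT z. Proof. by rewrite /eN sqr_sqrtr // ltW. Qed.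
Let kN z : cmod (k z) <= eN z.
Proof. by rewrite -(@ler_pXn2r _ 2) ?nnegrE ?cge0 ?(ltW (N0 z)) // N2 /eT lerDl ltW. Qed.

Definition epN z : C := ((2 * eN z)^-1)%:C * (k1 z * cj (k z)).
Definition esN z := (2 * eN z)^-1 * cmod (k1 z) ^+ 2 - (4 * eN z ^+ 3)^-1 * cmod (k1 z * cj (k z)) ^+ 2.

Let C2eN : C2 1 eN epN esN.
Proof.
have := C2D (C2_cmod2 Hk) (C2_cst 1 eta) => H.
have := sqrt_C2 (fun z _ => T0 z) H; apply: C2_ext => z //=; by rewrite /epN /esN /eN !addr0.
Qed.

Let cN : rc 1 eN. Proof. exact: C2v C2eN. Qed.
Let csN : rc 1 esN. Proof. exact: C2s C2eN. Qed.
Let cpN : con 1 epN. Proof. exact: C2p C2eN. Qed.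
Let cNV : rc 1 (fun z=> (eN z)^-1). Proof. by apply: rcV => // z _; rewrite gt_eqF. Qed.

(** A quantitative form of subharmonicity: the negative term of [esN] takes away at most half of the
    positive one, as |k| <= eN. *)
Let sN_ge z : cmod (k1 z) ^+ 2 * (eN z)^-1 <= 4 * esN z.
Proof.
rewrite /esN cmodM cmodJ; have n0 := N0 z; have h := kN z.
have : cmod (k z) ^+ 2 <= eN z ^+ 2 by rewrite lerXn2r ?nnegrE ?cge0 // ltW.
move: h; move: (eN z) n0 (cmod (k z)) (cmod (k1 z)) => n n0 x y _ xn.
have -> : 4 * ((2 * n)^-1 * y ^+ 2 - (4 * n ^+ 3)^-1 * (y * x) ^+ 2) = y ^+ 2 * n^-1 + y ^+ 2 / n ^+ 3 * (n ^+ 2 - x ^+ 2).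
 by field; rewrite gt_eqF.
rewrite lerDl mulr_ge0 ?subr_ge0 // divr_ge0 ?sqr_ge0 //.
by apply: exprn_ge0; exact: ltW.
Qed.

Let sN_ge0 z : 0 <= esN z.
Proof.
have := sN_ge z; have : 0 <= cmod (k1 z) ^+ 2 * (eN z)^-1 by have n0 := N0 z; nneg.
lra.
Qed.

Let pN_le z : cmod (epN z) <= cmod (k1 z) / 2.
Proof.
rewrite /epN !cmodM cmodJ cmodR.
rewrite ger0_norm; last by nneg.
rewrite mulrCA ler_wpM2l ?cge0 // invfM -mulrA ler_piMr //.
by rewrite mulrC ler_pdivrMr // mul1r.
Qed.

Let AM : 2 * Ar 1 (fun z=> rho z * esN z) + 2 * Ar 1 eN = Mr 1 eN.
Proof. by rewrite (green_C2 C2eN) addrC. Qed.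

Let Ars0 : 0 <= Ar 1 (fun z=> rho z * esN z).
Proof. by apply: (posf_ge0 PA); [conT|move=> z hz; rewrite mulr_ge0 ?rho_ge0 ?sN_ge0]. Qed.

Let AN0 : 0 <= Ar 1 eN.
Proof. by apply: (posf_ge0 PA) => // z _; exact: ltW. Qed.

Let MN0 : 0 <= Mr 1 eN.
Proof. by have := AM; have := Ars0; have := AN0; lra. Qed.

Let Ak : Ar 1 (fun z=> rho z * (cmod (k1 z) ^+ 2 * (eN z)^-1)) <= 2 * Mr 1 eN.
Proof.
have : Ar 1 (fun z=> rho z * (cmod (k1 z) ^+ 2 * (eN z)^-1)) <= Ar 1 (fun z=> 4 * (rho z * esN z)).
 apply: (posf_le PA); [by conT|by conT|move=> z hz].
 by rewrite [leRHS]mulrCA ler_wpM2l ?rho_ge0.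
by rewrite (posfZ PA); [have := AM; have := Ars0; have := AN0; lra|conT].
Qed.

Let ArN : Ar 1 (fun z=> rho z * eN z) <= Mr 1 eN / 2.
Proof.
have : Ar 1 (fun z=> rho z * eN z) <= Ar 1 eN.
 apply: (posf_le PA) => //; first by conT.
 by move=> z hz; rewrite ler_piMl ?(ltW (N0 z)) ?rho_le1.
by have := AM; have := Ars0; have := AN0; lra.
Qed.

(** Green's formula [green_C2] for U eN. The term U esN is nonnegative and dropped, and the cross
    term costs at most |pU| |k'| because |epN| <= |k'| / 2. *)
Let key U pU sU (beta : R) : C2 1 U pU sU -> 0 <= beta -> (onD z, 0 <= U z <= beta) ->
 2 * Ar 1 (fun z=> rho z * (eN z * sU z)) <= beta * Mr 1 eN + 2 * Ar 1 (fun z=> rho z * (cmod (pU z) * cmod (k1 z))).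
Proof.
move=> KU be0 HU; have cU := C2v KU; have cpU := C2p KU; have csU := C2s KU.
have K := C2M KU C2eN; have E := green_C2 K.
have h1 : Mr 1 (fun z=> U z * eN z) <= beta * Mr 1 eN.
 rewrite -(posfZ PM) //; apply: (posf_le PM); [by conT|by conT|move=> z hz].
 by rewrite ler_wpM2r ?(ltW (N0 z)) //; case/andP: (HU z hz).
have h2 : 0 <= Ar 1 (fun z=> U z * eN z).
 apply: (posf_ge0 PA); first by conT.
 by move=> z hz; rewrite mulr_ge0 ?(ltW (N0 z)) //; case/andP: (HU z hz).
have h3 : Ar 1 (fun z=> rho z * (eN z * sU z)) <= Ar 1 (fun z=> rho z * (sU z * eN z + U z * esN z + 2 * Re (pU z * cj (epN z)))) + Ar 1 (fun z=> rho z * (cmod (pU z) * cmod (k1 z))).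
 rewrite -(posfD PA); [|by conT|by conT].
 apply: (posf_le PA); [by conT|by conT|move=> z hz].
 rewrite -mulrDr ler_wpM2l ?rho_ge0 //.
 have u0 : 0 <= U z * esN z by rewrite mulr_ge0 ?sN_ge0 //; case/andP: (HU z hz).
 have : - (cmod (pU z) * cmod (epN z)) <= Re (pU z * cj (epN z)).
  by have := cmod_Re (pU z * cj (epN z)); rewrite cmodM cmodJ ler_norml => /andP[].
 have := ler_wpM2l (cge0 (pU z)) (pN_le z).
 by rewrite (mulrC (eN z)); lra.
by move: E h1 h2 h3; set x1 := Mr _ _; set x2 := Ar _ _; set x3 := Ar _ _; set x4 := Ar _ _; set x5 := Ar _ _; lra.
Qed.

Let amgm (x y n : R) : 0 < n -> x * y <= (x ^+ 2 * n + y ^+ 2 * n^-1) / 2.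
Proof.
move=> n0; have : 0 <= (x * n - y) ^+ 2 / n by rewrite divr_ge0 ?sqr_ge0 // ltW.
have -> : (x * n - y) ^+ 2 / n = x ^+ 2 * n + y ^+ 2 * n^-1 - 2 * (x * y) by field; rewrite gt_eqF.
lra.
Qed.

(** [key] with U = |F|^2, whose mixed derivative is |F'|^2; the cross term is split so that one part
    is absorbed and the other is bounded by [Ak]. *)
Let Ahol F F1 F2 : hol2 1 F F1 F2 -> (onD z, cmod (F z) <= 1) ->
 Ar 1 (fun z=> rho z * (eN z * cmod (F1 z) ^+ 2)) <= 3 * Mr 1 eN.
Proof.
move=> HF HF1; have [cF cF1] := hol2_con HF.
have U1 z : cmod z <= 1 -> 0 <= cmod (F z) ^+ 2 <= 1.
 by move=> hz; rewrite sqr_ge0 exprn_ile1 ?cge0 ?HF1.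
have := key (C2_cmod2 HF) ler01 U1.
have : Ar 1 (fun z=> rho z * (cmod (F1 z * cj (F z)) * cmod (k1 z))) <=
 Ar 1 (fun z=> 1 / 2 * (rho z * (eN z * cmod (F1 z) ^+ 2)) + 1 / 2 * (rho z * (cmod (k1 z) ^+ 2 * (eN z)^-1))).
 apply: (posf_le PA); [by conT|by conT|move=> z hz].
 rewrite cmodM cmodJ -!(mulrCA (rho z)) -mulrDr ler_wpM2l ?rho_ge0 //.
 have := amgm (cmod (F1 z)) (cmod (k1 z)) (N0 z); rewrite (mulrC (eN z)).
 have : cmod (F1 z) * cmod (F z) * cmod (k1 z) <= cmod (F1 z) * cmod (k1 z).
  by rewrite ler_wpM2r ?cge0 // ler_piMr ?cge0 ?HF1.
 lra.
rewrite (posfD PA); [|by conT|by conT].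
rewrite !(posfZ PA); [|by conT|by conT].
by have := Ak; lra.
Qed.

(** [key] with U = V^2, whose mixed derivative is 2 |p|^2 + 2 V s. The lower bound [Vs] turns the
    second term into an error in |f'|^2 + 1, to which [Ahol] applies. *)
Let AV : Ar 1 (fun z=> rho z * (eN z * cmod (p z) ^+ 2)) <= (5 / 2 * B ^+ 2 + 7 * b) * Mr 1 eN.
Proof.
have K := C2M HV HV.
have U1 z : cmod z <= 1 -> 0 <= V z * V z <= B ^+ 2.
 move=> hz; rewrite -expr2 sqr_ge0 -real_normK ?num_real // lerXn2r ?nnegrE ?VB //.
have := key K (sqr_ge0 B) U1.
have h1 : Ar 1 (fun z=> rho z * (cmod (p z * (V z)%:C + (V z)%:C * p z) * cmod (k1 z))) <=
 Ar 1 (fun z=> (rho z * (eN z * cmod (p z) ^+ 2)) + B ^+ 2 * (rho z * (cmod (k1 z) ^+ 2 * (eN z)^-1))).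
 apply: (posf_le PA); [by conT|by conT|move=> z hz].
 rewrite (mulrCA (B ^+ 2)) -mulrDr ler_wpM2l ?rho_ge0 //.
 have -> : p z * (V z)%:C + (V z)%:C * p z = (2 * V z)%:C * p z by rewrite realCM (_ : 2%:C = 2); [ring|apply: cx_eq => /=; rewrite ?addr0].
 rewrite cmodM cmodR normrM normr_nat.
 have := amgm (cmod (p z)) (`|V z| * cmod (k1 z)) (N0 z); rewrite (mulrC (eN z)).
 have : (`|V z| * cmod (k1 z)) ^+ 2 * (eN z)^-1 <= B ^+ 2 * (cmod (k1 z) ^+ 2 * (eN z)^-1).
  rewrite exprMn -mulrA ler_wpM2r //; first by have n0 := N0 z; nneg.
  by rewrite lerXn2r ?nnegrE ?VB.
 lra.
have h2 : Ar 1 (fun z=> 2 * (rho z * (eN z * cmod (p z) ^+ 2)) - 2 * b * (rho z * (eN z * cmod (f1 z) ^+ 2)) - 2 * b * (rho z * eN z)) <=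
 Ar 1 (fun z=> rho z * (eN z * (s z * V z + V z * s z + 2 * Re (p z * cj (p z))))).
 apply: (posf_le PA); [by conT|by conT|move=> z hz].
 rewrite mulcJ /=.
 have := Vs hz; have r0 := rho_ge0 hz; have n0 := ltW (N0 z); have rn := mulr_ge0 r0 n0 => h.
 have := ler_wpM2l rn h; move: (rho z) (eN z) (V z * s z) (s z * V z) (mulrC (V z) (s z)) => x n y y' E; rewrite -E.
 lra.
move: h1 h2; rewrite (posfD PA); [|by conT|by conT].
rewrite !(posfZ PA); [|by conT].
rewrite !(posfB PA); [|by conT..].
rewrite !(posfZ PA); [|by conT..].
have h3 := Ahol Hf f_le; have h4 := Ak; have h5 := ArN.
have h6 := ler_wpM2l b0 h3; have h7 := ler_wpM2l b0 h5; have h8 := ler_wpM2l (sqr_ge0 B) h4.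
by lra.
Qed.

Lemma AQ : Ar 1 (fun z=> rho z * (eN z * Qmaj z)) <= Kc * Mr 1 eN.
Proof.
have -> : (fun z=> rho z * (eN z * Qmaj z)) = (fun z=> rho z * (eN z * cmod (p z) ^+ 2) + rho z * (eN z * cmod (f1 z) ^+ 2) + rho z * (eN z * cmod (g1 z) ^+ 2) + rho z * eN z).
 by apply/funext => z; rewrite /Qmaj; ring.
do 3 (rewrite (posfD PA); [|by conT|by conT]).
by have := AV; have := Ahol Hf f_le; have := Ahol Hg g_le; have := ArN; rewrite /Kc; lra.
Qed.

Let cQ : rc 1 Qmaj. Proof. by rewrite /Qmaj; conT. Qed.

(** [int_rho] supplies the weight rho. Of the terms so produced, those with k are bounded by Qmaj
    eN, and the term G k' is split into |G|^2 eN and |k'|^2 / eN, which are covered by [AQ] and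
    [Ak]. *)
Lemma carleson_eta : cmod (Ac 1 (fun z=> G z * k z)) <= ((1 + 5 / 2 * c) * Kc + 1) * Mr 1 eN.
Proof.
have W z : cmod z <= 1 -> wd (fun z=> G z * k z) z (dG z * k z + G z * k1 z) (bG z * k z).
 by move=> hz; have [h _] := Hk.2 z hz; apply: wd_eq (wdM (wG hz) h); rewrite ?mulr0 ?addr0.
rewrite (int_rho _ _ W); [|by conT|by conT].
have c1 : con 1 (fun z=> 2 * (rho z)%:C * (G z * k z) + (rho z)%:C * z * (dG z * k z + G z * k1 z)) by conT.
apply: le_trans (cI_norm PA c1) _.
apply: (@le_trans _ _ (Ar 1 (fun z=> (1 + 5 / 2 * c) * (rho z * (eN z * Qmaj z)) + 1 / 2 * (rho z * (cmod (k1 z) ^+ 2 * (eN z)^-1))))).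
 apply: (posf_le PA); [by conT|by conT|move=> z hz].
 have r0 := rho_ge0 hz.
 have -> : 2 * (rho z)%:C * (G z * k z) + (rho z)%:C * z * (dG z * k z + G z * k1 z) = (rho z)%:C * (2 * (G z * k z) + z * (dG z * k z + G z * k1 z)) by ring.
 rewrite cmodM cmodR ger0_norm // -!(mulrCA (rho z)) -mulrDr ler_wpM2l //.
 tri; rewrite !cmodM (cmod_nat R 2).
 have n0 := N0 z; have gq := GQ hz; have dgq := dGQ hz.
 have Q1 : 1 <= Qmaj z by rewrite /Qmaj lerDr; nneg.
 have h1 : cmod z * cmod (dG z * k z + G z * k1 z) <= cmod (dG z) * cmod (k z) + cmod (G z) * cmod (k1 z).
  apply: (@le_trans _ _ (1 * cmod (dG z * k z + G z * k1 z))); first by rewrite ler_wpM2r ?cge0.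
  by rewrite mul1r; tri; rewrite !cmodM.
 have h2 := amgm (cmod (G z)) (cmod (k1 z)) n0.
 have h3 : cmod (dG z) * cmod (k z) <= c * Qmaj z * eN z by apply: ler_pM; rewrite ?cge0.
 have h4 : 2 * (cmod (G z) * cmod (k z)) <= (1 + cmod (G z) ^+ 2) * eN z.
  have h5 : cmod (G z) * cmod (k z) <= cmod (G z) * eN z by rewrite ler_wpM2l ?cge0.
  have : 2 * cmod (G z) <= 1 + cmod (G z) ^+ 2 by have := sqr_ge0 (cmod (G z) - 1); lra.
  by move=> /(ler_wpM2r (ltW n0)); lra.
 have h5 : cmod (G z) ^+ 2 * eN z <= c * Qmaj z * eN z by rewrite ler_wpM2r // ltW.
 have h6 : eN z <= Qmaj z * eN z by rewrite -[leLHS]mul1r ler_wpM2r // ltW.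
 by lra.
rewrite (posfD PA); [|by conT|by conT].
rewrite !(posfZ PA); [|by conT|by conT].
have h : 0 <= 1 + 5 / 2 * c by move: c0; lra.
have := ler_wpM2l h AQ; have := Ak; lra.
Qed.
Lemma AM_eta : 2 * Ar 1 eN <= Mr 1 eN /\ 0 <= Ar 1 eN.
Proof. by have := AM; have := Ars0; have := AN0; split; lra. Qed.

Lemma eN_con : rc 1 eN. Proof. exact: cN. Qed.

Lemma k_eN z : cmod (k z) <= eN z. Proof. exact: kN. Qed.

End Eta.

Lemma eta_lim (X CC : R) : 0 <= CC -> (forall eta, 0 < eta -> X <= CC * Mr 1 (eN eta)) -> X <= CC * Mr 1 (fun z=> cmod (k z)).
Proof.
move=> CC0 H.
apply/ler_addgt0Pr => e e0.
have p0 := pi_gt0 R.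
(* The choice eta = x^2 allows the bound of the regularised modulus by |k| + x; the excess CC 2 pi x
   is then at most e. *)
pose x := e / (CC * (2 * pi) + 1).
have d0 : 0 < CC * (2 * pi) + 1 by apply: ltr_wpDl => //; apply: mulr_ge0 => //; lra.
have x0 : 0 < x by rewrite divr_gt0.
apply: le_trans (H _ (exprn_gt0 2 x0)) _.
have : Mr 1 (fun z=> Num.sqrt (cmod (k z) ^+ 2 + x ^+ 2)) <= Mr 1 (fun z=> cmod (k z) + x).
 apply: (posf_le PM); last 1 first.
 - move=> z _; rewrite -[leRHS]ger0_norm ?addr_ge0 ?cge0 ?(ltW x0) // -sqrtr_sqr ler_wsqrtr //.
  have := mulr_ge0 (cge0 (k z)) (ltW x0); lra.
 - have := C2v (sqrt_C2 (t := fun z=> cmod (k z) ^+ 2 + x ^+ 2) (fun z _ => _) (C2D (C2_cmod2 Hk) (C2_cst 1 (x ^+ 2)))); apply.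
  by move=> z; have := exprn_gt0 2 x0; have := sqr_ge0 (cmod (k z)); lra.
 - by conT.
rewrite (posfD PM); [|by conT|by conT].
rewrite (posf_cst _ PM) Mr1 => /(ler_wpM2l CC0) h; apply: le_trans h _.
have : CC * (2 * pi) * x <= e.
 have -> : CC * (2 * pi) * x = CC * (2 * pi) * e / (CC * (2 * pi) + 1) by rewrite /x !mulrA.
 by rewrite ler_pdivrMr //; move: e0; lra.
by rewrite mulrDr; lra.
Qed.

Lemma carleson : cmod (Ac 1 (fun z=> G z * k z)) <= ((1 + 5 / 2 * c) * Kc + 1) * Mr 1 (fun z=> cmod (k z)).
Proof.
apply: eta_lim; last by move=> eta e0; exact: carleson_eta.
by rewrite /Kc; have := sqr_ge0 B; have := mulr_ge0 c0 b0; have := mulr_ge0 c0 (sqr_ge0 B); move: c0 b0; lra.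
Qed.

Lemma Ar_cmod_le : Ar 1 (fun z=> cmod (k z)) <= 1 * Mr 1 (fun z=> cmod (k z)).
Proof.
apply: eta_lim => // eta e0.
have [h1 h2] := AM_eta e0; have : Ar 1 (fun z=> cmod (k z)) <= Ar 1 (eN eta).
 apply: (posf_le PA); [by conT|exact: eN_con|].
 by move=> z _; exact: k_eN.
lra.
Qed.

End Fixed.
End Carleson.

(** * The positive part, whose cube is of class C^2 *)

Section Pos.
Variable R : realType.
Local Notation C := R[i].

Definition pos (x : R) := Num.max 0 x.

Lemma pos_ge0 x : 0 <= pos x. Proof. by rewrite le_max lexx. Qed.
Lemma pos_id x : 0 <= x -> pos x = x. Proof. by move=> h; rewrite /pos; apply/max_idPr. Qed.
Lemma pos_0 x : x <= 0 -> pos x = 0. Proof. by move=> h; rewrite /pos; apply/max_idPl. Qed.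
Lemma pos_le x y : 0 <= y -> x <= y -> pos x <= y. Proof. by move=> h1 h2; rewrite ge_max h1 h2. Qed.

Lemma pos_lip x y : `|pos x - pos y| <= `|x - y|.
Proof.
rewrite /pos; case: (ltP 0 x) => hx; case: (ltP 0 y) => hy; rewrite ?subr0 ?sub0r ?normrN ?subrr ?normr0 //.
- by rewrite gtr0_norm // gtr0_norm; lra.
- by rewrite gtr0_norm // ltr0_norm; lra.
Qed.

Lemma pos_cont (x : R) : {for x, continuous pos}.
Proof.
apply/contP => e e0; exists e => // h hh; apply: le_trans (pos_lip _ _) _.
by rewrite addrC addKr ltW.
Qed.

Lemma is_derive_posX n (x : R) : is_derive x 1 (fun x=> pos x ^+ n.+2) (n.+2%:R * pos x ^+ n.+1).
Proof.
apply/is_deriveP => e e0; have [x0|x0|->] := ltrgtP x 0.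
- exists (- x); rewrite ?oppr_gt0 // => h /ltr_normlP[_ h1].
 have xh : x + h <= 0 by lra.
 by rewrite !pos_0 ?(ltW x0) // !expr0n /= !mulr0 mul0r !subr0 normr0 mulr_ge0 // ltW.
- have /is_deriveP/(_ e e0)[d d0 H] : is_derive x 1 (fun x : R => x ^+ n.+2) (n.+2%:R * x ^+ n.+1).
  by have := @is_deriveX R R^o id n.+2 x 1 1 (is_derive_id _ _); rewrite exprfctE /GRing.scale /= mulr1.
 exists (Num.min d x) => [|h]; first by rewrite lt_min d0.
 rewrite lt_min => /andP[h1 /ltr_normlP[h2 _]].
 have xh : 0 <= x + h by lra.
 by rewrite !pos_id ?(ltW x0) //; exact: H.
exists (Num.min 1 e) => [|h]; first by rewrite lt_min ltr01.
rewrite lt_min add0r (pos_0 (lexx 0)) !expr0n /= mulr0 mul0r !subr0 => /andP[h1 h2].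
have n0 := normr_ge0 h; have p0 := pos_ge0 h; have ph := pos_le n0 (ler_norm h).
rewrite ger0_norm ?exprn_ge0 // exprSr; apply: ler_pM; rewrite ?exprn_ge0 // exprSr; apply: le_trans (ltW h2).
by apply: (le_trans _ ph); rewrite -[leRHS]mul1r ler_wpM2r // exprn_ile1 // (le_trans ph) // ltW.
Qed.
Lemma is_derive_pos3 (x : R) : is_derive x 1 (fun x=> pos x ^+ 3) (3 * pos x ^+ 2).
Proof. exact: is_derive_posX. Qed.

Lemma is_derive_pos2 (x : R) : is_derive x 1 (fun x=> 3 * pos x ^+ 2) (6 * pos x).
Proof. by have H := is_derive_posX 0 x; apply: is_derive_eq; rewrite /GRing.scale /= expr1; ring. Qed.
Lemma C2_pos3 r (v : C -> R) p s : C2 r v p s -> C2 r (fun z=> pos (v z) ^+ 3) (fun z=> (3 * pos (v z) ^+ 2)%:C * p z)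
 (fun z=> 3 * pos (v z) ^+ 2 * s z + 6 * pos (v z) * cmod (p z) ^+ 2).
Proof.
move=> K; apply: (@C2_comp R r (fun x=> pos x ^+ 3) (fun x=> 3 * pos x ^+ 2) (fun x=> 6 * pos x)) => // z _.
split; [exact: is_derive_pos3|exact: is_derive_pos2|].
by apply: cvgM; [exact: cvg_cst|exact: pos_cont].
Qed.

Lemma C2_ln r (v : C -> R) p s : C2 r v p s -> (forall z, 0 < v z) -> C2 r (fun z=> ln (v z)) (fun z=> ((v z)^-1)%:C * p z)
 (fun z=> (v z)^-1 * s z + - (v z) ^- 2 * cmod (p z) ^+ 2).
Proof.
move=> K v0; apply: (@C2_comp R r (@ln R) (fun x=> x^-1) (fun x=> - x ^- 2)) => // z _.
have vz := v0 z; have vn : v z != 0 by rewrite gt_eqF.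
split; first exact: is_derive1_ln.
- have := @is_deriveV R id (v z) _ 1 vn (is_derive_id _ _) => D3; apply: (is_derive_eq D3).
 by rewrite /GRing.scale /= mulr1.
- apply: cvgN; apply: cvgV; first by rewrite expf_neq0.
 by rewrite /=; under eq_fun do rewrite expr2; rewrite expr2; apply: cvgM; exact: cvg_id.
Qed.

End Pos.

(** * The smoothed log |f|, the cutoff of |g|^2, and the equation that links them *)

Section Data.
Variable R : realType.
Local Notation C := R[i].
Variable D : R.
Hypotheses (D0 : 0 < D) (D1 : D <= 1).
Variables (f f1 f2 g g1 g2 : C -> C).
Hypotheses (Hf : forall r, hol2 r f f1 f2) (Hg : forall r, hol2 r g g1 g2).
Hypotheses (f_le : onD z, cmod (f z) <= 1) (g_le : onD z, cmod (g z) <= 1).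
Hypothesis fg : onD z, D <= cmod (f z) ^+ 2 + cmod (g z) ^+ 2.

Let t1 := D / 4.
Definition tf z := cmod (f z) ^+ 2.
Definition tg z := cmod (g z) ^+ 2.
Definition xf z := pos (D / 4 - tf z).
Definition xg z := pos (tg z - D / 4).
(** A positive C^2 replacement for |f|^2, equal to it where |f|^2 >= D/4. Hence [Lf] is a bounded
    real function, and it is the harmonic function log |f| there. *)
Definition Lam z := tf z + xf z ^+ 3.
Definition Lf z := 2^-1 * ln (Lam z).
(** It factors as g theta and vanishes where |g|^2 <= D/4; the cube makes the cutoff C^2. By the
    corona bound [psi] is bounded below where |f|^2 <= D/4, the region in which [Lf] may fail to be
    harmonic. *)
Definition psi z := tg z * xg z ^+ 3.
Definition theta z := cj (g z) * (xg z ^+ 3)%:C.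
(** As in [C2], the names from here on that begin with p denote z-derivatives and those that begin
    with s denote quarter Laplacians. *)
Definition pLam z := f1 z * cj (f z) + (3 * xf z ^+ 2)%:C * (0 - f1 z * cj (f z)).
Definition sLam z := cmod (f1 z) ^+ 2 + (3 * xf z ^+ 2 * (0 - cmod (f1 z) ^+ 2) + 6 * xf z * cmod (0 - f1 z * cj (f z)) ^+ 2).
Definition pL z : C := (2^-1)%:C * (((Lam z)^-1)%:C * pLam z).
Definition sL z := 2^-1 * ((Lam z)^-1 * sLam z + - (Lam z) ^- 2 * cmod (pLam z) ^+ 2).
Definition ptg z := g1 z * cj (g z).
Definition psg z := (3 * xg z ^+ 2)%:C * ptg z.
Definition ssg z := 3 * xg z ^+ 2 * cmod (g1 z) ^+ 2 + 6 * xg z * cmod (ptg z) ^+ 2.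
Definition ppsi z := ptg z * (xg z ^+ 3)%:C + (tg z)%:C * psg z.
(** For h(t) = t (t - D/4)^3 the quarter Laplacian of h(|g|^2) is |g'|^2 (h' + t h''), and this is
    the factor h' + t h'' where the positive part is active. *)
Definition wg z := xg z ^+ 3 + 9 * xg z ^+ 2 * tg z + 6 * xg z * tg z ^+ 2.
Definition spsi z := cmod (g1 z) ^+ 2 * wg z.

Lemma C2_tf r : C2 r tf (fun z=> f1 z * cj (f z)) (fun z=> cmod (f1 z) ^+ 2).
Proof. exact: C2_cmod2. Qed.
Lemma C2_tg r : C2 r tg ptg (fun z=> cmod (g1 z) ^+ 2).
Proof. exact: C2_cmod2. Qed.

Lemma tf_ge0 z : 0 <= tf z. Proof. exact: sqr_ge0. Qed.
Lemma tg_ge0 z : 0 <= tg z. Proof. exact: sqr_ge0. Qed.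

Lemma Lam_gt0 z : 0 < Lam z.
Proof.
have tf0 := tf_ge0 z; have x0 := pos_ge0 (D / 4 - tf z).
rewrite /Lam; have [h|h] := ltP (tf z) (D / 4).
 by apply: ltr_wpDl => //; apply: exprn_gt0; rewrite /xf pos_id; lra.
apply: ltr_pwDl; last by rewrite exprn_ge0.
by move: D0 h; lra.
Qed.
Lemma C2_Lam r : C2 r Lam pLam sLam.
Proof. exact: (C2D (C2_tf r) (C2_pos3 (C2B (C2_cst r (D / 4)) (C2_tf r)))). Qed.

Lemma C2_L r : C2 r Lf pL sL.
Proof. exact: (C2Z 2^-1 (C2_ln (C2_Lam r) Lam_gt0)). Qed.

Lemma C2_xg3 r : C2 r (fun z=> xg z ^+ 3) psg ssg.
Proof.
apply: C2_ext (C2_pos3 (C2B (C2_tg r) (C2_cst r (D / 4)))) => z //.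
 by rewrite /psg subr0.
by rewrite /ssg !subr0.
Qed.

Lemma C2_psi r : C2 r psi ppsi spsi.
Proof.
apply: C2_ext (C2M (C2_tg r) (C2_xg3 r)) => z //.
rewrite /spsi /ssg /psg /wg /ptg conjcM /= oppr0.
have -> : g1 z * cj (g z) * ((3 * xg z ^+ 2)%:C * cj (g1 z * cj (g z))) = (3 * xg z ^+ 2)%:C * (cmod (g1 z * cj (g z)) ^+ 2)%:C.
 by rewrite cmod2_real; ring.
rewrite -realCM /= !cmodM cmodJ exprMn -/(tg z); ring.
Qed.

Lemma xf_facts z : cmod z <= 1 -> [/\ 0 <= xf z, xf z <= 1 / 4 & 0 <= tf z <= 1].
Proof.
move=> hz; have tf0 := tf_ge0 z; split.
- exact: pos_ge0.
- by apply: pos_le; move: D1; lra.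
- by rewrite tf0 exprn_ile1 ?cge0 ?f_le.
Qed.

Lemma xg_facts z : cmod z <= 1 -> [/\ 0 <= xg z, xg z <= tg z, xg z <= 1 & 0 <= tg z <= 1].
Proof.
move=> hz; have tg0 := tg_ge0 z.
have tg1 : tg z <= 1 by rewrite exprn_ile1 ?cge0 ?g_le.
have xt : xg z <= tg z by apply: pos_le => //; move: D0; lra.
split=> //; [exact: pos_ge0|exact: le_trans tg1|by rewrite tg0].
Qed.

Definition lam0 : R := (D / 8) ^+ 3.

Lemma lam0_gt0 : 0 < lam0. Proof. by apply: exprn_gt0; move: D0; lra. Qed.

Lemma Lam_bounds z : cmod z <= 1 -> lam0 <= Lam z <= 2.
Proof.
move=> hz; have [x0 x1 /andP[t0 tt1]] := xf_facts hz.
have x3 : 0 <= xf z ^+ 3 by rewrite exprn_ge0.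
apply/andP; split; last first.
 have : xf z ^+ 3 <= 1 by rewrite exprn_ile1 //; lra.
 by rewrite /Lam; lra.
have d8 : 0 <= D / 8 <= 1 by move: D0 D1; lra.
have d83 : (D / 8) ^+ 3 <= D / 8.
 rewrite exprS -[leRHS]mulr1 ler_wpM2l ?exprn_ile1 //; case/andP: d8 => //.
have [h|h] := leP (D / 8) (tf z).
 by rewrite /Lam /lam0; lra.
have : lam0 <= xf z ^+ 3.
 rewrite /lam0 lerXn2r ?nnegrE //; first by case/andP: d8.
 by rewrite /xf pos_id; lra.
by rewrite /Lam; lra.
Qed.

Lemma Lf_bound z : cmod z <= 1 -> `|Lf z| <= lam0^-1.
Proof.
move=> hz; have /andP[l1 l2] := Lam_bounds hz; have l0 := lam0_gt0; have L0 := Lam_gt0 z.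
have h1 : ln (Lam z) <= 2.
 have := @ln_sublinear R (Lam z) L0; lra.
have h2 : - lam0^-1 <= ln (Lam z).
 have Li : 0 < (Lam z)^-1 by rewrite invr_gt0.
 have := @ln_sublinear R (Lam z)^-1 Li; rewrite lnV //.
 have : (Lam z)^-1 <= lam0^-1 by rewrite lef_pV2.
 by lra.
have h3 : 1 <= lam0^-1.
 rewrite invf_ge1 // /lam0 exprn_ile1 //; move: D0 D1; lra.
by rewrite /Lf ler_norml; apply/andP; split; lra.
Qed.
Lemma Lf_eq z : D / 4 <= tf z -> Lam z = tf z.
Proof. by move=> h; rewrite /Lam /xf pos_0 ?expr0n ?addr0 //; lra. Qed.

Lemma sL_eq0 z : D / 4 <= tf z -> sL z = 0.
Proof.
move=> h; have t0 : 0 < tf z by move: D0 h; lra.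
rewrite /sL (Lf_eq h) /sLam /pLam /xf pos_0; last lra.
rewrite expr0n /= !mulr0 !mul0r !addr0 cmodM cmodJ (exprMn _ (cmod (f1 z))) -/(tf z).
by move: (tf z) t0 => t t0; field; rewrite gt_eqF.
Qed.

Lemma sL_bound z : cmod z <= 1 -> `|sL z| <= 4 / lam0 ^+ 2 * cmod (f1 z) ^+ 2.
Proof.
move=> hz; have [x0 x1 /andP[t0 tt1]] := xf_facts hz.
have /andP[l1 l2] := Lam_bounds hz; have l0 := lam0_gt0; have L0 := Lam_gt0 z.
have lam1 : lam0 <= 1 by rewrite /lam0 exprn_ile1 //; move: D0 D1; lra.
have E1 : cmod (0 - f1 z * cj (f z)) ^+ 2 = cmod (f1 z) ^+ 2 * tf z by rewrite sub0r cmodN cmodM cmodJ exprMn.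
have E2 : pLam z = (1 - 3 * xf z ^+ 2)%:C * (f1 z * cj (f z)) by rewrite /pLam realCD realCN; ring.
have E3 : cmod (pLam z) ^+ 2 = (1 - 3 * xf z ^+ 2) ^+ 2 * (cmod (f1 z) ^+ 2 * tf z).
 by rewrite E2 cmodM exprMn cmodR real_normK ?num_real // cmodM cmodJ exprMn.
rewrite /sL /sLam E1 E3; set F := cmod (f1 z) ^+ 2; have F0 : 0 <= F by exact: sqr_ge0.
have i1 : (Lam z)^-1 <= lam0^-1 by rewrite lef_pV2.
have i10 : 0 <= (Lam z)^-1 by nneg.
have i2 : (Lam z) ^- 2 <= lam0 ^- 2.
 have : lam0 ^+ 2 <= Lam z ^+ 2 by rewrite lerXn2r ?nnegrE ?(ltW l0) ?(ltW L0).
 by rewrite lef_pV2 // posrE exprn_gt0.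
have i3 : lam0^-1 <= lam0 ^- 2.
 have : lam0 ^+ 2 <= lam0 by rewrite expr2 -[leRHS]mul1r ler_wpM2r ?(ltW l0).
 by rewrite lef_pV2 // posrE exprn_gt0.
have i20 : 0 <= (Lam z) ^- 2 by nneg.
set a := 1 - 3 * xf z ^+ 2.
have x2 : 0 <= xf z ^+ 2 <= 1 / 16 by rewrite sqr_ge0 /=; have := @lerXn2r R 2 (xf z) (1 / 4); rewrite !nnegrE => /(_ x0 ltac:(lra) x1); lra.
have a01 : 0 <= a <= 1 by rewrite /a; lra.
have -> : 2^-1 * ((Lam z)^-1 * (F + (3 * xf z ^+ 2 * (0 - F) + 6 * xf z * (F * tf z))) + - Lam z ^- 2 * (a ^+ 2 * (F * tf z))) =
 2^-1 * (((Lam z)^-1 * (a + 6 * xf z * tf z)) * F - (Lam z ^- 2 * (a ^+ 2 * tf z)) * F) by rewrite /a; ring.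
have xt : 0 <= xf z * tf z <= 1 / 4 by nra.
have u1 : 0 <= (Lam z)^-1 * (a + 6 * xf z * tf z) <= lam0 ^- 2 * 3.
 apply/andP; split; first by apply: mulr_ge0 => //; lra.
 by apply: ler_pM => //; [lra|exact: le_trans i3|lra].
have u2 : 0 <= Lam z ^- 2 * (a ^+ 2 * tf z) <= lam0 ^- 2 * 1.
 have at0 : 0 <= a ^+ 2 * tf z <= 1 by nra.
 by apply/andP; split; [apply: mulr_ge0; lra|apply: ler_pM => //; lra].
move: u1 u2; set X := _ * (a + _); set Y := _ * (a ^+ 2 * _) => /andP[X0 X1] /andP[Y0 Y1].
have := ler_wpM2r F0 X1; have := ler_wpM2r F0 Y1; have := mulr_ge0 X0 F0; have := mulr_ge0 Y0 F0.
have : 0 <= lam0 ^- 2 * F by nneg.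
by rewrite ler_norml => h1 h2 h3 h4 h5; apply/andP; split; lra.
Qed.

Lemma wg_bound z : cmod z <= 1 -> 0 <= wg z <= 16 * xg z.
Proof.
move=> /xg_facts[x0 xt x1 /andP[t0 tt1]]; rewrite /wg.
have x2 : 0 <= xg z ^+ 2 <= xg z by nra.
have x3 : 0 <= xg z ^+ 3 <= xg z by rewrite exprS; nra.
have t2 : 0 <= tg z ^+ 2 <= 1 by nra.
by apply/andP; split; nra.
Qed.
Lemma psi_ge0 z : 0 <= psi z.
Proof. by rewrite /psi mulr_ge0 ?tg_ge0 // exprn_ge0 // pos_ge0. Qed.

Definition psi0 : R := (D / 8) ^+ 4.

Lemma psi0_gt0 : 0 < psi0. Proof. by apply: exprn_gt0; move: D0; lra. Qed.

Lemma psi_low z : cmod z <= 1 -> tf z <= D / 4 -> psi0 <= psi z.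
Proof.
move=> hz h; have := fg hz; rewrite -/(tf z) -/(tg z) => hfg; have d0 := D0.
have d8 : 0 <= D / 8 by lra.
have tgz : D / 8 <= tg z by lra.
have xgz : D / 8 <= xg z by rewrite /xg pos_id; lra.
rewrite /psi0 exprS; apply: ler_pM => //; first exact: exprn_ge0.
by rewrite lerXn2r ?nnegrE //; lra.
Qed.

(** The quotient sL / psi, with a denominator kept away from 0. The maximum changes nothing where sL
    is nonzero, for there psi >= psi0; so psi r0 = sL still holds. *)
Definition r0 z := sL z / Num.max (psi z) psi0.

Lemma max_gt0 z : 0 < Num.max (psi z) psi0. Proof. by rewrite lt_max psi0_gt0 orbT. Qed.

Lemma psi_r0 z : cmod z <= 1 -> psi z * r0 z = sL z.
Proof.
move=> hz; rewrite /r0; have [h|h] := leP (D / 4) (tf z); first by rewrite sL_eq0 // mul0r mulr0.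
have p := psi_low hz (ltW h); have p0 := psi0_gt0.
by rewrite max_l // mulrCA mulfV ?mulr1 // gt_eqF //; lra.
Qed.

Definition C1 : R := 4 / lam0 ^+ 2 / psi0.

Lemma C1_ge0 : 0 <= C1.
Proof. by have := lam0_gt0; have := psi0_gt0; move=> /ltW h1 /ltW h2; rewrite /C1; nneg. Qed.

Lemma r0_bound z : cmod z <= 1 -> `|r0 z| <= C1 * cmod (f1 z) ^+ 2.
Proof.
move=> hz; have h := sL_bound hz; have m0 := max_gt0 z; have p0 := psi0_gt0.
rewrite /r0 normrM normfV (gtr0_norm m0) ler_pdivrMr //; apply: le_trans h _.
have h1 : 1 <= psi0^-1 * Num.max (psi z) psi0 by rewrite mulrC ler_pdivlMr // mul1r le_max lexx orbT.
have h2 : 0 <= 4 / lam0 ^+ 2 * cmod (f1 z) ^+ 2 by have /ltW l0 := lam0_gt0; nneg.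
have := ler_wpM2l h2 h1; rewrite /C1 mulr1; move: (4 / _) (cmod _ ^+ 2) (psi0^-1) (Num.max _ _) => a b c d; lra.
Qed.

(** The coefficient spsi / psi of the equation, which [eta] keeps continuous at the zeros of psi. *)
Definition qf (eta : R) z := spsi z / (psi z + eta).

Lemma spsi_ge0 z : cmod z <= 1 -> 0 <= spsi z.
Proof. by move=> /wg_bound/andP[h _]; rewrite /spsi; nneg. Qed.

Lemma qf_ge0 eta z : 0 < eta -> cmod z <= 1 -> 0 <= qf eta z.
Proof.
move=> e0 hz; have h1 := spsi_ge0 hz; have h2 := psi_ge0 z; have h3 : 0 <= psi z + eta by lra.
by rewrite /qf; nneg.
Qed.

Lemma cpsi r : rc r psi. Proof. exact: C2v (C2_psi r). Qed.
Lemma cspsi r : rc r spsi. Proof. exact: C2s (C2_psi r). Qed.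
Lemma csL r : rc r sL. Proof. exact: C2s (C2_L r). Qed.

Lemma cqf eta r : 0 < eta -> rc r (qf eta).
Proof.
move=> e0; have c1 : rc r psi by exact: cpsi.
have c2 : rc r spsi by exact: cspsi.
have c3 : rc r (fun z=> (psi z + eta)^-1).
 by apply: rcV; [conT|move=> z _; rewrite gt_eqF //; have := psi_ge0 z; lra].
by apply: rcM.
Qed.

Lemma cr0 r : rc r r0.
Proof.
have c1 : rc r psi by exact: cpsi.
have c2 : rc r sL by exact: csL.
apply: rcM => //; apply: rcV; last by move=> z _; rewrite gt_eqF // max_gt0.
have -> : (fun z=> Num.max (psi z) psi0) = (fun z=> psi0 + pos (psi z - psi0)).
 by apply/funext => z; rewrite /pos maxC addr_maxr addr0 subrKC.
apply: rcD; first exact: rc_cst.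
by apply: rc_comp; [conT|move=> z _; exact: pos_cont].
Qed.

(** Where xg <= kap, [wg] itself is at most 16 kap. Elsewhere psi >= D/4 kap^3, so that eta = D/4
    kap^4 is at most kap psi. *)
Lemma eta_small z (kap : R) : cmod z <= 1 -> 0 < kap <= 1 ->
 D / 4 * kap ^+ 4 * wg z <= 16 * kap * (psi z + D / 4 * kap ^+ 4).
Proof.
move=> hz /andP[k0 k1]; have d0 := D0; have d1 := D1.
have /andP[w0 w1] := wg_bound hz; have [x0 xt x1 /andP[t0 tt1]] := xg_facts hz.
have p0 := psi_ge0 z.
have e0 : 0 <= D / 4 * kap ^+ 4 by rewrite mulr_ge0 ?exprn_ge0 ?(ltW k0) //; lra.
have [h|h] := leP (xg z) kap.
 have : D / 4 * kap ^+ 4 * wg z <= D / 4 * kap ^+ 4 * (16 * kap) by rewrite ler_wpM2l //; lra.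
 have : 0 <= kap * psi z by rewrite mulr_ge0 // ltW.
 by lra.
have tgz : D / 4 <= tg z.
 rewrite leNgt; apply/negP => hh; move: h; rewrite /xg pos_0; [lra|].
 by move: hh; lra.
have x3 : kap ^+ 3 <= xg z ^+ 3 by rewrite lerXn2r ?nnegrE ?(ltW k0) ?(ltW h).
have ps : D / 4 * kap ^+ 3 <= psi z by rewrite /psi; apply: ler_pM => //; [lra|rewrite exprn_ge0 // ltW].
have w16 : wg z <= 16 by lra.
have : D / 4 * kap ^+ 4 * wg z <= D / 4 * kap ^+ 4 * 16 by rewrite ler_wpM2l.
have := ler_wpM2l (ltW k0) ps; have -> : kap * (D / 4 * kap ^+ 3) = D / 4 * kap ^+ 4 by rewrite [kap ^+ 4]exprS; ring.
have : 0 <= kap * (D / 4 * kap ^+ 4) by rewrite mulr_ge0 // ltW.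
by lra.
Qed.

(** The barrier C1 (1 - |f|^2) + 2 ep rho with 2 ep <= 1 gives this bound for V. *)
Definition Bcst : R := C1 + 1.

(* The almost-solution [V] of the equation, and the potential [phi] of the form it produces. *)
Lemma core_pot (tau : R) : 0 < tau -> exists (V : C -> R) pV sV (phi : C -> R) pphi, [/\
 C2 1 V pV sV,
 onD z, `|V z| <= Bcst,
 onD z, - (Bcst * (C1 + 1) * (cmod (f1 z) ^+ 2 + 1)) <= V z * sV z,
 onD z, `|cmod (theta z) * sV z| <= 64 / D * Bcst * cmod (g1 z) ^+ 2 + C1 * cmod (f1 z) ^+ 2 + 1 &
 con 1 pphi /\ onD z, wd (fun z=> (phi z)%:C) z (pphi z) (cj (pphi z)) /\
  cmod (pphi z - 'i%C * ((psi z)%:C * pV z - (V z)%:C * ppsi z - pL z)) <= tau].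
Proof.
move=> tau0; have d0 := D0; have d1 := D1; have cc1 := C1_ge0.
have B0 : 0 < Bcst by rewrite /Bcst; qlra.
have [_ cg1] := hol2_con (Hg 1).
have [Mg Mg0 HMg] := con_bdd (conX 2 cg1).
have MgE z : cmod z <= 1 -> cmod (g1 z) ^+ 2 <= Mg by move=> hz; have := HMg z hz; rewrite cmodX.
(* So small that the error caused by [eta], at most 16 kap Mg after [eta_small] and multiplied by
   the bound of V, stays below tau / 4. *)
pose kap := Num.min 1 (tau / 4 / (16 * Mg * Bcst)).
have den0 : 0 < 16 * Mg * Bcst by npos.
have kap0 : 0 < kap by rewrite lt_min ltr01 /= divr_gt0 //; qlra.
have kap1 : kap <= 1 by rewrite ge_min lexx.
have kapt : 16 * kap * Mg * Bcst <= tau / 4.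
 have : kap <= tau / 4 / (16 * Mg * Bcst) by rewrite ge_min lexx orbT.
 by rewrite ler_pdivlMr //; qlra.
pose eta := D / 4 * kap ^+ 4.
have eta0 : 0 < eta by rewrite /eta; apply: mulr_gt0; [qlra|exact: exprn_gt0].
pose ep := Num.min (1 / 2) (tau / 4).
have ep0 : 0 < ep by rewrite lt_min; apply/andP; split; qlra.
have ep1 : ep <= 1 / 2 by rewrite ge_min lexx.
have ept : ep <= tau / 4 by rewrite ge_min lexx orbT.
have [V [pV [sV [KV HV Hs]]]] := pde_solvable (cqf eta0) (fun z hz => qf_ge0 eta0 hz) (cr0 (r:=1)) ep0.
have Hs' z : cmod z <= 1 -> exists2 er : R, `|er| <= ep & sV z = qf eta z * V z + r0 z + er.
 move=> hz; exists (sV z - 1 * qf eta z * V z - r0 z); first exact: Hs.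
 by ring.
have half W pW sW : (forall r, C2 r W pW sW) -> (forall z, cmod z = 1 -> W z = 0) ->
  (onD z, - (C1 * cmod (f1 z) ^+ 2) - ep <= sW z - qf eta z * W z) -> onD z, W z <= Bcst.
 move=> KW HW HsW z hz.
 have K := C2B (C2B (KW 1) (C2Z C1 (C2B (C2_cst 1 1) (C2_tf 1)))) (C2Z (2 * ep) (C2_rho 1)).
 (* The barrier C1 (1 - |f|^2) has mixed derivative -C1 |f'|^2 and outweighs r0; the barrier 2 ep
    rho outweighs the error ep of the approximate solution, with strict inequality. *)
 have : W z - C1 * (1 - tf z) - 2 * ep * rho z <= 0.
  apply: (max_principle K) => // w hw.
   have hw1 : cmod w <= 1 by rewrite hw.
   have [_ _ /andP[_ tt]] := xf_facts hw1; have : 0 <= C1 * (1 - tf w) by rewrite mulr_ge0 //; qlra.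
   by rewrite HW // rho_circ //; qlra.
  have hw1 := ltW hw; have [_ _ /andP[_ tt]] := xf_facts hw1; have q0 := qf_ge0 eta0 hw1.
  have h1 : 0 <= C1 * (1 - tf w) by rewrite mulr_ge0 //; qlra.
  have h2 : 0 <= 2 * ep * rho w by rewrite mulr_ge0 ?rho_ge0 //; qlra.
  move=> h3; have W0 : 0 <= W w by qlra.
  by have := mulr_ge0 q0 W0; have := HsW w hw1; qlra.
 have [_ _ /andP[tt0 _]] := xf_facts hz; have := mulr_ge0 cc1 tt0.
 have e2 : 0 <= 2 * ep by qlra.
 have := ler_wpM2l e2 (rho_le1 z); rewrite /Bcst; qlra.
have VB z : cmod z <= 1 -> `|V z| <= Bcst.
 move=> hz; rewrite ler_norml lerNl; apply/andP; split.
  apply: (half _ _ _ (fun r=> C2N (KV r))) => // w hw; first by rewrite HV // oppr0.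
  by have [er] := Hs' w hw; have := r0_bound hw; rewrite !ler_norml => /andP[h1 h2] /andP[h3 h4] ->; qlra.
 apply: (half _ _ _ KV) => // w hw.
 by have [er] := Hs' w hw; have := r0_bound hw; rewrite !ler_norml => /andP[h1 h2] /andP[h3 h4] ->; qlra.
(* The z-derivative wanted for phi. A real potential exists when the d-bar derivative of Bf is real,
   which says psi sV - V spsi = sL: this is the equation behind [qf] and [r0]. *)
pose Bf z := 'i%C * ((psi z)%:C * pV z - (V z)%:C * ppsi z - pL z).
have [aV caV HaV] := C2wd2 (KV 2); have [aP caP HaP] := C2wd2 (C2_psi 2); have [aL caL HaL] := C2wd2 (C2_L 2).
have cpV := C2p (KV 2); have csV := C2s (KV 2); have cV := C2v (KV 2).
have cps := C2v (C2_psi 2); have cpps := C2p (C2_psi 2); have csps := C2s (C2_psi 2).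
have cpL := C2p (C2_L 2); have csL2 := C2s (C2_L 2).
pose Bz z := 'i%C * ((ppsi z * pV z + (psi z)%:C * aV z) - (pV z * ppsi z + (V z)%:C * aP z) - aL z).
pose Bb z := 'i%C * ((cj (ppsi z) * pV z + (psi z)%:C * (sV z)%:C) - (cj (pV z) * ppsi z + (V z)%:C * (spsi z)%:C) - (sL z)%:C).
have HB z : cmod z <= 2 -> wd Bf z (Bz z) (Bb z).
 move=> hz; apply: wdZ; apply: wdB; last exact: HaL.
 apply: wdB; apply: wdM; [exact: C2wd (C2_psi 2) _ hz|exact: HaV|exact: C2wd (KV 2) _ hz|exact: HaP].
have cBz : con 2 Bz by rewrite /Bz; conT.
have cBb : con 2 Bb by rewrite /Bb; conT.
have [phi [pphi [cph Hph Hpb]]] := potential cBz cBb HB.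
have ImB z : cmod z <= 1 -> `|Im (Bb z)| <= tau / 2.
 move=> hz; have [er her sE] := Hs' z hz.
 (* With the equation inserted, only the error of the solver and the effect of [eta] in the
    denominator remain. *)
 have -> : Im (Bb z) = psi z * er - V z * (spsi z * eta / (psi z + eta)).
  have -> : Im (Bb z) = psi z * sV z - V z * spsi z - sL z.
   rewrite /Bb; move: (ppsi z) (pV z) => [x y] [x' y'].
   by rewrite !(cReM, cImM, cReD, cImD, cReN, cImN) /=; ring.
  rewrite sE -(psi_r0 hz) /qf; have := psi_ge0 z; move: (psi z) (spsi z) (r0 z) (V z) => a b c d a0.
  by field; rewrite gt_eqF //; qlra.
 have ps1 : `|psi z| <= 1.
  have [x0 xt x1 /andP[t0 tt1]] := xg_facts hz.
  rewrite ger0_norm ?psi_ge0 // /psi -[leRHS]mulr1; apply: ler_pM => //; rewrite ?exprn_ge0 //.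
  by rewrite exprn_ile1.
 have t1' : `|psi z * er| <= ep.
  by rewrite normrM -[leRHS]mul1r; apply: ler_pM.
 have pe : 0 < psi z + eta by have := psi_ge0 z; qlra.
 have t2 : `|spsi z * eta / (psi z + eta)| <= 16 * kap * Mg.
  have s0 := spsi_ge0 hz.
  rewrite ger0_norm; last by rewrite divr_ge0 ?(ltW pe) // mulr_ge0 // ltW.
  rewrite ler_pdivrMr //; have := eta_small hz (introT andP (conj kap0 kap1)); rewrite -/eta => hk.
  have G0 := sqr_ge0 (cmod (g1 z)).
  have := ler_wpM2l G0 hk; rewrite /spsi.
  have : cmod (g1 z) ^+ 2 * (16 * kap * (psi z + eta)) <= Mg * (16 * kap * (psi z + eta)).
   by rewrite ler_wpM2r ?MgE // mulr_ge0 ?(ltW pe) //; qlra.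
  by qlra.
 have t3 : `|V z * (spsi z * eta / (psi z + eta))| <= Bcst * (16 * kap * Mg) by rewrite normrM; apply: ler_pM => //; exact: VB.
 by move: t1' t3; rewrite !ler_norml => /andP[h1 h2] /andP[h3 h4]; apply/andP; split; qlra.
exists V, pV, sV, phi, pphi; split=> //.
- move=> z hz; have [er her ->] := Hs' z hz.
 (* V sV is qf V^2 plus V (r0 + er), and the first summand is nonnegative: this is where the sign of
    the equation helps a second time. *)
 have q0 := qf_ge0 eta0 hz; have := VB z hz; have r0b := r0_bound hz; have V2 : 0 <= qf eta z * V z ^+ 2 by rewrite mulr_ge0 ?sqr_ge0.
 have F0 := sqr_ge0 (cmod (f1 z)).
 have re : `|r0 z + er| <= (C1 + 1) * (cmod (f1 z) ^+ 2 + 1).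
  apply: le_trans (ler_normD _ _) _; qlra.
 move=> Vb; have : `|V z * (r0 z + er)| <= Bcst * ((C1 + 1) * (cmod (f1 z) ^+ 2 + 1)) by rewrite normrM; apply: ler_pM.
 by rewrite ler_norml => /andP[h1 h2]; qlra.
- move=> z hz; have [er her ->] := Hs' z hz.
 have [x0 xt x1 /andP[t0 tt1]] := xg_facts hz.
 have g1' : cmod (g z) <= 1 by exact: g_le.
 have x3 : 0 <= xg z ^+ 3 <= 1 by rewrite exprn_ge0 // exprn_ile1.
 have thE : cmod (theta z) = cmod (g z) * xg z ^+ 3.
  by rewrite /theta cmodM cmodJ cmodR ger0_norm //; case/andP: x3.
 have th1 : 0 <= cmod (theta z) <= 1.
  by rewrite cge0 thE -[leRHS]mul1r; apply: ler_pM; rewrite ?cge0 //; case/andP: x3.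
 have G0 := sqr_ge0 (cmod (g1 z)).
 have pe : 0 < psi z + eta by have := psi_ge0 z; qlra.
 have q0 := qf_ge0 eta0 hz.
 (* Where theta is nonzero, |theta| D/4 <= psi; so the division by psi + eta costs 4/D, and wg <= 16
    makes it 64/D. *)
 have tq : cmod (theta z) * qf eta z <= 64 / D * cmod (g1 z) ^+ 2.
  have [xz|xz] := leP (xg z) 0.
   have -> : cmod (theta z) = 0 by rewrite thE (_ : xg z = 0) ?expr0n ?mulr0 //; apply/le_anti; rewrite xz.
   by rewrite mul0r mulr_ge0 // divr_ge0 // ltW.
  have tgz : D / 4 <= tg z.
   rewrite leNgt; apply/negP => hh; move: xz; rewrite /xg pos_0; [qlra|].
   by move: hh; qlra.
  have := wg_bound hz => /andP[w0 w1].
  rewrite /qf /spsi mulrA ler_pdivrMr // thE.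
  have gx : cmod (g z) * xg z ^+ 3 * (D / 4) <= psi z + eta.
   have : xg z ^+ 3 * (D / 4) <= psi z by rewrite /psi mulrC ler_wpM2r //; case/andP: x3.
   have : cmod (g z) * (xg z ^+ 3 * (D / 4)) <= 1 * (xg z ^+ 3 * (D / 4)).
    by rewrite ler_wpM2r // mulr_ge0 //; [case/andP: x3|qlra].
   by qlra.
  have w16 : wg z <= 16 by qlra.
  have h1 : cmod (g z) * xg z ^+ 3 * wg z <= cmod (g z) * xg z ^+ 3 * 16.
   by rewrite ler_wpM2l // mulr_ge0 ?cge0 //; case/andP: x3.
  have h2 : cmod (g z) * xg z ^+ 3 <= (psi z + eta) * (4 / D).
   have -> : 4 / D = (D / 4)^-1 by rewrite invf_div.
   by rewrite ler_pdivlMr //; qlra.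
  have h3 : cmod (g z) * xg z ^+ 3 * wg z <= (psi z + eta) * (64 / D).
   have -> : 64 / D = 16 * (4 / D) by field; rewrite gt_eqF.
   by move: h1 h2; set u := _ / D; qlra.
  have := ler_wpM2r G0 h3; set u := 64 / D; qlra.
 have VBz := VB z hz; have r0b := r0_bound hz; have F0 := sqr_ge0 (cmod (f1 z)).
 have -> : cmod (theta z) * (qf eta z * V z + r0 z + er) = cmod (theta z) * qf eta z * V z + cmod (theta z) * (r0 z + er) by ring.
 have h1 : `|cmod (theta z) * qf eta z * V z| <= 64 / D * cmod (g1 z) ^+ 2 * Bcst.
  rewrite normrM; apply: ler_pM => //; rewrite ger0_norm // mulr_ge0 ?cge0 //.
 have h2 : `|cmod (theta z) * (r0 z + er)| <= 1 * (C1 * cmod (f1 z) ^+ 2 + 1).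
  rewrite normrM; apply: ler_pM => //; first by rewrite ger0_norm ?cge0 //; case/andP: th1.
  by apply: le_trans (ler_normD _ _) _; qlra.
 by apply: le_trans (ler_normD _ _) _; move: h1 h2; set u := 64 / D; qlra.
- split=> // z hz; split; first exact: Hph.
 have := Hpb _ ImB z hz; rewrite -/(Bf z) mulrC divfK // pnatr_eq0.
Qed.

End Data.

(** * Complex exponential, argument, and coverings by small discs *)

Section Exp.
Variable R : realType.
Local Notation C := R[i].

Definition expC (z : C) : C := (expR (Re z))%:C * (cos (Im z) +i* sin (Im z)).

Lemma expCD z w : expC (z + w) = expC z * expC w.
Proof.
rewrite /expC cReD cImD expRD cosD sinD; apply: cx_eq; rewrite !(cReM, cImM) /=; ring.
Qed.
Lemma expC0 : expC 0 = 1.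
Proof. by rewrite /expC /= expR0 cos0 sin0 mul1r. Qed.

Lemma cmod_expC z : cmod (expC z) = expR (Re z).
Proof.
rewrite /expC cmodM cmodR (gtr0_norm (expR_gt0 _)) /cmod /= cos2Dsin2 sqrtr1 mulr1 //.
Qed.
Lemma expC_neq0 z : expC z != 0.
Proof. by rewrite -cmod_gt0 cmod_expC expR_gt0. Qed.

Lemma expCN z : expC (- z) = (expC z)^-1.
Proof. by apply: (mulfI (expC_neq0 z)); rewrite -expCD subrr expC0 mulfV // expC_neq0. Qed.

Lemma wd_Re (z : C) : wd (fun z=> (Re z)%:C) z 2^-1 2^-1.
Proof.
apply: (@wd_ext _ (fun w=> 2^-1 * (w + cj w))); first by move=> x; rewrite cReE.
by apply: wd_eq (wdZ 2^-1 (wdD (wd_id z) (wd_conj (wd_id z)))); rewrite ?conjc0 ?conjc1 ?addr0 ?add0r ?mulr1.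
Qed.
Lemma cImE (z : C) : (Im z)%:C = - 'i%C / 2 * (z - cj z).
Proof. by rewrite subcJ mulrC mulrA; apply: cx_eq; rewrite !(cReM, cImM, cReN, cImN) /= ?(cReD, cImD) /=; field. Qed.

Lemma wd_Im (z : C) : wd (fun z=> (Im z)%:C) z (- 'i%C / 2) ('i%C / 2).
Proof.
apply: (@wd_ext _ (fun w=> - 'i%C / 2 * (w - cj w))); first by move=> x; rewrite cImE.
by apply: wd_eq (wdZ (- 'i%C / 2) (wdB (wd_id z) (wd_conj (wd_id z)))); rewrite ?conjc0 ?conjc1 ?subr0 ?sub0r ?mulr1 //; ring.
Qed.

Lemma wd_expC z : wd expC z (expC z) 0.
Proof.
have W1 := wd_re_comp (wd_Re z) (is_derive_expR (Re z)).
have W2 := wd_re_comp (wd_Im z) (is_derive_cos (Im z)).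
have W3 := wd_re_comp (wd_Im z) (is_derive_sin (Im z)).
apply: (@wd_ext _ (fun z=> (expR (Re z))%:C * ((cos (Im z))%:C + 'i%C * (sin (Im z))%:C))).
 by move=> w; rewrite /expC; congr (_ * _); apply: cx_eq; rewrite !(cReD, cImD, cReM, cImM) /=; ring.
have i2 : 'i%C * 'i%C = -1 :> C by rewrite -expr2 sqr_i.
have S : expC z = (expR (Re z))%:C * ((cos (Im z))%:C + 'i%C * (sin (Im z))%:C).
 by rewrite /expC; congr (_ * _); apply: cx_eq; rewrite !(cReD, cImD, cReM, cImM) /=; ring.
apply: wd_eq (wdM W1 (wdD W2 (wdZ 'i%C W3))); rewrite ?S realCN.
- move: (expR _)%:C (cos _)%:C (sin _)%:C 'i%C i2 => E c s ii i2.
 transitivity (E * 2^-1 * (c + ii * s) + E * ((ii * s - (ii * ii) * c) / 2)); first by field.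
 by rewrite i2; field.
- move: (expR _)%:C (cos _)%:C (sin _)%:C 'i%C i2 => E c s ii i2.
 transitivity (E * 2^-1 * (c + ii * s) + E * ((- (ii * s) + (ii * ii) * c) / 2)); first by field.
 by rewrite i2; field.
Qed.

(** The half-angle formula: on the unit circle it gives an argument that is smooth away from w =
    -1. *)
Definition Arg (w : C) : R := 2 * atan (Im w / (1 + Re w)).

Lemma Arg_bound w : `|Arg w| <= pi.
Proof.
rewrite /Arg; have := atan_gtNpi2 (Im w / (1 + Re w)); have := atan_ltpi2 (Im w / (1 + Re w)).
by rewrite ler_norml => h1 h2; apply/andP; split; lra.
Qed.

Lemma expC_Arg w : cmod w = 1 -> 1 + Re w != 0 -> expC ('i%C * (Arg w)%:C) = w.
Proof.
move=> hw n0; have E := cmod_sqE w; rewrite hw expr1n in E.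
have -> : 'i%C * (Arg w)%:C = 0 +i* Arg w by apply: cx_eq; rewrite ?(cReM, cImM) /=; ring.
rewrite /expC /= expR0 mul1r /Arg; set t := Im w / (1 + Re w).
have c0 : cos (atan t) ^+ 2 = (1 + t ^+ 2)^-1.
 by rewrite cos_atan exprVn sqr_sqrtr // addr_ge0 ?sqr_ge0.
have sE : sin (atan t) = t * cos (atan t).
 rewrite -{2}[t]atanK /tan divfK // cos_atan invr_neq0 // gt_eqF // sqrtr_gt0.
 by apply: ltr_pwDl => //; exact: sqr_ge0.
have tE : 1 + t ^+ 2 = 2 / (1 + Re w).
 rewrite /t exprMn exprVn; have -> : Im w ^+ 2 = (1 - Re w) * (1 + Re w) by lra.
 by field.
have c2 : cos (atan t) ^+ 2 = (1 + Re w) / 2 by rewrite c0 tE invf_div.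
have D2 (x : R) : 2 * x = x + x by ring.
apply: cx_eq => /=; rewrite D2.
 rewrite cosD sE; have -> : cos (atan t) * cos (atan t) - t * cos (atan t) * (t * cos (atan t)) = cos (atan t) ^+ 2 * (2 - (1 + t ^+ 2)) by ring.
 by rewrite c2 tE; field.
rewrite sinD sE; have -> : t * cos (atan t) * cos (atan t) + cos (atan t) * (t * cos (atan t)) = 2 * t * cos (atan t) ^+ 2 by ring.
by rewrite c2 /t; field.
Qed.

Lemma unimod_arg w : cmod w = 1 -> exists2 c : R, `|c| <= pi & expC ('i%C * c%:C) = w.
Proof.
move=> hw; have [h|h] := eqVneq (1 + Re w) 0; last by exists (Arg w); [exact: Arg_bound|exact: expC_Arg].
exists pi; first by rewrite ger0_norm // pi_ge0.
have E := cmod_sqE w; rewrite hw expr1n in E.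
have r1 : Re w = -1 by lra.
have i0 : Im w = 0.
 by apply/eqP; rewrite -sqrf_eq0; apply/eqP; move: E; rewrite r1; lra.
have -> : 'i%C * (pi%:C : C) = 0 +i* pi by apply: cx_eq; rewrite ?(cReM, cImM) /=; ring.
by rewrite /expC /= expR0 mul1r cospi sinpi; apply: cx_eq; rewrite /= ?r1 ?i0.
Qed.

Lemma wd_Arg (u : C -> C) z p q : wd u z p q -> 1 + Re (u z) != 0 ->
 exists P, wd (fun z=> (Arg (u z))%:C) z P (cj P).
Proof.
move=> Hu n0.
have W1 := wd_comp Hu (wd_Im (u z)); have W2 := wdD (wd_cst 1 z) (wd_comp Hu (wd_Re (u z))).
have n0' : 1 + (Re (u z))%:C != 0 :> C.
 have -> : 1 + (Re (u z))%:C = (1 + Re (u z))%:C :> C by rewrite realCD.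
 by rewrite -cmod_eq0 cmodR normr_eq0.
have W3 := wdM W1 (wdV W2 n0').
set p3 := _ + _ in W3; set q3 := (X in wd _ _ _ X) in W3.
have W4 : wd (fun z=> (Im (u z) / (1 + Re (u z)))%:C) z p3 q3.
 apply: wd_ext W3 => w; rewrite realCM realCV realCD //.
have [p5 [q5 W5]] : exists p5 q5, wd (fun z=> 2 * (atan (Im (u z) / (1 + Re (u z))))%:C) z p5 q5.
 by eexists; eexists; exact: (wdZ 2 (wd_re_comp W4 (is_derive1_atan _))).
have W6 : wd (fun z=> (Arg (u z))%:C) z p5 q5.
 by apply: wd_ext W5 => w; rewrite /Arg realCM; congr (_ * _); apply: cx_eq => /=; rewrite ?addr0.
by exists p5; rewrite -(wd_real_conj W6).
Qed.

(** Pigeonhole: the n+1 points of the circle with abscissas k/(n+1) are at least 1/(n+1) apart, so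
    two of them cannot both be within half that distance of the same value. *)
Lemma unimod_avoid n (v : 'I_n -> C) : exists2 u : C, cmod u = 1 & forall i, (2 * n.+1%:R)^-1 <= cmod (u - v i).
Proof.
pose x (k : nat) : R := k%:R / n.+1%:R.
have n0 : 0 < n.+1%:R :> R by [].
have x01 (k : nat) : (k <= n.+1)%N -> 0 <= x k <= 1.
 by move=> hk; rewrite divr_ge0 // ler_pdivrMr // mul1r ler_nat.
pose u (k : nat) : C := x k +i* Num.sqrt (1 - x k ^+ 2).
have hu (k : nat) : (k <= n.+1)%N -> cmod (u k) = 1.
 move=> hk; have /andP[h0 h1] := x01 k hk.
 rewrite /cmod /= sqr_sqrtr; first by rewrite addrC subrK sqrtr1.
 by rewrite subr_ge0 exprn_ile1.
have [//|H] := pselect (exists2 u : C, cmod u = 1 & forall i, (2 * n.+1%:R)^-1 <= cmod (u - v i)).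
have J (k : 'I_n.+1) : exists i : 'I_n, cmod (u k - v i) < (2 * n.+1%:R)^-1.
 have [//|Hk] := pselect (exists i : 'I_n, cmod (u k - v i) < (2 * n.+1%:R)^-1).
 exfalso; apply: H; exists (u k); first by apply: hu; exact: ltnW.
 by move=> i; rewrite leNgt; apply/negP => h; apply: Hk; exists i.
have [j Hj] := choice J.
have : ~~ injectiveb j.
 by apply/negP => /injectiveP/leq_card; rewrite !card_ord ltnn.
case/injectivePn => k [l kl E].
have := Hj k; have := Hj l; rewrite -E => h1 h2; exfalso.
have h3 : cmod (u k - u l) < (n.+1%:R)^-1.
 have -> : u k - u l = (u k - v (j k)) + (v (j k) - u l) by ring.
 apply: le_lt_trans (cmodD _ _) _; rewrite (cmodBC (v _)).
 have -> : (n.+1%:R : R)^-1 = (2 * n.+1%:R)^-1 + (2 * n.+1%:R)^-1 by field; rewrite addrC natr1 gt_eqF.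
 exact: ltrD.
have h4 := le_lt_trans (cmod_Re _) h3; move: h4.
rewrite cReD cReN /= /x -mulrBl normrM normfV (gtr0_norm n0) -[ltRHS]mul1r ltr_pM2r ?invr_gt0 //.
have hz (a b : nat) : a != b -> 1 <= `|a%:R - b%:R : R|.
 move=> ab; wlog h : a b ab / (b < a)%N.
  move=> W; have [h|h|h] := ltngtP a b; [rewrite distrC; apply: W => //; by rewrite eq_sym|exact: W|by rewrite h eqxx in ab].
 by rewrite -natrB ?(ltnW h) // normr_nat ler1n subn_gt0.
by have := hz k l kl; lra.
Qed.

Lemma grid_cover (d : R) : 0 < d -> exists n (c : 'I_n -> C), onD z, exists i, cmod (z - c i) < d.
Proof.
move=> d0; pose m := (Num.truncn (2 / d)).+1.
have m0 : 0 < (m%:R : R) by rewrite ltr0n.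
have md : 2 / m%:R < d.
 by rewrite ltr_pdivrMr // mulrC -ltr_pdivrMr //; exact: Num.Theory.truncnS_gt.
pose pt (i j : nat) : C := (i%:R / m%:R - 1) +i* (j%:R / m%:R - 1).
pose T := ('I_(2 * m).+1 * 'I_(2 * m).+1)%type.
exists #|{: T}|; exists (fun i : 'I_#|{: T}| => let p : T := enum_val i in pt p.1 p.2) => z hz.
have key (x : R) : `|x| <= 1 -> exists i : 'I_(2 * m).+1, `|x - (i%:R / m%:R - 1)| <= m%:R^-1.
 rewrite ler_norml => /andP[x0 x1]; have y0 : 0 <= m%:R * (x + 1) by rewrite mulr_ge0 ?(ltW m0) //; lra.
 have /andP[t1 t2] := Num.Theory.truncn_itv y0.
 have ti : (Num.truncn (m%:R * (x + 1)) < (2 * m).+1)%N.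
  rewrite ltnS -(ler_nat R); apply: le_trans t1 _; rewrite natrM mulrC ler_wpM2r ?(ltW m0) //; lra.
 exists (Ordinal ti) => /=; set i := Num.truncn _ in t1 t2 *.
 have -> : x - (i%:R / m%:R - 1) = (m%:R * (x + 1) - i%:R) / m%:R by field; rewrite gt_eqF.
 rewrite ger0_norm; last by rewrite divr_ge0 ?subr_ge0 // ltW.
 rewrite ler_pdivrMr // mulVf ?gt_eqF //; move: t2; rewrite -natr1; lra.
have [i Hi] := key _ (le_trans (cmod_Re z) hz); have [j Hj] := key _ (le_trans (cmod_Im z) hz).
exists (enum_rank (i, j)); rewrite enum_rankK /=.
apply: le_lt_trans (cmod_ReIm _) _; rewrite cReD cImD cReN cImN /=.
apply: le_lt_trans (lerD Hi Hj) _; have -> : m%:R^-1 + m%:R^-1 = 2 / m%:R :> R by ring.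
exact: md.
Qed.

End Exp.

(** * A C^2 cutoff function with explicit derivatives *)

Section Cut.
Variable R : realType.
Variable D : R.
Hypothesis D0 : 0 < D.

Lemma is_derive_shift (F : R -> R) (s x d : R) : is_derive (x - s) 1 F d -> is_derive x 1 (fun t=> F (t - s)) d.
Proof.
move=> /is_deriveP H; apply/is_deriveP => e e0; have [dl d0 Hd] := H e e0; exists dl => // h hh.
by rewrite (_ : x + h - s = x - s + h); [exact: Hd|ring].
Qed.

Let h := D / 48.
(** The third difference of t^3 with step D/48 is 6 (D/48)^3; [kcut] normalises it to 1. *)
Definition kcut : R := (6 * (D / 48) ^+ 3)^-1.
Definition node (j : nat) : R := D / 16 + j%:R * (D / 48).

(* A C^2 cutoff, equal to 1 on (-oo, D/16] and to 0 on [D/8, +oo): the third difference of [pos ^+ 3] is eventually constant. *)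
Definition cut (t : R) : R := 1 - kcut * (pos (t - node 0) ^+ 3 - 3 * pos (t - node 1) ^+ 3 + 3 * pos (t - node 2) ^+ 3 - pos (t - node 3) ^+ 3).
Definition cut1 (t : R) : R := - (kcut * (3 * pos (t - node 0) ^+ 2 - 3 * (3 * pos (t - node 1) ^+ 2) + 3 * (3 * pos (t - node 2) ^+ 2) - 3 * pos (t - node 3) ^+ 2)).
Definition cut2 (t : R) : R := - (kcut * (6 * pos (t - node 0) - 3 * (6 * pos (t - node 1)) + 3 * (6 * pos (t - node 2)) - 6 * pos (t - node 3))).

Lemma cut_derive (t : R) : is_derive t 1 cut (cut1 t).
Proof.
have H j := is_derive_shift (is_derive_pos3 (t - node j)).
have H3 := H 3%N.
by apply: is_derive_eq; rewrite /cut1 /GRing.scale /=; ring.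
Qed.

Lemma cut1_derive (t : R) : is_derive t 1 cut1 (cut2 t).
Proof.
have H j := is_derive_shift (is_derive_pos2 (t - node j)).
have H3 := H 3%N.
by apply: is_derive_eq; rewrite /cut2 /GRing.scale /=; ring.
Qed.

Lemma cut_cont (t : R) : [/\ {for t, continuous cut}, {for t, continuous cut1} & {for t, continuous cut2}].
Proof.
split; [exact: derive_cont (cut_derive t)|exact: derive_cont (cut1_derive t)|].
have P j : pos (x - node j) @[x --> t] --> pos (t - node j).
 have h1 : {for t, continuous (fun x : R => x - node j)} by apply: cvgB; [exact: cvg_id|exact: cvg_cst].
 exact: (continuous_comp h1 (@pos_cont _ _)).
apply: cvgN; apply: cvgM; first exact: cvg_cst.
apply: cvgB; last by apply: cvgM; [exact: cvg_cst|exact: P].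
apply: cvgD; last by apply: cvgM; [exact: cvg_cst|apply: cvgM; [exact: cvg_cst|exact: P]].
apply: cvgB; first by apply: cvgM; [exact: cvg_cst|exact: P].
by apply: cvgM; [exact: cvg_cst|apply: cvgM; [exact: cvg_cst|exact: P]].
Qed.
Lemma node_le j : D / 16 <= node j.
Proof. by rewrite /node lerDl mulr_ge0 //; move: D0; lra. Qed.

Lemma cut_low t : t <= D / 16 -> [/\ cut t = 1, cut1 t = 0 & cut2 t = 0].
Proof.
move=> ht; have P j : pos (t - node j) = 0 by apply: pos_0; have := node_le j; lra.
by rewrite /cut /cut1 /cut2 !P; split; ring.
Qed.

Lemma cut_high t : D / 8 <= t -> [/\ cut t = 0, cut1 t = 0 & cut2 t = 0].
Proof.
move=> ht; have d0 := D0.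
have [x [x0 tx]] : exists x, 0 <= x /\ t = D / 8 + x by exists (t - D / 8); split; [lra|ring].
have E0 : t - node 0 = x + 3 * (D / 48) by rewrite tx /node; field.
have E1 : t - node 1 = x + 2 * (D / 48) by rewrite tx /node; field.
have E2 : t - node 2 = x + D / 48 by rewrite tx /node; field.
have E3 : t - node 3 = x by rewrite tx /node; field.
have k0 : kcut * (6 * (D / 48) ^+ 3) = 1 by rewrite /kcut mulVf // gt_eqF //; apply: mulr_gt0 => //; apply: exprn_gt0; lra.
rewrite /cut /cut1 /cut2 E0 E1 E2 E3 !pos_id; [|lra..].
split.
- rewrite -[X in X - _ = _]k0; ring.
- ring.
- ring.
Qed.

(** The coefficients in [cut2] add up to 6 + 18 + 18 + 6 = 48 in absolute value, and those in [cut]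
    and [cut1] to less. *)
Definition Kcut : R := 1 + 48 * kcut.

Lemma kcut_gt0 : 0 < kcut.
Proof. by rewrite invr_gt0; apply: mulr_gt0 => //; apply: exprn_gt0; move: D0; lra. Qed.

Lemma cut_bound t : t <= 1 -> [/\ `|1 - cut t| <= Kcut, `|cut1 t| <= Kcut & `|cut2 t| <= Kcut].
Proof.
move=> t1; have k0 := kcut_gt0.
have P j : 0 <= pos (t - node j) <= 1.
 by rewrite pos_ge0 pos_le //; have := node_le j; move: D0; lra.
have P2 j : 0 <= pos (t - node j) ^+ 2 <= 1 by have /andP[a b] := P j; rewrite exprn_ge0 // exprn_ile1.
have P3 j : 0 <= pos (t - node j) ^+ 3 <= 1 by have /andP[a b] := P j; rewrite exprn_ge0 // exprn_ile1.
rewrite /cut /cut1 /cut2 /Kcut.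
have B x : `|x| <= 48 -> `|kcut * x| <= 1 + 48 * kcut.
 by move=> hx; rewrite normrM (gtr0_norm k0); have := ler_wpM2l (ltW k0) hx; lra.
split.
- rewrite opprB addrC subrK; apply: B.
 move: (P3 0%N) (P3 1%N) (P3 2%N) (P3 3%N) => /andP[a a'] /andP[b b'] /andP[c c'] /andP[d d'].
 by rewrite ler_norml; apply/andP; split; lra.
- rewrite normrN; apply: B.
 move: (P2 0%N) (P2 1%N) (P2 2%N) (P2 3%N) => /andP[a a'] /andP[b b'] /andP[c c'] /andP[d d'].
 by rewrite ler_norml; apply/andP; split; lra.
- rewrite normrN; apply: B.
 move: (P 0%N) (P 1%N) (P 2%N) (P 3%N) => /andP[a a'] /andP[b b'] /andP[c c'] /andP[d d'].
 by rewrite ler_norml; apply/andP; split; lra.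
Qed.

End Cut.

(** * A branch of the argument of a slowly varying unimodular function *)

Section Arg.
Variable R : realType.
Local Notation C := R[i].

(** With small derivatives [kap] is nearly constant on each cell of a finite grid, so that its
    values miss a point of the circle, and a branch of the argument can be cut there. [tau0] depends
    on t and d0 only, not on kap: in the application kap is built after tau0 is known. *)
Lemma arg_branch (t : C -> R) (a d0 : R) : rc 1 t -> 0 < d0 -> exists2 tau0 : R, 0 < tau0 & forall kap : C -> C,
 (onD z, t z <= a + d0 -> cmod (kap z) = 1 /\ exists p q, wd kap z p q /\ cmod p + cmod q <= tau0) ->
 exists gam : C -> R, (forall z, `|gam z| <= 2 * pi) /\
 onD z, t z <= a -> (exists2 d : R, 0 < d & forall w, cmod (w - z) < d -> cmod (kap w) = 1) ->
  exists2 dd : R, 0 < dd & (forall w, cmod (w - z) < dd -> expC ('i%C * (gam w)%:C) = kap w) /\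
   exists P, wd (fun z=> (gam z)%:C) z P (cj P).
Proof.
move=> ct dd0.
have [e1 e10 He1] := con_unif ct dd0.
pose e := Num.min 1 e1.
have e0 : 0 < e by rewrite lt_min ltr01.
have e2 : 0 < e / 2 by lra.
have [n [c Hc]] := @grid_cover R _ e2.
pose m0 : R := (2 * n.+1%:R)^-1.
have m00 : 0 < m0 by rewrite invr_gt0 mulr_gt0.
exists (m0 / 2); first lra.
move=> kap Hk.
pose N z := cmod z <= 1 /\ t z <= a.
have near z w : N z -> cmod w <= 1 -> cmod (w - z) < e -> t w <= a + d0.
 move=> [hz hza] hw hwz.
 have := He1 w z hw hz (lt_le_trans hwz _); rewrite ge_min lexx orbT => /(_ isT).
 by rewrite -realCN -realCD cmodR => /ler_normlP[_ h]; lra.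
have lipk z w : N z -> cmod w <= 1 -> cmod (w - z) < e -> cmod (kap w - kap z) < m0.
 move=> Nz hw hwz.
 have E : w = z + (w - z) by ring.
 have := @mvt_seg R kap z (w - z) (m0 / 2).
 rewrite -E => H; apply: le_lt_trans (H _) _.
  move=> s hs; have hz := Nz.1; have hsw := seg_norm hs hz hw.
  have hts : t (z + s%:C * (w - z)) <= a + d0.
   apply: (near z) => //; rewrite addrC addKr cmodM cmodR; apply: le_lt_trans hwz.
   by case/andP: hs => s0 s1; rewrite ger0_norm // ler_piMl ?cge0.
  by have [_ [p [q [W b]]]] := Hk _ hsw hts; exists p, q.
 have e1' : e <= 1 by rewrite ge_min lexx.
 have c0 := cge0 (w - z).
 by nra.
(* One representative value of kap for each grid cell that meets the region; cells that do not meet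
   it get an idle value. *)
have [v Hv] : exists v : 'I_n -> C, forall i z, N z -> cmod (z - c i) < e / 2 -> exists2 z', N z' /\ cmod (z' - c i) < e / 2 & v i = kap z'.
 have h (i : 'I_n) : exists y, forall z, N z -> cmod (z - c i) < e / 2 -> exists2 z', N z' /\ cmod (z' - c i) < e / 2 & y = kap z'.
  have [[z' [Nz' hz']]|Hno] := pselect (exists z', N z' /\ cmod (z' - c i) < e / 2).
   by exists (kap z') => z _ _; exists z'.
  by exists 0 => z Nz hz; exfalso; apply: Hno; exists z.
 by have [v Hv] := choice h; exists v.
have [u0 hu0 Hu0] := unimod_avoid v.
have away z : N z -> kap z != u0.
 move=> Nz; have [i Hi] := Hc z Nz.1.
 have [z' [Nz' hz'] vE] := Hv i z Nz Hi.
 have h1 : cmod (z - z') < e.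
  have -> : z - z' = (z - c i) + (c i - z') by ring.
  by apply: le_lt_trans (cmodD _ _) _; rewrite (cmodBC (c i)); lra.
 have h2 := lipk z' z Nz' Nz.1 h1; apply/eqP => E.
 by have := Hu0 i; rewrite vE -E leNgt => /negP; apply.
have hu : cmod (- u0) = 1 by rewrite cmodN.
have [c0 c0b Hc0] := unimod_arg hu.
(* A rotation that moves the missed value u0 to -1, the singular point of [Arg]. *)
pose kp z := - cj u0 * kap z.
have kpE z : - u0 * kp z = kap z.
 by rewrite /kp mulrA mulrNN mulcJ hu0 expr1n mul1r.
exists (fun z=> Arg (kp z) + c0); split.
 move=> z; apply: le_trans (ler_normD _ _) _; have := Arg_bound (kp z); lra.
move=> z hz hza [d d1 Hd].
have Nz : N z by [].
have [_ [p [q [W _]]]] := Hk z hz ltac:(move: hza dd0; lra).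
have ck : ccont kp z by apply: ccontM; [exact: ccont_cst|exact: ccont_wd W].
have kp1 w : cmod (kap w) = 1 -> cmod (kp w) = 1 by move=> h; rewrite /kp cmodM cmodN cmodJ hu0 mul1r.
have kz1 : cmod (kap z) = 1 by apply: Hd; rewrite subrr cmod0.
have re_pos : 0 < 1 + Re (kp z).
 have h1 := ler_Re_cmod (- kp z); rewrite cReN cmodN kp1 // in h1.
 rewrite lt_def; apply/andP; split; last lra.
 apply/eqP => E; have E2 := cmod_sqE (kp z); rewrite kp1 // expr1n in E2.
 have r1 : Re (kp z) = -1 by lra.
 have i0 : Im (kp z) = 0.
  by apply/eqP; rewrite -sqrf_eq0; apply/eqP; move: E2; rewrite r1; lra.
 have kpm : kp z = -1 by apply: cx_eq; rewrite ?r1 ?i0 //= oppr0.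
 by have := away z Nz; rewrite -kpE kpm mulrNN mulr1 eqxx.
have re2 : 0 < (1 + Re (kp z)) / 2 by lra.
have [d2 d20 D2] := ck _ re2.
have ren : 1 + Re (- cj u0 * kap z) != 0 by rewrite -/(kp z) gt_eqF.
have [P HP] := wd_Arg (wdZ (- cj u0) W) ren.
exists (Num.min d (Num.min d2 d2)); first by rewrite !lt_min d1 d20.
split; last first.
 exists P; apply: (@wd_ext _ (fun z=> (Arg (kp z))%:C + c0%:C)); first by move=> w; rewrite realCD.
 by apply: wd_eq (wdD HP (wd_cst c0%:C z)); rewrite addr0.
move=> w; rewrite !lt_min => /andP[w1 /andP[w2 _]].
have kw := Hd w w1.
have hre : 1 + Re (kp w) != 0.
 have := D2 (w - z) w2; rewrite (addrC z) subrK => h.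
 have := le_trans (cmod_Re _) h; rewrite cReD cReN ler_norml => /andP[h1 _].
 by rewrite gt_eqF //; lra.
by rewrite realCD mulrDr expCD Hc0 expC_Arg ?kp1 // mulrC kpE.
Qed.

End Arg.

(** Here and in [num_lin] the letters a, f, y stand for the moduli of the z-derivative of V, of f'
    and of g', so that the last factor is [Qmaj]. *)
Lemma num_sq (R : realType) (a y m c f : R) : 0 <= f -> 2 + 2 * m ^+ 2 <= c -> (a + m * y) ^+ 2 <= c * (a ^+ 2 + f ^+ 2 + y ^+ 2 + 1).
Proof.
move=> f0 hc; apply: (@le_trans _ _ ((2 + 2 * m ^+ 2) * (a ^+ 2 + y ^+ 2))).
 have q1 := sqr_ge0 (a - m * y); have q2 := mulr_ge0 (sqr_ge0 m) (sqr_ge0 a).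
 have q3 := sqr_ge0 y.
 have -> : (a + m * y) ^+ 2 = 2 * (a ^+ 2 + m ^+ 2 * y ^+ 2) - (a - m * y) ^+ 2 by ring.
 by lra.
apply: ler_pM => //.
- by have := sqr_ge0 m; lra.
- by rewrite addr_ge0 ?sqr_ge0.
- by have := sqr_ge0 f; lra.
Qed.

Lemma num_lin (R : realType) (a f y al c1 B K be m2 t : R) : 0 <= a -> 0 <= y -> 0 <= al -> 0 <= c1 -> 0 <= B -> 0 <= K -> 0 <= be -> 0 <= m2 ->
 t <= 7 * (y * a) + (al * y ^+ 2 + c1 * f ^+ 2 + 1) + B * (12 * y ^+ 2) + (K * y + be * y ^+ 2) ->
 t <= (2 + 2 * m2 + (7 / 2 + al + c1 + 1 + 12 * B + K + be)) * (a ^+ 2 + f ^+ 2 + y ^+ 2 + 1).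
Proof.
move=> a0 y0 al0 c10 B0 K0 be0 m20 /le_trans; apply.
have ay : y * a <= 1 / 2 * (a ^+ 2 + y ^+ 2) by have := sqr_ge0 (a - y); lra.
have y1 : y <= 1 + y ^+ 2 by have := sqr_ge0 (y - 1); lra.
have F0 := sqr_ge0 f; have Y0 := sqr_ge0 y; have A0 := sqr_ge0 a.
have k1' := ler_wpM2l K0 y1.
move: F0 Y0 A0 ay k1'; clear y1; move: (a ^+ 2) (f ^+ 2) (y ^+ 2) (y * a) (K * y) => A F Y w Ky F0 Y0 A0 ay k1'.
have Q0 : 0 <= A + F + Y + 1 by lra.
have hx (p x z : R) : 0 <= p -> 0 <= x -> x <= z -> p * x <= p * z by move=> p1 p2 p3; rewrite ler_wpM2l.
have i1 : al * Y <= al * (A + F + Y + 1) by apply: hx => //; lra.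
have i2 : c1 * F <= c1 * (A + F + Y + 1) by apply: hx => //; lra.
have i3 : B * Y <= B * (A + F + Y + 1) by apply: hx => //; lra.
have i4 : K * (1 + Y) <= K * (A + F + Y + 1) by apply: hx; lra.
have i5 : be * Y <= be * (A + F + Y + 1) by apply: hx => //; lra.
have i6 : 0 <= m2 * (A + F + Y + 1) by rewrite mulr_ge0.
by lra.
Qed.

Lemma num_s (R : realType) (x p y : R) : 0 <= x <= 1 -> 0 <= p <= y -> 0 <= 3 * x ^+ 2 * y ^+ 2 + 6 * x * p ^+ 2 <= 9 * y ^+ 2.
Proof.
move=> /andP[x0 x1] /andP[p0 py].
have p2 : p ^+ 2 <= y ^+ 2 by rewrite lerXn2r ?nnegrE ?(le_trans p0).
have p3 := sqr_ge0 p; have y2 := sqr_ge0 y.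
have x2 : x ^+ 2 <= 1 by rewrite exprn_ile1.
have h1 := ler_wpM2r y2 x2; have h2 := mulr_ge0 (sqr_ge0 x) y2.
have h3 : x * p ^+ 2 <= 1 * y ^+ 2 by apply: ler_pM.
have h4 := mulr_ge0 x0 p3.
by apply/andP; split; lra.
Qed.

(** * The function W and the factor G of its d-bar derivative *)

Section WCore.
Variable R : realType.
Local Notation C := R[i].
Variable D : R.
Hypotheses (D0 : 0 < D) (D1 : D <= 1).
Variables (f f1 f2 g g1 g2 : C -> C).
Hypotheses (Hf : forall r, hol2 r f f1 f2) (Hg : forall r, hol2 r g g1 g2).
Hypotheses (f_le : onD z, cmod (f z) <= 1) (g_le : onD z, cmod (g z) <= 1).
Hypothesis fg : onD z, D <= cmod (f z) ^+ 2 + cmod (g z) ^+ 2.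

Local Notation Tg := (tg g).
Local Notation Xg := (xg D g).
Local Notation Ps := (psi D g).
Local Notation Th := (theta D g).
Local Notation pPs := (ppsi D g g1).
Local Notation Pt := (ptg g g1).
Local Notation Psg := (psg D g g1).
Local Notation Ssg := (ssg D g g1).
Local Notation PL := (pL D f f1).
Local Notation L := (Lf D f).

(** The main part of G is at most |pV| + mW |g'|: a share 4 Bcst comes from the derivative of theta
    and 2 pi Kcut from the cut-off argument. *)
Definition mW : R := 4 * Bcst D + 2 * pi * Kcut D.
Definition cW : R := 2 + 2 * mW ^+ 2 + (7 / 2 + 64 / D * Bcst D + C1 D + 1 + 12 * Bcst D + Kcut D + 2 * pi * Kcut D).
Definition bW : R := Bcst D * (C1 D + 1).
(** The constant of [carleson] plus 1 for the remainder [E], which is estimated without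
    derivatives. *)
Definition CW : R := (1 + 5 / 2 * cW) * Kc (Bcst D) bW + 2.

Lemma wd_cut (H H1 : R -> R) (z : C) : cmod z <= 1 -> (forall t : R, is_derive t 1 H (H1 t)) ->
 wd (fun z=> (H (Tg z))%:C) z ((H1 (Tg z))%:C * Pt z) ((H1 (Tg z))%:C * cj (Pt z)).
Proof. by move=> hz HH; exact: (wd_re_comp (C2wd (C2_tg Hg 1) hz) (HH _)). Qed.

(** W is L + i phi minus i times a cut-off argument. The first part has the d-bar derivative g
    (theta d-bar V - V d-bar theta) up to a small T; the argument makes exp W equal to f exactly
    where g is small and removes T there, so that what is left is divisible by g. *)
Lemma core_W : exists W G pW : C -> C, [/\ con 1 pW, con 1 G, onD z, wd W z (pW z) (g z * G z),
  onD z, `|Re (W z)| <= (lam0 D)^-1 &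
  onD z, Tg z <= D / 16 -> expC (W z) = f z /\ G z = 0] /\
 forall k k1 k2, hol2 1 k k1 k2 -> cmod (Ac 1 (fun z=> G z * k z)) <= CW * Mr 1 (fun z=> cmod (k z)).
Proof.
have d0 := D0; have d1 := D1; have cc1 := C1_ge0 D0.
have [cg cg1] := hol2_con (Hg 1); have cg2 := (Hg 1).1.
have [cf cf1] := hol2_con (Hf 1).
have ct : rc 1 Tg by exact: C2v (C2_tg Hg 1).
have ctf : rc 1 (tf f) by exact: C2v (C2_tf Hf 1).
have d8 : 0 < D / 8 by qlra.
have [tau0 tau00 Hgam] := arg_branch (D / 8) ct d8.
have K0 : 0 < Kcut D by rewrite /Kcut; have := kcut_gt0 D0; qlra.
(* Below 1 for the derivative bounds on [G2], below tau0 / 2 so that the two derivatives of [kap]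
   add up to at most tau0, and below (D/16) / Kcut so that the remainder [E] is at most 1. *)
pose tau := Num.min (Num.min 1 (tau0 / 2)) (D / 16 / Kcut D).
have taup : 0 < tau by rewrite !lt_min ltr01 /=; apply/andP; split; [qlra|rewrite divr_gt0 //; qlra].
have tau1 : tau <= 1 by rewrite /tau !ge_min lexx.
have taut : tau <= tau0 / 2 by rewrite /tau !ge_min lexx orbT.
have tauK : tau * Kcut D <= D / 16 by rewrite -ler_pdivlMr // /tau ge_min lexx orbT.
clearbody tau.
have [V [pV [sV [phi [pphi [KV VB Vs ths [cph Hph]]]]]]] := core_pot D0 D1 Hf Hg f_le g_le fg taup.
have KP : C2 1 Ps pPs (spsi D g g1) by exact: C2_psi.
have KL : C2 1 L PL (sL D f f1) by exact: C2_L.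
have KX : C2 1 (fun z=> Xg z ^+ 3) Psg Ssg by exact: C2_xg3.
have cpV := C2p KV; have csV := C2s KV; have cV := C2v KV.
have cPs := C2v KP; have cpPs := C2p KP; have cPL := C2p KL.
have cX3 := C2v KX; have cPsg := C2p KX; have cSsg := C2s KX.
have cPt : con 1 Pt by exact: C2p (C2_tg Hg 1).
pose T0 z := pphi z - 'i%C * ((Ps z)%:C * pV z - (V z)%:C * pPs z - PL z).
have T0b z : cmod z <= 1 -> cmod (T0 z) <= tau by move=> hz; have [_] := Hph z hz.
have cT0 : con 1 T0 by rewrite /T0; conT.
have phE z : pphi z = T0 z + 'i%C * ((Ps z)%:C * pV z - (V z)%:C * pPs z - PL z) by rewrite /T0 subrK.
clearbody T0.
pose T z := 'i%C * cj (T0 z).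
have cT : con 1 T by rewrite /T; conT.
have Tb z : cmod z <= 1 -> cmod (T z) <= tau by move=> hz; rewrite /T cmodM cmod_i mul1r cmodJ T0b.
pose X0 z := (Ps z)%:C * cj (pV z) - (V z)%:C * cj (pPs z).
(* The contributions of L cancel here; X0 is divisible by g because psi = g theta, and T is the
   error of the potential. *)
have qZ z : cj (PL z) + 'i%C * cj (pphi z) = X0 z + T z.
 rewrite phE /X0 /T; move: (PL z) (pPs z) (pV z) (T0 z) (Ps z) (V z) => l p v t0 x y.
 rewrite conjcD (conjcM 'i%C) conji !conjcD !conjcN !conjcM !conj_real.
 transitivity (cj l + 'i%C * cj t0 - ('i%C * 'i%C) * (x%:C * cj v - y%:C * cj p - cj l)); first by ring.
 by rewrite mulii; ring.
pose Z z := (L z)%:C + 'i%C * (phi z)%:C.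
have wZ z : cmod z <= 1 -> wd Z z (PL z + 'i%C * pphi z) (X0 z + T z).
 move=> hz; have [h _] := Hph z hz; rewrite -qZ.
 by apply: wdD; [exact: C2wd KL _ hz|exact: wdZ].
(* Where |f|^2 > D/4 the real part of Z is log |f|, so kap is unimodular; where moreover g is small,
   X0 vanishes and its derivatives consist of the small terms T0 and T alone. *)
pose kap z := expC (Z z) / f z.
have small z : cmod z <= 1 -> Tg z <= D / 4 -> [/\ D / 4 < tf f z, Xg z = 0, X0 z = 0 & f z != 0].
 move=> hz ht; have := fg hz; rewrite -/(tf f z) -/(tg g z) => h.
 have tfz : D / 4 < tf f z by qlra.
 have x0 : Xg z = 0 by rewrite /xg pos_0 //; qlra.
 split=> //.
 - rewrite /X0 /psi /ppsi /psg x0 !expr0n /= !mulr0 !mul0r !mulr0 addr0.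
  by rewrite conjc0 mulr0 subr0.
 - by apply/eqP => f0; move: tfz; rewrite /tf f0 cmod0 expr0n /=; qlra.
have kap1 w : D / 4 < tf f w -> cmod (kap w) = 1.
 move=> h; have tp : 0 < tf f w by qlra.
 have ft : tf f w = cmod (f w) ^+ 2 by [].
 have fp : 0 < cmod (f w) by rewrite lt_def cge0 andbT; apply/eqP => f0; move: tp; rewrite ft f0 expr0n /= ltxx.
 rewrite /kap cmodM cmodV cmod_expC /Z; have -> : Re ((L w)%:C + 'i%C * (phi w)%:C) = L w by rewrite !(cReD, cReM) /=; ring.
 rewrite /Lf Lf_eq; last exact: ltW.
 have E : expR (2^-1 * ln (tf f w)) = cmod (f w).
  apply/eqP; rewrite -(@eqrXn2 _ 2) ?expR_ge0 ?cge0 // -expRM_natl mulrA mulfV ?mul1r ?pnatr_eq0 //.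
  by rewrite lnK ?posrE.
 by rewrite E mulfV // gt_eqF.
have wkap z : cmod z <= 1 -> Tg z <= D / 4 -> wd kap z (kap z * ('i%C * T0 z)) (kap z * T z).
 move=> hz ht; have [tfz x0 X00 fz] := small z hz ht.
 have [wf _] := (Hf 1).2 z hz.
 have pe : PL z + 'i%C * pphi z = f1 z / f z + 'i%C * T0 z.
  have PLE : PL z = f1 z / f z / 2.
   rewrite /pL Lf_eq; last exact: ltW.
   rewrite /pLam /xf pos_0; last qlra.
   rewrite expr0n /= mulr0 mul0r addr0 (_ : (tf f z)^-1%:C = (f z * cj (f z))^-1); last by rewrite realCV -cmod2_real.
   have cfz : cj (f z) != 0 by rewrite -cmod_gt0 cmodJ cmod_gt0.
   have -> : (2^-1 : R)%:C = 2^-1 :> C by rewrite realCV; congr (_^-1); apply: cx_eq => /=; rewrite ?addr0.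
   by field; rewrite fz cfz.
  rewrite phE /psi /ppsi /psg x0 !expr0n /= !mulr0 !mul0r !mulr0 addr0 !mulr0 subr0 sub0r mulrDr mulrA mulii PLE.
  by field.
 have W0 := wZ z hz; rewrite pe in W0; have W := wdM (wd_comp W0 (wd_expC (Z z))) (wdV wf fz).
 apply: wd_eq W; rewrite /kap ?pe X00 ?conjc0 ?mul0r ?addr0 ?add0r ?oppr0 ?mul0r ?mulr0 ?addr0.
  by field.
 by ring.
have kb z : cmod z <= 1 -> Tg z <= D / 8 + D / 8 -> cmod (kap z) = 1 /\ exists p q, wd kap z p q /\ cmod p + cmod q <= tau0.
 move=> hz ht; have ht' : Tg z <= D / 4 by qlra.
 have [tfz _ _ _] := small z hz ht'; have k1 := kap1 z tfz.
 split=> //; exists (kap z * ('i%C * T0 z)), (kap z * T z); split; first exact: wkap.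
 rewrite !(cmodM (kap z)) k1 !mul1r cmodM cmod_i mul1r; have := T0b z hz; have := Tb z hz; qlra.
have [gam [gamb Hgam']] := Hgam kap kb.
have wgam z : cmod z <= 1 -> Tg z <= D / 8 -> wd (fun z=> (gam z)%:C) z ('i%C * cj (T z)) (cj ('i%C * cj (T z))).
 move=> hz ht; have ht' : Tg z <= D / 4 by qlra.
 have [tfz _ _ _] := small z hz ht'; have k1 := kap1 z tfz.
 have nb : exists2 d : R, 0 < d & forall w, cmod (w - z) < d -> cmod (kap w) = 1.
  have tt : 0 < (tf f z - D / 4) / 2 by qlra.
  have [d dd H] := ctf z hz _ tt; exists d => // w hw; apply: kap1.
  have := H (w - z) hw; rewrite (addrC z) subrK -realCN -realCD cmodR => /ler_normlP[h1 h2]; qlra.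
 have [dd dd0 [Hexp [P wP]]] := Hgam' z hz ht nb.
 have W := wd_comp (wdZ 'i%C wP) (wd_expC ('i%C * (gam z)%:C)).
 have W2 : wd kap z _ _ := wd_loc dd0 Hexp W.
 have [_ E] := wd_uniq W2 (wkap z hz ht').
 have ez : expC ('i%C * (gam z)%:C) = kap z by apply: Hexp; rewrite subrr cmod0.
 have kz : kap z != 0 by rewrite -cmod_gt0 k1.
 have E2 : 'i%C * cj P = T z by apply: (mulfI kz); rewrite -E ez mul0r addr0.
 have -> : 'i%C * cj (T z) = P.
  by rewrite -E2 conjcM conjcK conji mulrA mulrN mulii opprK mul1r.
 exact: wP.
have far z : cmod z <= 1 -> D / 8 < Tg z -> exists2 d : R, 0 < d & forall w, cmod (w - z) < d -> D / 8 <= Tg w.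
 move=> hz ht; have tt : 0 < (Tg z - D / 8) by qlra.
 have [d dd H] := ct z hz _ tt; exists d => // w hw.
 by have := H (w - z) hw; rewrite (addrC z) subrK -realCN -realCD cmodR => /ler_normlP[h1 h2]; qlra.
(* gam is known to be regular only where |g|^2 <= D/8; the factor c vanishes beyond and makes the
   product regular everywhere. *)
have gc (c : R -> R) : (forall t : R, {for t, continuous c}) -> (forall t, D / 8 <= t -> c t = 0) -> rc 1 (fun z=> gam z * c (Tg z)).
 move=> cc c0 z hz; have [h|h] := leP (Tg z) (D / 8).
  apply: (@ccont_ext R (fun z=> (gam z)%:C * (c (Tg z))%:C)); first by move=> w; rewrite realCM.
  apply: ccontM; first exact: ccont_wd (wgam z hz h).
  have H : rc 1 (fun z=> c (Tg z)) by apply: rc_comp; [exact: ct|move=> w _; exact: cc].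
  exact: H.
 have [d dd H] := far z hz h => e e0; exists d => // k hk.
 rewrite !c0 ?mulr0 ?subrr ?cmod0 ?(ltW e0) //; first exact: ltW.
 by apply: H; rewrite addrC addKr.
have wgc (c c' : R -> R) z : (forall t : R, is_derive t 1 c (c' t)) -> (forall t, D / 8 <= t -> c t = 0) -> (forall t, D / 8 <= t -> c' t = 0) -> cmod z <= 1 ->
  wd (fun z=> (gam z * c (Tg z))%:C) z ('i%C * cj (T z) * (c (Tg z))%:C + (gam z * c' (Tg z))%:C * Pt z)
   (cj ('i%C * cj (T z)) * (c (Tg z))%:C + (gam z * c' (Tg z))%:C * cj (Pt z)).
 move=> dc c0 c'0 hz; have [h|h] := leP (Tg z) (D / 8).
  apply: (@wd_ext _ (fun z=> (gam z)%:C * (c (Tg z))%:C)); first by move=> w; rewrite realCM.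
  by apply: wd_eq (wdM (wgam z hz h) (wd_cut hz dc)); rewrite realCM; ring.
 have [d dd H] := far z hz h; apply: (@wd_loc _ (fun=> 0) _ _ _ _ d) => //.
  by move=> w hw; rewrite c0 ?mulr0 //; exact: H.
 apply: wd_eq (wd_cst 0 z); rewrite c0 ?c'0 ?(ltW h) // !mulr0 mul0r addr0 //.
have chigh t : D / 8 <= t -> cut D t = 0 by move=> /(cut_high D0)[].
have chigh1 t : D / 8 <= t -> cut1 D t = 0 by move=> /(cut_high D0)[].
have chigh2 t : D / 8 <= t -> cut2 D t = 0 by move=> /(cut_high D0)[].
have cc0 (t : R) : {for t, continuous (cut D)} by have [] := cut_cont D t.
have cc2 (t : R) : {for t, continuous (cut1 D)} by have [] := cut_cont D t.
have cc3 (t : R) : {for t, continuous (cut2 D)} by have [] := cut_cont D t.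
have cg1c := gc _ cc2 chigh1; have cg2c := gc _ cc3 chigh2.
have ccut : rc 1 (fun z=> cut D (Tg z)) by apply: rc_comp.
have ccut1 : rc 1 (fun z=> cut1 D (Tg z)) by apply: rc_comp.
(* The d-bar derivative of theta. *)
pose qth z := cj (g1 z) * (Xg z ^+ 3)%:C + cj (g z) * cj (Psg z).
pose G1 z := Th z * cj (pV z) - (V z)%:C * qth z.
(* The quotient of T (1 - cut) by g, as conj(g) / |g|^2. The maximum does no harm, since 1 - cut
   vanishes where |g|^2 <= D/16. *)
pose E z := T z * cj (g z) * ((1 - cut D (Tg z)) * (Num.max (Tg z) (D / 16))^-1)%:C.
pose G2 z := (gam z * cut1 D (Tg z))%:C * cj (g1 z).
pose G z := G1 z - 'i%C * G2 z + E z.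
pose W z := Z z - 'i%C * (gam z * cut D (Tg z))%:C.
pose pW z := PL z + 'i%C * pphi z - 'i%C * ('i%C * cj (T z) * (cut D (Tg z))%:C + (gam z * cut1 D (Tg z))%:C * Pt z).
have max0 z : 0 < Num.max (Tg z) (D / 16) by rewrite lt_max; apply/orP; right; qlra.
have cmax : rc 1 (fun z=> (Num.max (Tg z) (D / 16))^-1).
 apply: rcV; last by move=> z _; rewrite gt_eqF.
 have -> : (fun z=> Num.max (Tg z) (D / 16)) = (fun z=> D / 16 + pos (Tg z - D / 16)).
  by apply/funext => z; rewrite /pos maxC addr_maxr addr0 subrKC.
 apply: rcD; first exact: rc_cst.
 by apply: rc_comp; [conT|move=> z _; exact: pos_cont].
have cX : rc 1 Xg by apply: rc_comp; [conT|move=> z _; exact: pos_cont].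
have cqth : con 1 qth by rewrite /qth; conT.
have cTh : con 1 Th by rewrite /theta; conT.
have cE : con 1 E by rewrite /E; conT.
have cG1 : con 1 G1 by rewrite /G1; conT.
have cG2 : con 1 G2 by apply: (@conM _ 1 (fun z=> (gam z * cut1 D (Tg z))%:C)); [exact: cg1c|conT].
have gE z : g z * E z = T z * (1 - cut D (Tg z))%:C.
 rewrite /E; have [h|h] := leP (Tg z) (D / 16).
  by have [-> _ _] := cut_low D0 h; rewrite subrr !mul0r !mulr0.
 have tn : Tg z != 0 by rewrite gt_eqF //; qlra.
 transitivity (T z * (g z * cj (g z)) * ((1 - cut D (Tg z)) * (Tg z)^-1)%:C); first by ring.
 by rewrite -cmod2_real -/(tg g z) -mulrA -realCM mulrCA mulfV // mulr1.
have gG1 z : g z * G1 z = X0 z.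
 rewrite /G1 /X0 /qth /theta /psi /ppsi /ptg conjcD !conjcM !conjcK !conj_real realCM /tg cmod2_real; ring.
exists W, G, pW; split; first split.
- pose gq z := gam z * cut1 D (Tg z).
 rewrite /pW; change (con 1 (fun z=> PL z + 'i%C * pphi z - 'i%C * ('i%C * cj (T z) * (cut D (Tg z))%:C + (gq z)%:C * Pt z))).
 by conT.
- by rewrite /G; conT.
- move=> z hz; have := wdB (wZ z hz) (wdZ 'i%C (wgc _ _ z (cut_derive D) chigh chigh1 hz)).
 apply: wd_eq => //.
 have -> : g z * G z = X0 z - 'i%C * (g z * G2 z) + T z * (1 - cut D (Tg z))%:C by rewrite -gG1 -gE /G; ring.
 rewrite /G2 /ptg conjcM conjcM !conjcK conji.
 move: (T z) (gam z * _)%:C (cut D _) (cj (g1 z)) (g z) (X0 z) => a b c e h x.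
 rewrite realCD realCN (_ : 1%:C = 1 :> C) //.
 transitivity (x + a + ('i%C * 'i%C) * a * c%:C - 'i%C * b * (e * h)); first by ring.
 by rewrite mulii; ring.
- move=> z hz; rewrite /W /Z; have -> : Re ((L z)%:C + 'i%C * (phi z)%:C - 'i%C * (gam z * cut D (Tg z))%:C) = L z.
  by rewrite !(cReD, cReM, cReN) /=; ring.
 exact: Lf_bound.
- move=> z hz ht; have ht' : Tg z <= D / 4 by qlra.
 have ht8 : Tg z <= D / 8 by qlra.
 have [tfz x0 X00 fz] := small z hz ht'; have [c1 c1' c1''] := cut_low D0 ht; split.
  rewrite /W c1 mulr1 expCD expCN.
  have nb : exists2 d : R, 0 < d & forall w, cmod (w - z) < d -> cmod (kap w) = 1.
   have tt : 0 < (tf f z - D / 4) / 2 by qlra.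
   have [d dd H] := ctf z hz _ tt; exists d => // w hw; apply: kap1.
   have := H (w - z) hw; rewrite (addrC z) subrK -realCN -realCD cmodR => /ler_normlP[h1 h2]; qlra.
  have [dd dd0 [Hexp _]] := Hgam' z hz ht8 nb.
  rewrite Hexp ?subrr ?cmod0 // /kap invfM invrK mulrA mulfV ?mul1r // expC_neq0 //.
 have r0 : 0%:C = 0 :> C by [].
 have q0 : qth z = 0 by rewrite /qth /psg x0 !expr0n /= !(mulr0, mul0r, r0, conjc0, addr0).
 have t0 : Th z = 0 by rewrite /theta x0 !expr0n /= r0 mulr0.
 by rewrite /G /G1 /G2 /E q0 t0 c1 c1' subrr !(mulr0, mul0r, r0, subr0, addr0).
move=> k k1 k2 Hk.
have [ck _] := hol2_con Hk.
have [aX caX HaX] := C2wd2 KX; have [aV caV HaV] := C2wd2 KV.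
pose dq z := cj (g1 z) * Psg z + cj (g z) * (Ssg z)%:C.
pose bq z := cj (g2 z) * (Xg z ^+ 3)%:C + cj (g1 z) * cj (Psg z) + (cj (g1 z) * cj (Psg z) + cj (g z) * cj (aX z)).
have wTh z : cmod z <= 1 -> wd Th z (cj (g z) * Psg z) (qth z).
 move=> hz; have [wg _] := (Hg 1).2 z hz.
 by apply: wd_eq (wdM (wd_conj wg) (C2wd KX hz)); rewrite ?conjc0 ?mul0r ?add0r.
have wq z : cmod z <= 1 -> wd qth z (dq z) (bq z).
 move=> hz; have [wg wg1] := (Hg 1).2 z hz.
 by apply: wd_eq (wdD (wdM (wd_conj wg1) (C2wd KX hz)) (wdM (wd_conj wg) (wd_conj (HaX z hz)))); rewrite ?conjc0 ?conj_real ?mul0r ?add0r.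
pose dG1 z := cj (g z) * Psg z * cj (pV z) + Th z * (sV z)%:C - (pV z * qth z + (V z)%:C * dq z).
pose bG1 z := qth z * cj (pV z) + Th z * cj (aV z) - (cj (pV z) * qth z + (V z)%:C * bq z).
have wG1 z : cmod z <= 1 -> wd G1 z (dG1 z) (bG1 z).
 move=> hz; apply: wd_eq (wdB (wdM (wTh z hz) (wd_conj (HaV z hz))) (wdM (C2wd KV hz) (wq z hz))) => //.
 by rewrite conj_real.
pose dG2 z := ('i%C * cj (T z) * (cut1 D (Tg z))%:C + (gam z * cut2 D (Tg z))%:C * Pt z) * cj (g1 z).
pose bG2 z := (cj ('i%C * cj (T z)) * (cut1 D (Tg z))%:C + (gam z * cut2 D (Tg z))%:C * cj (Pt z)) * cj (g1 z) + (gam z * cut1 D (Tg z))%:C * cj (g2 z).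
have wG2 z : cmod z <= 1 -> wd G2 z (dG2 z) (bG2 z).
 move=> hz; have [wg wg1] := (Hg 1).2 z hz.
 by apply: wd_eq (wdM (wgc _ _ z (cut1_derive D) chigh1 chigh2 hz) (wd_conj wg1)); rewrite ?conjc0 ?mulr0 ?addr0.
(* G without E: no derivative of T is under control, so E is kept out of [carleson] and bounded
   directly by [Ar_cmod_le]. *)
pose G0 z := G1 z - 'i%C * G2 z.
pose dG0 z := dG1 z - 'i%C * dG2 z.
pose bG0 z := bG1 z - 'i%C * bG2 z.
have wG0 z : cmod z <= 1 -> wd G0 z (dG0 z) (bG0 z) by move=> hz; apply: wdB; [exact: wG1|apply: wdZ; exact: wG2].
have cdq : con 1 dq by rewrite /dq; conT.
have cbq : con 1 bq by rewrite /bq; conT.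
have cga (c : C -> R) (u : C -> C) : rc 1 (fun z=> gam z * c z) -> con 1 u -> con 1 (fun z=> (gam z * c z)%:C * u z) by move=> h hu; apply: (@conM _ 1 (fun z=> (gam z * c z)%:C)).
have cdG2 : con 1 dG2.
 rewrite /dG2; apply: (@conM _ 1 (fun z=> _ + _)); last by conT.
 by apply: (@conD _ 1 (fun z=> _ * _)); [conT|exact: cga].
have cbG2 : con 1 bG2.
 rewrite /bG2; apply: (@conD _ 1 (fun z=> _ * _)); last by apply: cga => //; conT.
 apply: (@conM _ 1 (fun z=> _ + _)); last by conT.
 by apply: (@conD _ 1 (fun z=> _ * _)); [conT|apply: cga => //; conT].
have cdG0 : con 1 dG0 by rewrite /dG0 /dG1; conT.
have cbG0 : con 1 bG0 by rewrite /bG0 /bG1; conT.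
have B0 : 0 <= Bcst D by rewrite /Bcst; qlra.
have p0 := pi_gt0 R.
have pK : 0 <= 2 * pi * Kcut D by rewrite mulr_ge0 ?(ltW K0) //; qlra.
have BD : 0 <= 64 / D * Bcst D by rewrite mulr_ge0 // divr_ge0 // ltW.
have pieces z : cmod z <= 1 -> [/\ cmod (Psg z) <= 3 * cmod (g1 z), cmod (qth z) <= 4 * cmod (g1 z), cmod (dq z) <= 12 * cmod (g1 z) ^+ 2,
 cmod (Th z) <= 1 & cmod (G2 z) <= 2 * pi * Kcut D * cmod (g1 z) /\ cmod (dG2 z) <= Kcut D * cmod (g1 z) + 2 * pi * Kcut D * cmod (g1 z) ^+ 2].
 move=> hz; have [x0 xt x1 /andP[t0 tt1]] := xg_facts D0 g_le hz.
 have gz := g_le hz; have g0 := cge0 (g z); have y0 := cge0 (g1 z); have y2 := sqr_ge0 (cmod (g1 z)).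
 have x2 : 0 <= Xg z ^+ 2 <= 1 by rewrite exprn_ge0 // exprn_ile1.
 have x3 : 0 <= Xg z ^+ 3 <= 1 by rewrite exprn_ge0 // exprn_ile1.
 have [b0 b1 b2] := cut_bound D0 tt1.
 have ptb : cmod (Pt z) <= cmod (g1 z) by rewrite /ptg cmodM cmodJ -[leRHS]mulr1 ler_wpM2l.
 have Psb : cmod (Psg z) <= 3 * cmod (g1 z).
  rewrite /psg cmodM cmodR ger0_norm; last by qlra.
  by apply: ler_pM => //; [qlra|exact: cge0|qlra].
 have sb : 0 <= Ssg z <= 9 * cmod (g1 z) ^+ 2.
  by apply: num_s; rewrite ?x0 ?cge0.
 split=> //.
 - tri; rewrite !cmodM !cmodJ cmodR ger0_norm; last by case/andP: x3.
  have h1 : cmod (g1 z) * Xg z ^+ 3 <= cmod (g1 z) * 1 by rewrite ler_wpM2l //; case/andP: x3.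
  have h2 : cmod (g z) * cmod (Psg z) <= 1 * (3 * cmod (g1 z)) by apply: ler_pM => //; exact: cge0.
  qlra.
 - tri; rewrite (cmodM (cj (g1 z))) (cmodM (cj (g z))) !cmodJ cmodR ger0_norm; last by case/andP: sb.
  have h1 : cmod (g1 z) * cmod (Psg z) <= cmod (g1 z) * (3 * cmod (g1 z)) by rewrite ler_wpM2l.
  have h2 : cmod (g z) * Ssg z <= 1 * (9 * cmod (g1 z) ^+ 2) by case/andP: sb => *; apply: ler_pM.
  by move: h1; rewrite [cmod (g1 z) ^+ 2]expr2 in h2 *; qlra.
 - rewrite /theta cmodM cmodJ cmodR ger0_norm; last by case/andP: x3.
  by rewrite -[leRHS]mul1r; apply: ler_pM => //; case/andP: x3.
 have gcb (c : R) : `|c| <= Kcut D -> `|gam z * c| <= 2 * pi * Kcut D by move=> hc; rewrite normrM; apply: ler_pM.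
 split.
 - by rewrite /G2 cmodM cmodR cmodJ ler_wpM2r // gcb.
 - rewrite /dG2 cmodM cmodJ.
  have h1 : cmod ('i%C * cj (T z) * (cut1 D (Tg z))%:C + (gam z * cut2 D (Tg z))%:C * Pt z) <= Kcut D + 2 * pi * Kcut D * cmod (g1 z).
   tri; rewrite (cmodM (_ * _)) (cmodM 'i%C) (cmodM (_%:C)) cmod_i mul1r (cmodJ (T z)) !cmodR; apply: lerD.
    by rewrite -[leRHS]mul1r; apply: ler_pM; rewrite ?cge0 //; exact: le_trans (Tb z hz) tau1.
   by apply: ler_pM; rewrite ?cge0 // gcb.
  by have := ler_wpM2r y0 h1; rewrite expr2; qlra.
have bc : 0 <= 7 / 2 + 64 / D * Bcst D + C1 D + 1 + 12 * Bcst D + Kcut D + 2 * pi * Kcut D by move: BD pK; set u := 64 / D * _; set v := 2 * pi * _; qlra.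
have m0 : 0 <= mW by rewrite /mW; qlra.
have c0 : 0 <= cW.
 by rewrite /cW; have := sqr_ge0 mW; qlra.
have b0 : 0 <= bW by rewrite /bW mulr_ge0 //; qlra.
have GQ z : cmod z <= 1 -> cmod (G0 z) ^+ 2 <= cW * Qmaj f1 g1 pV z.
 move=> hz; have [h1 h2 h3 h4 [h5 h6]] := pieces z hz; have Vb := VB z hz.
 have a0 := cge0 (pV z); have y0 := cge0 (g1 z).
 have G0b : cmod (G0 z) <= cmod (pV z) + mW * cmod (g1 z).
  apply: le_trans (cmodB _ _) _; rewrite cmodM cmod_i mul1r.
  have : cmod (G1 z) <= cmod (pV z) + Bcst D * (4 * cmod (g1 z)).
   apply: le_trans (cmodB _ _) _; rewrite (cmodM (Th z)) (cmodM (_%:C)) cmodJ cmodR; apply: lerD.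
    by rewrite -[leRHS]mul1r ler_wpM2r.
   by apply: ler_pM => //; exact: cge0.
  by rewrite /mW; qlra.
 have : cmod (G0 z) ^+ 2 <= (cmod (pV z) + mW * cmod (g1 z)) ^+ 2.
  by rewrite lerXn2r ?nnegrE ?cge0 // addr_ge0 // mulr_ge0.
 move=> /le_trans; apply; apply: num_sq; first exact: cge0.
 by move: bc; rewrite /cW; qlra.
have dGQ z : cmod z <= 1 -> cmod (dG0 z) <= cW * Qmaj f1 g1 pV z.
 move=> hz; have [h1 h2 h3 h4 [h5 h6]] := pieces z hz; have Vb := VB z hz; have ht := ths z hz.
 have a0 := cge0 (pV z); have y0 := cge0 (g1 z).
 have g0 := cge0 (g z); have gz := g_le hz.
 have e1 : cmod (cj (g z) * Psg z * cj (pV z)) <= 3 * (cmod (g1 z) * cmod (pV z)).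
  rewrite (cmodM (_ * _)) (cmodM (cj (g z))) !cmodJ mulrA ler_wpM2r //.
  by rewrite -[leRHS]mul1r; apply: ler_pM => //; exact: cge0.
 have e2 : cmod (Th z * (sV z)%:C) <= 64 / D * Bcst D * cmod (g1 z) ^+ 2 + C1 D * cmod (f1 z) ^+ 2 + 1.
  by move: ht; rewrite (cmodM (Th z)) cmodR normrM (ger0_norm (cge0 _)).
 have e3 : cmod (pV z * qth z) <= 4 * (cmod (g1 z) * cmod (pV z)).
  by rewrite (cmodM (pV z)); have := ler_wpM2l a0 h2; clear h3 h6; qlra.
 have e4 : cmod ((V z)%:C * dq z) <= Bcst D * (12 * cmod (g1 z) ^+ 2).
  by rewrite (cmodM (_%:C)) cmodR; apply: ler_pM => //; exact: cge0.
 have tot : cmod (dG0 z) <= 7 * (cmod (g1 z) * cmod (pV z)) + (64 / D * Bcst D * cmod (g1 z) ^+ 2 + C1 D * cmod (f1 z) ^+ 2 + 1) + Bcst D * (12 * cmod (g1 z) ^+ 2) +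
  (Kcut D * cmod (g1 z) + 2 * pi * Kcut D * cmod (g1 z) ^+ 2).
  apply: le_trans (cmodB _ _) _; rewrite (cmodM 'i%C) cmod_i mul1r.
  have := cmodB (cj (g z) * Psg z * cj (pV z) + Th z * (sV z)%:C) (pV z * qth z + (V z)%:C * dq z).
  have := cmodD (cj (g z) * Psg z * cj (pV z)) (Th z * (sV z)%:C).
  have := cmodD (pV z * qth z) ((V z)%:C * dq z).
  by rewrite -/(dG1 z); move: e2; set u := 64 / D; qlra.
 by apply: num_lin tot => //; [exact: ltW|exact: sqr_ge0].
have main := carleson (Hf 1) (Hg 1) Hk f_le g_le B0 b0 c0 KV VB Vs cdG0 cbG0 wG0 GQ dGQ.
have cG0 : con 1 G0 by rewrite /G0; conT.
have A1 := posf_Ar (@ltr01 R).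
have -> : (fun z=> G z * k z) = (fun z=> G0 z * k z + E z * k z) by apply/funext => z; rewrite /G /G0 mulrDl.
rewrite /Ac (cID A1); [|by conT|by conT].
tri.
have Eb : cmod (Ac 1 (fun z=> E z * k z)) <= Mr 1 (fun z=> cmod (k z)).
 have cEk : con 1 (fun z=> E z * k z) by conT.
 apply: le_trans (cI_norm A1 cEk) _; rewrite -[leRHS]mul1r; apply: le_trans (Ar_cmod_le Hk).
 apply: (posf_le A1); [by conT|by conT|move=> z hz].
 rewrite cmodM -[leRHS]mul1r ler_wpM2r ?cge0 //.
 have [x0 xt x1 /andP[t0 tt1]] := xg_facts D0 g_le hz; have [b1 _ _] := cut_bound D0 tt1.
 rewrite /E (cmodM (_ * _)) (cmodM (T z)) cmodJ cmodR normrM normfV (gtr0_norm (max0 z)).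
 have d16 : 0 < D / 16 by qlra.
 have i1 : (Num.max (Tg z) (D / 16))^-1 <= (D / 16)^-1 by rewrite lef_pV2 ?posrE ?max0 // le_max lexx orbT.
 have s1 : cmod (T z) * cmod (g z) <= tau * 1 by apply: ler_pM; rewrite ?cge0 //; [exact: Tb|exact: g_le].
 have s2 : `|1 - cut D (Tg z)| * (Num.max (Tg z) (D / 16))^-1 <= Kcut D * (D / 16)^-1.
  by apply: ler_pM => //; rewrite invr_ge0 ltW.
 have s3 : cmod (T z) * cmod (g z) * (`|1 - cut D (Tg z)| * (Num.max (Tg z) (D / 16))^-1) <= tau * 1 * (Kcut D * (D / 16)^-1).
  apply: ler_pM => //; first by rewrite mulr_ge0 ?cge0.
  by rewrite mulr_ge0 // invr_ge0 ltW.
 apply: le_trans s3 _; rewrite mulr1 mulrA ler_pdivrMr // mul1r //.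
move: main; rewrite /CW -/(Ac 1 _) => main; apply: le_trans (lerD main Eb) _.
by rewrite [in leRHS](_ : 2 = 1 + 1) // addrA [in leRHS]mulrDl mul1r.
Qed.

End WCore.

(** * Hahn-Banach extension from analytic to trigonometric polynomials *)

Section HB.
Variable R : realType.
Local Notation C := R[i].
Implicit Types (p q : {poly C}) (z : C).

Lemma wd_horner p z : wd (fun z=> p.[z]) z p^`().[z] 0.
Proof.
elim/poly_ind: p => [|p c IH].
 by apply: (@wd_ext _ (fun=> 0)) => [w|]; rewrite ?horner0 // deriv0 horner0; exact: wd_cst.
apply: (@wd_ext _ (fun z=> p.[z] * z + c)); first by move=> w; rewrite hornerMXaddC.
by apply: wd_eq (wdD (wdM IH (wd_id z)) (wd_cst c z)); rewrite ?derivMXaddC ?hornerE; ring.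
Qed.
Lemma hol2_horner r p : hol2 r (fun z=> p.[z]) (fun z=> p^`().[z]) (fun z=> p^`()^`().[z]).
Proof. by split=> z hz; [exact: ccont_wd (wd_horner _ _)|split; exact: wd_horner]. Qed.

Lemma con_horner r p : con r (fun z=> p.[z]).
Proof. by move=> z hz; exact: ccont_wd (wd_horner _ _). Qed.
Lemma Mr_ext (r : R) (u v : C -> R) : 0 <= r -> (forall z, cmod z = r -> u z = v z) -> Mr r u = Mr r v.
Proof. by move=> r0 E; apply: RI_eq => t _; rewrite E // cmod_circ. Qed.

Lemma Mr_le_circ (r : R) (u v : C -> R) : 0 < r -> rc r u -> rc r v -> (forall z, cmod z = r -> u z <= v z) -> Mr r u <= Mr r v.
Proof.
move=> r0 cu cv H; have M1 := posf_Mr r0; have cb := rcB cv cu.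
rewrite -subr_ge0 -(posfB M1) // (@Mr_ext r _ (fun z=> `|v z - u z|)) ?(ltW r0) //; last first.
 by move=> z hz; rewrite ger0_norm // subr_ge0 H.
apply: posf_ge0 M1 _ _ => //; apply: rc_ext (rc_cmod cb) => z.
by rewrite cmodR.
Qed.
Lemma Mr_le (u v : C -> R) : rc 1 u -> rc 1 v -> (forall z, cmod z = 1 -> u z <= v z) -> Mr 1 u <= Mr 1 v.
Proof. exact: Mr_le_circ ltr01. Qed.

Definition pm p : R := Mr 1 (fun z=> cmod p.[z]).

Lemma rc_pm p : rc 1 (fun z=> cmod p.[z]).
Proof. exact: rc_cmod (con_horner p). Qed.

Lemma pmD p q : pm (p + q) <= pm p + pm q.
Proof.
have M1 := posf_Mr (@ltr01 R); have cp := rc_pm p; have cq := rc_pm q.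
rewrite /pm -(posfD M1) //; apply: (posf_le M1); [exact: rc_pm|exact: rcD|].
by move=> z hz; rewrite hornerD cmodD.
Qed.

Lemma pmZ (c : C) p : pm (c *: p) = cmod c * pm p.
Proof.
have M1 := posf_Mr (@ltr01 R); rewrite /pm -(posfZ M1); last exact: rc_pm.
by congr Mr; apply/funext => z; rewrite hornerZ cmodM.
Qed.

Lemma pmX p : pm ('X * p) = pm p.
Proof.
apply: Mr_ext => // z hz; by rewrite hornerM hornerX cmodM hz mul1r.
Qed.

Lemma gap_real (T : Type) (t0 : T) (a b : T -> R) : (forall s t, a s <= b t) -> exists c, forall t, a t <= c <= b t.
Proof.
move=> H; have E0 : has_sup (range a).
 split; first by exists (a t0), t0.
 by exists (b t0) => _ [s _ <-].
exists (sup (range a)) => t; apply/andP; split.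
 by apply: sup_upper_bound => //; exists t.
by apply: ge_sup; [exact: E0.1|move=> _ [s _ <-]].
Qed.

(** The real one-dimensional extension step: subadditivity leaves a nonempty interval for the value
    at v. The subspace is given by an embedding [e], so that quotients and subtypes of polynomials
    are avoided. *)
Lemma one_step (V W : lmodType C) (e : W -> V) (phi : W -> R) (n : V -> R) (v : V) :
 (forall x y, e (x + y) = e x + e y) -> (forall (r : R) x, e (r%:C *: x) = r%:C *: e x) ->
 (forall x y, phi (x + y) = phi x + phi y) -> (forall (r : R) x, phi (r%:C *: x) = r * phi x) ->
 (forall x y, n (x + y) <= n x + n y) -> (forall (r : R) x, 0 <= r -> n (r%:C *: x) = r * n x) ->
 (forall x, phi x <= n (e x)) ->
 exists c : R, forall x (r : R), phi x + r * c <= n (e x + r%:C *: v).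
Proof.
move=> eD eZ pD pZ nD nZ bd.
have [s t|c Hc] := @gap_real W 0 (fun s=> phi s - n (e s - v)) (fun t=> n (e t + v) - phi t).
 rewrite lerBlDr addrAC lerBrDr -pD; apply: le_trans (bd _) _.
 have -> : e (s + t) = (e t + v) + (e s - v) by rewrite eD addrACA subrr addr0 addrC.
 exact: nD.
exists c => x r; have [r0|r0|->] := ltrgtP r 0; last by rewrite mul0r addr0 scale0r addr0.
- have r1 : 0 < - r by rewrite oppr_gt0.
 have /andP[+ _] := Hc ((- r)^-1%:C *: x); rewrite pZ eZ.
 have -> : (- r)^-1%:C *: e x - v = (- r)^-1%:C *: (e x + r%:C *: v).
  rewrite scalerDr scalerA -realCM invrN mulNr mulVf ?lt_eqF // realCN.
  by rewrite realCN (_ : 1%:C = 1 :> C) // scaleN1r.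
 by rewrite nZ ?invr_ge0 ?(ltW r1) // -mulrBr mulrC ler_pdivrMr // mulrN; lra.
- have /andP[_] := Hc (r^-1%:C *: x); rewrite pZ eZ.
 have -> : r^-1%:C *: e x + v = r^-1%:C *: (e x + r%:C *: v).
  by rewrite scalerDr scalerA -realCM mulVf ?gt_eqF // (_ : 1%:C = 1 :> C) // scale1r.
 by rewrite nZ ?invr_ge0 ?(ltW r0) // -mulrBr mulrC ler_pdivlMr //; lra.
Qed.

Record pfun (K : R) (l : {poly C} -> C) : Prop := {
 pfunD : forall p q, l (p + q) = l p + l q;
 pfunZ : forall c p, l (c *: p) = c * l p;
 pfun_le : forall p, cmod (l p) <= K * pm p }.

Lemma polyX_split p : p = 'X * drop_poly 1 p + (p`_0)%:P.
Proof. by apply/polyP => -[|i]; rewrite coefD coefXM coef_drop_poly coefC /= ?add0r ?addr0 ?addn1. Qed.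

(** Multiplication by X is an isometry on the circle, so l is also a functional on the multiples of
    X; only the constants are missing, one complex dimension, added in the real directions 1 and
    i. *)
Lemma hahn_banach_X K l : 0 <= K -> pfun K l -> exists2 l', pfun K l' & forall q, l' ('X * q) = l q.
Proof.
move=> K0 [lD lZ lb]; pose n p := K * pm p.
have nD p q : n (p + q) <= n p + n q by rewrite /n -mulrDr ler_wpM2l // pmD.
have nZ (r : R) p : 0 <= r -> n (r%:C *: p) = r * n p.
 by move=> r0; rewrite /n pmZ cmodR ger0_norm // mulrCA.
have Re0 (r : R) (w : C) : Re (r%:C * w) = r * Re w by rewrite cReM /=; ring.
have [c1 H1] : exists c : R, forall x (r : R), Re (l x) + r * c <= n ('X * x + r%:C *: 1).
 apply: one_step => //.
 - by move=> x y; rewrite mulrDr.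
 - by move=> r x; rewrite scalerAr.
 - by move=> x y; rewrite lD cReD.
 - by move=> r x; rewrite lZ Re0.
 - by move=> x; apply: le_trans (ler_Re_cmod _) _; rewrite /n pmX.
have [c2 H2] : exists c : R, forall (x : {poly C} * (C^o)%type) (r : R),
 (Re (l x.1) + Re x.2 * c1) + r * c <= n (('X * x.1 + (Re x.2)%:C *: 1) + r%:C *: ('i%C *: 1)).
 apply: one_step => //.
 - by move=> x y /=; rewrite cReD realCD scalerDl mulrDr addrACA.
 - by move=> r x /=; rewrite Re0 realCM -scalerA scalerDr scalerAr.
 - by move=> x y /=; rewrite lD !cReD mulrDl addrACA.
 - by move=> r x /=; rewrite lZ !Re0 mulrDr mulrA.
pose c : C := c1 -i* c2.
pose l' p := c * p`_0 + l (drop_poly 1 p).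
have lD' p q : l' (p + q) = l' p + l' q by rewrite /l' coefD drop_polyD lD; ring.
have lZ' a p : l' (a *: p) = a * l' p by rewrite /l' coefZ drop_polyZ lZ; ring.
have lR p : Re (l' p) <= n p.
 have := H2 (drop_poly 1 p, ((Re p`_0)%:C : C^o)) (Im p`_0).
 have Hp : 'X * drop_poly 1 p + (Re p`_0)%:C *: 1 + (Im p`_0)%:C *: ('i%C *: 1) = p.
  rewrite -addrA scalerA -scalerDl [RHS]polyX_split; congr (_ + _).
  by rewrite alg_polyC; congr (_%:P); apply: cx_eq; rewrite !(cReD, cImD, cReM, cImM) /=; ring.
 by rewrite /= Hp; apply: le_trans; rewrite /l' cReD cReM /=; lra.
exists l'; last by move=> q; rewrite /l' coefXM mulr0 add0r mulrC -['X]expr1 drop_polyMXn_id.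
split=> // p; have [->|h] := eqVneq (l' p) 0.
 by rewrite cmod0 mulr_ge0 // (posf_ge0 (posf_Mr ltr01)) // => [|z _]; [exact: rc_pm|exact: cge0].
have h0 : 0 < cmod (l' p) by rewrite cmod_gt0.
(* Rotation by a unimodular constant carries the bound from the real part of l' over to its
   modulus. *)
pose e := (cmod (l' p))%:C / l' p.
have e1 : cmod e = 1 by rewrite /e cmodM cmodV cmodR ger0_norm ?cge0 // mulfV // gt_eqF.
have := lR (e *: p); rewrite lZ' /e mulfVK // /n pmZ -/e e1 mul1r //.
Qed.

(** [L n p] is the value of the extended functional at z^(-n) p, which explains the compatibility
    relation; the norm does not grow. *)
Lemma hahn_banach_seq K l : 0 <= K -> pfun K l -> exists L : nat -> {poly C} -> C,
 [/\ L 0%N = l, forall n, pfun K (L n) & forall n q, L n.+1 ('X * q) = L n q].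
Proof.
move=> K0 Hl.
have H (u : {l : {poly C} -> C | pfun K l}) : exists u' : {l : {poly C} -> C | pfun K l}, forall q, sval u' ('X * q) = sval u q.
 by case: u => u hu; have [u' hu' E] := hahn_banach_X K0 hu; exists (exist _ u' hu').
have [F HF] := choice H.
exists (fun n=> sval (iter n F (exist _ l Hl))); split=> // n; last by move=> q; exact: HF.
exact: svalP.
Qed.

Lemma pfun_mulXn (L : nat -> {poly C} -> C) : (forall n q, L n.+1 ('X * q) = L n q) ->
 forall m n q, L (m + n)%N ('X^m * q) = L n q.
Proof.
move=> H m n q; elim: m => [|m IH]; first by rewrite expr0 mul1r.
by rewrite addSn exprS -mulrA H.
Qed.

End HB.

(** * The Poisson kernel and the analytic function given by a functional *)

Section PoissonKernel.
Variable R : realType.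
Local Notation C := R[i].
Implicit Types (a z : C).

(** On the circle this is (1 - |a|^2) / |z - a|^2 by [pk_circ]; the form through [ck] is continuous
    on the closed disc. *)
Definition pk a z : R := 2 * Re (ck a z) - 1.

Lemma pkE a z : (pk a z)%:C = ck a z + cj (ck a z) - 1.
Proof. by rewrite /pk; case: (ck a z) => x y; apply: cx_eq => /=; ring. Qed.
Lemma rc_pk a : cmod a < 1 -> rc 1 (pk a).
Proof. by move=> ha; have H := con_ck ha; rewrite /pk; conT. Qed.

Lemma pk_circ a z : cmod a < 1 -> cmod z = 1 -> pk a z * cmod (z - a) ^+ 2 = 1 - cmod a ^+ 2.
Proof.
move=> ha hz.
have n0 : 1 - a * cj z != 0 by apply: ck_neq0; rewrite ?hz.
have -> : cmod (z - a) = cmod (1 - a * cj z).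
 have -> : z - a = z * (1 - a * cj z) by rewrite mulrBr mulr1 mulrCA mulcJ hz expr1n mulr1.
 by rewrite cmodM hz mul1r.
have n1 : cj (1 - a * cj z) != 0 by rewrite -cmod_gt0 cmodJ cmod_gt0.
have E := pkE a z.
suff : (pk a z * cmod (1 - a * cj z) ^+ 2)%:C = (1 - cmod a ^+ 2)%:C :> C by move=> [].
rewrite realCM E -mulcJ /ck.
have -> : cj (1 - a * cj z)^-1 = (cj (1 - a * cj z))^-1 by exact: fmorphV.
transitivity (cj (1 - a * cj z) + (1 - a * cj z) - (1 - a * cj z) * cj (1 - a * cj z)).
 by move: n0 n1; set x := 1 - _; set y := cj _ => n0 n1; field; rewrite n0 n1.
rewrite conjcD conjcN conjcM conjcK (_ : cj 1 = 1 :> C); last by apply: cx_eq; rewrite /= ?oppr0.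
transitivity (1 - a * cj a * (z * cj z)); first by ring.
by rewrite !mulcJ hz expr1n mulr1 realCD realCN.
Qed.

Lemma pk_ge0 a z : cmod a < 1 -> cmod z = 1 -> 0 <= pk a z.
Proof.
move=> ha hz; have E := pk_circ ha hz.
have a2 : 0 < 1 - cmod a ^+ 2 by have := cge0 a; rewrite subr_gt0; move=> h; rewrite expr_lt1.
have := sqr_ge0 (cmod (z - a)); rewrite le_eqVlt => /orP[/eqP h|h].
 by move: a2; rewrite -E -h mulr0 ltxx.
by rewrite -(pmulr_lge0 _ h) E ltW.
Qed.

(** The truncated Fourier series of the Poisson kernel: on the circle its product with z^N is a
    polynomial, to which a functional on polynomials applies. *)
Definition pkN a N z : C := \sum_(n < N.+1) a ^+ n * cj z ^+ n + \sum_(n < N) cj a ^+ n.+1 * z ^+ n.+1.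

Lemma con_pkN a N : con 1 (pkN a N).
Proof. by apply: conD; apply: con_sum => i; conT. Qed.

Lemma pkN_close a N z : cmod a < 1 -> cmod z <= 1 -> cmod (pkN a N z - (pk a z)%:C) <= 2 * (cmod a ^+ N.+1 / (1 - cmod a)).
Proof.
move=> ha hz; have E := ck_geo N.+1 ha hz.
set S := \sum_(i < N.+1) _ in E.
have -> : pkN a N z = S + (cj S - 1).
 congr (_ + _); rewrite /S big_ord_recl !expr0 mulr1 conjcD (_ : cj 1 = 1 :> C); last by apply: cx_eq; rewrite /= ?oppr0.
 rewrite [RHS]addrC addrA addNr add0r [RHS](rmorph_sum cj) /=; apply: eq_bigr => i _.
 by rewrite [RHS]conjcM !conjX conjcK.
have Ep := pkE a z.
have -> : S + (cj S - 1) - (pk a z)%:C = - ((ck a z - S) + cj (ck a z - S)).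
 by rewrite Ep conjcD conjcN; ring.
rewrite cmodN; tri; rewrite cmodJ -mulr2n -[leLHS]mulr_natl ler_pM2l ?ltr0n //.
rewrite E addrC addKr !cmodM !cmodX cmodJ ler_wpM2l ?exprn_ge0 ?cge0 //.
rewrite /ck cmodV.
have h1 : 1 - cmod a <= cmod (1 - a * cj z).
 have := cmodD3 1 (a * cj z); rewrite cmod1 cmodM cmodJ.
 have : cmod a * cmod z <= cmod a * 1 by rewrite ler_wpM2l ?cge0.
 by lra.
apply: le_trans (_ : 1 * (cmod (1 - a * cj z))^-1 <= _).
 by rewrite ler_wpM2r ?invr_ge0 ?cge0 // exprn_ile1 ?cge0.
by rewrite mul1r lef_pV2 // posrE //; lra.
Qed.

Lemma Mr_pk a : cmod a < 1 -> Mr 1 (pk a) = 2 * pi.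
Proof.
move=> ha; have M1 := posf_Mr (@ltr01 R); have cc := con_ck ha.
have cR := rc_Re cc; have H2 : rc 1 (fun z=> 2 * Re (ck a z)) by conT.
rewrite /pk (posfB M1) //; last exact: rc_cst.
rewrite (posfZ M1) // Mr1; suff -> : Mr 1 (fun z=> Re (ck a z)) = 2 * pi by ring.
suff : Mc 1 (ck a) = (2 * pi)%:C by move=> E; rewrite -[LHS]/(Re (Mc 1 (ck a))) E.
apply/eqP; rewrite -subr_eq0 -cmod_eq0; apply/negPn/negP => n0.
have n1 : 0 < cmod (Mc 1 (ck a) - (2 * pi)%:C) by rewrite lt_def n0 cge0.
have p0 := pi_gt0 R.
have q01 : 0 <= cmod a < 1 by rewrite cge0.
have KK := con_bdd cc; have [K K0 HK] := KK.
have e0' : 0 < cmod (Mc 1 (ck a) - (2 * pi)%:C) / (2 * (K * (2 * pi))) by apply: divr_gt0 => //; npos.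
have [N HN] := pow_small q01 e0'.
have e0 := HN N.+1 (leqnSn N).
have E : Mc 1 (ck a) - (2 * pi)%:C = a ^+ N.+1 * Mc 1 (fun z=> cj z ^+ N.+1 * ck a z).
 have cS i : con 1 (fun z=> a ^+ i * cj z ^+ i) by conT.
 have cT : con 1 (fun z=> cj z ^+ N.+1 * ck a z) by conT.
 have -> : Mc 1 (ck a) = Mc 1 (fun z=> \sum_(n < N.+1) a ^+ n * cj z ^+ n + a ^+ N.+1 * (cj z ^+ N.+1 * ck a z)).
  by apply: Mc_ext => // z hz; rewrite -ck_geo // hz.
 rewrite /Mc (cID M1); [|by apply: con_sum => i; exact: cS|by conT].
 rewrite (cIZ _ M1 cT) (cI_sum _ M1) // big_ord_recl big1 ?addr0.
  have -> : (fun z : C => a ^+ @ord0 N * cj z ^+ @ord0 N) = fun=> 1 by apply/funext => z; rewrite !expr0 mul1r.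
  have -> : cI (Mr 1) (fun _ : C => 1) = (2 * pi)%:C by rewrite [LHS](Mc_cst 1) // mulr1.
  by rewrite addrC addKr.
 move=> i _; rewrite (cIZ _ M1); last by conT.
 by rewrite [X in _ * X](Mc_cpow i (@ltr01 R)) mulr0.
move: n1; rewrite E cmodM cmodX => n1.
have : cmod (Mc 1 (fun z=> cj z ^+ N.+1 * ck a z)) <= K * (2 * pi).
 rewrite -(@Mr1 R 1); apply: (cI_le M1); first by conT.
 move=> z hz; rewrite cmodM cmodX cmodJ -[leRHS]mul1r; apply: ler_pM => //; rewrite ?exprn_ge0 ?cge0 //.
  by rewrite exprn_ile1 ?cge0.
 exact: HK.
move: e0; rewrite E cmodM cmodX ler_pdivlMr; last by npos.
move: n1; set x := cmod a ^+ _; set y := cmod _; set w := K * _ => n1 h1 h2.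
have x0 : 0 <= x by rewrite exprn_ge0 // cge0.
have h3 : x * y <= x * w by rewrite ler_wpM2l.
by have := h1; rewrite mulrCA; lra.
Qed.

Lemma poisson_close (v : C -> C) (e : R) : con 1 v -> 0 < e -> exists2 d : R, 0 < d & inD a, 1 - d < cmod a ->
 cmod (Mc 1 (fun z=> v z * (pk a z)%:C) - (2 * pi)%:C * v a) <= 2 * pi * e.
Proof.
move=> cv e0; have M1 := posf_Mr (@ltr01 R); have p0 := pi_gt0 R.
have e2 : 0 < e / 2 by lra.
have [d d0 Hd] := con_unif cv e2; have [B B0 HB] := con_bdd cv.
(* Far from a, where |z - a| >= d, the difference is at most 2 B <= K |z - a|^2, and |z - a|^2 times
   the kernel is 1 - |a|^2, which is small near the circle. *)
pose K := 2 * B / d ^+ 2; have K0 : 0 < K by rewrite /K; npos.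
exists (e / 4 / K) => [|a ha had]; first by npos.
have cp := rc_pk ha.
have c2 : con 1 (fun z=> v z * (pk a z)%:C) by conT.
have c3 : con 1 (fun z=> v a * (pk a z)%:C) by conT.
have -> : (2 * pi)%:C * v a = Mc 1 (fun z=> v a * (pk a z)%:C).
 have -> : Mc 1 (fun z=> v a * (pk a z)%:C) = v a * Mc 1 (fun z=> (pk a z)%:C) by exact: (cIZ _ M1).
 by rewrite Mc_real Mr_pk // mulrC.
rewrite /Mc -(cIB M1) //; have c4 : con 1 (fun z=> v z * (pk a z)%:C - v a * (pk a z)%:C) by conT.
apply: le_trans (cI_norm M1 c4) _.
apply: (@le_trans _ _ (Mr 1 (fun z=> (e / 2) * pk a z + (K * (1 - cmod a ^+ 2)))));
 last first.
 rewrite (posfD M1); [|by conT|exact: rc_cst].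
 rewrite (posfZ M1) // Mr_pk // (posf_cst _ M1) Mr1.
 have : K * (1 - cmod a ^+ 2) <= e / 2.
  rewrite mulrC -ler_pdivlMr //.
  have : 1 - cmod a ^+ 2 <= 2 * (e / 4 / K) by nra.
  by move=> h; apply: le_trans h _; rewrite mulrA ler_wpM2r ?invr_ge0 ?(ltW K0) //; lra.
 set x := K * _ => hx; have : x * (2 * pi) <= e / 2 * (2 * pi) by rewrite ler_wpM2r //; lra.
 by lra.
apply: Mr_le; [exact: rc_cmod|by conT|move=> z hz].
have k0 := pk_ge0 ha hz; have E := pk_circ ha hz.
have -> : e / 2 * pk a z + K * (1 - cmod a ^+ 2) = (e / 2 + K * cmod (z - a) ^+ 2) * pk a z by rewrite -E; ring.
rewrite -mulrBl cmodM cmodR ger0_norm // ler_wpM2r //.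
have [h|h] := ltP (cmod (z - a)) d.
 have := Hd z a _ (ltW ha) h; rewrite hz lexx => /(_ isT) h1; apply: le_trans h1 _.
 by rewrite lerDl mulr_ge0 ?sqr_ge0 // ltW.
have h1 : cmod (v z - v a) <= 2 * B.
 have z1 : cmod z <= 1 by rewrite hz.
 by apply: le_trans (cmodB _ _) _; have := HB z z1; have := HB a (ltW ha); lra.
apply: le_trans h1 _; apply: (@le_trans _ _ (K * d ^+ 2)).
 by rewrite /K mulfVK // gt_eqF // exprn_gt0.
have : K * d ^+ 2 <= K * cmod (z - a) ^+ 2.
 by rewrite ler_wpM2l ?(ltW K0) // lerXn2r // nnegrE ?cge0 ?ltW.
lra.
Qed.

Lemma poisson_close_re (v : C -> R) (e : R) : rc 1 v -> 0 < e -> exists2 d : R, 0 < d & inD a, 1 - d < cmod a ->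
 `|Mr 1 (fun z=> v z * pk a z) - 2 * pi * v a| <= 2 * pi * e.
Proof.
move=> cv e0; have [d d0 H] := poisson_close cv e0; exists d => // a ha had.
have := H a ha had; have -> : (fun z=> (v z)%:C * (pk a z)%:C) = (fun z=> (v z * pk a z)%:C) by apply/funext => z; rewrite realCM.
by rewrite Mc_real -realCM -realCN -realCD cmodR.
Qed.

(* The power series with the nonpositive Fourier coefficients of a functional that annihilates the positive
 frequencies is its Poisson integral. *)
Lemma functional_series (W : C -> C) (g : {poly C}) (K : R) (L : nat -> {poly C} -> C) : con 1 W -> 0 <= K ->
 (forall n, pfun K (L n)) -> (forall n q, L n.+1 ('X * q) = L n q) ->
 (forall n, Mc 1 (fun z=> W z * z ^+ n.+1) + L 0%N (g * 'X^n) = 0) ->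
 exists h c, [/\ PS c h, forall n, (2 * pi)%:C * c n = Mc 1 (fun z=> cj z ^+ n * W z) + L n.+1 g &
 inD a, cmod ((2 * pi)%:C * h a - Mc 1 (fun z=> W z * (pk a z)%:C)) <= K * Mr 1 (fun z=> cmod g.[z] * pk a z)].
Proof.
move=> cW K0 HL LX an.
have M1 := posf_Mr (@ltr01 R); have p0 := pi_gt0 R; have [B B0 HB] := con_bdd cW.
pose tp : R := 2 * pi; have tp0 : 0 < tp by rewrite /tp; lra.
have tpC : tp%:C != 0 :> C by rewrite -cmod_gt0 cmodR gtr0_norm.
pose c n : C := tp%:C^-1 * (Mc 1 (fun z=> cj z ^+ n * W z) + L n.+1 g).
have cE n : tp%:C * c n = Mc 1 (fun z=> cj z ^+ n * W z) + L n.+1 g by rewrite /c mulrA mulfV // mul1r.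
have cb n : cmod (c n) <= tp^-1 * (B * tp + K * pm g).
 rewrite /c cmodM cmodV cmodR gtr0_norm // ler_wpM2l ?invr_ge0 ?(ltW tp0) //.
 tri; apply: lerD; last exact: pfun_le (HL _) _.
 rewrite -[X in _ * X](@Mr1 R 1); apply: (cI_le M1); first by conT.
 move=> z hz; rewrite cmodM cmodX cmodJ -[leRHS]mul1r; apply: ler_pM; rewrite ?exprn_ge0 ?cge0 ?HB //.
 by rewrite exprn_ile1 ?cge0.
have [r /andP[r0 r1]|h Hh] := @PS_exists R c.
 exists (tp^-1 * (B * tp + K * pm g) + 1) => [|n].
  by have := cb 0%N; have := cge0 (c 0%N); lra.
 have : cmod (c n) * r ^+ n <= cmod (c n) * 1 by rewrite ler_wpM2l ?cge0 // exprn_ile1 // ltW.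
 by have := cb n; lra.
exists h, c; split=> // a ha.
pose Q N : {poly C} := \sum_(n < N.+1) a ^+ n *: 'X^(N - n) + \sum_(n < N) cj a ^+ n.+1 *: 'X^(N.+1 + n).
have QE N z : cmod z = 1 -> (Q N).[z] = z ^+ N * pkN a N z.
 move=> hz; rewrite /Q /pkN hornerD !horner_sum mulrDr !mulr_sumr; congr (_ + _); apply: eq_bigr => i _; rewrite hornerZ hornerXn.
  rewrite mulrCA; congr (_ * _); have iN : (i <= N)%N by rewrite -ltnS.
  have -> : z ^+ N = z ^+ (N - i) * z ^+ i by rewrite -exprD subnK.
  by rewrite -mulrA -exprMn mulcJ hz expr1n expr1n mulr1.
 by rewrite mulrCA -exprD addSn addnS.
have LQ N : L N.+1 (g * Q N) = \sum_(n < N.+1) a ^+ n * L n.+1 g + \sum_(n < N) cj a ^+ n.+1 * L 0%N (g * 'X^n).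
 have Lsum (I : Type) (s : seq I) (F : I -> {poly C}) m : L m (\sum_(i <- s) F i) = \sum_(i <- s) L m (F i).
  elim: s => [|i s IH]; last by rewrite !big_cons (pfunD (HL m)) IH.
  by rewrite !big_nil -(scale0r (0 : {poly C})) (pfunZ (HL m)) mul0r.
 rewrite /Q mulrDr (pfunD (HL _)) !mulr_sumr !Lsum; congr (_ + _); apply: eq_bigr => i _; rewrite -scalerAr (pfunZ (HL _)); congr (_ * _).
  have iN : (i <= N)%N by rewrite -ltnS.
  by rewrite mulrC -[in RHS](pfun_mulXn LX (N - i) i.+1) addnS subnK.
 by rewrite exprD mulrCA -[X in L X _]addn0 pfun_mulXn.
have cpk := rc_pk ha.
(* The positive frequencies of pkN drop out by annihilation, so that the partial sum of the series
   is the functional evaluated at the truncated kernel. *)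
have PN N : tp%:C * psum c a N.+1 = Mc 1 (fun z=> W z * pkN a N z) + L N.+1 (g * Q N).
 have -> : Mc 1 (fun z=> W z * pkN a N z) = \sum_(n < N.+1) a ^+ n * Mc 1 (fun z=> cj z ^+ n * W z) + \sum_(n < N) cj a ^+ n.+1 * Mc 1 (fun z=> W z * z ^+ n.+1).
  have -> : (fun z=> W z * pkN a N z) = (fun z=> \sum_(n < N.+1) a ^+ n * (cj z ^+ n * W z) + \sum_(n < N) cj a ^+ n.+1 * (W z * z ^+ n.+1)).
   apply/funext => z; rewrite /pkN mulrDr !mulr_sumr; congr (_ + _); apply: eq_bigr => i _; ring.
  rewrite /Mc (cID M1); [|by apply: con_sum => i; conT|by apply: con_sum => i; conT].
  by rewrite !(cI_sum _ M1); [congr (_ + _); apply: eq_bigr => i _; rewrite (cIZ _ M1) //; conT|move=> i; conT|move=> i; conT].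
 rewrite LQ addrACA -!big_split /= [X in _ = _ + X]big1 ?addr0; last by move=> i _; rewrite -mulrDr an mulr0.
 rewrite /psum mulr_sumr; apply: eq_bigr => i _; rewrite -mulrDr -cE; ring.
have cg := rc_pm g.
have [Bg Bg0 HBg] := con_bdd (con_horner (r := 1) g).
apply/ler_addgt0Pr => e e0.
pose e1 := e / (tp + B * tp + K * (Bg * tp)).
have den : 0 < tp + B * tp + K * (Bg * tp).
 have h1 : 0 < B * tp by npos.
 have h2 : 0 < Bg * tp by npos.
 have h3 := mulr_ge0 K0 (ltW h2); lra.
have e10 : 0 < e1 by rewrite /e1 divr_gt0.
have [N1 HN1] := Hh.2 a ha _ e10.
have k0 : 0 < 1 - cmod a by lra.
have q01 : 0 <= cmod a < 1 by rewrite cge0.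
have e2' : 0 < e1 / 2 * (1 - cmod a) by npos.
have [N2 HN2] := pow_small q01 e2'.
pose N := maxn N1 N2.
have b1 : cmod (psum c a N.+1 - h a) <= e1 by apply: HN1; rewrite leqW // leq_maxl.
have b2 z : cmod z <= 1 -> cmod (pkN a N z - (pk a z)%:C) <= e1.
 move=> hz; apply: le_trans (pkN_close N ha hz) _.
 have := HN2 N.+1 _; rewrite leqW ?leq_maxr // => /(_ isT); rewrite -ler_pdivrMr //; lra.
have cN := con_pkN a N.
have b3 : cmod (Mc 1 (fun z=> W z * pkN a N z) - Mc 1 (fun z=> W z * (pk a z)%:C)) <= B * e1 * tp.
 rewrite /Mc -(cIB M1); [|by conT|by conT]; rewrite -[X in _ * X](@Mr1 R 1); apply: (cI_le M1); first by conT.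
 by move=> z hz; rewrite -mulrBr cmodM; apply: ler_pM; rewrite ?cge0 ?HB ?b2.
have b4 : cmod (L N.+1 (g * Q N)) <= K * (Mr 1 (fun z=> cmod g.[z] * pk a z) + Bg * e1 * tp).
 apply: le_trans (pfun_le (HL _) _) _; rewrite ler_wpM2l //.
 rewrite (_ : Bg * e1 * tp = Mr 1 (fun=> Bg * e1)); last first.
  by rewrite (posf_cst _ M1) Mr1.
 have cgk : rc 1 (fun z=> cmod g.[z] * pk a z) by exact: rcM.
 rewrite -(posfD M1) //; last exact: rc_cst.
 apply: Mr_le; [exact: rc_pm|by apply: rcD => //; exact: rc_cst|move=> z hz].
 have hz1 : cmod z <= 1 by rewrite hz.
 rewrite hornerM cmodM QE // cmodM cmodX hz expr1n mul1r.
 have := cmodD3 (pkN a N z) (pk a z)%:C; rewrite cmodR ger0_norm ?pk_ge0 // => h1.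
 have h2 := b2 z hz1; have h3 : cmod (pkN a N z) <= pk a z + e1 by lra.
 apply: le_trans (ler_wpM2l (cge0 _) h3) _; rewrite mulrDr lerD2l.
 by rewrite ler_wpM2r ?(ltW e10) // HBg.
have E : tp%:C * h a - Mc 1 (fun z=> W z * (pk a z)%:C) = L N.+1 (g * Q N) + (Mc 1 (fun z=> W z * pkN a N z) - Mc 1 (fun z=> W z * (pk a z)%:C)) - tp%:C * (psum c a N.+1 - h a).
 by rewrite mulrBr PN; ring.
rewrite -/tp E; apply: le_trans (cmodB _ _) _; have := cmodD (L N.+1 (g * Q N)) (Mc 1 (fun z=> W z * pkN a N z) - Mc 1 (fun z=> W z * (pk a z)%:C)).
have b5 : cmod (tp%:C * (psum c a N.+1 - h a)) <= tp * e1 by rewrite cmodM cmodR gtr0_norm // ler_wpM2l // ltW.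
have eE : e = tp * e1 + B * e1 * tp + K * (Bg * e1 * tp) by rewrite /e1; field; exact: lt0r_neq0.
by rewrite eE; move: b3 b4 b5; rewrite mulrDr; lra.
Qed.

End PoissonKernel.

(** * Removable singularities, division by roots, and the maximum modulus *)

Section Division.
Variable R : realType.
Local Notation C := R[i].
Implicit Types (a z : C) (F f u v W G : C -> C) (s : seq C).

Lemma ccont_loc u v z (d : R) : 0 < d -> (forall w, cmod (w - z) < d -> u w = v w) -> ccont v z -> ccont u z.
Proof.
move=> d0 E H e e0; have [d' d'0 D'] := H e e0.
have m0 : 0 < Num.min d d' by rewrite lt_min d0.
exists (Num.min d d') => // h; rewrite lt_min => /andP[h1 h2].
by rewrite !E ?subrr ?cmod0 //; [exact: D'|rewrite addrC addKr].
Qed.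

Lemma PS_shift c f : PS c f -> exists2 g, PS (fun n=> c n.+1) g & inD z, f z = c 0%N + z * g z.
Proof.
move=> [H1 H2]; have [r /andP[r0 r1]|g Hg] := @PS_exists R (fun n=> c n.+1).
 have [|K K0 HK] := H1 r; first by rewrite r0.
 exists (K / r); first by rewrite divr_gt0.
 by move=> n; rewrite ler_pdivlMr // -mulrA -exprSr.
exists g => // z hz; apply: (@lim_uniq _ (fun n=> psum c z n.+1)).
 by move=> e e0; have [N HN] := H2 z hz e e0; exists N => n Nn; apply: HN; exact: leqW.
move=> e e0; have [N HN] := Hg.2 z hz e e0; exists N => n /HN h.
have -> : psum c z n.+1 = c 0%N + z * psum (fun n=> c n.+1) z n.
 rewrite /psum big_ord_recl expr0 mulr1 mulr_sumr; congr (_ + _); apply: eq_bigr => i _.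
 by rewrite exprS mulrCA.
rewrite opprD addrACA subrr add0r -mulrBr cmodM -[leRHS]mul1r.
by apply: ler_pM; rewrite ?cge0 // ltW.
Qed.

Definition dquot F d a z : C := if z == a then d else (F z - F a) / (z - a).

Lemma dquotE F d a z : F z = F a + (z - a) * dquot F d a z.
Proof.
rewrite /dquot; have [->|h] := eqVneq z a; first by rewrite subrr mul0r addr0.
by rewrite mulrC mulfVK ?subr_eq0 // addrC subrK.
Qed.

Lemma dquot_wd F d a z p q : z != a -> wd F z p q ->
 wd (dquot F d a) z (p / (z - a) - (F z - F a) / (z - a) ^+ 2) (q / (z - a)).
Proof.
move=> za HF; have z1 : z - a != 0 by rewrite subr_eq0.
have := wdM (wdB HF (wd_cst (F a) z)) (wdV (wdB (wd_id z) (wd_cst a z)) z1).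
move=> H; apply: wd_loc (_ : 0 < cmod (z - a)) _ (wd_eq _ _ H); first by rewrite cmod_gt0.
- move=> w hw; rewrite /dquot ifN //; apply/eqP => wa.
 by move: hw; rewrite wa cmodBC ltxx.
- by field.
- by field.
Qed.

(* Removable singularity: near [a], [F] is a power series in [z - a]. *)
Lemma dquot_holo F d q a (r : R) : 0 < r -> (forall z, cmod (z - a) < r -> exists p, wd F z p 0) -> wd F a d q ->
 exists p1, forall z, cmod (z - a) < r -> wd (dquot F d a) z (p1 z) 0 /\ ccont p1 z.
Proof.
move=> r0 HF Fd; have rC : r%:C != 0 :> C by rewrite -cmod_gt0 cmodR gtr0_norm.
pose f w := F (a + r%:C * w).
have sc (w : C) : cmod w < 1 -> cmod (a + r%:C * w - a) < r.
 by move=> hw; rewrite addrAC subrr add0r cmodM cmodR gtr0_norm // -[ltRHS]mulr1 ltr_pM2l.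
have wa w : wd (fun w=> a + r%:C * w) w r%:C 0.
 by apply: wd_eq (wdD (wd_cst a w) (wdZ r%:C (wd_id w))); rewrite ?add0r ?mulr1 ?mulr0 ?addr0.
have hf : holo f.
 move=> w hw; have [p Hp] := HF _ (sc w hw); exists (p * r%:C).
 by apply: wd_eq (wd_comp (wa w) Hp); rewrite ?mul0r ?mulr0 ?addr0.
have [c Hc] := holo_PS hf; have [g Hg fg] := PS_shift Hc.
have [g1 Hg1] := PS_exists (dcoef_bound Hg.1).
pose L z := (z - a) / r%:C.
have Ls z : cmod (z - a) < r -> cmod (L z) < 1.
 by move=> hz; rewrite /L cmodM cmodV cmodR gtr0_norm // ltr_pdivrMr // mul1r.
have wL z : wd L z r%:C^-1 0.
 by apply: wd_eq (wdM (wdB (wd_id z) (wd_cst a z)) (wd_cst r%:C^-1 z)); rewrite ?subr0 ?mul1r ?mulr0 ?mul0r ?addr0.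
have FL z : cmod (z - a) < r -> F z = F a + (z - a) * (g (L z) / r%:C).
 move=> hz; have E w : cmod w < 1 -> f w = f 0 + w * g w.
  by move=> hw; rewrite fg // [f 0]fg ?cmod0 // mul0r addr0.
 have := E (L z) (Ls z hz); rewrite /f mulr0 addr0 /L mulrCA mulfV // mulr1 addrC subrK => ->.
 by rewrite -mulrA (mulrC _^-1).
pose k z := g (L z) / r%:C; pose k1 z := g1 (L z) / r%:C ^+ 2.
have wk z : cmod (z - a) < r -> wd k z (k1 z) 0.
 move=> hz; have := wdM (wd_comp (wL z) (PS_derive Hg Hg1 (Ls z hz))) (wd_cst r%:C^-1 z).
 by apply: wd_eq; rewrite /k1 ?mulr0 ?mul0r ?addr0 ?mul0r //; field.
have ka : k a = d.
 have h0 : cmod (a - a) < r by rewrite subrr cmod0.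
 have H := wdD (wd_cst (F a) a) (wdM (wdB (wd_id a) (wd_cst a a)) (wk a h0)).
 have H2 := wd_loc (v := F) r0 (fun z hz => esym (FL z hz)) H.
 by have [+ _] := wd_uniq Fd H2; rewrite subrr mul0r addr0 add0r subr0 mul1r.
have dk z : cmod (z - a) < r -> dquot F d a z = k z.
 move=> hz; rewrite /dquot; have [->|za] := eqVneq z a; first by rewrite ka.
 by rewrite FL // addrAC subrr add0r mulrC mulKf // subr_eq0.
exists k1 => z hz.
have rz : 0 < r - cmod (z - a) by lra.
split.
 apply: wd_loc rz _ (wk z hz) => w hw; apply/esym/dk.
 by have := cmodD (w - z) (z - a); rewrite addrA subrK; lra.
apply: ccontM; last exact: ccont_cst.
have [p Hp] := PS_holo Hg1 (Ls z hz).
by apply: (ccont_comp (v := g1)); [exact: ccont_wd (wL z)|exact: ccont_wd Hp].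
Qed.

Lemma holo_dquot F d a : holo F -> cmod a < 1 -> wd F a d 0 -> holo (dquot F d a).
Proof.
move=> hF ha Fd z hz; have [->|za] := eqVneq z a.
 have r0 : 0 < 1 - cmod a by lra.
 have [z' hz'|p1 H] := dquot_holo r0 _ Fd.
  by apply: hF; have := cmodD3 z' a; lra.
 by exists (p1 a); have [] := H a; rewrite ?subrr ?cmod0.
have [p Hp] := hF z hz; exists (p / (z - a) - (F z - F a) / (z - a) ^+ 2).
by apply: wd_eq (dquot_wd d za Hp) => //; rewrite mul0r.
Qed.

Lemma cmod_le_closure u v a (r K : R) : 0 < r -> 0 <= K -> ccont u a -> ccont v a ->
 (forall z, cmod (z - a) < r -> z != a -> cmod (u z) <= K * cmod (v z)) -> cmod (u a) <= K * cmod (v a).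
Proof.
move=> r0 K0 cu cv H; apply/ler_addgt0Pr => e e0.
have e1 : 0 < e / (1 + K) by rewrite divr_gt0 //; lra.
have [d1 d10 D1] := cu _ e1; have [d2 d20 D2] := cv _ e1.
pose m := Num.min r (Num.min d1 d2); have m0 : 0 < m by rewrite !lt_min r0 d10.
pose h : C := (m / 2)%:C.
have hc : cmod h = m / 2 by rewrite cmodR gtr0_norm //; lra.
have [m1 m2 m3] : [/\ m <= r, m <= d1 & m <= d2] by rewrite /m !ge_min !lexx !orbT.
have hn : h != 0 by rewrite -cmod_gt0 hc; lra.
have := D1 h; have := D2 h; rewrite hc => /(_ ltac:(lra)) h2 /(_ ltac:(lra)) h1.
have := H (a + h); rewrite addrAC subrr add0r hc => /(_ ltac:(lra)) h3.
have {}h3 := h3 (_ : a + h != a); rewrite -subr_eq0 addrAC subrr add0r in h3; have {}h3 := h3 hn.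
have h4 := cmodD3 (u a) (u (a + h)); have h5 := cmodD3 (v (a + h)) (v a).
rewrite cmodBC in h4.
have h6 : K * cmod (v (a + h)) <= K * (cmod (v a) + e / (1 + K)) by rewrite ler_wpM2l //; lra.
have eE : e = e / (1 + K) + K * (e / (1 + K)) by field; rewrite gt_eqF //; lra.
by move: h1 h2 h6 eE; rewrite mulrDr; set w := e / (1 + K); lra.
Qed.

Definition rprod s z : C := \prod_(b <- s) (z - b).

Lemma rprod_cons b s z : rprod (b :: s) z = (z - b) * rprod s z.
Proof. by rewrite /rprod big_cons. Qed.

Lemma wd_rprod s z : exists p, wd (rprod s) z p 0.
Proof.
elim: s => [|b s [p IH]].
 by exists 0; apply: (@wd_ext _ (fun=> 1)); [move=> w; rewrite /rprod big_nil|exact: wd_cst].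
exists (1 * rprod s z + (z - b) * p); apply: (@wd_ext _ (fun z=> (z - b) * rprod s z)).
 by move=> w; rewrite rprod_cons.
by apply: wd_eq (wdM (wdB (wd_id z) (wd_cst b z)) IH); rewrite ?subr0 ?mul0r ?mulr0 ?addr0.
Qed.

Lemma holo_factor s F : holo F -> (forall b, b \in s -> cmod b < 1) ->
 (forall r : R, 0 < r < 1 -> exists2 K : R, 0 <= K & forall z, cmod z < r -> cmod (F z) <= K * cmod (rprod s z)) ->
 exists2 y, holo y & inD z, F z = rprod s z * y z.
Proof.
elim: s F => [|b s IH] F hF hs H.
 by exists F => // z _; rewrite /rprod big_nil mul1r.
have hb : cmod b < 1 by apply: hs; rewrite inE eqxx.
have [d Fd] := hF b hb.
have Fb : F b = 0.
 have b1 : 0 < (1 + cmod b) / 2 < 1 by have := cge0 b; lra.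
 have [K K0 HK] := H _ b1.
 have := HK b; rewrite rprod_cons subrr mul0r cmod0 mulr0 => /(_ ltac:(have := cge0 b; lra)) h.
 by apply/eqP; rewrite -cmod_eq0 eq_le h cge0.
have hd := holo_dquot hF hb Fd.
have [c cs|r /andP[r0 r1]|y hy Ey] := IH (dquot F d b) hd.
- by apply: hs; rewrite inE cs orbT.
- pose t := Num.max r ((1 + cmod b) / 2).
 have [rt bt] : r <= t /\ (1 + cmod b) / 2 <= t by rewrite /t !le_max !lexx !orbT.
 have t1 : 0 < t < 1 by rewrite (lt_le_trans r0) // /t gt_max r1; lra.
 have [K K0 HK] := H t t1; exists K => // z hz.
 have off w : w != b -> cmod w < t -> cmod (dquot F d b w) <= K * cmod (rprod s w).
  move=> wb wt; have := HK w wt; rewrite rprod_cons cmodM (dquotE F d b) Fb add0r cmodM mulrCA ler_pM2l //.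
  by rewrite cmod_gt0 subr_eq0.
 have [->|zb] := eqVneq z b; last by apply: off => //; lra.
 have e0 : 0 < (1 - cmod b) / 2 by lra.
 apply: cmod_le_closure e0 K0 _ _ _.
 + by have [p /ccont_wd] := hd b hb.
 + by have [p /ccont_wd] := wd_rprod s b.
 + by move=> w hw wb; apply: off => //; have := cmodD3 w b; lra.
- exists y => // z hz; rewrite (dquotE F d b) Fb add0r Ey // rprod_cons mulrA //.
Qed.

Lemma coef_bound c f (r K : R) : PS c f -> 0 < r < 1 -> (forall w, cmod w = r -> cmod (f w) <= K) ->
 forall m, cmod (c m) * r ^+ m <= K.
Proof.
move=> Hc hr Hb m; have /andP[r0 r1] := hr; have p0 := pi_gt0 R; have Mrr := posf_Mr r0.
have cy : con r f by exact: PS_con Hc r1.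
have h : cmod (Mc r (fun z=> cj z ^+ m * f z)) <= r ^+ m * K * (2 * pi).
 have cc : con r (fun z=> cj z ^+ m * f z) by conT.
 apply: le_trans (cI_norm Mrr cc) _; rewrite -(@Mr1 R r) -(posf_cst _ Mrr).
 apply: Mr_le_circ => //; [exact: rc_cmod|exact: rc_cst|move=> w hw].
 by rewrite cmodM cmodX cmodJ hw ler_wpM2l ?exprn_ge0 ?(ltW r0) // Hb.
move: h; rewrite (PS_coef m Hc hr) cmodM cmodR ger0_norm; last by rewrite mulr_ge0 ?exprn_ge0 ?(ltW r0) //; lra.
have -> : 2 * pi * r ^+ (2 * m) * cmod (c m) = (2 * pi * r ^+ m) * (cmod (c m) * r ^+ m) by rewrite mul2n -addnn exprD; ring.
have -> : r ^+ m * K * (2 * pi) = (2 * pi * r ^+ m) * K by ring.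
by rewrite ler_pM2l //; npos.
Qed.

(* Landau's trick: estimate the coefficients of all powers of [y]. *)
Lemma max_modulus y (K r0 : R) : 0 < K -> r0 < 1 -> holo y ->
 (forall z, r0 < cmod z -> cmod z < 1 -> cmod (y z) <= K) -> inD z, cmod (y z) <= K.
Proof.
move=> K0 r01 hy Hb z hz; rewrite leNgt; apply/negP => hK.
pose r := (1 + Num.max 0 (Num.max r0 (cmod z))) / 2.
have [h1 h2 h3] : [/\ 0 <= Num.max 0 (Num.max r0 (cmod z)), r0 <= Num.max 0 (Num.max r0 (cmod z)) & cmod z <= Num.max 0 (Num.max r0 (cmod z))].
 by rewrite !le_max !lexx !orbT.
have h4 : Num.max 0 (Num.max r0 (cmod z)) < 1 by rewrite !gt_max ltr01 r01.
have [r00 rr zr r1] : [/\ 0 < r, r0 < r, cmod z < r & r < 1] by rewrite /r; split; lra.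
have rr1 : 0 < r < 1 by rewrite r00.
have hyn n : holo (fun z=> y z ^+ n).
 move=> w hw; have [p Hp] := hy w hw; exists (n%:R * y w ^+ n.-1 * p).
 by apply: wd_eq (wdX n Hp) => //; rewrite mulr0.
have zr1 : 0 < 1 - cmod z / r by rewrite subr_gt0 ltr_pdivrMr // mul1r.
(* The coefficients of y^n are at most K^n / r^m, and the geometric factor in |z| / r does not
   depend on n; so n-th powers defeat it. *)
have bound n : cmod (y z) ^+ n <= K ^+ n / (1 - cmod z / r).
 have [c Hc] := holo_PS (hyn n).
 have cb m : cmod (c m) * r ^+ m <= K ^+ n.
  apply: (coef_bound Hc rr1) => w hw; rewrite cmodX lerXn2r ?nnegrE ?cge0 ?(ltW K0) //.
  by apply: Hb; rewrite hw.
 have := PS_tail Hc rr1 cb zr 0; rewrite /psum big_ord0 sub0r cmodN cmodX expr0 mulr1 //.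
have q01 : 0 <= K / cmod (y z) < 1.
 have := lt_trans K0 hK => y0; by rewrite divr_ge0 ?ltW //= ltr_pdivrMr // mul1r.
have e0 : 0 < (1 - cmod z / r) / 2 by lra.
have [N HN] := pow_small q01 e0.
have y0 := lt_trans K0 hK.
have := HN N (leqnn N); have := bound N; rewrite ler_pdivlMr // expr_div_n ler_pdivrMr ?exprn_gt0 //.
have : 0 < cmod (y z) ^+ N by rewrite exprn_gt0.
by set x := cmod (y z) ^+ N => x0 b1 b2; have := mulr_gt0 x0 zr1; lra.
Qed.

End Division.

(** * The analytic function attached to W, and its divisibility *)

Section DbarSolution.
Variable R : realType.
Local Notation C := R[i].
Implicit Types (a z : C) (F f u v W : C -> C) (s : seq C) (g : {poly C}).
Variables (G : C -> C) (K : R) (L : nat -> {poly C} -> C).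
Hypotheses (cG : con 1 G) (K0 : 0 <= K) (HL : forall n, pfun K (L n)) (LX : forall n q, L n.+1 ('X * q) = L n q).
Hypothesis L0 : forall q, L 0%N q = - 2 * Ac 1 (fun z=> G z * q.[z]).

(** h is recorded by its coefficients, since [sol_div] compares those of two such functions. The
    shift to [L n.+1] matches [dbar_annihilates], where W z^(n+1) is paired with g z^n. *)
Definition sol g W h := exists pW c, [/\ con 1 pW, onD z, wd W z (pW z) (g.[z] * G z), PS c h &
 forall n, (2 * pi)%:C * c n = Mc 1 (fun z=> cj z ^+ n * W z) + L n.+1 g].

Lemma sol_con g W h : sol g W h -> con 1 W.
Proof. by move=> [pW [c [_ H _ _]]] z hz; exact: ccont_wd (H z hz). Qed.
Lemma sol_holo g W h : sol g W h -> holo h.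
Proof. by move=> [pW [c [_ _ H _]]]; exact: PS_holo H. Qed.

(** Green's formula for z^n W: the area term is minus the functional [L 0%N] at g X^n. *)
Lemma dbar_annihilates g W pW : con 1 pW -> (onD z, wd W z (pW z) (g.[z] * G z)) ->
 forall n, Mc 1 (fun z=> W z * z ^+ n.+1) + L 0%N (g * 'X^n) = 0.
Proof.
move=> cp HW n; have cgG : con 1 (fun z=> g.[z] * G z) by apply: conM => //; exact: con_horner.
have cW : con 1 W by move=> z hz; exact: ccont_wd (HW z hz).
have cq : con 1 (fun z=> z ^+ n * (g.[z] * G z)) by apply: conM => //; conT.
have cpp : con 1 (fun z=> n%:R * z ^+ n.-1 * 1 * W z + z ^+ n * pW z) by conT.
have H z : cmod z <= 1 -> wd (fun z=> z ^+ n * W z) z (n%:R * z ^+ n.-1 * 1 * W z + z ^+ n * pW z) (z ^+ n * (g.[z] * G z)).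
 by move=> hz; apply: wd_eq (wdM (wdX n (wd_id z)) (HW z hz)) => //; rewrite mulr0 mul0r add0r.
have := green (@ltr01 R) cpp cq H; rewrite L0.
have -> : (fun z=> z * (z ^+ n * W z)) = (fun z=> W z * z ^+ n.+1) by apply/funext => z; rewrite exprS; ring.
have -> : (fun z=> z ^+ n * (g.[z] * G z)) = (fun z=> G z * (g * 'X^n).[z]) by apply/funext => z; rewrite hornerM hornerXn; ring.
by move=> ->; rewrite mulNr addrN.
Qed.

Lemma sol_exists g W pW : con 1 pW -> (onD z, wd W z (pW z) (g.[z] * G z)) ->
 exists2 h, sol g W h & forall a, cmod a < 1 ->
  cmod ((2 * pi)%:C * h a - Mc 1 (fun z=> W z * (pk a z)%:C)) <= K * Mr 1 (fun z=> cmod g.[z] * pk a z).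
Proof.
move=> cp HW; have cW : con 1 W by move=> z hz; exact: ccont_wd (HW z hz).
have [h [c [Hc cE hb]]] := functional_series cW K0 HL LX (dbar_annihilates cp HW).
by exists h => //; exists pW, c.
Qed.

Lemma sol_div g W h b (d : R) : cmod b < 1 -> 0 < d -> (forall z, cmod (z - b) < d -> cmod z <= 1 /\ G z = 0) ->
 sol (('X - b%:P) * g) W h -> exists W1 h1, [/\ sol g W1 h1, forall z, W z = W b + (z - b) * W1 z &
  inD z, h z = W b + (z - b) * h1 z].
Proof.
move=> hb d0 Gb [pW [c [cp HW Hc cE]]].
have gE z : (('X - b%:P) * g).[z] = (z - b) * g.[z] by rewrite hornerM hornerXsubC.
have hol z : cmod (z - b) < d -> wd W z (pW z) 0.
 by move=> hz; have [hz1 G0] := Gb z hz; have := HW z hz1; rewrite G0 mulr0.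
have hbb : cmod (b - b) < d by rewrite subrr cmod0.
have hol' z : cmod (z - b) < d -> exists p, wd W z p 0 by exists (pW z); exact: hol.
have [p1 Hp1] := dquot_holo d0 hol' (hol b hbb).
pose W1 := dquot W (pW b) b.
pose E z := pW z / (z - b) - (W z - W b) / (z - b) ^+ 2.
pose pW1 z := if z == b then p1 b else E z.
have cW : con 1 W by move=> z hz; exact: ccont_wd (HW z hz).
have pE z : cmod (z - b) < d -> pW1 z = p1 z.
 move=> hz; rewrite /pW1; have [->//|zb] := eqVneq z b.
 by have [+ _] := wd_uniq (dquot_wd (pW b) zb (hol z hz)) (Hp1 z hz).1.
have cp1 : con 1 pW1.
 move=> z hz; have [->|zb] := eqVneq z b.
  by apply: ccont_loc d0 pE (Hp1 b hbb).2.
 have zb0 : z - b != 0 by rewrite subr_eq0.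
 apply: (@ccont_loc _ _ E _ (cmod (z - b))); first by rewrite cmod_gt0.
  move=> w hw; rewrite /pW1 ifN //; apply/eqP => wb; move: hw; rewrite wb cmodBC ltxx //.
 have cz : ccont (fun z=> z - b) z by apply: ccontB; [exact: ccont_id|exact: ccont_cst].
 apply: ccontB; first by apply: ccontM; [exact: cp|apply: ccontV].
 apply: ccontM; first by apply: ccontB; [exact: cW|exact: ccont_cst].
 by apply: ccontV; [exact: ccontX|rewrite expf_neq0].
have HW1 z : cmod z <= 1 -> wd W1 z (pW1 z) (g.[z] * G z).
 move=> hz; have [->|zb] := eqVneq z b.
  by rewrite pE // (Gb b hbb).2 mulr0; have [] := Hp1 b hbb.
 have zb0 : z - b != 0 by rewrite subr_eq0.
 by apply: wd_eq (dquot_wd (pW b) zb (HW z hz)); rewrite /pW1 ?(negPf zb) // gE; field.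
have [h1 [q1 [c1 [cq1 HW1' Hc1 c1E]]] _] := sol_exists cp1 HW1.
have an := dbar_annihilates cp1 HW1 0; rewrite expr0 mulr1 in an.
exists W1, h1; split; [by exists q1, c1|by move=> z; exact: dquotE|].
have WE z : W z = W b + (z - b) * W1 z by exact: dquotE.
have cW1 : con 1 W1 by move=> z hz; exact: ccont_wd (HW1 z hz).
have M1 := posf_Mr (@ltr01 R); have p0 := pi_gt0 R.
have tpC : (2 * pi)%:C != 0 :> C by rewrite -cmod_gt0 cmodR gtr0_norm; npos.
have LE n : L n.+1 (('X - b%:P) * g) = L n g - b * L n.+1 g.
 rewrite mulrBl (pfunD (HL _)) LX; congr (_ + _).
 by rewrite mul_polyC -scaleN1r (pfunZ (HL _)) (pfunZ (HL _)) mulN1r.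
have c0E : c 0%N = W b - b * c1 0%N.
 apply: (mulfI tpC); rewrite cE mulrBr mulrCA c1E LE.
 have -> : Mc 1 (fun z=> cj z ^+ 0 * W z) = (2 * pi)%:C * W b + Mc 1 (fun z=> W1 z * z ^+ 1) - b * Mc 1 (fun z=> cj z ^+ 0 * W1 z).
  rewrite -(Mc_cst _ (@ltr01 R)) /Mc -(cIZ _ M1); last by conT.
  rewrite -(cID M1); [|exact: con_cst|by conT]; rewrite -(cIB M1); [|by conT|by conT].
  by congr cI; apply/funext => z; rewrite expr0 expr1 {1}WE; ring.
 have -> : L 0%N g = - Mc 1 (fun z=> W1 z * z ^+ 1) by apply/eqP; rewrite -addr_eq0 addrC an.
 ring.
have cnE n : c n.+1 = c1 n - b * c1 n.+1.
 apply: (mulfI tpC); rewrite cE mulrBr mulrCA !c1E LE.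
 have -> : Mc 1 (fun z=> cj z ^+ n.+1 * W z) = Mc 1 (fun z=> cj z ^+ n * W1 z) - b * Mc 1 (fun z=> cj z ^+ n.+1 * W1 z).
  have -> : Mc 1 (fun z=> cj z ^+ n.+1 * W z) = Mc 1 (fun z=> W b * cj z ^+ n.+1 + (cj z ^+ n * W1 z - b * (cj z ^+ n.+1 * W1 z))).
   apply: Mc_ext => // z hz; rewrite WE.
   transitivity (W b * cj z ^+ n.+1 + ((z * cj z) * cj z ^+ n * W1 z - b * (cj z ^+ n.+1 * W1 z))); first by rewrite exprS; ring.
   by rewrite mulcJ hz expr1n mul1r.
  rewrite /Mc (cID M1); [|by conT|by conT]; rewrite (cIZ _ M1); last by conT.
  rewrite [X in _ * X](Mc_cpow n (@ltr01 R)) mulr0 add0r (cIB M1); [|by conT|by conT].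
  by rewrite (cIZ _ M1) //; conT.
 ring.
have PSE n z : psum c z n.+1 = W b + z * psum c1 z n - b * psum c1 z n.+1.
 elim: n => [|n IH]; first by rewrite /psum !big_ord_recl !big_ord0 /= !expr0 c0E; ring.
 by rewrite psumS IH cnE !(psumS c1) !exprS; ring.
move=> z hz; apply: (@lim_uniq _ (fun n=> psum c z n.+1)).
 by move=> e e0; have [N HN] := Hc.2 z hz e e0; exists N => n Nn; apply: HN; exact: leqW.
move=> e e0; have e2 : 0 < e / 2 by lra.
have [N HN] := Hc1.2 z hz _ e2; exists N => n Nn; rewrite PSE.
have -> : W b + z * psum c1 z n - b * psum c1 z n.+1 - (W b + (z - b) * h1 z) = z * (psum c1 z n - h1 z) - b * (psum c1 z n.+1 - h1 z) by ring.
apply: le_trans (cmodB _ _) _; rewrite !cmodM.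
have i1 : cmod z * cmod (psum c1 z n - h1 z) <= 1 * (e / 2) by apply: ler_pM; rewrite ?cge0 ?(ltW hz) // HN.
have i2 : cmod b * cmod (psum c1 z n.+1 - h1 z) <= 1 * (e / 2) by apply: ler_pM; rewrite ?cge0 ?(ltW hb) // HN // leqW.
by lra.
Qed.

Lemma sol_div_all s g W h : (forall b, b \in s -> cmod b < 1 /\ exists2 d : R, 0 < d & forall z, cmod (z - b) < d -> cmod z <= 1 /\ G z = 0) ->
 sol ((\prod_(b <- s) ('X - b%:P)) * g) W h -> exists W1 h1, [/\ con 1 W1, holo h1 &
  inD z, h z - W z = rprod s z * (h1 z - W1 z)].
Proof.
elim: s W h => [|b s IH] W h Hs.
 rewrite big_nil mul1r => H; exists W, h; split; [exact: sol_con H|exact: sol_holo H|].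
 by move=> z _; rewrite /rprod big_nil mul1r.
rewrite big_cons -mulrA => H.
have [hb [d d0 Hd]] : cmod b < 1 /\ exists2 d : R, 0 < d & forall z, cmod (z - b) < d -> cmod z <= 1 /\ G z = 0 by apply: Hs; rewrite inE eqxx.
have [W1 [h1 [S1 WE hE]]] := sol_div hb d0 Hd H.
have [W2 [h2 [c2 H2 E]]] := IH W1 h1 (fun c cs => Hs c ltac:(by rewrite inE cs orbT)) S1.
exists W2, h2; split=> // z hz; rewrite WE hE // rprod_cons -mulrA -E //; ring.
Qed.

End DbarSolution.

(** * Treil's theorem for polynomials *)

Section TreilPoly.
Variable R : realType.
Local Notation C := R[i].
Implicit Types (a z : C) (s : seq C) (f g : {poly C}).

Lemma expC_lip a b (M : R) : Re a <= M -> Re b <= M -> cmod (expC a - expC b) <= expR M * cmod (a - b).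
Proof.
move=> ha hb; have := @mvt_seg R (@expC R) b (a - b) (expR M); rewrite subrKC; apply=> s /andP[s0 s1].
exists (expC (b + s%:C * (a - b))), 0; split; first exact: wd_expC.
rewrite cmod0 addr0 cmod_expC ler_expR !(cReD, cReM, cReN) /= mul0r subr0.
have h1 : s * Re a <= s * M by rewrite ler_wpM2l.
have h2 : (1 - s) * Re b <= (1 - s) * M by rewrite ler_wpM2l // subr_ge0.
lra.
Qed.

Lemma poly_split_disc g : g != 0 -> (forall z, cmod z = 1 -> g.[z] != 0) ->
 exists s g1, [/\ g = (\prod_(b <- s) ('X - b%:P)) * g1, forall b, b \in s -> cmod b < 1 & onD z, g1.[z] != 0].
Proof.
move=> g0 g1; have [r E] := closed_field_poly_normal g.
exists [seq b <- r | cmod b < 1], (lead_coef g *: \prod_(b <- r | ~~ (cmod b < 1)) ('X - b%:P)); split.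
- by rewrite {1}E (bigID (fun b=> cmod b < 1)) /= scalerAr big_filter.
- by move=> b; rewrite mem_filter => /andP[].
move=> z hz; rewrite hornerZ mulf_neq0 ?lead_coef_eq0 // horner_prod prodf_seq_neq0; apply/allP => b br; apply/implyP => hb.
rewrite hornerXsubC subr_eq0; apply/eqP => zb.
have hzb : cmod b <= 1 by rewrite -zb.
have b1 : cmod b = 1 by apply/eqP; rewrite eq_le hzb leNgt; exact: hb.
have := g1 b b1; rewrite E hornerZ horner_prod mulf_eq0 negb_or => /andP[_]; rewrite prodf_seq_neq0 => /allP /(_ b br).
by rewrite hornerXsubC subrr eqxx.
Qed.
Lemma rprodE s z : (\prod_(b <- s) ('X - b%:P)).[z] = rprod s z.
Proof. by rewrite horner_prod; apply: eq_bigr => b _; rewrite hornerXsubC. Qed.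

Lemma bounded_below_near_circle (u : C -> C) : con 1 u -> (forall z, cmod z = 1 -> u z != 0) ->
 exists2 m : R, 0 < m & exists2 d : R, 0 < d & forall z, 1 - d < cmod z -> cmod z <= 1 -> m <= cmod (u z) ^+ 2.
Proof.
move=> cu u0; pose v z : R := - (cmod (u z) ^+ 2 + (1 - cmod z ^+ 2)).
have cv : con 1 (fun z=> (v z)%:C) by rewrite /v; conT.
have [z0 hz0 Hmax] := con_max ler01 cv.
have v0 : 0 < - v z0.
 rewrite /v opprK; have [h|h] := ltP (cmod z0) 1.
  have : 0 < 1 - cmod z0 ^+ 2 by rewrite subr_gt0 expr_lt1 ?cge0.
  by have := sqr_ge0 (cmod (u z0)); lra.
 have h1 : cmod z0 = 1 by apply/eqP; rewrite eq_le hz0.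
 by rewrite h1 expr1n subrr addr0 exprn_gt0 // cmod_gt0 u0.
exists (- v z0 / 2); first by rewrite divr_gt0.
exists (- v z0 / 4) => [|z h1 h2]; first by rewrite divr_gt0.
have Hz : v z <= v z0 := Hmax z h2.
have vE : v z = - (cmod (u z) ^+ 2 + (1 - cmod z ^+ 2)) by [].
move: v0 h1 Hz vE; move: (v z) (v z0) => x y v0 h1 Hz vE.
by have : 1 - cmod z ^+ 2 <= 2 * (- y / 4); [have := cge0 z; nra|lra].
Qed.

(** The constant depends on D alone, not on the degrees or on the minimum of |g| on the circle; this
    is what allows the later passage to the limit. *)
Theorem treil_poly (D : R) : 0 < D -> D <= 1 -> exists2 K : R, 0 < K & forall f g : {poly C},
 (onD z, cmod f.[z] <= 1) -> (onD z, cmod g.[z] <= 1) ->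
 (onD z, D <= cmod f.[z] ^+ 2 + cmod g.[z] ^+ 2) -> (forall z, cmod z = 1 -> g.[z] != 0) ->
 exists2 Y, holo Y & inD z, cmod (Y z) <= K /\ K^-1 <= cmod (f.[z] + g.[z] * Y z).
Proof.
move=> D0 D1.
(* The norm of the functional [l0], whose factor -2 comes from Green's formula. *)
pose K1 : R := 2 * `|CW D|; have K10 : 0 <= K1 by rewrite /K1 mulr_ge0.
pose C1 : R := (lam0 D)^-1; have C10 : 0 <= C1 by rewrite /C1 invr_ge0 /lam0 exprn_ge0 //; qlra.
(* C1 bounds Re W and K1 the Poisson integral in [sol_exists], so C1 + K1 bounds |Re h| and E bounds
   |exp h| and its inverse. *)
pose E := expR (C1 + K1); have E0 : 0 < E by exact: expR_gt0.
pose K2 := E * (K1 + 1) + (E + 1) * (16 / D).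
have dd : 0 < 16 / D by rewrite divr_gt0.
have EK : 0 <= E * (K1 + 1) by apply: mulr_ge0; qlra.
have ED : 0 < (E + 1) * (16 / D) by apply: mulr_gt0 => //; qlra.
have K20 : 0 < K2 by rewrite /K2; qlra.
exists (K2 + E) => [|f g f_le g_le fg g1]; first by qlra.
have g_neq0 : g != 0.
 by apply/eqP => g0; have := g1 1 (cmod1 R); rewrite g0 horner0 eqxx.
have [W [G [pW [[cpW cG HW WR WG] HA]]]] := core_W D0 D1 (fun r=> hol2_horner r f) (fun r=> hol2_horner r g) f_le g_le fg.
have cW : con 1 W by move=> z hz; exact: ccont_wd (HW z hz).
have A1 := posf_Ar (@ltr01 R); have M1 := posf_Mr (@ltr01 R); have p0 := pi_gt0 R.
pose l0 q : C := - 2 * Ac 1 (fun z=> G z * q.[z]).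
have cGq q : con 1 (fun z=> G z * q.[z]) by apply: conM => //; exact: con_horner.
have Hl0 : pfun K1 l0.
 split.
 - move=> p q; rewrite /l0 -mulrDr /Ac -(cID A1) //; congr (_ * cI _ _); apply/funext => z.
  by rewrite hornerD mulrDr.
 - move=> c p; have -> : l0 (c *: p) = - 2 * (c * Ac 1 (fun z=> G z * p.[z])); last by rewrite /l0 mulrCA.
  rewrite /l0 /Ac -(cIZ c A1 (cGq p)); congr (_ * cI _ _); apply/funext => z.
  by rewrite hornerZ mulrCA.
 - move=> p; rewrite /l0 cmodM cmodN (_ : cmod 2 = 2 :> R); last exact: (cmod_nat _ 2).
  rewrite /K1 -mulrA ler_wpM2l //; apply: le_trans (HA _ _ _ (hol2_horner 1 p)) _.
  rewrite ler_wpM2r ?ler_norm //; apply: posf_ge0 M1 _ _; first exact: rc_pm.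
  by move=> z _; exact: cge0.
have [L [L0 HL LX]] := hahn_banach_seq K10 Hl0.
have L0' q : L 0%N q = - 2 * Ac 1 (fun z=> G z * q.[z]) by rewrite L0.
have [h Sh hb] := sol_exists cG K10 HL LX L0' cpW HW.
have hh : holo h := sol_holo Sh.
pose tp : R := 2 * pi; have tp0 : 0 < tp by rewrite /tp; qlra.
have cg1 : rc 1 (fun z=> cmod g.[z]) by exact: rc_pm.
have hR a : cmod a < 1 -> `|Re (h a)| <= C1 + K1.
 move=> ha; have cp := rc_pk ha; have pp := Mr_pk ha.
 have cWR : rc 1 (fun z=> Re (W z)) by exact: rc_Re.
 have i1 : Mr 1 (fun z=> cmod g.[z] * pk a z) <= tp.
  rewrite /tp -pp; apply: Mr_le => //; first exact: rcM.
  by move=> z hz; rewrite -[leRHS]mul1r ler_wpM2r ?pk_ge0 // g_le ?hz.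
 have cpC : con 1 (fun z=> (pk a z)%:C) by exact: cp.
 have i2 : `|Re (Mc 1 (fun z=> W z * (pk a z)%:C))| <= C1 * tp.
  have -> : Re (Mc 1 (fun z=> W z * (pk a z)%:C)) = Mr 1 (fun z=> Re (W z) * pk a z).
   by rewrite /Mc /cI /=; congr Mr; apply/funext => z; rewrite cReM /=; ring.
  have cw : rc 1 (fun z=> Re (W z) * pk a z) by exact: rcM.
  have b1 z : cmod z = 1 -> - C1 * pk a z <= Re (W z) * pk a z <= C1 * pk a z.
   move=> hz; have := WR z; rewrite hz lexx => /(_ isT); rewrite ler_norml => /andP[h1 h2].
   by rewrite !ler_wpM2r ?pk_ge0.
  rewrite ler_norml /tp -pp -mulNr -!(posfZ M1) //; apply/andP; split; apply: Mr_le => //.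
  + by apply: rcM => //; exact: rc_cst.
  + by move=> z /b1/andP[].
  + by apply: rcM => //; exact: rc_cst.
  + by move=> z /b1/andP[].
 have := le_trans (cmod_Re _) (hb a ha); rewrite cReD cReN cReM /= mul0r subr0 -/tp => i3.
 have i4 : K1 * Mr 1 (fun z=> cmod g.[z] * pk a z) <= K1 * tp by rewrite ler_wpM2l.
 have : tp * `|Re (h a)| <= tp * (C1 + K1).
  rewrite -[X in X * `|_|](gtr0_norm tp0) -normrM.
  have := ler_normD (tp * Re (h a) - Re (Mc 1 (fun z=> W z * (pk a z)%:C))) (Re (Mc 1 (fun z=> W z * (pk a z)%:C))).
  by rewrite subrK; qlra.
 by rewrite ler_pM2l.
have Wle z : cmod z <= 1 -> Re (W z) <= C1 + K1.
 by move=> hz; have := le_trans (ler_norm _) (WR z hz); rewrite -/C1; qlra.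
have hle z : cmod z < 1 -> Re (h z) <= C1 + K1.
 by move=> hz; apply: le_trans (ler_norm _) (hR z hz).
pose F z := expC (h z) - f.[z].
have hF : holo F.
 move=> z hz; have [p Hp] := hh z hz; exists (expC (h z) * p - f^`().[z]).
 by apply: wd_eq (wdB (wd_comp Hp (wd_expC (h z))) (wd_horner f z)); rewrite ?mulr0 ?mul0r ?addr0 ?subr0.
have Fb (z : C) : cmod z < 1 -> cmod (F z) <= E + 1.
 move=> hz; apply: le_trans (cmodB _ _) _; apply: lerD; last exact: f_le (ltW hz).
 by rewrite cmod_expC ler_expR hle.
have F_near z : cmod z < 1 -> cmod g.[z] ^+ 2 <= D / 16 -> cmod (F z) <= E * cmod (h z - W z).
 move=> hz hg; have [Ef _] := WG z (ltW hz) hg; rewrite /F -Ef; apply: expC_lip; [exact: hle|exact: Wle (ltW hz)].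
(* Where |g| is not small the trivial bound on F is a multiple of |g|, for |g| >= |g|^2 > D/16. *)
have F_far z : cmod z < 1 -> D / 16 < cmod g.[z] ^+ 2 -> cmod (F z) <= (E + 1) * (16 / D) * cmod g.[z].
 move=> hz hg; apply: le_trans (Fb z hz) _; rewrite -mulrA -[leLHS]mulr1 ler_wpM2l //; first qlra.
 have : D / 16 <= cmod g.[z].
  apply: le_trans (ltW hg) _; rewrite expr2 -[leRHS]mulr1 ler_wpM2l ?cge0 //; exact: g_le (ltW hz).
 by rewrite mulrAC ler_pdivlMr //; qlra.
have cgh : con 1 (fun z=> g.[z]) by exact: con_horner.
have [m m0 [d1 d10 Hm]] := bounded_below_near_circle cgh g1.
have m1 z : 1 - d1 < cmod z -> cmod z <= 1 -> m <= cmod g.[z].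
 move=> h1 h2; apply: le_trans (Hm z h1 h2) _; rewrite expr2 -[leRHS]mulr1 ler_wpM2l ?cge0 //; exact: g_le.
(* Near the circle |g| >= m, so the Poisson errors, (K1 + 1) e = m in all, are absorbed by one more
   |g|. *)
pose e := m / (K1 + 1); have e0 : 0 < e by rewrite /e divr_gt0 //; qlra.
have [d2 d20 Hd2] := poisson_close cW e0.
have [d3 d30 Hd3] := poisson_close_re cg1 e0.
pose dl := Num.min d1 (Num.min d2 d3); have dl0 : 0 < dl by rewrite !lt_min d10 d20.
have [l1 l2 l3] : [/\ dl <= d1, dl <= d2 & dl <= d3] by rewrite /dl !ge_min !lexx !orbT.
have hW z : 1 - dl < cmod z -> cmod z < 1 -> cmod (h z - W z) <= (K1 + 1) * cmod g.[z].
 move=> h1 h2; have b1 := Hd2 z h2 ltac:(qlra); have b2 := Hd3 z h2 ltac:(qlra); have b3 := hb z h2.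
 have b4 := m1 z ltac:(qlra) (ltW h2).
 have eE : (K1 + 1) * e = m by rewrite /e mulrC mulfVK // gt_eqF //; qlra.
 have b6 : Mr 1 (fun w=> cmod g.[w] * pk z w) <= tp * (cmod g.[z] + e).
  by move: b2; rewrite -/tp ler_norml => /andP[_]; qlra.
 have b7 : K1 * Mr 1 (fun w=> cmod g.[w] * pk z w) <= K1 * (tp * (cmod g.[z] + e)) by rewrite ler_wpM2l.
 have : tp * cmod (h z - W z) <= tp * ((K1 + 1) * cmod g.[z]).
  have -> : tp * cmod (h z - W z) = cmod (tp%:C * (h z - W z)) by rewrite cmodM cmodR gtr0_norm.
  have := cmodD (tp%:C * h z - Mc 1 (fun w=> W w * (pk z w)%:C)) (Mc 1 (fun w=> W w * (pk z w)%:C) - tp%:C * W z).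
  rewrite addrA subrK -mulrBr => h3; apply: le_trans h3 _; apply: le_trans (lerD b3 b1) _.
  have b8 : tp * ((K1 + 1) * e) <= tp * cmod g.[z] by rewrite eE ler_wpM2l // ltW.
  by move: b7 b8; rewrite -/tp; qlra.
 by rewrite ler_pM2l.
have F_circ z : 1 - dl < cmod z -> cmod z < 1 -> cmod (F z) <= K2 * cmod g.[z].
 move=> h1 h2; rewrite /K2 mulrDl; have [h3|h3] := leP (cmod g.[z] ^+ 2) (D / 16).
  have := F_near z h2 h3; have := ler_wpM2l (ltW E0) (hW z h1 h2); rewrite mulrA.
  by have := mulr_ge0 (ltW ED) (cge0 g.[z]); qlra.
 by have := F_far z h2 h3; have := mulr_ge0 EK (cge0 g.[z]); qlra.
have [s [g2 [gE sd g20]]] := poly_split_disc g_neq0 g1.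
have gzE z : g.[z] = rprod s z * g2.[z] by rewrite gE hornerM rprodE.
have Hs b : b \in s -> cmod b < 1 /\ exists2 d : R, 0 < d & forall z, cmod (z - b) < d -> cmod z <= 1 /\ G z = 0.
 move=> bs; have hb1 := sd b bs; split=> //.
 have gb : g.[b] = 0 by rewrite gzE /rprod (big_rem b bs) /= subrr !mul0r.
 have q0 : 0 < D / 16 by rewrite divr_gt0.
 have [d d0 Hd] := cgh b (ltW hb1) _ q0.
 exists (Num.min d (1 - cmod b)) => [|z]; first by rewrite lt_min d0 subr_gt0.
 rewrite lt_min => /andP[h1 h2].
 have hz : cmod z <= 1 by have := cmodD3 z b; qlra.
 have h3 := Hd (z - b) h1; rewrite subrKC gb subr0 in h3.
 split=> //; have [] // := WG z hz; apply: le_trans _ h3.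
 by rewrite /tg expr2 -[leRHS]mulr1 ler_wpM2l ?cge0 // g_le.
have Sh' : sol G L ((\prod_(b <- s) ('X - b%:P)) * g2) W h by rewrite -gE.
(* Near the zeros of g, F is bounded by h - W, which carries all roots of g as factors; so F is
   divisible by them, with a bound that may depend on f and g. The uniform bound on Y comes from the
   circle by the maximum modulus. *)
have [W1 [h1 [cW1 hh1 hWE]]] := sol_div_all cG K10 HL LX L0' Hs Sh'.
have [|y0 hy0 Ey0] := @holo_factor R s F hF sd.
 move=> r /andP[r0 r1]; have ch1 : con r h1.
  by move=> z hz; have [p /ccont_wd] := hh1 z (le_lt_trans hz r1).
 have [B1 B10 HB1] := con_bdd ch1; have [B2 B20 HB2] := con_bdd cW1.
 have [B3 B30 HB3] := con_bdd (con_horner (r := 1) g2).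
 have x1 : 0 <= E * (B1 + B2) by apply: mulr_ge0; qlra.
 have x2 : 0 <= (E + 1) * (16 / D) * B3 by apply: mulr_ge0; qlra.
 exists (E * (B1 + B2) + (E + 1) * (16 / D) * B3) => [|z hz]; first by qlra.
 have hz1 : cmod z < 1 by qlra.
 rewrite mulrDl; have y1 := mulr_ge0 x1 (cge0 (rprod s z)); have y2 := mulr_ge0 x2 (cge0 (rprod s z)).
 have [h3|h3] := leP (cmod g.[z] ^+ 2) (D / 16).
  apply: le_trans (F_near z hz1 h3) _; rewrite hWE // cmodM.
  have : cmod (h1 z - W1 z) <= B1 + B2.
   by apply: le_trans (cmodB _ _) _; apply: lerD; [exact: HB1 (ltW hz)|exact: HB2 (ltW hz1)].
  move=> /(ler_wpM2l (cge0 (rprod s z))) /(ler_wpM2l (ltW E0)); qlra.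
 apply: le_trans (F_far z hz1 h3) _; rewrite gzE cmodM.
 have := HB3 z (ltW hz1) => /(ler_wpM2l (cge0 (rprod s z))) /(ler_wpM2l (ltW ED)); qlra.
pose Y z := y0 z / g2.[z].
have gY z : cmod z < 1 -> g.[z] * Y z = F z.
 move=> hz; rewrite Ey0 // gzE /Y; have := g20 z (ltW hz); move=> n0; by field.
have hY : holo Y.
 move=> z hz; have [p Hp] := hy0 z hz; have n0 := g20 z (ltW hz).
 by eexists; apply: wd_eq (wdM Hp (wdV (wd_horner g2 z) n0)) => //; rewrite !(mulr0, mul0r, oppr0, addr0).
have YK : inD z, cmod (Y z) <= K2.
 apply: (@max_modulus R Y K2 (1 - dl)) => //; first by qlra.
 move=> z hz1 hz2; have := F_circ z hz1 hz2; rewrite -gY // cmodM mulrC ler_pM2r //.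
 by apply: lt_le_trans m0 _; apply: m1; qlra.
exists Y => // z hz; split; first by have := YK z hz; qlra.
rewrite gY // /F subrKC cmod_expC.
apply: (@le_trans _ _ E^-1); first by rewrite lef_pV2 ?posrE //; qlra.
rewrite /E -expRN ler_expR; have := hR z hz; rewrite ler_norml => /andP[+ _]; qlra.
Qed.

End TreilPoly.

(** * Treil's theorem for bounded analytic functions by a normal family argument *)

Section TreilBounded.
Variable R : realType.
Local Notation C := R[i].
Implicit Types (a z : C) (p q : {poly C}) (f g Y : C -> C).

Lemma avoid_seq (s : seq R) (a b : R) : a < b -> exists2 t, a < t < b & t \notin s.
Proof.
elim: s a b => [|x s IH] a b ab; first by exists ((a + b) / 2) => //; apply/andP; split; lra.
have [/andP[ax xb]|h] := boolP (a < x < b).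
 have [t /andP[at_ tx] ts] := IH a x ax; exists t; first by rewrite at_ (lt_trans tx).
 by rewrite inE negb_or ts andbT lt_eqF.
have [t tab ts] := IH a b ab; exists t => //; rewrite inE negb_or ts andbT.
by apply: contraNneq h => <-.
Qed.

(** p(t z) has a zero on the circle only if some root of p has modulus t; as there are finitely many
    roots, a t close to 1 avoids this. *)
Lemma poly_perturb p (e : R) : 0 < e -> exists2 q, onD z, cmod (q.[z] - p.[z]) <= e & forall z, cmod z = 1 -> q.[z] != 0.
Proof.
move=> e0; have [->|p0] := eqVneq p 0.
 exists (e%:C)%:P => z hz; first by rewrite hornerC horner0 subr0 cmodR gtr0_norm.
 by rewrite hornerC -cmod_gt0 cmodR gtr0_norm.
have [d d0 Hd] := con_unif (con_horner (r := 1) p) e0.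
have [r E] := closed_field_poly_normal p.
pose m : R := Num.max 0 (1 - d); have m1 : m < 1 by rewrite gt_max ltr01 /=; lra.
have [m0 md] : 0 <= m /\ 1 - d <= m by rewrite !le_max !lexx orbT.
have [t /andP[tm t1] tr] := avoid_seq [seq cmod b | b <- r] m1.
have sE z : (p \Po (t%:C *: 'X)).[z] = p.[t%:C * z] by rewrite horner_comp hornerZ hornerX.
have t0 : 0 < t by lra.
exists (p \Po (t%:C *: 'X)) => z hz; rewrite sE.
 apply: Hd => //; first by rewrite cmodM cmodR gtr0_norm // -[leRHS]mul1r; apply: ler_pM; rewrite ?cge0 // ltW.
 have -> : t%:C * z - z = (t - 1)%:C * z by rewrite realCD realCN mulrBl mul1r.
 rewrite cmodM cmodR ltr0_norm ?subr_lt0 // opprB; apply: le_lt_trans (_ : (1 - t) * 1 < _); last by lra.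
 by rewrite ler_wpM2l // subr_ge0 ltW.
apply/negP => h0; have : root p (t%:C * z) by exact: h0.
rewrite E rootZ ?lead_coef_eq0 // root_prod_XsubC => /(map_f (@cmod R)).
by rewrite cmodM cmodR gtr0_norm // hz mulr1 (negPf tr).
Qed.

Lemma holo_poly_approx f (r e : R) : holo f -> 0 < r < 1 -> 0 < e -> exists p, onD z, cmod (p.[z] - f (r%:C * z)) <= e.
Proof.
move=> hf hr e0; have [c Hc] := holo_PS hf; have [N HN] := PS_unif Hc hr e0; have /andP[r0 r1] := hr.
exists (\poly_(i < N) (c i * r%:C ^+ i)) => z hz.
rewrite horner_poly; have := HN N (leqnn N) (r%:C * z).
rewrite cmodM cmodR gtr0_norm // -[X in _ <= X -> _]mulr1 ler_wpM2l ?(ltW r0) // => /(_ isT).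
by rewrite /psum; under eq_bigr do rewrite exprMn mulrA.
Qed.

Lemma sq_perturb (x a e : R) : 0 <= e -> 0 <= x -> x <= 1 / 2 -> 0 <= a -> x <= a + e -> x ^+ 2 - e <= a ^+ 2.
Proof.
move=> e0 x0 x1 a0 h; have [h1|h1] := leP x e; first by nra.
have : (x - e) ^+ 2 <= a ^+ 2 by rewrite lerXn2r ?nnegrE //; lra.
by nra.
Qed.

Section Ultralimit.
Variable U : set_system nat.
Hypothesis HU : UltraFilter U.

Lemma ulim_real (u : nat -> R) (K : R) : (forall n, `|u n| <= K) -> exists l : R, forall e, 0 < e -> U [set n | `|u n - l| <= e].
Proof.
move=> Hb.
pose A := [set x : R | U [set n | x <= u n]].
have A0 : A (- K).
 by apply: filterS (@filterT _ U _) => n _; have := Hb n; rewrite ler_norml => /andP[].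
have AK x : A x -> x <= K.
 move=> /filter_ex[n h]; apply: le_trans h _; by have := Hb n; rewrite ler_norml => /andP[].
have hs : has_sup A by split; [exists (- K)|exists K => x /AK].
exists (sup A) => e e0.
have [x Ax xs] := sup_adherent e0 hs.
have h2 : U (~` [set n | sup A + e <= u n]).
 have [h|//] := in_ultra_setVsetC [set n | sup A + e <= u n] HU.
 have := ub_le_sup hs.2 (h : A (sup A + e)); lra.
apply: filterS (filterI Ax h2) => n [/= h1 /negP]; rewrite -ltNge => h3.
by rewrite ler_norml; apply/andP; split; lra.
Qed.

Definition ulim (u : nat -> C) l := forall e : R, 0 < e -> U [set n | cmod (u n - l) <= e].

Lemma ulim_exists (u : nat -> C) (K : R) : (forall n, cmod (u n) <= K) -> exists l, ulim u l.
Proof.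
move=> Hb.
have [x Hx] := ulim_real (fun n=> le_trans (cmod_Re (u n)) (Hb n)).
have [y Hy] := ulim_real (fun n=> le_trans (cmod_Im (u n)) (Hb n)).
exists (x +i* y) => e e0; have e2 : 0 < e / 2 by lra.
apply: filterS (filterI (Hx _ e2) (Hy _ e2)) => n [/= h1 h2].
by apply: le_trans (cmod_ReIm _) _; rewrite cReD cImD cReN cImN /=; lra.
Qed.

Lemma ulim_le u l (K : R) : ulim u l -> U [set n | cmod (u n) <= K] -> cmod l <= K.
Proof.
move=> Hu HK.
apply/ler_addgt0Pr => e e0; have [n [/= h1 h2]] := filter_ex (filterI (Hu e e0) HK).
by have := cmodD3 l (u n); rewrite (cmodBC l); lra.
Qed.

Lemma ulim_ge u l (K : R) : ulim u l -> U [set n | K <= cmod (u n)] -> K <= cmod l.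
Proof.
move=> Hu HK.
apply/ler_addgt0Pr => e e0; have [n [/= h1 h2]] := filter_ex (filterI (Hu e e0) HK).
by have := cmodD3 (u n) l; lra.
Qed.

Lemma ulimD u v l l' : ulim u l -> ulim v l' -> ulim (fun n=> u n + v n) (l + l').
Proof.
move=> Hu Hv e e0; have e2 : 0 < e / 2 by lra.
apply: filterS (filterI (Hu _ e2) (Hv _ e2)) => n [/= h1 h2].
by rewrite opprD addrACA; tri; lra.
Qed.

Lemma ulimM u v l l' (K : R) : ulim u l -> ulim v l' -> (forall n, cmod (v n) <= K) -> ulim (fun n=> u n * v n) (l * l').
Proof.
move=> Hu Hv Hb e e0; have c0 := cge0 l; have K0 : 0 <= K := le_trans (cge0 _) (Hb 0%N).
have d0 : 0 < e / (K + cmod l + 1) by rewrite divr_gt0 //; lra.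
apply: filterS (filterI (Hu _ d0) (Hv _ d0)) => n [/= h1 h2].
have -> : u n * v n - l * l' = (u n - l) * v n + l * (v n - l') by ring.
tri; rewrite !cmodM.
have i1 : cmod (u n - l) * cmod (v n) <= e / (K + cmod l + 1) * K by apply: ler_pM; rewrite ?cge0.
have i2 : cmod l * cmod (v n - l') <= cmod l * (e / (K + cmod l + 1)) by rewrite ler_wpM2l.
have : e = e / (K + cmod l + 1) * (K + cmod l + 1) by rewrite mulfVK // gt_eqF //; lra.
by move: d0 i1 i2; set x := e / _; lra.
Qed.
Lemma ulim_cst c : ulim (fun=> c) c.
Proof. by move=> e e0; apply: filterS (@filterT _ U _) => n _ /=; rewrite subrr cmod0 ltW. Qed.

Lemma ulim_psum (c : nat -> nat -> C) (l : nat -> C) z N : (forall m, ulim (c ^~ m) (l m)) -> ulim (fun n=> psum (c n) z N) (psum l z N).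
Proof.
move=> H; elim: N => [|N IH].
 have -> : (fun n=> psum (c n) z 0) = fun=> 0 by apply/funext => n; rewrite /psum big_ord0.
 by rewrite /psum big_ord0; exact: ulim_cst.
have -> : (fun n=> psum (c n) z N.+1) = (fun n=> psum (c n) z N + c n N * z ^+ N) by apply/funext => n; rewrite psumS.
rewrite psumS; apply: ulimD => //; exact: (@ulimM _ _ _ _ (cmod (z ^+ N)) (H N) (ulim_cst _)).
Qed.

(** Montel's theorem: coefficientwise limits along the ultrafilter inherit the Cauchy estimates with
    the bound K. The tails of all series are then uniformly small, so that finitely many
    coefficients decide. *)
Lemma ulim_holo (Y : nat -> C -> C) (K : R) : (forall n, holo (Y n)) -> (forall n z, cmod z < 1 -> cmod (Y n z) <= K) ->
 exists2 Z, holo Z & inD z, ulim (fun n=> Y n z) (Z z).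
Proof.
move=> hY HK; have K0 : 0 <= K by apply: le_trans (cge0 _) (HK 0%N 0 _); rewrite cmod0.
have [c Hc] := choice (fun n=> holo_PS (hY n)).
have cb n (r : R) : 0 < r < 1 -> forall m, cmod (c n m) * r ^+ m <= K.
 by move=> hr; apply: (coef_bound (Hc n) hr) => w hw; apply: HK; rewrite hw; case/andP: hr.
have h2 : 0 < (1 / 2 : R) < 1 by lra.
have [l Hl] : exists l : nat -> C, forall m, ulim (c ^~ m) (l m).
 have Hex m : exists l, ulim (c ^~ m) l; last by have [l Hl] := choice Hex; exists l.
 apply: (ulim_exists (K := K * 2 ^+ m)) => n.
 have := cb n _ h2 m; rewrite expr_div_n expr1n mul1r ler_pdivrMr // exprn_gt0 //.
have lb (r : R) : 0 < r < 1 -> forall m, cmod (l m) * r ^+ m <= K.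
 move=> hr m; have /andP[r0 r1] := hr; rewrite -ler_pdivlMr ?exprn_gt0 //; apply: ulim_le (Hl m) _.
 apply: filterS (@filterT _ U _) => n _ /=; rewrite ler_pdivlMr ?exprn_gt0 //; exact: cb.
have [r hr|Z HZ] := @PS_exists R l.
 by exists (K + 1) => [|n]; [lra|apply: le_trans (lb r hr n) _; lra].
exists Z; first exact: PS_holo HZ.
move=> z hz e e0; pose r := (1 + cmod z) / 2; have z0 := cge0 z.
have [zr r1] : cmod z < r /\ r < 1 by rewrite /r; lra.
have r0 : 0 < r by lra.
have hr : 0 < r < 1 by rewrite r0.
have q01 : 0 <= cmod z / r < 1 by rewrite divr_ge0 ?(ltW r0) //= ltr_pdivrMr // mul1r.
have p1 : 0 < 1 - cmod z / r by move: q01 => /andP[_]; rewrite subr_gt0.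
have e3 : 0 < e / 3 * (1 - cmod z / r) / (K + 1) by rewrite divr_gt0 ?mulr_gt0 //; lra.
have [N HN] := pow_small q01 e3.
have tail (a : nat -> C) f : PS a f -> (forall m, cmod (a m) * r ^+ m <= K) -> cmod (psum a z N - f z) <= e / 3.
 move=> Ha Hb; apply: le_trans (PS_tail Ha hr Hb zr N) _.
 rewrite ler_pdivrMr //; have := HN N (leqnn N); rewrite ler_pdivlMr; last lra.
 apply: le_trans; rewrite mulrC ler_wpM2l ?exprn_ge0 //; [by case/andP: q01|lra].
have e3' : 0 < e / 3 by lra.
apply: filterS (ulim_psum z N Hl e3') => n /= h.
have t1 := tail _ _ (Hc n) (cb n r hr); have t2 := tail _ _ HZ (lb r hr).
have -> : Y n z - Z z = (psum (c n) z N - psum l z N) + (psum l z N - Z z) - (psum (c n) z N - Y n z) by ring.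
apply: le_trans (cmodB _ _) _; have := cmodD (psum (c n) z N - psum l z N) (psum l z N - Z z); lra.
Qed.

End Ultralimit.

(** Dilates of f and g are approximated by polynomials. The bounds 1/2 and D leave room for the
    approximants to satisfy the bounds 1 and D/2 of [treil_poly]. *)
Lemma treil_normalized (D : R) f g : holo f -> holo g -> 0 < D -> (inD z, cmod (f z) <= 1 / 2) ->
 (inD z, cmod (g z) <= 1 / 2) -> (inD z, D <= cmod (f z) ^+ 2 + cmod (g z) ^+ 2) ->
 exists2 Y, holo Y & exists2 K : R, 0 < K & inD z, cmod (Y z) <= K /\ K^-1 <= cmod (f z + g z * Y z).
Proof.
move=> hf hg D0 fb gb fg.
have D12 : D <= 1 / 2.
 have z0 : cmod (0 : C) < 1 by rewrite cmod0.
 have := fg 0 z0; have := fb 0 z0; have := gb 0 z0; have := cge0 (f 0); have := cge0 (g 0); nra.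
have D20 : 0 < D / 2 by lra.
have D21 : D / 2 <= 1 by lra.
have [K K0 HK] := treil_poly D20 D21.
(* By [sq_perturb] each square loses at most e, which D/16 makes affordable; the divisor n+1 sends
   the errors to 0. *)
pose e n : R := D / 16 / n.+1%:R.
have e0 n : 0 < e n by rewrite /e divr_gt0 //; lra.
have eD n : e n <= D / 16 by rewrite /e ler_pdivrMr ?ltr0n // -[leLHS]mulr1 ler_wpM2l ?ler1n //; lra.
pose r n : R := 1 - n.+2%:R^-1.
have hr n : 0 < r n < 1.
 rewrite /r; have h1 : 0 < n.+2%:R^-1 :> R by rewrite invr_gt0 ltr0n.
 have h2 : n.+2%:R^-1 < 1 :> R by rewrite invf_lt1 ?ltr0n // ltr1n.
 by move: (n.+2%:R^-1) h1 h2 => w h1 h2; apply/andP; split; lra.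
have H n : exists P : {poly C} * {poly C} * (C -> C), [/\ onD z, cmod (P.1.1.[z] - f ((r n)%:C * z)) <= e n,
 onD z, cmod (P.1.2.[z] - g ((r n)%:C * z)) <= e n, holo P.2 &
 inD z, cmod (P.2 z) <= K /\ K^-1 <= cmod (P.1.1.[z] + P.1.2.[z] * P.2 z)].
 have e2 : 0 < e n / 2 by have := e0 n; lra.
 have [p Hp] := holo_poly_approx hf (hr n) (e0 n).
 have [q0 Hq0] := holo_poly_approx hg (hr n) e2.
 have [q Hq q1] := poly_perturb q0 e2.
 have Hqg z : cmod z <= 1 -> cmod (q.[z] - g ((r n)%:C * z)) <= e n.
  move=> hz; have := Hq z hz; have := Hq0 z hz.
  by have := cmodD (q.[z] - q0.[z]) (q0.[z] - g ((r n)%:C * z)); rewrite addrA subrK; lra.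
 have sc z : cmod z <= 1 -> cmod ((r n)%:C * z) < 1.
  have /andP[r0 r1] := hr n; move=> hz; rewrite cmodM cmodR gtr0_norm //; apply: le_lt_trans r1.
  by rewrite ler_piMr // ltW.
 have en := eD n; have e1 := e0 n.
 have [z hz|z hz|z hz|z hz|Y hY HY] := HK p q.
 - by have := Hp z hz; have := fb _ (sc z hz); have := cmodD3 p.[z] (f ((r n)%:C * z)); lra.
 - by have := Hqg z hz; have := gb _ (sc z hz); have := cmodD3 q.[z] (g ((r n)%:C * z)); lra.
 - have h1 := Hp z hz; have h2 := Hqg z hz; have h3 := fb _ (sc z hz); have h4 := gb _ (sc z hz); have h5 := fg _ (sc z hz).
  have h6 := cmodD3 (f ((r n)%:C * z)) p.[z]; have h7 := cmodD3 (g ((r n)%:C * z)) q.[z].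
  rewrite cmodBC in h6; rewrite cmodBC in h7.
  have s1 := sq_perturb (ltW e1) (cge0 _) h3 (cge0 p.[z]) (le_trans h6 (lerD (lexx _) h1)).
  have s2 := sq_perturb (ltW e1) (cge0 _) h4 (cge0 q.[z]) (le_trans h7 (lerD (lexx _) h2)).
  by move: s1 s2 h5 en; lra.
 - exact: q1.
 - by exists (p, q, Y); split.
have [P HP] := choice H.
have [U [HU HUo]] := ultraFilterLemma (@eventually_filter : ProperFilter \oo).
have hYn n : holo (P n).2 by have [] := HP n.
have HYn n z : cmod z < 1 -> cmod ((P n).2 z) <= K by move=> hz; have [_ _ _ h] := HP n; have [] := h z hz.
have [Z hZ HZ] := ulim_holo HU hYn HYn.
exists Z => //; exists K => // z hz; split.
 by apply: (ulim_le HU (HZ z hz)); apply: filterS (@filterT _ U _) => n _ /=; have [_ _ _ h] := HP n; have [] := h z hz.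
have small (d : R) : 0 < d -> U [set n | n.+1%:R^-1 <= d].
 move=> d0; apply: HUo; apply: filterS (near_infty_natSinv_lt (PosNum d0)) => n /ltW.
 exact.
have conv (u : C -> C) (v : nat -> C) : holo u -> (forall n, cmod (v n - u ((r n)%:C * z)) <= e n) -> ulim U v (u z).
 move=> hu Hv d d0; have d2 : 0 < d / 2 by lra.
 have [q Hq] := hu z hz; have [t t0 Ht] := ccont_wd Hq d2.
 have t2 : 0 < t / 2 by lra.
 apply: filterS (filterI (small _ d2) (small _ t2)) => n [/= h1 h2].
 have n0 : 0 < n.+1%:R^-1 :> R by rewrite invr_gt0.
 have h3 : e n <= d / 2.
  apply: le_trans h1; rewrite /e ler_piMl ?(ltW n0) //; lra.
 have rz : (r n)%:C * z = z + (- n.+2%:R^-1)%:C * z by rewrite /r realCD (_ : 1%:C = 1 :> C) // mulrDl mul1r.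
 have h4 : n.+2%:R^-1 <= n.+1%:R^-1 :> R by rewrite lef_pV2 ?posrE ?ltr0n // ler_nat.
 have h5 := Hv n; rewrite rz in h5.
 have := Ht ((- n.+2%:R^-1)%:C * z); rewrite cmodM cmodR normrN gtr0_norm ?invr_gt0 // => /(_ _) h6.
 have h7 : n.+2%:R^-1 * cmod z < t.
  apply: le_lt_trans (_ : n.+1%:R^-1 * 1 < _); last by rewrite mulr1; apply: le_lt_trans h2 _; lra.
  by apply: ler_pM; rewrite ?cge0 ?invr_ge0 ?(ltW hz).
 have := h6 h7; set w := _ * z; have := cmodD (v n - u (z + w)) (u (z + w) - u z); rewrite addrA subrK.
 by move: h5; rewrite -/w; lra.
have [Pf Pg] : ulim U (fun n=> (P n).1.1.[z]) (f z) /\ ulim U (fun n=> (P n).1.2.[z]) (g z).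
 by split; apply: conv => // n; have [h1 h2 _ _] := HP n; [apply: h1|apply: h2]; exact: ltW.
have Yb n : cmod ((P n).2 z) <= K by have [_ _ _ h] := HP n; have [] := h z hz.
apply: (ulim_ge HU (ulimD HU Pf (ulimM HU Pg (HZ z hz) Yb))).
by apply: filterS (@filterT _ U _) => n _ /=; have [_ _ _ h] := HP n; have [] := h z hz.
Qed.

End TreilBounded.

(** * The notions of the statement in terms of the calculus above *)

Section Link.
Variable R : realType.
Local Notation C := R[i].

Lemma normC_cmod (z : Cx R) : `|z| = (cmod z)%:C :> C.
Proof. by rewrite cmodE. Qed.

Lemma posC (e : C) : 0 < e -> exists2 x : R, 0 < x & e = x%:C.
Proof.
case: e => a b; rewrite ltcE /= => /andP[/eqP b0 a0]; exists a => //.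
by apply: cx_eq => //=.
Qed.

Lemma wd_is_derive (f : Cx R -> Cx R) (z p : C) : wd f z p 0 -> derivable f z 1 /\ derive1 f z = p.
Proof.
move=> H.
have L : (fun h : Cx R => h^-1 *: (f (h + z) - f z)) @ 0^' --> (p : Cx R).
 apply/cvgrPdist_le => /= _ /posC[e e0 ->].
 have [d d0 Hd] := H e e0.
 near=> h.
 have h0 : h != 0 by near: h; exact: nbhs_dnbhs_neq.
 have hd : cmod h < d.
  have : `|h| < d%:C :> C by near: h; apply: dnbhs0_lt; rewrite ltcR.
  by rewrite normC_cmod ltcR.
 rewrite normC_cmod lecR.
 have := Hd h hd; rewrite mul0r addr0 -cmodN opprB => h1.
 have -> : p - h^-1 *: (f (h + z) - f z) = h^-1 * (p * h - (f (z + h) - f z)).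
  rewrite (addrC z) mulrBr mulrCA mulVf // mulr1 //.
 by rewrite cmodM cmodV mulrC ler_pdivrMr ?cmod_gt0.
have L2 : (fun h : Cx R => h^-1 *: ((f \o shift z) (h *: 1) - f z)) @ 0^' --> (p : Cx R).
 suff -> : (fun h : Cx R => h^-1 *: ((f \o shift z) (h *: 1) - f z)) = (fun h : Cx R => h^-1 *: (f (h + z) - f z)) by [].
 by apply/funext => h /=; rewrite [h *: 1]mulr1.
split; first by apply/cvg_ex; exists p.
exact: cvg_lim.
Unshelve. all: by end_near. Qed.

Lemma derivable_wd (f : Cx R -> Cx R) (z : C) : derivable f z 1 -> exists p, wd f z p 0.
Proof.
move=> /cvg_ex[/= p L]; exists p => e e0.
have eC : 0 < e%:C by rewrite ltcR.
move/cvgrPdist_le : L => /(_ _ eC); rewrite near_withinE => /nbhs_ballP[/= _ /posC[d d0 ->] Hd].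
exists d => // h hd; have [->|h0] := eqVneq h 0.
 by rewrite addr0 mulr0 mul0r addr0 subrr subr0 cmod0 mulr0.
have := Hd h; rewrite -ball_normE /= sub0r normrN normC_cmod ltcR => /(_ hd h0).
rewrite normC_cmod lecR [h *: 1]mulr1 => h1.
have -> : f (z + h) - f z - (p * h + 0 * cj h) = - h * (p - h^-1 * (f (h + z) - f z)).
 by rewrite mulrBr mulNr mulNr mulrA mulfV // mul1r (addrC h) mul0r addr0; ring.
by rewrite cmodM cmodN mulrC ler_wpM2r ?cge0.
Qed.

Lemma holo_discE (f : Cx R -> Cx R) : holo_disc f <-> holo f.
Proof.
by split=> H z hz; [apply: derivable_wd; exact: H|have [p Hp] := H z hz; have [] := wd_is_derive Hp].
Qed.
Lemma derive1_PS (a : nat -> C) (f f1 : C -> C) : PS a f -> PS (dcoef a) f1 -> inD z, derive1 (f : Cx R -> Cx R) z = f1 z.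
Proof. by move=> Ha Hd z hz; have [] := wd_is_derive (PS_derive Ha Hd hz). Qed.

Lemma Mr_EFin (r : R) (v : C -> R) : 0 < r -> rc r v ->
 (\int[lebesgue_measure]_(t in `[0%R, (2 * pi)%R]) (v (circ r t))%:E = (Mr r v)%:E)%E.
Proof.
move=> r0 cv; rewrite /Mr /Rintegral fineK //.
apply: integrable_fin_num => //.
apply: continuous_compact_integrable; first exact: segment_compact.
by apply: continuous_subspaceT => t; apply: (cont_circ (ltW r0) cv).
Qed.

Lemma H2E (f : Cx R -> Cx R) : H2 f <-> holo f /\ exists M : R, forall r : R, 0 < r < 1 -> Mr r (fun z=> cmod (f z) ^+ 2) <= M.
Proof.
rewrite /H2 holo_discE; split=> -[hf [M HM]]; split=> //.
 exists M => r /andP[r0 r1]; have := HM r; rewrite (ltW r0) r1 => /(_ isT).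
 have cf : rc r (fun z=> cmod (f z) ^+ 2) by apply: rcX; apply: rc_cmod; exact: holo_con hf r1.
 by rewrite (Mr_EFin r0 cf) lee_fin.
(* The definition of [H2] includes the radius 0, where the integral is 2 pi |f(0)|^2; the bound is
   enlarged by that amount. *)
exists (`|M| + cmod (f 0) ^+ 2 * (2 * pi)) => r /andP[]; rewrite le_eqVlt => /orP[/eqP<- _|r0 r1].
 have -> : (fun t : R => (cmod (f ((0 * cos t) +i* (0 * sin t))) ^+ 2)%:E) = cst (cmod (f 0) ^+ 2)%:E.
  by apply/funext => t; rewrite !mul0r.
 rewrite integral_cst //= lebesgue_measure_itv /= lte_fin mulr_gt0 ?pi_gt0 // oppr0 adde0 -EFinM lee_fin.
 by rewrite lerDr.
have cf : rc r (fun z=> cmod (f z) ^+ 2) by apply: rcX; apply: rc_cmod; exact: holo_con hf r1.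
rewrite (Mr_EFin r0 cf) lee_fin; apply: le_trans (HM r _) _; first by rewrite r0.
have := ler_norm M; have : 0 <= cmod (f 0) ^+ 2 * (2 * pi) by rewrite mulr_ge0 ?sqr_ge0 // mulr_ge0 ?pi_ge0.
lra.
Qed.

Lemma Ar_EFin (r : R) (v : C -> R) : 0 < r -> rc r v ->
 (\int[(lebesgue_measure \x lebesgue_measure)%E]_(p in dsk r) (v (p.1 +i* p.2))%:E = (Ar r v)%:E)%E.
Proof.
move=> r0 cv; rewrite /Ar /Rintegral fineK //.
by apply: integrable_fin_num; [exact: measurable_dsk|exact: Ar_integrable].
Qed.

(** Monotone convergence along the discs of radius 1 - 1/(n+2), which exhaust the open unit disc. *)
Lemma disc_integral (v : C -> R) : (forall r : R, 0 < r < 1 -> rc r v) -> (inD z, 0 <= v z) ->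
 (\int[(lebesgue_measure \x lebesgue_measure)%E]_(p in [set p : R * R | (p.1 ^+ 2 + p.2 ^+ 2 < 1)%R]) (v (p.1 +i* p.2))%:E < +oo)%E <->
 exists M : R, forall r : R, 0 < r < 1 -> Ar r v <= M.
Proof.
move=> cv v0; set B := [set p : R * R | _].
have BE : B = dsk 1 by apply/seteqP; split=> p; rewrite /B /dsk /= expr1n.
have in1 p : dsk 1 p -> cmod (p.1 +i* p.2) < 1.
 rewrite /dsk /= expr1n => h; rewrite /cmod /=.
 by rewrite -[ltRHS]sqrtr1 ltr_sqrt.
pose rr n : R := 1 - n.+2%:R^-1.
have hr n : 0 < rr n < 1.
 rewrite /rr; have h1 : 0 < n.+2%:R^-1 :> R by rewrite invr_gt0 ltr0n.
 have h2 : n.+2%:R^-1 < 1 :> R by rewrite invf_lt1 ?ltr0n // ltr1n.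
 by move: (n.+2%:R^-1) h1 h2 => w h1 h2; apply/andP; split; lra.
have sub (s t : R) : 0 < s -> s <= t -> dsk s `<=` dsk t.
 move=> s0 st p; rewrite /dsk /= => h; apply: lt_le_trans h _.
 by rewrite lerXn2r ?nnegrE ?(ltW s0) // (le_trans (ltW s0)).
have nd : nondecreasing_seq (fun n=> dsk (rr n)).
 move=> m n mn; rewrite subsetEset; apply: sub; first by case/andP: (hr m).
 by rewrite /rr lerB // lef_pV2 ?posrE ?ltr0n // ler_nat ltnS ltnS.
have BU : B = \bigcup_n dsk (rr n).
 rewrite BE; apply/seteqP; split=> [p hp|p [n _ hp]]; last by apply: sub hp; case/andP: (hr n) => // ? /ltW.
 move: (hp); rewrite /dsk /= expr1n => h; set s := _ + _ in h.
 have s0 : 0 <= s by rewrite /s addr_ge0 ?sqr_ge0.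
 have e0 : 0 < (1 - s) / 2 by lra.
 have [N _ HN] := near_infty_natSinv_lt (PosNum e0).
 exists N => //; rewrite /dsk /= -/s; have := HN N (leqnn N); rewrite /= => h1.
 have h2 : N.+2%:R^-1 <= N.+1%:R^-1 :> R by rewrite lef_pV2 ?posrE ?ltr0n // ler_nat.
 rewrite /rr; move: (N.+2%:R^-1) (N.+1%:R^-1) h1 h2 => w w' h1 h2.
 have := sqr_ge0 w; nra.
have mB : measurable B by rewrite BE; exact: measurable_dsk.
have mf n : measurable_fun (dsk (rr n)) (fun p : R * R => (v (p.1 +i* p.2))%:E).
 have /andP[r0 _] := hr n.
 by have /measurable_int := Ar_integrable r0 (cv _ (hr n)).
have mfB : measurable_fun B (fun p : R * R => (v (p.1 +i* p.2))%:E).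
 by rewrite BU; apply/measurable_fun_bigcup => // n; exact: measurable_dsk.
have nn p : B p -> (0%:E <= (v (p.1 +i* p.2))%:E)%E by rewrite BE => /in1 h; rewrite lee_fin v0.
split.
 move=> hfin; exists (fine (\int[(lebesgue_measure \x lebesgue_measure)%E]_(p in B) (v (p.1 +i* p.2))%:E)%E) => r /andP[r0 r1].
 have cvr : rc r v by apply: cv; rewrite r0.
 rewrite -lee_fin -(Ar_EFin r0 cvr) fineK.
  apply: ge0_subset_integral => //; first exact: measurable_dsk.
  by rewrite BE; apply: sub => //; exact: ltW.
 by rewrite ge0_fin_numE //; apply: integral_ge0.
move=> [M HM]; apply: (@le_lt_trans _ _ M%:E); last exact: ltry.
have H : (\int[(lebesgue_measure \x lebesgue_measure)%E]_(p in dsk (rr i)) (v (p.1 +i* p.2))%:E @[i --> \oo] -->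
 \int[(lebesgue_measure \x lebesgue_measure)%E]_(p in \bigcup_i dsk (rr i)) (v (p.1 +i* p.2))%:E)%E.
 apply: ge0_nondecreasing_set_cvg_integral => //; first by move=> n; exact: measurable_dsk.
 by move=> n p hp; apply: nn; rewrite BU; exists n.
rewrite BU -(cvg_lim _ H) //; apply: lime_le; first by apply/cvg_ex; eexists; exact: H.
apply: nearW => n; have /andP[r0 r1] := hr n.
by rewrite (Ar_EFin r0 (cv _ (hr n))) lee_fin; exact: HM.
Qed.

End Link.

(** * Parseval identities for circle and weighted area integrals *)

Section Parseval.
Variable R : realType.
Local Notation C := R[i].
Implicit Types (a b c q : nat -> C) (z : C).

Definition l2 a := exists M : R, forall N, \sum_(n < N) cmod (a n) ^+ 2 <= M.

Lemma cmod_sub_sq (x y : C) : `|cmod x ^+ 2 - cmod y ^+ 2| <= cmod (x - y) * (cmod x + cmod y).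
Proof. by rewrite subr_sqr normrM (ger0_norm (addr_ge0 (cge0 _) (cge0 _))) ler_wpM2r ?addr_ge0 ?cge0 // cmod_dist. Qed.

Section Weighted.
Variables (r : R) (I : (C -> R) -> R) (w : C -> R) (Wt : nat -> R).
Hypotheses (hr : 0 < r < 1) (HI : posf r I) (cw : rc r w) (W0 : forall n, 0 <= Wt n).
(** Satisfied by circle integrals with w = 1 and by area integrals with w = rho, which are the two
    cases treated below. *)
Hypothesis orth : forall m n, cI I (fun z=> (w z)%:C * (z ^+ n * cj z ^+ m)) = if n == m then (Wt n)%:C else 0.

Lemma parseval_psum a N : I (fun z=> w z * cmod (psum a z N) ^+ 2) = \sum_(n < N) cmod (a n) ^+ 2 * Wt n.
Proof.
have I0 : I (fun=> 0) = 0 by rewrite (posf_cst _ HI) mul0r.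
suff : (I (fun z=> w z * cmod (psum a z N) ^+ 2))%:C = (\sum_(n < N) cmod (a n) ^+ 2 * Wt n)%:C :> C by move=> [].
rewrite -(cI_real _ I0).
have cm (i j : 'I_N) : con r (fun z=> (w z)%:C * (z ^+ i * cj z ^+ j)) by conT.
have -> : (fun z=> (w z * cmod (psum a z N) ^+ 2)%:C) =
 (fun z=> \sum_(i < N) \sum_(j < N) (a i * cj (a j)) * ((w z)%:C * (z ^+ i * cj z ^+ j))).
 apply/funext => z; rewrite realCM -mulcJ /psum (rmorph_sum cj) mulr_suml mulr_sumr; apply: eq_bigr => i _.
 rewrite mulr_sumr mulr_sumr; apply: eq_bigr => j _.
 by rewrite /= conjcM conjX; ring.
rewrite (cI_sum _ HI) => [|i]; last by apply: con_sum => j; apply: conM; [exact: con_cst|exact: cm].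
rewrite (rmorph_sum (real_complex R)); apply: eq_bigr => i _.
rewrite (cI_sum _ HI) => [|j]; last by conT.
rewrite (bigD1 i) //= big1 ?addr0 => [|j ji]; rewrite (cIZ _ HI) // orth.
 by rewrite eqxx mulcJ [RHS]realCM.
have -> : (i == j :> nat) = false by apply/eqP => /val_inj E; rewrite E eqxx in ji.
by rewrite mulr0.
Qed.

Lemma parseval_lim a f : PS a f -> forall e : R, 0 < e -> exists N0, forall N, (N0 <= N)%N ->
 `|I (fun z=> w z * cmod (f z) ^+ 2) - \sum_(n < N) cmod (a n) ^+ 2 * Wt n| <= e.
Proof.
move=> Hf e e0; have /andP[r0 r1] := hr; have cf : con r f by exact: PS_con Hf r1.
have [Bf Bf0 HBf] := con_bdd cf; have [Bw Bw0 HBw] := con_bdd cw.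
have i0 : 0 <= I (fun=> 1) by apply: posf_ge0 HI _ _; [exact: rc_cst|].
pose K := Bw * (2 * Bf + 1) * (I (fun=> 1) + 1).
have K0 : 0 < K by rewrite /K; apply: mulr_gt0; [apply: mulr_gt0 => //|]; lra.
pose e1 := Num.min 1 (e / K); have e10 : 0 < e1 by rewrite /e1 lt_min ltr01 divr_gt0.
have [e11 e1K] : e1 <= 1 /\ e1 <= e / K by rewrite /e1 !ge_min !lexx orbT.
have [N0 HN0] := PS_unif Hf hr e10; exists N0 => N /HN0 HN.
rewrite -parseval_psum; have cp : con r (fun z=> psum a z N) by exact: con_psum.
have r1' : rc r (fun z=> w z * cmod (f z) ^+ 2) by conT.
have r2 : rc r (fun z=> w z * cmod (psum a z N) ^+ 2) by conT.
rewrite -(posfB HI) //.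
have b z : cmod z <= r -> `|w z * cmod (f z) ^+ 2 - w z * cmod (psum a z N) ^+ 2| <= Bw * (e1 * (2 * Bf + 1)).
 move=> hz; rewrite -mulrBr normrM; apply: ler_pM => //; first by have := HBw z hz; rewrite cmodR.
 apply: le_trans (cmod_sub_sq _ _) _; have h1 := HN z hz; have h2 := HBf z hz.
 have h3 := cmodD3 (psum a z N) (f z).
 by apply: ler_pM; rewrite ?addr_ge0 ?cge0 // 1?cmodBC //; lra.
have cE : Bw * (e1 * (2 * Bf + 1)) * I (fun=> 1) <= e.
 apply: (@le_trans _ _ (e1 * K)); last by rewrite -ler_pdivlMr.
 rewrite /K; have -> : Bw * (e1 * (2 * Bf + 1)) * I (fun=> 1) = e1 * (Bw * (2 * Bf + 1)) * I (fun=> 1) by ring.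
 have -> : e1 * (Bw * (2 * Bf + 1) * (I (fun=> 1) + 1)) = e1 * (Bw * (2 * Bf + 1)) * (I (fun=> 1) + 1) by ring.
 by rewrite ler_wpM2l; [|apply: mulr_ge0; [exact: ltW|apply: mulr_ge0; lra]|lra].
apply: le_trans cE; rewrite -(posf_cst _ HI) ler_norml -(posfN HI); last exact: rc_cst.
have cb := rcB r1' r2.
apply/andP; split.
 by apply: (posf_le HI) => [||z /b]; [exact: rc_cst|exact: cb|rewrite ler_norml => /andP[]].
by apply: (posf_le HI) => [||z /b]; [exact: cb|exact: rc_cst|rewrite ler_norml => /andP[]].
Qed.

Lemma parseval_ge a f N : PS a f -> \sum_(n < N) cmod (a n) ^+ 2 * Wt n <= I (fun z=> w z * cmod (f z) ^+ 2).
Proof.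
move=> Hf; apply/ler_addgt0Pr => e e0; have [N0 HN0] := parseval_lim Hf e0.
have := HN0 _ (leq_maxr N N0); rewrite ler_norml => /andP[+ _] => h.
have : \sum_(n < N) cmod (a n) ^+ 2 * Wt n <= \sum_(n < maxn N N0) cmod (a n) ^+ 2 * Wt n.
 rewrite -(big_mkord xpredT (fun n=> cmod (a n) ^+ 2 * Wt n)) -(big_mkord xpredT (fun n=> cmod (a n) ^+ 2 * Wt n)).
 rewrite (@big_cat_nat _ _ _ N 0 (maxn N N0)) ?leq_maxl //= lerDl.
 by apply: sumr_ge0 => n _; rewrite mulr_ge0 ?sqr_ge0.
lra.
Qed.

Lemma parseval_le a f M : PS a f -> (forall N, \sum_(n < N) cmod (a n) ^+ 2 * Wt n <= M) -> I (fun z=> w z * cmod (f z) ^+ 2) <= M.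
Proof.
move=> Hf HM; apply/ler_addgt0Pr => e e0; have [N0 HN0] := parseval_lim Hf e0.
by have := HN0 _ (leqnn N0); have := HM N0; rewrite ler_norml => h /andP[_]; lra.
Qed.

End Weighted.

Lemma bernoulli_ineq (r : R) K : 0 <= r <= 1 -> 1 - K%:R * (1 - r) <= r ^+ K.
Proof.
move=> /andP[r0 r1]; elim: K => [|K IH]; first by rewrite mul0r subr0 expr0.
rewrite exprS; have : 0 <= K%:R * (1 - r) ^+ 2 by rewrite mulr_ge0 ?sqr_ge0.
by rewrite -natr1; set k := K%:R; nra.
Qed.

(** The passage r -> 1 by Bernoulli's inequality at one radius 1 - t, with t small compared with e /
    (S K). *)
Lemma pow_lim1 (S M : R) K : (forall r : R, 0 < r < 1 -> S * r ^+ K <= M) -> 0 <= S -> S <= M.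
Proof.
move=> H S0; apply/ler_addgt0Pr => e e0.
have k0 : 0 <= K%:R :> R by [].
have d0 : 0 < S * K%:R + e + 1 by have := mulr_ge0 S0 k0; lra.
pose t := e / (S * K%:R + e + 1); have t0 : 0 < t by rewrite divr_gt0.
have t1 : t < 1 by rewrite /t ltr_pdivrMr // mul1r; have := mulr_ge0 S0 k0; lra.
have h : 0 < 1 - t < 1 by apply/andP; split; lra.
have := H _ h; have h' : 0 <= 1 - t <= 1 by apply/andP; split; lra.
have := ler_wpM2l S0 (bernoulli_ineq K h'); rewrite opprB addrCA subrr addr0.
have : t * (S * K%:R + e + 1) = e by rewrite /t mulfVK // gt_eqF.
clearbody t; move=> E h1 h2; have te := mulr_gt0 t0 e0; lra.
Qed.

Lemma Mc_mon (r : R) m n : 0 < r -> Mc r (fun z=> z ^+ n * cj z ^+ m) = if n == m then (2 * pi * r ^+ (2 * n))%:C else 0.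
Proof.
move=> r0; have -> : (fun z : C => z ^+ n * cj z ^+ m) = (fun z=> cj z ^+ m * z ^+ n) by apply/funext => z; rewrite mulrC.
by rewrite Mc_orth //; case: eqP => // ->.
Qed.

Lemma Ac_mon (r : R) m n : 0 < r -> Ac r (fun z=> z ^+ n * cj z ^+ m) = if n == m then (pi * r ^+ (2 * n.+1) / n.+1%:R)%:C else 0.
Proof.
move=> r0.
pose p z : C := n%:R * z ^+ n.-1 * 1 * (cj z ^+ m.+1 / m.+1%:R).
have cp : con r p by rewrite /p; conT.
have cq : con r (fun z : C => z ^+ n * cj z ^+ m) by conT.
have H z : cmod z <= r -> wd (fun z=> z ^+ n * (cj z ^+ m.+1 / m.+1%:R)) z (p z) (z ^+ n * cj z ^+ m).
 move=> _; have := wdM (wdX n (wd_id z)) (wdM (wdX m.+1 (wd_conj (wd_id z))) (wd_cst (m.+1%:R^-1) z)).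
 apply: wd_eq; first by rewrite conjc0 mulr0 mul0r mulr0 addr0 mulr0 addr0.
 rewrite conjc1 mulr0 mul0r add0r mulr0 addr0 mulr1 /=; congr (_ * _).
 by rewrite mulrC mulrA mulVf // mul1r.
have := green r0 cp cq H.
have -> : (fun z : C => z * (z ^+ n * (cj z ^+ m.+1 / m.+1%:R))) = (fun z=> m.+1%:R^-1 * (z ^+ n.+1 * cj z ^+ m.+1)).
 by apply/funext => z; rewrite [z ^+ n.+1]exprS [RHS]mulrC -!mulrA.
have cc : con r (fun z : C => z ^+ n.+1 * cj z ^+ m.+1) by conT.
rewrite /Mc (cIZ _ (posf_Mr r0) cc) [X in _ * X = _](Mc_mon _ _ r0) eqSS => E.
have h2 : 2 != 0 :> C by rewrite pnatr_eq0.
apply: (mulfI h2); rewrite -E; case: eqP => [->|_]; last by rewrite !mulr0.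
have nE k : k%:R = (k%:R : R)%:C :> C by rewrite (rmorph_nat (real_complex R)).
rewrite !nE -realCV -!realCM; congr (_%:C); ring.
Qed.

Lemma Ac_rho_mon (r : R) m n : 0 < r -> Ac r (fun z=> (rho z)%:C * (z ^+ n * cj z ^+ m)) =
 if n == m then (pi * r ^+ (2 * n.+2) / (n.+1%:R * n.+2%:R) + (1 - r ^+ 2) * (pi * r ^+ (2 * n.+1) / n.+1%:R))%:C else 0.
Proof.
move=> r0; have A1 := posf_Ar r0.
have -> : (fun z : C => (rho z)%:C * (z ^+ n * cj z ^+ m)) = (fun z=> z ^+ n * cj z ^+ m - z ^+ n.+1 * cj z ^+ m.+1).
 apply/funext => z; rewrite rhoE !exprS; ring.
have c1 : con r (fun z : C => z ^+ n * cj z ^+ m) by conT.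
have c2 : con r (fun z : C => z ^+ n.+1 * cj z ^+ m.+1) by conT.
rewrite /Ac (cIB A1) // -!/(Ac _ _) !Ac_mon // eqSS; case: eqP => [_|_]; last by rewrite subr0.
rewrite -realCN -realCD; congr (_%:C).
have n1 : n.+1%:R != 0 :> R by rewrite pnatr_eq0.
have n2 : n.+2%:R != 0 :> R by rewrite pnatr_eq0.
have e2 : n.+2%:R = n.+1%:R + 1 :> R by rewrite natr1.
have -> : r ^+ (2 * n.+2) = r ^+ 2 * r ^+ (2 * n.+1) by rewrite -exprD; congr (_ ^+ _); lia.
rewrite e2 in n2 *; move: (n.+1%:R) n1 n2 (r ^+ (2 * n.+1)) => x n1 n2 y; field.
by rewrite n1 n2.
Qed.

Lemma H2_l2 a f : PS a f -> (exists M : R, forall r : R, 0 < r < 1 -> Mr r (fun z=> cmod (f z) ^+ 2) <= M) <-> l2 a.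
Proof.
move=> Hf; have p0 := pi_gt0 R.
have E (r : R) : Mr r (fun z=> cmod (f z) ^+ 2) = Mr r (fun z=> 1 * cmod (f z) ^+ 2) by congr Mr; apply/funext => z; rewrite mul1r.
have or (r : R) : 0 < r -> forall m n, cI (Mr r) (fun z : C => (1 : R)%:C * (z ^+ n * cj z ^+ m)) = if n == m then (2 * pi * r ^+ (2 * n))%:C else 0.
 move=> r0 m n; rewrite -(Mc_mon m n r0) /Mc; congr cI; apply/funext => z; by rewrite (_ : 1%:C = 1 :> C) // mul1r.
have W0 (r : R) : 0 < r -> forall n, 0 <= 2 * pi * r ^+ (2 * n).
 by move=> r0 n; rewrite mulr_ge0 ?exprn_ge0 ?(ltW r0) //; lra.
split=> -[M HM].
 exists (M / (2 * pi)) => N; rewrite ler_pdivlMr; last by npos.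
 apply: (@pow_lim1 _ _ (2 * N)) => [r hr|]; last by rewrite mulr_ge0 ?sumr_ge0 //; [move=> n _; rewrite sqr_ge0|lra].
 have /andP[r0 r1] := hr.
 have := parseval_ge hr (posf_Mr r0) (rc_cst _) (W0 r r0) (or r r0) N Hf.
 rewrite -E => h; apply: le_trans (le_trans h (HM r hr)).
 rewrite -mulrA mulr_suml; apply: ler_sum => n _; rewrite ler_wpM2l ?sqr_ge0 // ler_wpM2l //; first lra.
 by rewrite ler_wiXn2l ?(ltW r0) ?(ltW r1) // leq_mul2l /= ltnW.
exists (2 * pi * M) => r hr; have /andP[r0 r1] := hr; rewrite E.
apply: (parseval_le hr (posf_Mr r0) (rc_cst _) (or r r0) Hf) => N.
apply: le_trans (_ : \sum_(n < N) 2 * pi * cmod (a n) ^+ 2 <= _); last by rewrite -mulr_sumr ler_wpM2l //; lra.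
apply: ler_sum => n _; rewrite [leRHS]mulrC ler_wpM2l ?sqr_ge0 // ler_piMr //; first lra.
by rewrite exprn_ile1 // ltW.
Qed.

(** As r -> 1 the weight of the n-th coefficient tends to pi / ((n+1)(n+2)), which is comparable
    with 1/(n+1)^2. *)
Lemma area_l2 q Q : PS q Q -> (exists M : R, forall r : R, 0 < r < 1 -> Ar r (fun z=> rho z * cmod (Q z) ^+ 2) <= M) <-> l2 (fun n=> q n / n.+1%:R).
Proof.
move=> HQ; have p0 := pi_gt0 R.
pose W (r : R) n : R := pi * r ^+ (2 * n.+2) / (n.+1%:R * n.+2%:R) + (1 - r ^+ 2) * (pi * r ^+ (2 * n.+1) / n.+1%:R).
have n0 n : 0 < n.+1%:R :> R by rewrite ltr0n.
have or (r : R) : 0 < r -> forall m n, cI (Ar r) (fun z : C => (rho z)%:C * (z ^+ n * cj z ^+ m)) = if n == m then (W r n)%:C else 0.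
 by move=> r0 m n; rewrite -(Ac_rho_mon m n r0).
have W1 (r : R) n : 0 < r < 1 -> 0 <= (1 - r ^+ 2) * (pi * r ^+ (2 * n.+1) / n.+1%:R).
 move=> /andP[r0 r1]; apply: mulr_ge0; first by rewrite subr_ge0 exprn_ile1 // ltW.
 by apply: divr_ge0; rewrite ?(ltW (n0 _)) // mulr_ge0 ?exprn_ge0 ?(ltW r0) // ltW.
have W2 (r : R) n : 0 < r < 1 -> 0 <= pi * r ^+ (2 * n.+2) / (n.+1%:R * n.+2%:R).
 by move=> /andP[r0 r1]; apply: divr_ge0; apply: mulr_ge0; rewrite ?exprn_ge0 ?(ltW r0) // ltW.
have W0 (r : R) : 0 < r < 1 -> forall n, 0 <= W r n by move=> hr n; rewrite /W addr_ge0 ?W1 ?W2.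
have cr (r : R) : rc r (@rho R) by exact: rc_rho.
have qE n : cmod (q n / n.+1%:R) ^+ 2 = cmod (q n) ^+ 2 / n.+1%:R ^+ 2 by rewrite cmodM cmodV cmod_nat expr_div_n.
split=> -[M HM].
 exists (2 * (M / pi)) => N; rewrite -ler_pdivrMl // mulrC ler_pdivlMr //.
 apply: (@pow_lim1 _ _ (2 * N.+1)) => [r hr|].
  have /andP[r0 r1] := hr.
  have := parseval_ge hr (posf_Ar r0) (cr r) (W0 r hr) (or r r0) N HQ => h.
  apply: le_trans (le_trans h (HM r hr)).
  rewrite mulr_suml !mulr_suml; apply: ler_sum => n _.
  have h1 : pi * r ^+ (2 * n.+2) / (n.+1%:R * n.+2%:R) <= W r n by rewrite /W lerDl W1.
  apply: le_trans (ler_wpM2l (sqr_ge0 _) h1); rewrite qE.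
  have h2 : r ^+ (2 * N.+1) <= r ^+ (2 * n.+2) by rewrite ler_wiXn2l ?(ltW r0) ?(ltW r1) // leq_mul2l /= ltnS.
  have h3 : (n.+1%:R ^+ 2)^-1 / 2 <= (n.+1%:R * n.+2%:R)^-1 :> R.
   rewrite -invfM lef_pV2 ?posrE ?mulr_gt0 ?exprn_gt0 // expr2 -mulrA ler_wpM2l ?(ltW (n0 n)) //.
   by rewrite -!natr1; have : 0 <= n%:R :> R by []; lra.
  have h4 := exprn_ge0 (2 * N.+1) (ltW r0).
  have h5 : r ^+ (2 * N.+1) * ((n.+1%:R ^+ 2)^-1 / 2) <= r ^+ (2 * n.+2) * (n.+1%:R * n.+2%:R)^-1.
   by apply: ler_pM => //; rewrite divr_ge0 ?invr_ge0 ?sqr_ge0.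
  have c0 := sqr_ge0 (cmod (q n)); move: h5 c0.
  move: (cmod (q n) ^+ 2) (n.+1%:R ^+ 2)^-1 (n.+1%:R * n.+2%:R)^-1 (r ^+ (2 * N.+1)) (r ^+ (2 * n.+2)) => c x y u v h5 c0.
  have -> : c * x / 2 * pi * u = c * (pi * (u * (x / 2))) by ring.
  by rewrite ler_wpM2l // -mulrA ler_wpM2l // ltW.
 by rewrite mulr_ge0 ?(ltW p0) // divr_ge0 // sumr_ge0 // => n _; rewrite sqr_ge0.
exists (2 * pi * M) => r hr; have /andP[r0 r1] := hr.
apply: (parseval_le hr (posf_Ar r0) (cr r) (or r r0) HQ) => N.
apply: le_trans (_ : \sum_(n < N) 2 * pi * cmod (q n / n.+1%:R) ^+ 2 <= _); last by rewrite -mulr_sumr ler_wpM2l //; lra.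
apply: ler_sum => n _; rewrite qE.
have -> : 2 * pi * (cmod (q n) ^+ 2 / n.+1%:R ^+ 2) = cmod (q n) ^+ 2 * (2 * pi / n.+1%:R ^+ 2) by rewrite mulrCA.
rewrite ler_wpM2l ?sqr_ge0 //.
have x0 : 0 <= r ^+ 2 <= 1 by rewrite sqr_ge0 exprn_ile1 // ltW.
(* (1 - x) times the n+2 terms x^(n+1), each at most a term of the geometric sum of length n+2. It
   tames the second summand of the weight uniformly in r. *)
have geo : (1 - r ^+ 2) * r ^+ (2 * n.+1) * n.+2%:R <= 1.
 rewrite exprM; move: (r ^+ 2) x0 => x /andP[x0 x1].
 suff : (1 - x) * x ^+ n.+1 * n.+2%:R <= 1 - x ^+ n.+2 by have := exprn_ge0 n.+2 x0; lra.
 elim: (n.+1) => [|k IH]; first by rewrite expr0 mulr1 mulr1 expr1.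
 have xk := exprn_ge0 k.+1 x0.
 have h : x * ((1 - x) * x ^+ k * k.+1%:R) <= x * (1 - x ^+ k.+1) by rewrite ler_wpM2l.
 rewrite -natr1 mulrDr mulr1; have -> : (1 - x) * x ^+ k.+1 * k.+1%:R = x * ((1 - x) * x ^+ k * k.+1%:R) by rewrite exprS; ring.
 by apply: le_trans (lerD h (lexx _)) _; rewrite [x ^+ k.+2]exprS; move: (exprn_ile1 k.+1 x0 x1); move: (x ^+ k.+1) xk => y y0 y1; nra.
have i1 : pi * r ^+ (2 * n.+2) / (n.+1%:R * n.+2%:R) <= pi / n.+1%:R ^+ 2.
 apply: ler_pM.
 - by rewrite mulr_ge0 ?exprn_ge0 ?(ltW r0) ?(ltW p0).
 - by rewrite invr_ge0 mulr_ge0 // ltW.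
 - by rewrite ler_piMr ?(ltW p0) // exprn_ile1 // ltW.
 - by rewrite lef_pV2 ?posrE ?mulr_gt0 ?exprn_gt0 // expr2 ler_wpM2l ?(ltW (n0 n)) // ler_nat.
have i2 : (1 - r ^+ 2) * (pi * r ^+ (2 * n.+1) / n.+1%:R) <= pi / n.+1%:R ^+ 2.
 have -> : (1 - r ^+ 2) * (pi * r ^+ (2 * n.+1) / n.+1%:R) = pi / n.+1%:R * ((1 - r ^+ 2) * r ^+ (2 * n.+1)) by ring.
 have -> : pi / n.+1%:R ^+ 2 = pi / n.+1%:R * n.+1%:R^-1 :> R by rewrite expr2 invfM mulrA.
 rewrite ler_wpM2l ?divr_ge0 ?(ltW p0) //.
 rewrite -[leRHS]mul1r ler_pdivlMr //; apply: le_trans geo; rewrite ler_wpM2l ?ler_nat //.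
 by rewrite mulr_ge0 ?exprn_ge0 ?(ltW r0) // subr_ge0; case/andP: x0.
have -> : 2 * pi / n.+1%:R ^+ 2 = pi / n.+1%:R ^+ 2 + pi / n.+1%:R ^+ 2 :> R by rewrite -mulrA mulr_natl mulr2n.
exact: lerD.
Qed.

End Parseval.

(** * The inequalities of Hardy and Copson *)

Section Hardy.
Variable R : realType.
Implicit Types (b u v w : nat -> R).

(** The sum of A_n^2 - 2 b_n A_n is bounded by a telescoping quantity, each step being a perfect
    square; then 2 b A <= A^2 / 2 + 2 b^2. *)
Lemma hardy b N : (forall n, 0 <= b n) ->
 \sum_(n < N) ((\sum_(m < n.+1) b m) / n.+1%:R) ^+ 2 <= 4 * \sum_(n < N) b n ^+ 2.
Proof.
move=> b0; pose S n := \sum_(m < n) b m; pose A n := S n.+1 / n.+1%:R.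
have SS n : S n.+1 = S n + b n by rewrite /S big_ord_recr.
have H : \sum_(n < N) (A n ^+ 2 - 2 * (b n * A n)) <= - (S N ^+ 2 / N%:R).
 elim: N => [|k IH]; first by rewrite big_ord0 /S big_ord0 expr0n mul0r oppr0.
 rewrite big_ord_recr /=; apply: le_trans (lerD IH (lexx _)) _.
 case: k {IH} => [|k].
  by rewrite /A SS /S big_ord0 expr0n /= mul0r oppr0 !add0r !divr1; lra.
 have k0 : 0 < k.+1%:R :> R by rewrite ltr0n.
 have e2 : k.+2%:R = k.+1%:R + 1 :> R by rewrite natr1.
 have bE : b k.+1 = S k.+2 - S k.+1 by rewrite SS addrC addKr.
 rewrite /A bE e2; move: (k.+1%:R) (S k.+1) (S k.+2) k0 => K s t K0.
 rewrite -subr_ge0.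
 have -> : - (t ^+ 2 / (K + 1)) - (- (s ^+ 2 / K) + ((t / (K + 1)) ^+ 2 - 2 * ((t - s) * (t / (K + 1))))) = (s * (K + 1) - K * t) ^+ 2 / (K * (K + 1) ^+ 2).
  by field; rewrite !gt_eqF //; lra.
 by rewrite divr_ge0 ?sqr_ge0 // mulr_ge0 ?sqr_ge0 // ltW.
have h2 : 0 <= S N ^+ 2 / N%:R by rewrite divr_ge0 ?sqr_ge0.
have h3 : \sum_(n < N) A n ^+ 2 <= \sum_(n < N) (2^-1 * A n ^+ 2 + 2 * b n ^+ 2 + (A n ^+ 2 - 2 * (b n * A n))).
 by apply: ler_sum => n _; have := sqr_ge0 (A n - 2 * b n); lra.
rewrite !big_split /= -!mulr_sumr in h3 H *.
by rewrite -/(A _); lra.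
Qed.

(** The dual of Hardy's inequality: exchange of the sums gives sum T^2 = sum b H with H the running
    means of T, to which [hardy] applies. *)
Lemma copson b N : (forall n, 0 <= b n) ->
 \sum_(n < N) (\sum_(m < N | (n <= m)%N) b m / m.+1%:R) ^+ 2 <= 4 * \sum_(n < N) b n ^+ 2.
Proof.
move=> b0; pose T n := \sum_(m < N | (n <= m)%N) b m / m.+1%:R.
have T0 n : 0 <= T n by apply: sumr_ge0 => m _; rewrite divr_ge0.
pose H m := (\sum_(n < m.+1) T n) / m.+1%:R.
have E : \sum_(n < N) T n ^+ 2 = \sum_(m < N) b m * H m.
 transitivity (\sum_(n < N) \sum_(m < N | (n <= m)%N) T n * (b m / m.+1%:R)).
  by apply: eq_bigr => n _; rewrite expr2 {2}/T mulr_sumr.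
 rewrite (exchange_big_dep xpredT) //=; apply: eq_bigr => m _.
 rewrite /H (big_ord_widen N (fun n=> T n)) // mulr_suml mulr_sumr; apply: eq_bigr => n _; ring.
have h1 : \sum_(m < N) b m * H m <= \sum_(m < N) (2 * b m ^+ 2 + 8^-1 * H m ^+ 2).
 by apply: ler_sum => m _; have := sqr_ge0 (H m - 4 * b m); lra.
have h2 := hardy N T0; rewrite -/(H _) in h2.
rewrite big_split /= -!mulr_sumr -E in h1.
by rewrite -/(T _); move: h2; rewrite -/(H _); lra.
Qed.

Definition l2r u := exists M : R, forall N, \sum_(n < N) u n ^+ 2 <= M.

Lemma l2r_le u v w : (forall n, 0 <= w n <= u n + v n) -> l2r u -> l2r v -> l2r w.
Proof.
move=> H [M HM] [M' HM']; exists (2 * M + 2 * M') => N.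
apply: (@le_trans _ _ (\sum_(n < N) (2 * u n ^+ 2 + 2 * v n ^+ 2))).
 apply: ler_sum => n _; have /andP[w0 wu] := H n.
 have : w n ^+ 2 <= (u n + v n) ^+ 2 by rewrite lerXn2r ?nnegrE // (le_trans w0).
 by have := sqr_ge0 (u n - v n); lra.
by rewrite big_split /= -!mulr_sumr; have := HM N; have := HM' N; lra.
Qed.

Lemma l2r_shift u : l2r u -> l2r (fun n=> u n.+1).
Proof.
move=> [M HM]; exists M => N; apply: le_trans (HM N.+1).
by rewrite big_ord_recl lerDr sqr_ge0.
Qed.

Lemma l2r_unshift u : l2r u -> l2r (fun n=> if n is k.+1 then u k else 0).
Proof.
move=> [M HM]; exists M => -[|N]; first by rewrite big_ord0; have := HM 0%N; rewrite big_ord0.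
by rewrite big_ord_recl /= expr0n /= add0r; apply: le_trans (HM N); apply: ler_sum.
Qed.

End Hardy.

(** * The local Dirichlet integral at a boundary point *)

Section LocalDirichlet.
Variable R : realType.
Local Notation C := R[i].
Implicit Types (a b q : nat -> C) (z : C).

Definition H2c (g : C -> C) := exists2 b, PS b g & l2 b.

Lemma l2_bound b : l2 b -> exists2 K : R, 0 < K & forall n, cmod (b n) <= K.
Proof.
move=> [M HM]; have M0 : 0 <= M by have := HM 0%N; rewrite big_ord0.
exists (M + 1) => [|n]; first by lra.
have h : cmod (b n) ^+ 2 <= M.
 by apply: le_trans (HM n.+1); rewrite big_ord_recr /= lerDr sumr_ge0 // => i _; rewrite sqr_ge0.
by have := sqr_ge0 (cmod (b n) - 1); lra.
Qed.

Lemma l2_PS b : l2 b -> exists g, PS b g.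
Proof.
move=> /l2_bound[K K0 HK]; apply: PS_exists => r /andP[r0 r1]; exists K => // n.
by rewrite -[leRHS]mulr1; apply: ler_pM; rewrite ?cge0 ?exprn_ge0 ?exprn_ile1 // ltW.
Qed.

Lemma holo_sub f g : holo f -> holo g -> forall (c : C), holo (fun z=> f z + c * g z).
Proof.
move=> hf hg c z hz; have [p Hp] := hf z hz; have [q Hq] := hg z hz; exists (p + c * q).
by apply: wd_eq (wdD Hp (wdZ c Hq)); rewrite ?mulr0 ?addr0.
Qed.

Lemma PS_add a b f g (c : C) : PS a f -> PS b g -> PS (fun n=> a n + c * b n) (fun z=> f z + c * g z).
Proof.
move=> Ha Hb; have [d Hd] := holo_PS (holo_sub (PS_holo Ha) (PS_holo Hb) c).
rewrite (_ : (fun n=> _) = d) //; apply/funext => n; have h : 0 < (1 / 2 : R) < 1 by lra.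
have [r0 r1] := andP h; have p0 := pi_gt0 R; have M0 := posf_Mr r0; have cf := PS_con Ha r1; have cg := PS_con Hb r1.
have k0 : (2 * pi * (1 / 2) ^+ (2 * n))%:C != 0 :> C by rewrite -cmod_gt0 cmodR gtr0_norm !mulr_gt0 ?exprn_gt0.
apply: (mulfI k0); rewrite -(PS_coef n Hd h) mulrDr mulrCA -(PS_coef n Ha h) -(PS_coef n Hb h) /Mc -(cIZ _ M0); last by conT.
by rewrite -(cID M0); [congr cI; apply/funext => z; ring|conT|conT].
Qed.

Lemma PS_cst (c : C) : PS (fun n=> if n is k.+1 then 0 else c) (fun=> c).
Proof.
split=> [r /andP[r0 r1]|z hz e e0].
 exists (cmod c + 1) => [|[|n]]; first by have := cge0 c; lra.
  by rewrite expr0 mulr1; lra.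
 by rewrite cmod0 mul0r; have := cge0 c; lra.
by exists 1 => -[//|n] _; rewrite /psum big_ord_recl big1 => [|i _]; rewrite ?mul0r // expr0 mulr1 addr0 subrr cmod0 ltW.
Qed.

Lemma PS_mulX b g : PS b g -> PS (fun n=> if n is k.+1 then b k else 0) (fun z=> z * g z).
Proof.
move=> [H1 H2]; split=> [r hr|z hz e e0].
 have [K K0 HK] := H1 r hr; have /andP[r0 r1] := hr; exists K => // -[|n]; first by rewrite cmod0 mul0r ltW.
 have n0 : 0 <= cmod (b n) * r ^+ n by rewrite mulr_ge0 ?cge0 // exprn_ge0 // ltW.
 by rewrite exprS mulrCA; apply: le_trans (HK n); rewrite ler_piMl // ltW.
have [N HN] := H2 z hz e e0; exists N.+1 => -[//|n] Nn.
rewrite /psum big_ord_recl mul0r add0r (eq_bigr (fun i : 'I_n => z * (b i * z ^+ i))) => [|i _]; last by rewrite /= exprS; ring.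
by rewrite -mulr_sumr -mulrBr cmodM; apply: le_trans (HN n Nn); rewrite ler_piMl ?cge0 // ltW.
Qed.

Lemma PS_lin b g (c al be : C) : PS b g ->
 PS (fun n=> if n is k.+1 then al * b k.+1 + be * b k else c + al * b 0%N) (fun z=> c + (al + be * z) * g z).
Proof.
move=> Hb; have := PS_add be (PS_add al (PS_cst c) Hb) (PS_mulX Hb).
rewrite (_ : (fun n=> _) = (fun n=> if n is k.+1 then al * b k.+1 + be * b k else c + al * b 0%N)); last first.
 by apply/funext => -[|n]; rewrite ?mulr0 ?addr0 ?add0r.
by apply: PS_ext => z _; ring.
Qed.
Lemma PS_inj a f g : PS a f -> PS a g -> inD z, f z = g z.
Proof. by move=> [_ H] [_ H'] z hz; apply: lim_uniq (H z hz) (H' z hz). Qed.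

Variables (zt : C) (zt1 : cmod zt = 1).

Lemma zz1 : zt * cj zt = 1.
Proof. by rewrite mulcJ zt1 expr1n. Qed.

Variables (a q : nat -> C) (f f1 Q : C -> C).
Hypotheses (Ha : PS a f) (Hf1 : PS (dcoef a) f1) (HQ : PS q Q).
Hypothesis QE : inD z, (1 - cj zt * z) * Q z = f1 z.

Lemma q_rec n : dcoef a n = q n - cj zt * (if n is k.+1 then q k else 0).
Proof.
have H : PS (dcoef a) (fun z=> 0 + (1 + - cj zt * z) * Q z).
 by apply: PS_ext Hf1 => z hz; rewrite add0r mulNr QE.
have -> := PS_uniq H (PS_lin 0 1 (- cj zt) HQ) n.
by case: n => [|n]; ring.
Qed.

(** With b the coefficients of g, q_n = -zt (n+1) b_(n+1) + s_n, where s_n is a sum of n+1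
    coefficients of g up to unimodular factors; Hardy's inequality handles s_n / (n+1). *)
Lemma dirichlet_of_quotient c g : H2c g -> (inD z, f z = c + (z - zt) * g z) -> l2 (fun n=> q n / n.+1%:R).
Proof.
move=> [b Hb lb] E.
have aE n : a n = if n is k.+1 then - zt * b k.+1 + 1 * b k else c + - zt * b 0%N.
 have H : PS a (fun z=> c + (- zt + 1 * z) * g z) by apply: PS_ext Ha => z hz; rewrite E //; ring.
 by rewrite (PS_uniq H (PS_lin c (- zt) 1 Hb)).
pose s n := \sum_(m < n.+1) b m * cj zt ^+ (n - m).
have sS n : s n.+1 = b n.+1 + cj zt * s n.
 rewrite /s big_ord_recr /= subnn expr0 mulr1 addrC; congr (_ + _); rewrite mulr_sumr; apply: eq_bigr => i _.
 by rewrite mulrCA -exprS subSn // -ltnS.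
have qE n : q n = - zt * (n.+1%:R * b n.+1) + s n.
 elim: n => [|n IH].
  have := q_rec 0; rewrite /dcoef mulr0 subr0 => <-; rewrite aE /s big_ord_recl big_ord0 expr0 /=; ring.
 have := q_rec n.+1; rewrite IH sS /dcoef aE => /eqP; rewrite eq_sym subr_eq => /eqP ->.
 transitivity (n.+2%:R * (- zt * b n.+2 + 1 * b n.+1) + (- (zt * cj zt) * (n.+1%:R * b n.+1) + cj zt * s n)); first by ring.
 by rewrite zz1 -[n.+2%:R]natr1; ring.
have s_le n : cmod (s n) <= \sum_(m < n.+1) cmod (b m).
 apply: le_trans (cmod_sum _ _ _) _; apply: ler_sum => m _.
 by rewrite cmodM cmodX cmodJ zt1 expr1n mulr1.
suff H : l2r (fun n=> cmod (q n / n.+1%:R)) by exact: H.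
apply: (@l2r_le R (fun n=> cmod (b n.+1)) (fun n=> (\sum_(m < n.+1) cmod (b m)) / n.+1%:R)).
- move=> n; rewrite cge0 /= cmodM cmodV cmod_nat ler_pdivrMr // mulrDl mulfVK ?gt_eqF // qE.
 tri; apply: lerD (s_le n).
 by rewrite !cmodM cmodN zt1 mul1r cmod_nat mulrC.
- exact: (l2r_shift (u := fun n=> cmod (b n))).
- have [M HM] := lb; exists (4 * M) => N; apply: le_trans (hardy N (fun n=> cge0 (b n))) _.
 by rewrite ler_wpM2l.
Qed.

(** The coefficients of g are, up to powers of conj(zt), the tails of the series of a_(m+1) zt^m.
    Summation by parts rewrites these tails through q_m / ((m+1)(m+2)), and Copson's inequality
    shows that they are square summable. *)
Lemma quotient_of_dirichlet : l2 (fun n=> q n / n.+1%:R) -> exists c g, H2c g /\ inD z, f z = c + (z - zt) * g z.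
Proof.
move=> [M HM]; pose u n := cmod (q n / n.+1%:R).
have u0 n : 0 <= u n by exact: cge0.
have n0 n : 0 < n.+1%:R :> R by rewrite ltr0n.
have uE n : u n = cmod (q n) / n.+1%:R by rewrite /u cmodM cmodV cmod_nat.
pose v m : C := q m * zt ^+ m / (m.+1%:R * m.+2%:R).
have vE m : cmod (v m) = u m / m.+2%:R.
 by rewrite /v !cmodM cmodV !cmodM cmodX zt1 expr1n mulr1 !cmod_nat uE invfM mulrA.
pose P N := \sum_(m < N) v m.
have tele N : \sum_(m < N) (m.+2%:R ^+ 2)^-1 <= 1 - N.+1%:R^-1 :> R.
 elim: N => [|N IH]; first by rewrite big_ord0 invr1 subrr.
 rewrite big_ord_recr /=; apply: le_trans (lerD IH (lexx _)) _.
 have e2 : N.+2%:R = N.+1%:R + 1 :> R by rewrite natr1.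
 rewrite e2; move: (N.+1%:R) (n0 N) => x x0; rewrite -subr_ge0.
 have -> : 1 - (x + 1)^-1 - (1 - x^-1 + (x + 1) ^- 2) = (x * (x + 1) ^+ 2)^-1 by field; rewrite !gt_eqF //; lra.
 by rewrite invr_ge0 mulr_ge0 ?sqr_ge0 // ltW.
have Pb N : cmod (P N) <= M + 1.
 apply: le_trans (cmod_sum _ _ _) _.
 apply: (@le_trans _ _ (\sum_(m < N) (u m ^+ 2 + (m.+2%:R ^+ 2)^-1))).
  apply: ler_sum => m _; have y0 : 0 <= m.+2%:R^-1 :> R by rewrite invr_ge0.
  rewrite vE -exprVn; move: (u m) (u0 m) (m.+2%:R^-1) y0 => x x0 y y0.
  by have := sqr_ge0 (x - y); have := sqr_ge0 x; have := sqr_ge0 y; lra.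
 rewrite big_split /=; apply: lerD; first exact: HM.
 by apply: le_trans (tele N) _; rewrite gerBl invr_ge0.
(* A limit of the bounded partial sums P along an ultrafilter serves as the sum of the series of
   v. *)
have [U [HU HUo]] := ultraFilterLemma (@eventually_filter : ProperFilter \oo).
have [V HV] := ulim_exists HU Pb.
pose tau n := V - P n.
have tauS n : tau n - tau n.+1 = v n by rewrite /tau /P big_ord_recr /=; ring.
have Pdiff n N : (n <= N)%N -> cmod (P N - P n) <= \sum_(m < N | (n <= m)%N) u m / m.+1%:R.
 move=> nN; have -> : P N - P n = \sum_(m < N | (n <= m)%N) v m.
  rewrite /P (bigID (fun m : 'I_N => (m < n)%N)) /= -(big_ord_widen N v nN) addrC addrK.
  by apply: eq_bigl => m; rewrite -leqNgt.
 apply: le_trans (cmod_sum _ _ _) _; apply: ler_sum => m _; rewrite vE ler_wpM2l // lef_pV2 ?posrE //.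
 by rewrite ler_nat.
have M0 : 0 <= M by have := HM 0%N; rewrite big_ord0.
have ltau : l2 tau.
 exists (8 * M + 2) => K.
 have e0 : 0 < K.+1%:R^-1 :> R by rewrite invr_gt0.
 have UK : U [set n | (K <= n)%N] by apply: HUo; exists K.
 have [N [/= h1 h2]] := filter_ex (filterI (HV _ e0) UK).
 apply: (@le_trans _ _ (\sum_(n < K) (2 * (\sum_(m < N | (n <= m)%N) u m / m.+1%:R) ^+ 2 + 2 * (K.+1%:R^-1) ^+ 2))).
  apply: ler_sum => n _; have nN : (n <= N)%N by apply: leq_trans h2; exact: ltnW.
  have h3 := Pdiff n N nN.
  have h4 : cmod (tau n) <= cmod (P N - P n) + cmod (P N - V).
   by rewrite /tau (_ : V - P n = (P N - P n) - (P N - V)) ?cmodB //; ring.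
  move: h1 h3 h4 (cge0 (tau n)) e0; set T := \sum_(_ < _ | _) _; move: (K.+1%:R^-1) (cmod (tau n)) (cmod (P N - P n)) (cmod (P N - V)) => e t x y h1 h3 h4 t0 e0.
  have : t ^+ 2 <= (T + e) ^+ 2 by rewrite lerXn2r ?nnegrE //; lra.
  by have := sqr_ge0 (T - e); lra.
 rewrite big_split /= -!mulr_sumr sumr_const card_ord; apply: lerD.
  have h5 : \sum_(n < K) (\sum_(m < N | (n <= m)%N) u m / m.+1%:R) ^+ 2 <= \sum_(n < N) (\sum_(m < N | (n <= m)%N) u m / m.+1%:R) ^+ 2.
   rewrite (big_ord_widen N (fun n=> (\sum_(m < N | (n <= m)%N) u m / m.+1%:R) ^+ 2) h2) big_mkcond /=.
   by apply: ler_sum => n _; case: ifP => // _; rewrite sqr_ge0.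
  by have := copson N u0; have := HM N; move: h5; rewrite -/(u _); lra.
 have xk : K.+1%:R^-1 * K%:R <= 1 :> R by rewrite ler_pdivrMl // mulr1 ler_nat.
 have x1 : K.+1%:R^-1 <= 1 :> R by rewrite invf_le1 // ler1n.
 rewrite -[_ *+ K]mulr_natr; move: (K.+1%:R^-1) (K%:R) e0 xk x1 (ler0n R K) => x k x0 xk x1 k0.
 by have := ler_pM (ltW x0) (mulr_ge0 (ltW x0) k0) x1 xk; lra.
(* Summation by parts: tau n is the tail of v and n v_(n-1) the boundary term, so that B n - B (n+1)
   = a_(n+1) zt^n. *)
pose B n := tau n - (if n is k.+1 then k.+1%:R * v k else 0).
pose b n := B n * cj zt ^+ n.
have lb : l2 b.
 suff H : l2r (fun n=> cmod (b n)) by exact: H.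
 apply: (@l2r_le R (fun n=> cmod (tau n)) (fun n=> if n is k.+1 then u k else 0)) => //; last by apply: l2r_unshift; exists M.
 move=> n; rewrite cge0 /= /b cmodM cmodX cmodJ zt1 expr1n mulr1 /B.
 apply: le_trans (cmodB _ _) _; rewrite lerD2l; case: n => [|k]; first by rewrite cmod0.
 rewrite cmodM cmod_nat vE mulrCA ler_piMr // ler_pdivrMr // mul1r ler_nat //.
have [g Hg] := l2_PS lb.
exists (a 0%N + zt * b 0%N), g; split; first by exists b.
apply: PS_inj Ha _.
have H := PS_lin (a 0%N + zt * b 0%N) (- zt) 1 Hg.
have H2 : PS a (fun z=> a 0%N + zt * b 0%N + (- zt + 1 * z) * g z).
 suff E : (fun n=> if n is k.+1 then - zt * b k.+1 + 1 * b k else a 0%N + zt * b 0%N + - zt * b 0%N) = a by move: H; rewrite E.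
 apply/funext => -[|n]; first by ring.
 have k1 : n.+1%:R != 0 :> C by rewrite pnatr_eq0.
 have k2 : n.+2%:R != 0 :> C by rewrite pnatr_eq0.
 have zn : zt ^+ n * cj zt ^+ n = 1 by rewrite -exprMn zz1 expr1n.
 have BE : B n - B n.+1 = a n.+1 * zt ^+ n.
  apply: (mulfI k1); have -> : n.+1%:R * (a n.+1 * zt ^+ n) = dcoef a n * zt ^+ n by rewrite /dcoef mulrA.
  rewrite q_rec; have -> : B n - B n.+1 = n.+2%:R * v n - (if n is k.+1 then k.+1%:R * v k else 0).
   by rewrite /B -[n.+2%:R]natr1 -tauS; ring.
  rewrite mulrBr mulrBl; congr (_ - _).
   by rewrite /v; move: (n.+1%:R) (n.+2%:R) k1 k2 => x y k1 k2; field; rewrite k1 k2.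
  case: n {k2 zn} k1 => [|k] k1; first by rewrite !mulr0 mul0r.
  have k2 : k.+1%:R != 0 :> C by rewrite pnatr_eq0.
  transitivity (q k * zt ^+ k); first by rewrite /v; move: (k.+1%:R) (k.+2%:R) k1 k2 => x y k1 k2; field; rewrite k1 k2.
  transitivity ((zt * cj zt) * (q k * zt ^+ k)); first by rewrite zz1 mul1r.
  by rewrite exprS; ring.
 have -> : a n.+1 = (B n - B n.+1) * cj zt ^+ n by rewrite BE -mulrA zn mulr1.
 rewrite /b exprS; move: (B n) (B n.+1) (cj zt ^+ n) => x y w.
 transitivity (x * w - y * ((zt * cj zt) * w)); first by ring.
 by rewrite zz1; ring.
by apply: PS_ext H2 => z hz; ring.
Qed.

End LocalDirichlet.

(** * The Hardy space, its kernels, and its multipliers *)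

Section HardySpace.
Variable R : realType.
Local Notation C := R[i].
Implicit Types (f g y G : C -> C) (z : C).

Lemma H2cP f : H2c f <-> holo f /\ exists M : R, forall r : R, 0 < r < 1 -> Mr r (fun z=> cmod (f z) ^+ 2) <= M.
Proof.
split=> [[a Ha la]|[hf HM]]; first by split; [exact: PS_holo Ha|exact/(H2_l2 Ha)].
by have [a Ha] := holo_PS hf; exists a => //; apply/(H2_l2 Ha).
Qed.
Lemma H2c_holo f : H2c f -> holo f.
Proof. by move=> /H2cP[]. Qed.

Lemma H2c_ext f g : (inD z, f z = g z) -> H2c f -> H2c g.
Proof. by move=> E [a Ha la]; exists a => //; exact: PS_ext Ha. Qed.

Lemma holoM f g : holo f -> holo g -> holo (fun z=> f z * g z).
Proof.
move=> hf hg z hz; have [p Hp] := hf z hz; have [q Hq] := hg z hz; exists (p * g z + f z * q).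
by apply: wd_eq (wdM Hp Hq); rewrite ?mulr0 ?mul0r ?addr0.
Qed.
Lemma rc_holo f (r : R) : holo f -> r < 1 -> rc r (fun z=> cmod (f z) ^+ 2).
Proof. by move=> hf r1; apply: rcX; apply: rc_cmod; exact: holo_con hf r1. Qed.

Lemma H2c_lin f g (c : C) : H2c f -> H2c g -> H2c (fun z=> f z + c * g z).
Proof.
move=> /H2cP[hf [M HM]] /H2cP[hg [N HN]]; apply/H2cP; split; first exact: holo_sub.
have h := holo_sub hf hg c.
exists (2 * M + 2 * cmod c ^+ 2 * N) => r hr; have /andP[r0 r1] := hr; have M1 := posf_Mr r0.
have cf := rc_holo hf r1; have cg := rc_holo hg r1; have ch := rc_holo h r1.
apply: (@le_trans _ _ (Mr r (fun z=> 2 * cmod (f z) ^+ 2 + 2 * cmod c ^+ 2 * cmod (g z) ^+ 2))).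
 apply: (posf_le M1) => //; first by apply: rcD; apply: rcM => //; exact: rc_cst.
 move=> z _; have h1 := cmodD (f z) (c * g z); rewrite cmodM in h1.
 have : cmod (f z + c * g z) ^+ 2 <= (cmod (f z) + cmod c * cmod (g z)) ^+ 2.
  by rewrite lerXn2r ?nnegrE ?cge0 // (le_trans (cge0 _) h1).
 by have := sqr_ge0 (cmod (f z) - cmod c * cmod (g z)); lra.
rewrite (posfD M1); [|by apply: rcM => //; exact: rc_cst|by apply: rcM => //; exact: rc_cst].
rewrite (posfZ M1 _ cf) (posfZ M1 _ cg); apply: lerD; rewrite ler_wpM2l //; [exact: HM|by rewrite mulr_ge0 ?sqr_ge0|exact: HN].
Qed.

Lemma H2c_mulb y g (K : R) : holo y -> (inD z, cmod (y z) <= K) -> H2c g -> H2c (fun z=> y z * g z).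
Proof.
move=> hy Hy /H2cP[hg [M HM]]; apply/H2cP; split; first exact: holoM.
exists (K ^+ 2 * M) => r hr; have /andP[r0 r1] := hr; have M1 := posf_Mr r0.
have cg := rc_holo hg r1; have ch := rc_holo (holoM hy hg) r1.
apply: (@le_trans _ _ (K ^+ 2 * Mr r (fun z=> cmod (g z) ^+ 2))); last by rewrite ler_wpM2l ?sqr_ge0 ?HM.
rewrite -(posfZ M1) //; apply: (posf_le M1) => //; first by apply: rcM => //; exact: rc_cst.
move=> z hz; rewrite cmodM exprMn ler_wpM2r ?sqr_ge0 //.
have h := Hy z (le_lt_trans hz r1).
by rewrite lerXn2r ?nnegrE ?cge0 // (le_trans (cge0 _) h).
Qed.

Lemma H2c_cst (c : C) : H2c (fun=> c).
Proof.
exists (fun n=> if n is k.+1 then 0 else c); first exact: PS_cst.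
exists (cmod c ^+ 2) => -[|N]; first by rewrite big_ord0 sqr_ge0.
by rewrite big_ord_recl big1 ?addr0 // => i _; rewrite cmod0 expr0n.
Qed.

Lemma geo_sum_le (x : R) N : 0 <= x -> (1 - x) * \sum_(n < N) x ^+ n <= 1.
Proof.
move=> x0; suff -> : (1 - x) * \sum_(n < N) x ^+ n = 1 - x ^+ N by have := exprn_ge0 N x0; lra.
by elim: N => [|N IH]; [rewrite big_ord0 mulr0 expr0 subrr|rewrite big_ord_recr mulrDr IH exprS /=; ring].
Qed.

Definition sd z : R := Num.sqrt (1 - cmod z ^+ 2).

Lemma sd_gt0 z : cmod z < 1 -> 0 < sd z.
Proof. by move=> hz; rewrite sqrtr_gt0 subr_gt0 expr_lt1 ?cge0. Qed.
Lemma sd2 z : cmod z < 1 -> sd z ^+ 2 = 1 - cmod z ^+ 2.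
Proof. by move=> hz; rewrite sqr_sqrtr // subr_ge0 exprn_ile1 ?cge0 // ltW. Qed.

(** Cauchy-Schwarz, in the form of the arithmetic-geometric inequality for each term of the partial
    sums. *)
Lemma H2c_growth g : H2c g -> exists K : R, inD z, cmod (g z) * sd z <= K.
Proof.
move=> [b [_ Hb] [M HM]]; exists ((M + 1) / 2) => z hz; have s0 := sd_gt0 hz.
rewrite -ler_pdivlMr //; apply/ler_addgt0Pr => e e0; have [N HN] := Hb z hz e e0.
have h1 := HN N (leqnn N); have h2 := cmodD3 (g z) (psum b z N); rewrite (cmodBC (g z)) in h2.
suff : cmod (psum b z N) <= (M + 1) / 2 / sd z by lra.
rewrite ler_pdivlMr //; apply: le_trans (ler_wpM2r (ltW s0) (cmod_sum _ _ _)) _.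
rewrite mulr_suml.
apply: (@le_trans _ _ (\sum_(n < N) (2^-1 * cmod (b n) ^+ 2 + 2^-1 * (sd z ^+ 2 * (cmod z ^+ 2) ^+ n)))).
 apply: ler_sum => n _; rewrite cmodM cmodX -exprM mulnC exprM -mulrA.
 by have := sqr_ge0 (cmod (b n) - cmod z ^+ n * sd z); lra.
rewrite big_split /= -!mulr_sumr sd2 //.
by have := HM N; have := geo_sum_le N (sqr_ge0 (cmod z)); lra.
Qed.
Lemma kernel_id (w z : C) : cmod (1 - cj w * z) ^+ 2 = (1 - cmod w ^+ 2) * (1 - cmod z ^+ 2) + cmod (z - w) ^+ 2.
Proof. by rewrite !cmod_sqE; case: w => a b; case: z => c d /=; ring. Qed.

(** The normalised Szego kernel at w: it has norm one in H^2 and attains the extremal growth at w,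
    by [nk_diag]. *)
Definition nk (w z : C) : C := (sd w)%:C / (1 - cj w * z).

Lemma nk_den (w z : C) : cmod w < 1 -> cmod z < 1 -> sd w * sd z <= cmod (1 - cj w * z) /\ 1 - cj w * z != 0.
Proof.
move=> hw hz; have h : sd w * sd z <= cmod (1 - cj w * z).
 rewrite -(@ler_pXn2r _ 2) ?nnegrE ?mulr_ge0 ?cge0 ?(ltW (sd_gt0 _)) //.
 by rewrite exprMn !sd2 // kernel_id lerDl sqr_ge0.
by split=> //; rewrite -cmod_gt0; apply: lt_le_trans h; rewrite mulr_gt0 ?sd_gt0.
Qed.

Lemma nk_le (w z : C) : cmod w < 1 -> cmod z < 1 -> cmod (nk w z) * sd z <= 1.
Proof.
move=> hw hz; have [h n0] := nk_den hw hz.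
rewrite /nk cmodM cmodV cmodR ger0_norm ?sqrtr_ge0 // mulrAC ler_pdivrMr ?mul1r //.
by rewrite cmod_gt0.
Qed.

Lemma nk_diag (w : C) : cmod w < 1 -> cmod (nk w w) * sd w = 1.
Proof.
move=> hw; have s0 := sd_gt0 hw; rewrite /nk cmodM cmodV cmodR gtr0_norm //.
have -> : 1 - cj w * w = (sd w ^+ 2)%:C by rewrite mulrC mulcJ sd2 // realCD realCN.
by rewrite cmodR gtr0_norm ?exprn_gt0 // mulrAC -expr2 mulfV // gt_eqF // exprn_gt0.
Qed.

Lemma PS_nk (w : C) : cmod w < 1 -> PS (fun n=> (sd w)%:C * cj w ^+ n) (nk w).
Proof.
move=> hw; have s0 := sd_gt0 hw; split=> [r /andP[r0 r1]|z hz e e0].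
 exists (sd w) => // n; rewrite cmodM cmodR gtr0_norm // -[leRHS]mulr1 -mulrA ler_wpM2l ?(ltW s0) //.
 by rewrite cmodX cmodJ -exprMn exprn_ile1 ?mulr_ge0 ?cge0 ?(ltW r0) // mulr_ile1 ?cge0 ?(ltW r0) // ltW.
have [_ n0] := nk_den hw hz.
have q01 : 0 <= cmod (cj w * z) < 1.
 by rewrite cge0 cmodM cmodJ mulr_ilt1 ?cge0.
have c0 : 0 < cmod (1 - cj w * z) by rewrite cmod_gt0.
have e1 : 0 < e * cmod (1 - cj w * z) / sd w by rewrite divr_gt0 ?mulr_gt0.
have [N HN] := pow_small q01 e1; exists N => n Nn.
have -> : psum (fun n=> (sd w)%:C * cj w ^+ n) z n - nk w z = - ((sd w)%:C * (cj w * z) ^+ n / (1 - cj w * z)).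
 apply: (mulIf n0); rewrite mulrBl mulNr !mulfVK // /psum.
 elim: n {Nn} => [|n IH]; first by rewrite big_ord0 mul0r sub0r expr0 mulr1.
 rewrite big_ord_recr /= mulrDl addrAC IH exprS exprMn; ring.
rewrite cmodN !cmodM cmodV cmodX cmodR gtr0_norm // ler_pdivrMr // mulrC -ler_pdivlMr //.
exact: HN.
Qed.

Lemma jensen_sum (w x : nat -> R) n : (forall j, 0 <= w j) -> (\sum_(j < n) w j * x j) ^+ 2 <= (\sum_(j < n) w j) * \sum_(j < n) w j * x j ^+ 2.
Proof.
move=> w0; elim: n => [|n IH]; first by rewrite !big_ord0 expr0n mul0r.
rewrite !big_ord_recr /=.
have W0 : 0 <= \sum_(j < n) w j by apply: sumr_ge0.
have Q0 : 0 <= \sum_(j < n) w j * x j ^+ 2 by apply: sumr_ge0 => j _; rewrite mulr_ge0 ?sqr_ge0.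
move: IH W0 Q0 (w0 n); move: (\sum_(j < n) w j * x j) (\sum_(j < n) w j) (\sum_(j < n) w j * x j ^+ 2) (w n) (x n) => a W Q v t IH W0 Q0 v0.
have h : 2 * a * t <= W * t ^+ 2 + Q.
 have h0 : 0 <= W * t ^+ 2 + Q by rewrite addr_ge0 // mulr_ge0 ?sqr_ge0.
 apply: le_trans (ler_norm _) _; rewrite -(@ler_pXn2r _ 2) ?nnegrE // real_normK ?num_real //.
 have h1 := ler_wpM2r (sqr_ge0 t) IH; have := sqr_ge0 (W * t ^+ 2 - Q); lra.
have := ler_wpM2l v0 h; lra.
Qed.

Lemma PS_close (a b : nat -> C) f g (d : R) : PS a f -> PS b g -> (forall n, cmod (a n - b n) <= d) ->
 inD z, cmod (f z - g z) * (1 - cmod z) <= d.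
Proof.
move=> [_ Ha] [_ Hb] H z hz; have z0 := cge0 z; have d0 := le_trans (cge0 _) (H 0%N).
rewrite -ler_pdivlMr; last by lra.
apply/ler_addgt0Pr => e e0; have e2 : 0 < e / 2 by lra.
have [N HN] := Ha z hz _ e2; have [N' HN'] := Hb z hz _ e2.
pose n := maxn N N'; have h1 := HN n (leq_maxl _ _); have h2 := HN' n (leq_maxr _ _).
have h3 : cmod (psum a z n - psum b z n) <= d / (1 - cmod z).
 rewrite ler_pdivlMr; last by lra.
 rewrite /psum -sumrB; apply: le_trans (ler_wpM2r _ (cmod_sum _ _ _)) _; first by lra.
 apply: (@le_trans _ _ ((\sum_(m < n) d * cmod z ^+ m) * (1 - cmod z))).
  rewrite ler_wpM2r //; first by lra.
  by apply: ler_sum => m _; rewrite -mulrBl cmodM cmodX ler_wpM2r ?exprn_ge0.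
 by rewrite -mulr_sumr -mulrA ler_piMr // mulrC geo_sum_le.
have -> : f z - g z = (psum a z n - psum b z n) - (psum a z n - f z) + (psum b z n - g z) by ring.
tri; have := cmodB (psum a z n - psum b z n) (psum a z n - f z); lra.
Qed.

(* Uniform boundedness principle, by the sign choices of Sokal's proof. *)
Lemma H2_multiplier_bounded (psi : C -> C) : (forall G, H2c G -> H2c (fun z=> psi z * G z)) ->
 exists K : R, inD z, cmod (psi z) <= K.
Proof.
move=> Hpsi; apply: contrapT => Hn.
(* The bound allows for the weight t_n = 3^(-n) of the n-th kernel and for half of it being lost to
   later terms; n+1 is then left to diverge. *)
have Hz (n : nat) : exists z : C, cmod z < 1 /\ 2 * 3 ^+ n * n.+1%:R < cmod (psi z).
 apply: contrapT => Hz; apply: Hn; exists (2 * 3 ^+ n * n.+1%:R) => z hz.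
 by rewrite leNgt; apply/negP => h; apply: Hz; exists z.
have [zn Hzn] := choice Hz; have zn1 n : cmod (zn n) < 1 by have [] := Hzn n.
pose t n : R := (3 ^+ n)^-1; have t0 n : 0 < t n by rewrite /t invr_gt0 exprn_gt0.
have tS n : t n.+1 = t n / 3 by rewrite /t exprS invfM mulrC.
(* One of F + y and F - y has modulus at least |y|; the sign is chosen so that the n-th kernel is
   not cancelled at zn by the earlier ones. *)
pose sg n (F : C -> C) : C := if t n * cmod (nk (zn n) (zn n)) <= cmod (F (zn n) + (t n)%:C * nk (zn n) (zn n)) then 1 else -1.
pose F := fix F n : C -> C := if n is k.+1 then (fun z=> F k z + sg k (F k) * (t k)%:C * nk (zn k) z) else (fun=> 0).
pose e n := sg n (F n).
have e1 n : cmod (e n) = 1 by rewrite /e /sg; case: ifP; rewrite ?cmodN cmod1.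
have FS n z : F n.+1 z = F n z + e n * (t n)%:C * nk (zn n) z by [].
have Fbig n : t n <= cmod (F n.+1 (zn n)) * sd (zn n).
 have s0 := sd_gt0 (zn1 n); rewrite FS /e /sg; have D := nk_diag (zn1 n).
 suff : t n * cmod (nk (zn n) (zn n)) <= cmod (F n (zn n) + (if t n * cmod (nk (zn n) (zn n)) <= cmod (F n (zn n) + (t n)%:C * nk (zn n) (zn n)) then 1 else -1) * (t n)%:C * nk (zn n) (zn n)).
  by move=> h; have := ler_wpM2r (ltW s0) h; rewrite -(mulrA (t n) (cmod _)) D mulr1.
 case: ifP => [|/negbT]; first by rewrite mul1r.
 rewrite -ltNge mulN1r mulNr; set y := (t n)%:C * _; set w := F n _ => h.
 have yE : cmod y = t n * cmod (nk (zn n) (zn n)) by rewrite cmodM cmodR gtr0_norm.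
 have : 2 * cmod y <= cmod (w + y) + cmod (w - y).
  have <- : cmod ((w + y) - (w - y)) = 2 * cmod y by rewrite (_ : _ - _ = 2 * y) ?cmodM ?(cmod_nat _ 2) //; ring.
  exact: cmodB.
 by rewrite -yE in h *; lra.
pose kap j m : C := (sd (zn j))%:C * cj (zn j) ^+ m.
have ksq j N : \sum_(m < N) cmod (kap j m) ^+ 2 <= 1.
 have -> : \sum_(m < N) cmod (kap j m) ^+ 2 = (1 - cmod (zn j) ^+ 2) * \sum_(m < N) (cmod (zn j) ^+ 2) ^+ m.
  rewrite mulr_sumr; apply: eq_bigr => m _; rewrite /kap cmodM cmodX cmodJ cmodR ger0_norm ?sqrtr_ge0 //.
  by rewrite exprMn sd2 // -!exprM mulnC.
 exact: geo_sum_le (sqr_ge0 _).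
have k1 j m : cmod (kap j m) <= 1.
 have := ksq j m.+1; rewrite big_ord_recr /= => h.
 have : cmod (kap j m) ^+ 2 <= 1 by apply: le_trans h; rewrite lerDr sumr_ge0 // => i _; rewrite sqr_ge0.
 by rewrite expr_le1 ?cge0.
pose A n m : C := \sum_(j < n) e j * (t j)%:C * kap j m.
have AS n m : A n.+1 m = A n m + e n * (t n)%:C * kap n m by rewrite /A big_ord_recr.
have PF n : PS (A n) (F n).
 elim: n => [|n IH].
  by have := PS_cst (0 : C); rewrite (_ : (fun n=> _) = A 0%N) //; apply/funext => -[|m]; rewrite /A big_ord0.
 have := PS_add (e n * (t n)%:C) IH (PS_nk (zn1 n)); rewrite (_ : (fun m=> _) = A n.+1) //.
 by apply/funext => m; rewrite AS.
have q01 : 0 <= (3^-1 : R) < 1 by lra.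
have tq n : t n = 3^-1 ^+ n by rewrite /t exprVn.
have [Al HAl] : exists Al : nat -> C, forall m n, cmod (A n m - Al m) <= 1 * 3^-1 ^+ n / (1 - 3^-1).
 have Hex m : exists l, forall n, cmod (A n m - l) <= 1 * 3^-1 ^+ n / (1 - 3^-1).
  apply: geo_limit => // n; rewrite AS addrC addKr (cmodM (e n * _)) (cmodM (e n)) e1 mul1r cmodR gtr0_norm // tq mul1r.
  by rewrite ler_piMr ?exprn_ge0 // invr_ge0.
 by have [Al HAl] := choice Hex; exists Al.
have Wt n : \sum_(j < n) t j <= 3 / 2.
 have := geo_sum_le n (proj1 (andP q01)).
 by under eq_bigr do rewrite -tq; lra.
have An N n : \sum_(m < N) cmod (A n m) ^+ 2 <= 9 / 4.
 apply: (@le_trans _ _ (\sum_(m < N) (3 / 2) * \sum_(j < n) t j * cmod (kap j m) ^+ 2)).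
  apply: ler_sum => m _; have Q0 : 0 <= \sum_(j < n) t j * cmod (kap j m) ^+ 2.
   by apply: sumr_ge0 => j _; rewrite mulr_ge0 ?sqr_ge0 ?ltW.
  apply: le_trans (ler_wpM2r Q0 (Wt n)); apply: le_trans (@jensen_sum t (fun j=> cmod (kap j m)) n (fun j=> ltW (t0 j))).
  rewrite lerXn2r ?nnegrE ?cge0 //; first by apply: sumr_ge0 => j _; rewrite mulr_ge0 ?cge0 ?ltW.
  apply: le_trans (cmod_sum _ _ _) _; apply: ler_sum => j _.
  by rewrite (cmodM (e j * _)) (cmodM (e j)) e1 mul1r cmodR gtr0_norm.
 rewrite -mulr_sumr exchange_big /=.
 have : \sum_(j < n) \sum_(m < N) t j * cmod (kap j m) ^+ 2 <= \sum_(j < n) t j.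
  by apply: ler_sum => j _; rewrite -mulr_sumr ler_piMr ?ksq // ltW.
 by have := Wt n; lra.
have lA : l2 Al.
 exists (9 / 2 + 2) => N.
 have d0 : 0 < (N.+1%:R)^-1 * (2 / 3) :> R by rewrite mulr_gt0 ?invr_gt0 //; lra.
 have [n Hn'] := pow_small q01 d0.
 have h1 m : cmod (A n m - Al m) <= N.+1%:R^-1.
  apply: le_trans (HAl m n) _; rewrite mul1r ler_pdivrMr; last by lra.
  by apply: le_trans (Hn' n (leqnn n)) _; rewrite ler_wpM2l ?invr_ge0 //; lra.
 apply: (@le_trans _ _ (\sum_(m < N) (2 * cmod (A n m) ^+ 2 + 2 * N.+1%:R^-1 ^+ 2))).
  apply: ler_sum => m _; have h2 := cmodD3 (Al m) (A n m); rewrite cmodBC in h2; have := h1 m.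
  have e0 : 0 <= N.+1%:R^-1 :> R by rewrite invr_ge0.
  move: h2 e0 (cge0 (Al m)); move: (cmod (Al m)) (cmod (A n m)) (cmod (A n m - Al m)) (N.+1%:R^-1) => x y u v h2 v0 x0 h3.
  have : x ^+ 2 <= (y + v) ^+ 2 by rewrite lerXn2r ?nnegrE //; lra.
  by have := sqr_ge0 (y - v); lra.
 rewrite big_split /= -mulr_sumr sumr_const card_ord; apply: lerD; first by have := An N n; lra.
 have xk : N.+1%:R^-1 * N%:R <= 1 :> R by rewrite ler_pdivrMl // mulr1 ler_nat.
 have x1 : N.+1%:R^-1 <= 1 :> R by rewrite invf_le1 // ler1n.
 have x0 : 0 < N.+1%:R^-1 :> R by rewrite invr_gt0.
 rewrite -[_ *+ N]mulr_natr; move: (N.+1%:R^-1) (N%:R) x0 xk x1 (ler0n R N) => x k x0 xk x1 k0.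
 by have := ler_pM (ltW x0) (mulr_ge0 (ltW x0) k0) x1 xk; lra.
have [G HG] := l2_PS lA.
have [K HK] := H2c_growth (Hpsi G (ex_intro2 _ _ Al HG lA)).
have tail n N z : cmod z < 1 -> cmod (F (N + n)%N z - F n z) * sd z <= t n * (3 / 2).
 move=> hz; have s0 := sd_gt0 hz.
 suff : cmod (F (N + n)%N z - F n z) * sd z <= t n * (3 / 2) - t (N + n)%N * (3 / 2) by have := t0 (N + n)%N; lra.
 elim: N => [|N IH]; first by rewrite add0n !subrr cmod0 mul0r.
 have -> : F (N.+1 + n)%N z - F n z = (F (N + n)%N z - F n z) + e (N + n)%N * (t (N + n)%N)%:C * nk (zn (N + n)%N) z by rewrite addSn FS; ring.
 apply: le_trans (ler_wpM2r (ltW s0) (cmodD _ _)) _; rewrite mulrDl (cmodM (_ * _) (nk _ _)) (cmodM (e _)) e1 mul1r cmodR gtr0_norm //.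
 have := ler_wpM2l (ltW (t0 (N + n)%N)) (nk_le (zn1 (N + n)%N) hz); rewrite addSn tS; lra.
have GF n z : cmod z < 1 -> cmod (G z - F n z) * sd z <= t n * (3 / 2).
 move=> hz; have s0 := sd_gt0 hz; apply/ler_addgt0Pr => d d0.
 have z1 : 0 < 1 - cmod z by lra.
 have d1 : 0 < d / sd z * (1 - cmod z) * (2 / 3) by rewrite !mulr_gt0 ?invr_gt0 //; lra.
 have [N HN] := pow_small q01 d1; have h1 := HN (N + n)%N (leq_addr _ _).
 have h2 : cmod (F (N + n)%N z - G z) <= d / sd z.
  rewrite -(ler_pM2r z1); apply: (PS_close (PF (N + n)%N) HG) => // m.
  by apply: le_trans (HAl m (N + n)%N) _; rewrite mul1r ler_pdivrMr; lra.
 have h3 := tail n N z hz; rewrite ler_pdivlMr // in h2.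
 have -> : G z - F n z = (F (N + n)%N z - F n z) - (F (N + n)%N z - G z) by ring.
 by have := ler_wpM2r (ltW s0) (cmodB (F (N + n)%N z - F n z) (F (N + n)%N z - G z)); lra.
pose n := Num.truncn `|K|.
have := HK (zn n) (zn1 n); rewrite cmodM; have [_ big] := Hzn n; have s0 := sd_gt0 (zn1 n).
(* The terms after the n-th amount to at most (3/2) t_(n+1) = t_n / 2. *)
have g1 : t n / 2 <= cmod (G (zn n)) * sd (zn n).
 have := GF n.+1 (zn n) (zn1 n); have := Fbig n; rewrite tS.
 have := ler_wpM2r (ltW s0) (cmodD3 (F n.+1 (zn n)) (G (zn n))); rewrite mulrDl (cmodBC (F _ _)); lra.
have g2 : n.+1%:R <= cmod (psi (zn n)) * (t n / 2).
 rewrite mulrA ler_pdivlMr // /t ler_pdivlMr ?exprn_gt0 //; by have := ltW big; move: (n.+1%:R) (3 ^+ n) => x y; lra.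
have g3 := ler_wpM2l (cge0 (psi (zn n))) g1.
have g4 : K < n.+1%:R by apply: le_lt_trans (ler_norm K) _; exact: truncnS_gt.
by rewrite -mulrA; lra.
Qed.

End HardySpace.

(** * Boundary values at the nodes and the description of the multipliers *)

Section MultiplierAlgebra.
Variable R : realType.
Local Notation C := R[i].
Implicit Types (f g h u G : C -> C) (z zt c : C).

Definition has_value zt f c := exists2 g, H2c g & inD z, f z = c + (z - zt) * g z.

Lemma cmod_zt zt z : cmod zt = 1 -> cmod (1 - cj zt * z) = cmod (zt - z).
Proof.
move=> h; have -> : zt - z = zt * (1 - cj zt * z) by rewrite mulrBr mulr1 mulrA mulcJ h expr1n mul1r.
by rewrite cmodM h mul1r.
Qed.

Lemma posf_sum (r : R) (I : (C -> R) -> R) (J : Type) (s : seq J) (F : J -> C -> R) : posf r I -> (forall j, rc r (F j)) ->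
 rc r (fun z=> \sum_(j <- s) F j z) /\ I (fun z=> \sum_(j <- s) F j z) = \sum_(j <- s) I (F j).
Proof.
move=> HI H; elim: s => [|j s [IH1 IH2]].
 rewrite big_nil; have -> : (fun z=> \sum_(j <- [::]) F j z) = fun=> 0 by apply/funext => z; rewrite big_nil.
 by split; [exact: rc_cst|rewrite (posf_cst _ HI) mul0r].
have -> : (fun z=> \sum_(j <- j :: s) F j z) = (fun z=> F j z + \sum_(j <- s) F j z) by apply/funext => z; rewrite big_cons.
by split; [exact: rcD|rewrite (posfD HI) // IH2 big_cons].
Qed.

(** As |zeta - z| = |1 - conj(zeta) z|, the i-th part of the integral is the rho-weighted area
    integral of |f' / (1 - conj(zeta) z)|^2. The parts are nonnegative, so all must be finite, and
    each is decided by the two lemmas on the local Dirichlet integral. *)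
Lemma Dmu_iff (k : nat) (a : 'I_k -> R) (zeta : 'I_k -> C) (f : Cx R -> Cx R) : (1 <= k)%N -> (forall i, 0 < a i) -> (forall i, cmod (zeta i) = 1) ->
 Dmu a zeta f <-> forall i, exists c, has_value (zeta i) f c.
Proof.
move=> k1 a0 zt1; have p0 := pi_gt0 R; pose i0 : 'I_k := Ordinal k1.
have zn (i : 'I_k) z : cmod z < 1 -> zeta i - z != 0.
 by move=> hz; rewrite subr_eq0; apply/eqP => E; move: hz; rewrite -E zt1 ltxx.
have zn' (i : 'I_k) z : cmod z < 1 -> 1 - cj (zeta i) * z != 0.
 by move=> hz; rewrite -cmod_gt0 cmod_zt // cmod_gt0 zn.
suff main : H2 f -> (dirichlet_finite (poisson_atomic a zeta) f <-> forall i, exists c, has_value (zeta i) f c).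
 split; first by move=> [h1 h2]; apply/main.
 move=> H; suff h : H2 f by split=> //; apply/main.
 (* Membership in H^2 follows already from the representation at one node. *)
 have [c [g hg E]] := H i0; apply/H2E/H2cP.
 apply: (@H2c_ext R (fun z=> c + 1 * ((z - zeta i0) * g z))); first by move=> z hz; rewrite E // mul1r.
 apply: H2c_lin; first exact: H2c_cst.
 apply: (@H2c_mulb _ _ _ 2) => //.
  by move=> z _; exists 1; apply: wd_eq (wdB (wd_id z) (wd_cst (zeta i0) z)); rewrite ?subr0.
 by move=> z hz; apply: le_trans (cmodB _ _) _; rewrite zt1; lra.
move=> /H2E[hf _]; have [b Hb] := holo_PS hf; have [f1 Hf1] := PS_exists (dcoef_bound Hb.1).
have hf1 := PS_holo Hf1.
pose Q (i : 'I_k) z := f1 z / (1 - cj (zeta i) * z).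
have hQ i : holo (Q i).
 apply: holoM => // z hz; eexists; apply: wd_eq (wdV (wdB (wd_cst 1 z) (wdZ (cj (zeta i)) (wd_id z))) (zn' i z hz)); first by [].
 by rewrite mulr0 subr0 oppr0 mul0r.
have QE i z : cmod z < 1 -> (1 - cj (zeta i) * z) * Q i z = f1 z.
 by move=> hz; rewrite /Q mulrC mulfVK // zn'.
have char i : (exists M : R, forall r : R, 0 < r < 1 -> Ar r (fun z=> rho z * cmod (Q i z) ^+ 2) <= M) <-> exists c, has_value (zeta i) f c.
 have [q Hq] := holo_PS (hQ i); split.
  move=> /(area_l2 Hq) lq; have [c [g [hg E]]] := quotient_of_dirichlet (zt1 i) Hb Hf1 Hq (QE i) lq.
  by exists c, g.
 by move=> [c [g hg E]]; apply/(area_l2 Hq); exact: (dirichlet_of_quotient (zt1 i) Hb Hf1 Hq (QE i) hg E).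
pose w i z := a i / pi * (rho z * cmod (Q i z) ^+ 2).
pose v z := \sum_(i < k) w i z.
have cw i (r : R) : 0 < r < 1 -> rc r (w i).
 move=> /andP[r0 r1]; apply: rcM; first exact: rc_cst.
 by apply: rcM; [exact: rc_rho|exact: rc_holo].
have w0 i z : cmod z < 1 -> 0 <= w i z.
 move=> hz; apply: mulr_ge0; first by rewrite divr_ge0 // ltW.
 by rewrite mulr_ge0 ?sqr_ge0 // rho_ge0 // ltW.
have cv (r : R) : 0 < r < 1 -> rc r v.
 by move=> hr; have /andP[r0 _] := hr; have [] := posf_sum (index_enum 'I_k) (posf_Ar r0) (fun i=> cw i r hr).
have v0 z : cmod z < 1 -> 0 <= v z by move=> hz; apply: sumr_ge0 => i _; exact: w0.
have E : dirichlet_finite (poisson_atomic a zeta) f <-> exists M : R, forall r : R, 0 < r < 1 -> Ar r v <= M.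
 rewrite -(disc_integral cv v0) /dirichlet_finite.
 under eq_integral => p /set_mem /= hp.
  have hz : cmod (p.1 +i* p.2) < 1 by rewrite /cmod /= -[ltRHS]sqrtr1 ltr_sqrt.
  rewrite (derive1_PS Hb Hf1) //.
  have -> : (cmod (f1 (p.1 +i* p.2)) ^+ 2 * poisson_atomic a zeta (p.1 +i* p.2) / pi)%R = v (p.1 +i* p.2).
   rewrite /poisson_atomic /v mulr_sumr mulr_suml; apply: eq_bigr => i _.
   rewrite /w /Q /rho cmodM cmodV cmod_zt // expr_div_n.
   by move: (cmod (zeta i - (p.1 +i* p.2)) ^+ 2)^-1 (pi^-1 : R) => x y; ring.
  over.
 by [].
rewrite E; split.
 move=> [M HM] i; apply/char; exists (pi / a i * M) => r hr; have /andP[r0 r1] := hr.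
 have A1 := posf_Ar r0; have cQ : rc r (fun z=> rho z * cmod (Q i z) ^+ 2) by apply: rcM; [exact: rc_rho|exact: rc_holo].
 have h : Ar r (w i) <= M.
  apply: le_trans (HM r hr); apply: (posf_le A1) => //; [exact: cw|exact: cv|].
  move=> z hz; rewrite /v (bigD1 i) //= lerDl; apply: sumr_ge0 => j _; apply: w0; exact: le_lt_trans hz r1.
 rewrite /w (posfZ A1) // in h.
 have ap : 0 < pi / a i by rewrite divr_gt0.
 have := ler_wpM2l (ltW ap) h; rewrite mulrA (_ : pi / a i * (a i / pi) = 1) ?mul1r //.
 by rewrite mulrA mulfVK ?mulfV // gt_eqF.
move=> H; have [M HM] := choice (fun i=> proj2 (char i) (H i)).
exists (\sum_(i < k) a i / pi * M i) => r hr; have /andP[r0 r1] := hr.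
have A1 := posf_Ar r0; have [_ ->] := posf_sum (index_enum 'I_k) A1 (fun i=> cw i r hr).
apply: ler_sum => i _; have cQ : rc r (fun z=> rho z * cmod (Q i z) ^+ 2) by apply: rcM; [exact: rc_rho|exact: rc_holo].
by rewrite /w (posfZ A1) // ler_wpM2l ?HM // divr_ge0 // ltW.
Qed.

(** The point on the radius to zt with [sd] equal to t: H^2 functions are O(1/t) there, while the
    distance to zt is O(t^2). Hence (z - zt) g tends to 0 and values are radial limits. *)
Definition rad zt (t : R) : C := (Num.sqrt (1 - t ^+ 2))%:C * zt.

Lemma radP zt (t : R) : cmod zt = 1 -> 0 < t < 1 -> [/\ cmod (rad zt t) < 1, sd (rad zt t) = t & cmod (rad zt t - zt) <= t ^+ 2].
Proof.
move=> z1 /andP[t0 t1]; have t2 : 0 < t ^+ 2 < 1 by rewrite exprn_gt0 // expr_lt1 // ltW.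
have s0 := sqrtr_ge0 (1 - t ^+ 2).
have ss : Num.sqrt (1 - t ^+ 2) ^+ 2 = 1 - t ^+ 2 by rewrite sqr_sqrtr //; lra.
have cE : cmod (rad zt t) = Num.sqrt (1 - t ^+ 2) by rewrite cmodM z1 mulr1 cmodR ger0_norm.
have s1 : Num.sqrt (1 - t ^+ 2) < 1 by rewrite -[ltRHS]sqrtr1 ltr_sqrt //; lra.
split; first by rewrite cE.
 by rewrite /sd cE ss opprB addrCA subrr addr0 sqrtr_sqr gtr0_norm.
have -> : rad zt t - zt = (Num.sqrt (1 - t ^+ 2) - 1)%:C * zt by rewrite /rad realCD realCN mulrBl mul1r.
rewrite cmodM z1 mulr1 cmodR ler0_norm; last by lra.
by move: (Num.sqrt _) s0 s1 ss => s s0 s1 ss; nra.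
Qed.

Lemma H2c_radial zt g : cmod zt = 1 -> H2c g -> exists2 K : R, 0 < K & forall t : R, 0 < t < 1 -> cmod ((rad zt t - zt) * g (rad zt t)) <= K * t.
Proof.
move=> z1 hg; have [K HK] := H2c_growth hg; exists (`|K| + 1) => [|t ht]; first by have := normr_ge0 K; lra.
have [h1 h2 h3] := radP z1 ht; have /andP[t0 _] := ht.
have := HK _ h1; rewrite h2 => h4; rewrite cmodM.
apply: le_trans (ler_wpM2r (cge0 _) h3) _; rewrite expr2 -mulrA mulrC ler_wpM2r ?(ltW t0) //.
by rewrite mulrC; have := ler_norm K; lra.
Qed.

Lemma small_zero (x K : R) : 0 <= x -> (forall t : R, 0 < t < 1 -> x <= K * t) -> x = 0.
Proof.
move=> x0 H; apply/le_anti; rewrite x0 andbT leNgt; apply/negP => xp.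
have k0 : 0 < `|K| + x + 1 by have := normr_ge0 K; lra.
have ht : 0 < x / 2 / (`|K| + x + 1) < 1.
 by rewrite divr_gt0 ?ltr_pdivrMr //=; [have := normr_ge0 K; lra|lra].
have := H _ ht; have /andP[t0 _] := ht; have := ler_wpM2r (ltW t0) (ler_norm K).
have : x / 2 / (`|K| + x + 1) * (`|K| + x + 1) = x / 2 by rewrite mulfVK // gt_eqF.
by move: t0; set t := x / 2 / _; move=> t0 h1 h2 h3; have := mulr_gt0 t0 xp; lra.
Qed.

Definition bdd f := exists K : R, inD z, cmod (f z) <= K.

Lemma has_value_lin zt f g c d (e : C) : has_value zt f c -> has_value zt g d -> has_value zt (fun z=> f z + e * g z) (c + e * d).
Proof.
move=> [f0 hf Ef] [g0 hg Eg]; exists (fun z=> f0 z + e * g0 z); first exact: H2c_lin.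
by move=> z hz; rewrite Ef // Eg //; ring.
Qed.

Lemma has_value_holo zt f c : has_value zt f c -> holo f.
Proof.
move=> [g /H2c_holo hg E] z hz; have [p Hp] := hg z hz.
have := wdD (wd_cst c z) (wdM (wdB (wd_id z) (wd_cst zt z)) Hp) => H.
have d0 : 0 < 1 - cmod z by lra.
eexists; apply: wd_loc d0 _ (wd_eq (erefl _) _ H); last by rewrite subr0 mul0r mulr0 !addr0.
by move=> w hw; rewrite -E //; have := cmodD3 w z; lra.
Qed.

(** f g - c d = f (g - d) + d (f - c); the boundedness of f keeps the first quotient in H^2. *)
Lemma has_valueM zt f g c d : bdd f -> has_value zt f c -> has_value zt g d -> has_value zt (fun z=> f z * g z) (c * d).
Proof.
move=> [K HK] vf [g0 hg Eg]; have hf := has_value_holo vf; have [f0 hf0 Ef] := vf.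
exists (fun z=> f z * g0 z + d * f0 z); first by apply: H2c_lin => //; exact: H2c_mulb HK hg.
by move=> z hz; rewrite Eg // {1 2}Ef //; ring.
Qed.

Lemma has_value_vanish zt f y : holo y -> bdd y -> has_value zt f 0 -> has_value zt (fun z=> f z * y z) 0.
Proof.
move=> hy [K HK] [g hg E]; exists (fun z=> y z * g z); first exact: H2c_mulb HK hg.
by move=> z hz; rewrite E //; ring.
Qed.
Lemma has_value_cst zt c : has_value zt (fun=> c) c.
Proof. by exists (fun=> 0); [exact: H2c_cst|move=> z _; rewrite mulr0 addr0]. Qed.

Lemma has_value_uniq zt f c d : cmod zt = 1 -> has_value zt f c -> has_value zt f d -> c = d.
Proof.
move=> z1 [g hg Eg] [h hh Eh].
have [K K0 HK] := H2c_radial z1 (H2c_lin (-1) hg hh).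
apply/eqP; rewrite -subr_eq0 -cmod_eq0; apply/eqP; apply: (@small_zero _ K) => [|t ht]; first exact: cge0.
have [h1 _ _] := radP z1 ht; rewrite -cmodN; apply: le_trans (HK t ht); rewrite le_eqVlt; apply/orP; left; apply/eqP; congr cmod.
have := Eg _ h1; rewrite Eh // => /eqP; rewrite -subr_eq0 => /eqP E0.
by rewrite -[RHS]addr0 -E0; ring.
Qed.

Lemma has_value_ge zt f c (d : R) : cmod zt = 1 -> has_value zt f c -> (inD z, d <= cmod (f z)) -> d <= cmod c.
Proof.
move=> z1 [g hg E] H; have [K K0 HK] := H2c_radial z1 hg.
apply/ler_addgt0Pr => e e0; pose t := Num.min (1 / 2) (e / K).
have [t1 t2] : t <= 1 / 2 /\ t <= e / K by rewrite /t !ge_min !lexx orbT.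
have t0 : 0 < t by rewrite lt_min; apply/andP; split; [lra|rewrite divr_gt0].
have ht : 0 < t < 1 by rewrite t0; lra.
have [h1 _ _] := radP z1 ht; apply: le_trans (H _ h1) _; rewrite E //; tri.
by rewrite lerD2l; apply: le_trans (HK t ht) _; rewrite mulrC -ler_pdivlMr.
Qed.

Lemma has_valueV zt f c (d : R) : 0 < d -> cmod zt = 1 -> has_value zt f c -> (inD z, d <= cmod (f z)) ->
 has_value zt (fun z=> (f z)^-1) c^-1.
Proof.
move=> d0 z1 vf H; have hf := has_value_holo vf; have c0 : c != 0 by rewrite -cmod_gt0; apply: lt_le_trans d0 (has_value_ge z1 vf H).
have f0 z : cmod z < 1 -> f z != 0 by move=> hz; rewrite -cmod_gt0; apply: lt_le_trans d0 (H z hz).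
have hi : holo (fun z=> (f z)^-1).
 by move=> z hz; have [p Hp] := hf z hz; eexists; apply: wd_eq (wdV Hp (f0 z hz)); rewrite ?oppr0 ?mul0r.
have [g hg E] := vf; exists (fun z=> ((- c^-1) * (f z)^-1) * g z).
 apply: (@H2c_mulb _ _ _ (cmod c^-1 * d^-1)) => //.
  by apply: holoM => // z _; exists 0; exact: wd_cst.
 by move=> z hz; rewrite cmodM cmodN ler_wpM2l ?cge0 // cmodV lef_pV2 ?posrE ?H // (lt_le_trans d0) ?H.
move=> z hz; have n0 := f0 z hz; have EE := E z hz; apply: (mulfI n0); rewrite mulfV //.
transitivity (c^-1 * (f z - (z - zt) * g z)).
 by rewrite {1}EE addrK mulVf.
by field; rewrite n0 c0.
Qed.

Section Nodes.
Variables (k : nat) (zeta : 'I_k -> C).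
Hypotheses (k1 : (1 <= k)%N) (zt1 : forall i, cmod (zeta i) = 1).

Definition valued f := forall i, exists c, has_value (zeta i) f c.

Lemma separated (s : seq C) : exists2 d : R, 0 < d <= 1 & forall b b', b \in s -> b' \in s -> b != b' -> 2 * d <= cmod (b - b').
Proof.
have H (l : seq R) : (forall x, x \in l -> 0 < x) -> exists2 d : R, 0 < d <= 1 & forall x, x \in l -> d <= x.
 elim: l => [|y l IH] Hl; first by exists 1; rewrite ?ltr01 ?lexx.
 have [d /andP[d0 d1] Hd] := IH (fun x xl => Hl x ltac:(by rewrite inE xl orbT)).
 exists (Num.min y d) => [|x]; first by rewrite lt_min d0 Hl ?inE ?eqxx //= ge_min d1 orbT.
 by rewrite inE ge_min => /orP[/eqP->|/Hd->]; rewrite ?lexx ?orbT.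
have [|d hd Hd] := H [seq x <- [seq cmod (b - b') / 2 | b <- s, b' <- s] | 0 < x].
 by move=> x; rewrite mem_filter => /andP[].
exists d => // b b' bs bs' bb.
have : cmod (b - b') / 2 \in [seq x <- [seq cmod (b - b') / 2 | b <- s, b' <- s] | 0 < x].
 by rewrite mem_filter divr_gt0 ?cmod_gt0 ?subr_eq0 //=; apply/allpairsP; exists (b, b').
by move=> /Hd; lra.
Qed.

Lemma rprod_ge (s : seq C) z (d : R) : 0 < d <= 1 -> (forall b, b \in s -> d <= cmod (z - b)) -> d ^+ size s <= cmod (rprod s z).
Proof.
move=> /andP[d0 d1]; elim: s => [|b s IH] H; first by rewrite /rprod big_nil cmod1 expr0.
rewrite rprod_cons cmodM /= exprS; apply: ler_pM; rewrite ?exprn_ge0 ?(ltW d0) //.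
 by apply: H; rewrite inE eqxx.
by apply: IH => c cs; apply: H; rewrite inE cs orbT.
Qed.
Lemma rprod_rem (s : seq C) b z : b \in s -> rprod s z = (z - b) * rprod (rem b s) z.
Proof. by move=> bs; rewrite /rprod (big_rem b bs). Qed.

Lemma holo_rprod (s : seq C) : holo (rprod s).
Proof. by move=> z _; exact: wd_rprod. Qed.

Lemma bdd_rprod (s : seq C) : bdd (rprod s).
Proof.
have c : con 1 (rprod s) by move=> z _; have [p /ccont_wd] := wd_rprod s z.
by have [K _ HK] := con_bdd c; exists K => z hz; apply: HK; exact: ltW.
Qed.

(** Applied to rprod s G with G in H^2, the multiplier f gives a function with value 0 at a node b,
    so that f times the product over the other nodes multiplies H^2 into itself and is bounded. Near
    b these other factors are bounded below. *)
Lemma multiplier_bounded f : valued f -> (forall g, valued g -> valued (fun z=> f z * g z)) -> bdd f.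
Proof.
move=> vf Hf; pose s := undup [seq zeta i | i <- enum 'I_k]; pose i0 : 'I_k := Ordinal k1.
(* Repeated nodes have been merged: a double factor would not be bounded below near its node. *)
have sz i : zeta i \in s by rewrite mem_undup; apply/mapP; exists i; rewrite ?mem_enum.
have zs b : b \in s -> exists i, b = zeta i by rewrite mem_undup => /mapP[i _ ->]; exists i.
have zn (i : 'I_k) z : cmod z < 1 -> z - zeta i != 0.
 by move=> hz; rewrite subr_eq0; apply/eqP => E; move: hz; rewrite E zt1 ltxx.
have Hb b : b \in s -> bdd (fun z=> f z * rprod (rem b s) z).
 move=> /zs[i ->]; apply: H2_multiplier_bounded => G hG.
 have vp : valued (fun z=> rprod s z * G z).
  move=> j; exists 0; have [K HK] := bdd_rprod (rem (zeta j) s).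
  exists (fun z=> rprod (rem (zeta j) s) z * G z); first by apply: H2c_mulb HK hG; exact: holo_rprod.
  by move=> z hz; rewrite (rprod_rem z (sz j)) add0r mulrA.
 have [c [g hg E]] := Hf _ vp i.
 have [[c' [f0 hf0 Ef]] [K HK]] := (vf i, bdd_rprod (rem (zeta i) s)).
 have [K1 K10 HK1] := H2c_radial (zt1 i) hg; have [K2 K20 HK2] := H2c_radial (zt1 i) hf0; have [K3 K30 HK3] := H2c_radial (zt1 i) hG.
 have c0 : c = 0.
  apply/eqP; rewrite -cmod_eq0; apply/eqP; apply: (@small_zero _ ((cmod c' + K2) * (`|K| * K3) + K1)) => [|t ht]; first exact: cge0.
  have [h1 _ _] := radP (zt1 i) ht; have /andP[t0 t1] := ht.
  have -> : c = f (rad (zeta i) t) * (rprod (rem (zeta i) s) (rad (zeta i) t) * ((rad (zeta i) t - zeta i) * G (rad (zeta i) t))) - (rad (zeta i) t - zeta i) * g (rad (zeta i) t).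
   rewrite -[LHS](addrK ((rad (zeta i) t - zeta i) * g (rad (zeta i) t))) -E // (rprod_rem _ (sz i)); ring.
  apply: le_trans (cmodB _ _) _; rewrite [X in _ <= X]mulrDl; apply: lerD; last exact: HK1.
  have i1 : cmod (f (rad (zeta i) t)) <= cmod c' + K2.
   rewrite Ef //; tri; rewrite lerD2l; apply: le_trans (HK2 t ht) _.
   by rewrite ler_piMr // ltW.
  rewrite cmodM -mulrA; apply: ler_pM => //; rewrite ?cge0 // cmodM -mulrA.
  apply: ler_pM; rewrite ?cge0 ?HK3 //; apply: le_trans (HK _ h1) (ler_norm _).
 apply: H2c_ext hg => z hz; apply: (mulfI (zn i z hz)).
 by have := E z hz; rewrite c0 add0r => <-; rewrite (rprod_rem z (sz i)); ring.
have [K0 HK0] : exists K : R, forall b, b \in s -> inD z, cmod (f z * rprod (rem b s) z) <= K.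
 have : forall l : seq C, {subset l <= s} -> exists K : R, forall b, b \in l -> inD z, cmod (f z * rprod (rem b s) z) <= K.
  elim=> [|b l IH] Hl; first by exists 0.
  have [K HK] := IH (fun x xl => Hl x ltac:(by rewrite inE xl orbT)).
  have [K' HK'] := Hb b (Hl b (mem_head _ _)).
  exists (Num.max K' K) => x; rewrite inE => /orP[/eqP->|xl] z hz; rewrite le_max ?HK' //.
  by rewrite (HK x xl z hz) orbT.
 by apply.
have [d hd Hd] := separated s; have /andP[d0 d1] := hd.
exists (K0 / d ^+ (size s).-1) => z hz.
(* Nodes are at least 2 d apart, so every point is within distance d of at most one of them, which
   is taken for b. *)
have [b bs Hbz] : exists2 b, b \in s & forall b', b' \in rem b s -> d <= cmod (z - b').
 have [/hasP[b bs hb]|/hasPn h] := boolP (has (fun b=> cmod (z - b) < d) s).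
  exists b => // b'; rewrite mem_rem_uniq ?undup_uniq // inE /= => /andP[bb bs'].
  by have := Hd b' b bs' bs bb; have h3 := cmodB (z - b) (z - b'); rewrite (_ : z - b - (z - b') = b' - b) in h3; [lra|ring].
 by exists (zeta i0) => // b' /mem_rem /h; rewrite -leNgt.
have h := rprod_ge hd Hbz; rewrite size_rem // in h.
rewrite ler_pdivlMr ?exprn_gt0 //; apply: le_trans (HK0 b bs z hz).
by rewrite cmodM ler_wpM2l ?cge0.
Qed.

End Nodes.

End MultiplierAlgebra.

(** * Reduction of unimodular pairs *)

Section StableRank.
Variables (R : realType) (k : nat) (zeta : 'I_k -> R[i]).
Local Notation C := R[i].
Hypotheses (k1 : (1 <= k)%N) (zt1 : forall i, cmod (zeta i) = 1).
Implicit Types f g x b : C -> C.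

Definition bdd_valued f := valued zeta f /\ bdd f.

Lemma multiplier_algP (a : 'I_k -> R) f : (forall i, 0 < a i) -> multiplier_alg a zeta f <-> bdd_valued f.
Proof.
move=> a0; have DP g := Dmu_iff g k1 a0 zt1; split.
 move=> [/DP vf H]; split=> //; apply: (multiplier_bounded k1 zt1 vf) => g /DP hg; apply/DP; exact: H.
move=> [vf bf]; split; first exact/DP.
move=> g /DP vg; apply/DP => i; have [c hc] := vf i; have [d hd] := vg i.
by exists (c * d); exact: has_valueM.
Qed.

Lemma bdd_valued_lin f g (e : C) : bdd_valued f -> bdd_valued g -> bdd_valued (fun z=> f z + e * g z).
Proof.
move=> [vf [K HK]] [vg [L HL]]; split.
 by move=> i; have [c hc] := vf i; have [d hd] := vg i; exists (c + e * d); exact: has_value_lin.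
exists (K + cmod e * L) => z hz; tri; rewrite cmodM lerD ?HK //.
by rewrite ler_wpM2l ?cge0 ?HL.
Qed.
Lemma bddM f g : bdd f -> bdd g -> bdd (fun z=> f z * g z).
Proof. by move=> [K HK] [L HL]; exists (K * L) => z hz; rewrite cmodM ler_pM ?cge0 ?HK ?HL. Qed.

Lemma bdd_valuedM f g : bdd_valued f -> bdd_valued g -> bdd_valued (fun z=> f z * g z).
Proof.
move=> [vf bf] [vg bg]; split; last exact: bddM.
by move=> i; have [c hc] := vf i; have [d hd] := vg i; exists (c * d); exact: has_valueM.
Qed.
Lemma bdd_valued_cst c : bdd_valued (fun=> c).
Proof. by split=> [i|]; [exists c; exact: has_value_cst|exists (cmod c)]. Qed.

(* With [mu i] the quotient of the values of [b1] and [x0] at [zeta i], multiply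
 [x1 * B1] by [1 = x0 (b0 + mu i x1) + x1 (b1 - mu i x0)], one node at a time. *)
Lemma bezout_vanishing x0 x1 b0 b1 (c : 'I_k -> C) :
 bdd_valued x0 -> bdd_valued x1 -> bdd_valued b0 -> bdd_valued b1 ->
 (forall i, has_value (zeta i) x0 (c i)) -> (forall i, c i != 0) ->
 (inD z, x0 z * b0 z + x1 z * b1 z = 1) ->
 exists B : (C -> C) * (C -> C), [/\ bdd_valued B.1, bdd_valued B.2, forall i, has_value (zeta i) B.2 0 &
  inD z, x0 z * B.1 z + x1 z * B.2 z = 1].
Proof.
move=> h0 h1 k0 k1' hc c0 E.
suff : forall l : seq 'I_k, exists B : (C -> C) * (C -> C), [/\ bdd_valued B.1, bdd_valued B.2, forall i, i \in l -> has_value (zeta i) B.2 0 &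
  inD z, x0 z * B.1 z + x1 z * B.2 z = 1].
 by move=> /(_ (enum 'I_k))[B [H1 H2 H3 H4]]; exists B; split=> // i; apply: H3; rewrite mem_enum.
elim=> [|i l [[B0 B1] /= [H1 H2 H3 H4]]]; first by exists (b0, b1).
(* m is chosen so that w = b1 - m x0 has value 0 at the node i; nodes treated before keep the value
   0 because B1 is a factor of the new coefficient. *)
have [d hd] := k1'.1 i; pose m := d / c i.
pose w z := b1 z + (- m) * x0 z.
have bw : bdd_valued w by exact: bdd_valued_lin.
have wi : has_value (zeta i) w 0.
 rewrite (_ : 0 = d + (- m) * c i); last by rewrite mulNr mulfVK ?subrr.
 exact: has_value_lin.
exists (fun z=> B0 z + 1 * ((x1 z * B1 z) * (b0 z + m * x1 z)), fun z=> (B1 z * x1 z) * w z); split=> /=.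
- by apply: bdd_valued_lin => //; apply: bdd_valuedM; [exact: bdd_valuedM|exact: bdd_valued_lin].
- by apply: bdd_valuedM => //; exact: bdd_valuedM.
- move=> j; rewrite inE => /orP[/eqP->|jl].
  have [e he] := (bdd_valuedM H2 h1).1 i; rewrite -(mulr0 e); apply: has_valueM => //.
  exact: (bdd_valuedM H2 h1).2.
 have [e he] := h1.1 j; have [e' he'] := bw.1 j.
 rewrite (_ : 0 = 0 * e * e'); last by rewrite !mul0r.
 apply: has_valueM => //; first exact: (bdd_valuedM H2 h1).2.
 by apply: has_valueM (H3 j jl) he; exact: H2.2.
- move=> z hz; rewrite /w.
 transitivity (x0 z * B0 z + x1 z * B1 z * (x0 z * b0 z + x1 z * b1 z)); first by ring.
 by rewrite E // mulr1 H4.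
Qed.

(** Treil's theorem is applied to X = x0 + l x1 and x1 B1, where B1 has value 0 at all nodes. Its Y
    need have no values there, but B1 Y does, so that y = l + B1 Y lies in the algebra. *)
Lemma bezout_reduce x0 x1 b0 b1 :
 bdd_valued x0 -> bdd_valued x1 -> bdd_valued b0 -> bdd_valued b1 ->
 (inD z, x0 z * b0 z + x1 z * b1 z = 1) ->
 exists yu : (C -> C) * (C -> C), [/\ bdd_valued yu.1, bdd_valued yu.2 &
  inD z, (x0 z + yu.1 z * x1 z) * yu.2 z = 1].
Proof.
move=> h0 h1 k0 k1' E.
have [c hc] := choice h0.1; have [e he] := choice h1.1.
(* Evaluation of the Bezout identity at a node: the values of x0 and x1 cannot both be 0. *)
have ce i : e i = 0 -> c i != 0.
 move=> e0; apply/eqP => c0; have [d0 hd0] := k0.1 i; have [d1 hd1] := k1'.1 i.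
 have v1 := has_value_lin 1 (has_valueM h0.2 (hc i) hd0) (has_valueM h1.2 (he i) hd1).
 have [g hg Eg] := v1.
 have v2 : has_value (zeta i) (fun=> 1) (c i * d0 + 1 * (e i * d1)).
  by exists g => // z hz; rewrite -Eg // mul1r E.
 have := has_value_uniq (zt1 i) v2 (has_value_cst (zeta i) 1).
 by rewrite c0 e0 !mul0r mulr0 addr0 => /eqP; rewrite eq_sym oner_eq0.
(* For each node with e i nonzero there is a single l with c i + l e i = 0; a real l outside
   finitely many real parts avoids them all. *)
have [t _ ts] := avoid_seq [seq - Re (c i / e i) | i <- enum 'I_k] (@ltr01 R).
pose l : C := t%:C.
have n0 i : c i + l * e i != 0.
 apply/eqP => E0; have [ei|ei] := eqVneq (e i) 0; first by move: (ce i ei) E0; rewrite ei mulr0 addr0 => /eqP.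
 move/negP: ts; apply; apply/mapP; exists i; rewrite ?mem_enum //.
 have : l = - (c i / e i).
  by apply: (mulIf ei); rewrite mulNr mulfVK //; apply/eqP; rewrite -addr_eq0 addrC E0.
 by rewrite /l; case: (c i / e i) => p q /= [].
pose X z := x0 z + l * x1 z.
have hX : bdd_valued X by exact: bdd_valued_lin.
have vX i : has_value (zeta i) X (c i + l * e i) by exact: has_value_lin.
(* The Bezout identity rewritten for X: X b0 + x1 (b1 - l b0) = 1. *)
have hB : bdd_valued (fun z=> b1 z + (- l) * b0 z) by exact: bdd_valued_lin.
have [z hz|[B0 B1] /= [H1 H2 H3 H4]] := bezout_vanishing hX h1 k0 hB vX n0.
 by rewrite -(E z hz) /X; ring.
have hF := bdd_valuedM h1 H2.
have hol f : bdd_valued f -> holo f by move=> [vf _]; have [d hd] := vf (Ordinal k1); exact: has_value_holo hd.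
have [M [M1 MX MF MB]] : exists M : R, [/\ 1 <= M, inD z, cmod (X z) <= M,
  inD z, cmod (x1 z * B1 z) <= M & inD z, cmod (B0 z) <= M].
 have [KX HX] := hX.2; have [KF HF] := hF.2; have [KB HB] := H1.2.
 exists (1 + `|KX| + `|KF| + `|KB|).
 have p1 := normr_ge0 KX; have p2 := normr_ge0 KF; have p3 := normr_ge0 KB.
 have q1 := ler_norm KX; have q2 := ler_norm KF; have q3 := ler_norm KB.
 split=> [|z hz|z hz|z hz]; first by lra.
 - by have := HX z hz; lra.
 - by have := HF z hz; lra.
 - by have := HB z hz; lra.
(* Scales the functions bounded by M down to the bound 1/2 of [treil_normalized]; one common factor
   is used, so that it cancels in the final sum. *)
pose q : R := (2 * M)^-1; have M0 : 0 < M by lra.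
have q0 : 0 < q by rewrite invr_gt0; lra.
have qM : q * M = 1 / 2 by rewrite /q; field; rewrite gt_eqF.
have half f : (inD z, cmod (f z) <= M) -> inD z, cmod (q%:C * f z) <= 1 / 2.
 by move=> Hf z hz; rewrite cmodM cmodR gtr0_norm // -qM ler_wpM2l ?Hf // ltW.
have hq f : holo f -> holo (fun z=> q%:C * f z) by move=> hf; apply: holoM => // z _; exists 0; exact: wd_cst.
(* The Bezout identity X B0 + x1 B1 = 1 with |B0| <= M and M >= 1 gives 1 <= (|X| + |x1 B1|) M. *)
have low z : cmod z < 1 -> q ^+ 2 / (2 * M ^+ 2) <= cmod (q%:C * X z) ^+ 2 + cmod (q%:C * (x1 z * B1 z)) ^+ 2.
 move=> hz; have := cmodD (X z * B0 z) (x1 z * B1 z); rewrite H4 // cmod1 (cmodM (X z)).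
 have := ler_wpM2l (cge0 (X z)) (MB z hz).
 rewrite !(cmodM q%:C) cmodR gtr0_norm // !exprMn.
 move: (cge0 (X z)) (cge0 (x1 z * B1 z)).
 move: (cmod (X z)) (cmod (x1 z * B1 z)) (cmod (B0 z)) => u v w u0 v0 uw H.
 have {uw} H : 1 <= (u + v) * M by have := ler_wpM2l v0 M1; lra.
 have H' : 1 <= 2 * (u ^+ 2 + v ^+ 2) * M ^+ 2.
  have : 1 <= ((u + v) * M) ^+ 2 by rewrite expr_ge1 // (le_trans ler01).
  have : 0 <= ((u - v) * M) ^+ 2 by exact: sqr_ge0.
  by rewrite !exprMn; move: (M ^+ 2) => m; lra.
 rewrite -mulrDr ler_wpM2l ?sqr_ge0 // -[leLHS]mul1r ler_pdivrMr ?mulr_gt0 ?exprn_gt0 //.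
 by rewrite mulrCA mulrA.
have D0 : 0 < q ^+ 2 / (2 * M ^+ 2) by rewrite divr_gt0 ?mulr_gt0 ?exprn_gt0.
have [Y hY [K K0 HY]] := treil_normalized (hq _ (hol _ hX)) (hq _ (hol _ hF)) D0 (half _ MX) (half _ MF) low.
have bY : bdd Y by exists K => z /HY[].
pose y z := B1 z * Y z.
have vy : bdd_valued y.
 split; last exact: bddM H2.2 bY.
 by move=> i; exists 0; exact: has_value_vanish.
have hy' : bdd_valued (fun z=> l + 1 * y z) by apply: bdd_valued_lin => //; exact: bdd_valued_cst.
have vS : bdd_valued (fun z=> x0 z + 1 * ((l + 1 * y z) * x1 z)) by apply: bdd_valued_lin => //; exact: bdd_valuedM.
have SE z : q%:C * X z + q%:C * (x1 z * B1 z) * Y z = q%:C * (x0 z + 1 * ((l + 1 * y z) * x1 z)) by rewrite /X /y; ring.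
have d0 : 0 < K^-1 / q by apply: divr_gt0 => //; rewrite invr_gt0.
have lS z : cmod z < 1 -> K^-1 / q <= cmod (x0 z + 1 * ((l + 1 * y z) * x1 z)).
 move=> hz; have [_] := HY z hz; rewrite SE cmodM cmodR gtr0_norm // => h.
 by rewrite ler_pdivrMr // mulrC.
exists (fun z=> l + 1 * y z, fun z=> (x0 z + 1 * ((l + 1 * y z) * x1 z))^-1); split=> //=.
 split=> [i|]; first by have [d hd] := vS.1 i; exists d^-1; exact: has_valueV d0 (zt1 i) hd lS.
 exists (K^-1 / q)^-1 => z hz; rewrite cmodV lef_pV2 ?posrE ?lS //; exact: lt_le_trans (lS z hz).
by move=> z hz; rewrite -[X in x0 z + X]mul1r mulfV // -cmod_gt0; apply: lt_le_trans d0 (lS z hz).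
Qed.

End StableRank.

Theorem theorem4p3 (R : realType) (k : nat) (a : 'I_k -> R)
    (zeta : 'I_k -> R[i]) :
  (1 <= k)%N ->
  (forall i, 0 < a i) ->
  (forall i, cmod (zeta i) = 1) ->
  bass_stable_rank_eq (multiplier_alg a zeta) 1.
Proof.
(* Minimality is vacuous, since no m satisfies 1 <= m < 1. *)
move=> k1 a0 zt1; split=> //; split; last by move=> [|[|m]].
have AP f := multiplier_algP k1 zt1 f a0.
move=> x Hx [b [Hb E]].
have [z hz|[y u] /= [Hy Hu Eu]] := bezout_reduce k1 zt1
 (proj1 (AP _) (Hx ord0)) (proj1 (AP _) (Hx ord_max)) (proj1 (AP _) (Hb ord0)) (proj1 (AP _) (Hb ord_max)).
 rewrite -(E z hz) big_ord_recl big_ord_recl big_ord0 addr0.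
 by rewrite (_ : lift ord0 ord0 = ord_max) //; apply: val_inj.
exists (fun=> y); split; first by move=> _; apply/AP.
exists (fun=> u); split; first by move=> _; apply/AP.
move=> z hz; rewrite big_ord1 (_ : widen_ord _ _ = ord0); first exact: Eu.
exact: val_inj.
Qed.
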